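(* Let $\Gamma$ be a finite abelian group and let $L=\sum_{\gamma\in\Gamma}L_\gamma$ be a $\Gamma$-subgraded Lie algebra of compact operators on a complex Banach space $\mathcal{X}$. If every component $L_\gamma$ ($\gamma\in\Gamma$) consists of Engel elements of $L$, then $L$ is $E$-solvable and hence triangularizable. If $\Gamma=\mathbb{Z}_n$ is cyclic, the same conclusion holds under the weaker hypothesis that only $L_0$ consists of Engel elements of $L$.
   Context: $\mathcal{X}$ is a complex Banach space, $\mathcal{B}(\mathcal{X})$ the bounded operators with the operator norm, $\mathcal{K}(\mathcal{X})$ the compact operators. An operator Lie algebra is a linear subspace $L\subseteq\mathcal{B}(\mathcal{X})$ closed under $[a,b]=ab-ba$; it is normed by the operator norm, and for $a\in L$, $\operatorname{ad}a:L\to L$, $x\mapsto[a,x]$. An element $a$ of a normed Lie algebra $L$ is an Engel element of $L$ if $\operatorname{ad}a$ is quasinilpotent on $L$, i.e. $\lim_n\|(\operatorname{ad}a)^n\|^{1/n}=0$; $L$ is Engel if all its elements are Engel elements of $L$. A normed Lie algebra $L$ is $E$-solvable if for every closed ideal $I\neq L$ of $L$ the quotient $L/I$ (with quotient norm) contains a nonzero closed ideal which is an Engel Lie algebra. A set of operators is triangularizable if there is a maximal chain of closed subspaces of $\mathcal{X}$ each invariant under every operator of the set. For an abelian group $\Gamma$, a Lie algebra $L$ is $\Gamma$-subgraded if $L=\sum_{\gamma\in\Gamma}L_\gamma$ for linear subspaces $L_\gamma$ (the sum need not be direct) with $[L_\gamma,L_\delta]\subseteq L_{\gamma+\delta}$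 for all $\gamma,\delta$. *)

(* Defs.v *)
From mathcomp Require Import all_boot all_order all_algebra.
From mathcomp Require Import complex.
From mathcomp Require Import all_classical all_reals all_analysis.
Set Implicit Arguments. Unset Strict Implicit. Unset Printing Implicit Defensive.
Import Order.TTheory GRing.Theory Num.Theory.
Import numFieldNormedType.Exports.
Local Open Scope classical_set_scope.
Local Open Scope ring_scope.

Section OperatorLie.
Variables (R : realType) (X : normedModType R[i]).

(* real-valued norm on X (the norm of a normedModType over R[i] takes
   nonnegative real values in R[i]) *)
Definition nrm (x : X) : R := complex.Re `|x|.

Definition op := X -> X.
Definition op0 : op := fun _ => 0.
Definition opsub (a b : op) : op := fun x => a x - b x.

Definition is_linear_op (T : op) : Prop :=
  forall (c : R[i]) (x y : X), T (c *: x + y) = c *: T x + T y.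

Definition is_bounded_op (T : op) : Prop :=
  is_linear_op T /\ exists M : R, forall x, nrm (T x) <= M * nrm x.

Definition opnorm (T : op) : R :=
  sup [set nrm (T x) | x in [set x : X | nrm x <= 1]].

Definition is_compact_op (T : op) : Prop :=
  is_bounded_op T /\ compact (closure (T @` [set x : X | nrm x <= 1])).

Definition lie (a b : op) : op := fun x => a (b x) - b (a x).

Definition is_subspace (S : set op) : Prop :=
  [/\ S op0,
      (forall a b, S a -> S b -> S (fun x => a x + b x)) &
      (forall (c : R[i]) a, S a -> S (fun x => c *: a x))].

Definition operator_lie_algebra (L : set op) : Prop :=
  [/\ (forall a, L a -> is_bounded_op a), is_subspace L &
      (forall a b, L a -> L b -> L (lie a b))].

Definition quasinil_seq (s : nat -> R) : Prop :=
  (fun n : nat => powR (s n) (n%:R^-1)) @ \oo --> (0 : R).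

Definition ad_pow_norm (L : set op) (a : op) (n : nat) : R :=
  sup [set opnorm (iter n (lie a) x) | x in [set x | L x /\ opnorm x <= 1]].

Definition engel_element (L : set op) (a : op) : Prop :=
  quasinil_seq (ad_pow_norm L a).

Definition lie_ideal (L I : set op) : Prop :=
  [/\ I `<=` L, is_subspace I & (forall a x, L a -> I x -> I (lie a x))].

Definition closed_in (L I : set op) : Prop :=
  forall x, L x ->
    (forall e : R, 0 < e -> exists i, I i /\ opnorm (opsub x i) < e) -> I x.

Definition closed_ideal (L I : set op) : Prop := lie_ideal L I /\ closed_in L I.

Definition qnorm (I : set op) (x : op) : R :=
  inf [set opnorm (opsub x i) | i in I].

(* norm of (ad (a+I))^n as an operator on the normed Lie algebra J/I
   (normed by the quotient norm of L/I) *)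
Definition quot_ad_pow_norm (I J : set op) (a : op) (n : nat) : R :=
  sup [set qnorm I (iter n (lie a) x) | x in [set x | J x /\ qnorm I x <= 1]].

(* E-solvability.  Closed ideals of L/I are exactly the J/I with J a closed
   ideal of L containing I; J/I is nonzero iff J <> I; J/I is an Engel Lie
   algebra iff every a+I (a in J) is an Engel element of J/I. *)
Definition E_solvable (L : set op) : Prop :=
  forall I, closed_ideal L I -> I <> L ->
    exists J, [/\ closed_ideal L J, I `<=` J, J <> I &
                  forall a, J a -> quasinil_seq (quot_ad_pow_norm I J a)].

Definition closed_subspace (M : set X) : Prop :=
  [/\ closed M, M 0,
      (forall x y, M x -> M y -> M (x + y)) &
      (forall (c : R[i]) x, M x -> M (c *: x))].

Definition subspace_chain (C : set (set X)) : Prop :=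
  (forall M, C M -> closed_subspace M) /\
  (forall M N, C M -> C N -> M `<=` N \/ N `<=` M).

Definition maximal_subspace_chain (C : set (set X)) : Prop :=
  subspace_chain C /\ (forall D, subspace_chain D -> C `<=` D -> D = C).

Definition triangularizable (S : set op) : Prop :=
  exists C, maximal_subspace_chain C /\
    (forall M, C M -> forall T, S T -> forall x, M x -> M (T x)).

Definition subgraded (G : finZmodType) (L : set op) (Lg : G -> set op) : Prop :=
  [/\ (forall g, is_subspace (Lg g)),
      L = [set a | exists f : G -> op, (forall g, Lg g (f g)) /\
                     a = (fun x => \sum_(g : G) f g x)] &
      (forall g h a b, Lg g a -> Lg h b -> Lg (g + h) (lie a b))].

End OperatorLie.

Definition cyclic_group (G : finZmodType) : Prop :=
  exists g : G, forall h : G, exists k : nat, h = g *+ k.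

(* Main.v *)
Require Import Defs.
From HB Require Import structures.
From mathcomp Require Import all_boot all_order all_algebra.
From mathcomp Require Import complex.
From mathcomp Require Import all_classical all_reals all_analysis.
From mathcomp Require Import ring lra.
Set Implicit Arguments. Unset Strict Implicit. Unset Printing Implicit Defensive.
Import Order.TTheory GRing.Theory Num.Theory.
Import numFieldNormedType.Exports.
Local Open Scope classical_set_scope.
Local Open Scope ring_scope.

(** A graded Lie algebra acting irreducibly acts on a space without proper closed subspaces.  Indeed
products of exponentials of homogeneous elements grow subexponentially (Berger-Wang), so Hilden's
argument yields finite rank operators in the generated algebra; a minimal rank argument, the theorems
of Engel-Jacobson and Kreknin and the trace form then bound the dimension by one.  Hence the gaps of a
maximal chain of invariant subspaces are trivial, and Ringrose's theorem along the chain makes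
commutators quasinilpotent modulo any closed ideal. *)

(** The Engel condition is known for homogeneous elements only, and a sum of Engel elements need not
    be Engel; so the analysis is done with the set of homogeneous operators, which is closed under
    brackets but not under sums. Since the sum of the components is not direct, a limit of elements
    of [L] has no well-defined components. Growth is therefore studied on the functions from [G] to
    [X], where an operator of degree [g] also translates by [g] and components become continuous.
    Hilden's argument works by contradiction: it excludes subexponential growth once a nonzero
    operator occurs. The Berger-Wang alternative then provides a product [1 + k] of exponentials
    whose powers grow like [2 ^+ n]. Conjugation by it grows subexponentially on the closed graded
    algebra unless that algebra contains a nonzero finite rank operator; if it does grow
    subexponentially, the spectral subspace of [1 + k] for its large eigenvalues is
    finite-dimensional and invariant. Contour integrals are replaced by averages over roots of
    unity, subsequences by one fixed ultrafilter. *)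

Section Modulus.
Variable R : realType.
Implicit Types c d : R[i].

Definition nc (c : R[i]) : R := ComplexField.Normc.normc c.

Lemma nc_ge0 c : 0 <= nc c. Proof. by case: c => a b; rewrite /nc /= sqrtr_ge0. Qed.
Lemma nc0 : nc 0 = 0 :> R. Proof. exact: ComplexField.Normc.normc0. Qed.
Lemma nc1 : nc 1 = 1 :> R. Proof. exact: ComplexField.Normc.normc1. Qed.
Lemma ncM c d : nc (c * d) = nc c * nc d. Proof. exact: ComplexField.Normc.normcM. Qed.
Lemma ncV c : nc c^-1 = (nc c)^-1. Proof. exact: ComplexField.Normc.normcV. Qed.
Lemma ncN c : nc (- c) = nc c. Proof. exact: normcN. Qed.
Lemma ncD c d : nc (c + d) <= nc c + nc d. Proof. exact: le_normcD. Qed.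
Lemma nc_eq0 c : nc c = 0 -> c = 0. Proof. exact: ComplexField.Normc.eq0_normc. Qed.
Lemma nc_norm c : `|c| = (nc c)%:C%C. Proof. by []. Qed.
Lemma ncX c n : nc (c ^+ n) = nc c ^+ n.
Proof. by elim: n => [|n IH]; rewrite ?expr0 ?nc1 // !exprS ncM IH. Qed.
Lemma nc_real (x : R) : nc x%:C%C = `|x|.
Proof. by rewrite /nc /= expr0n addr0 sqrtr_sqr. Qed.
Lemma nc_pos (x : R) : 0 <= x -> nc x%:C%C = x.
Proof. by move=> x0; rewrite nc_real ger0_norm. Qed.
Lemma nc_gt0 c : (0 < nc c) = (c != 0).
Proof.
rewrite lt_neqAle nc_ge0 andbT eq_sym; congr negb; apply/eqP/eqP => [/nc_eq0//|->].
exact: nc0.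
Qed.
Lemma nc_nat n : nc n%:R = n%:R :> R.
Proof.
have -> : n%:R = (n%:R : R)%:C%C by rewrite rmorph_nat.
by rewrite nc_pos.
Qed.
Lemma nc_distC c d : nc (c - d) = nc (d - c).
Proof. by rewrite -ncN opprB. Qed.
End Modulus.

(** A bundled space with real norm and completeness in epsilon form. Quotients, operator algebras
    and finite sums of a space are again of this type, so every later statement applies to them
    directly. *)
Record banach (R : realType) := Banach {
 bsp :> lmodType R[i];
 bn : bsp -> R;
 bnD : forall x y, bn (x + y) <= bn x + bn y;
 bnZ : forall c x, bn (c *: x) = nc c * bn x;
 bn_eq0 : forall x, bn x = 0 -> x = 0;
 bcomp : forall u : nat -> bsp,
 (forall e, 0 < e -> exists N, forall m n, (N <= m)%N -> (N <= n)%N ->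
 bn (u m - u n) < e) ->
 exists l, forall e, 0 < e -> exists N, forall n, (N <= n)%N -> bn (u n - l) < e }.
Arguments bn {R b} x.

(** * Elementary norm estimates *)

Section BanachTheory.
Variables (R : realType) (E : banach R).
Implicit Types x y z : E.

Lemma bn0 : bn (0 : E) = 0. Proof. by rewrite -(scale0r (0 : E)) bnZ nc0 mul0r. Qed.
Lemma bnN x : bn (- x) = bn x.
Proof. by rewrite -scaleN1r bnZ ncN nc1 mul1r. Qed.
Lemma bn_ge0 x : 0 <= bn x.
Proof.
have := bnD x (- x); rewrite subrr bn0 bnN; set t := bn x; lra.
Qed.
Lemma bnB x y : bn (x - y) <= bn x + bn y.
Proof. by rewrite -(bnN y) bnD. Qed.
Lemma bnC x y : bn (x - y) = bn (y - x).
Proof. by rewrite -bnN opprB. Qed.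
Lemma bn_gt0 x : (0 < bn x) = (x != 0).
Proof.
rewrite lt_neqAle bn_ge0 andbT eq_sym; congr negb; apply/eqP/eqP => [/bn_eq0//|->].
exact: bn0.
Qed.
Lemma bn_tri z x y : bn (x - y) <= bn (x - z) + bn (z - y).
Proof. by rewrite -{1}(subrK z x) -addrA bnD. Qed.
Lemma bnB_ge x y : bn x - bn y <= bn (x - y).
Proof. by rewrite lerBlDr -{1}(subrK y x) bnD. Qed.
Lemma bnD_ge x y : bn x - bn y <= bn (x + y).
Proof. by rewrite -(bnN y) -{2}(opprK y) bnB_ge. Qed.
Lemma bn_sum (I : Type) (s : seq I) (P : pred I) (f : I -> E) :
 bn (\sum_(i <- s | P i) f i) <= \sum_(i <- s | P i) bn (f i).
Proof.
elim/big_rec2: _ => [|i y1 y2 _ H]; first by rewrite bn0.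
by apply: le_trans (bnD _ _) _; rewrite lerD2l.
Qed.
Lemma bn_small x : (forall e, 0 < e -> bn x <= e) -> x = 0.
Proof.
move=> H; apply: bn_eq0; apply/eqP; rewrite eq_le bn_ge0 andbT.
by apply/ler_addgt0Pr => e e0; rewrite add0r H.
Qed.
Definition nml x : E := ((bn x)^-1)%:C%C *: x.
Lemma nmlE x : x != 0 -> bn (nml x) = 1.
Proof.
rewrite -bn_gt0 => H; rewrite /nml bnZ nc_pos ?invr_ge0 ?ltW//.
by rewrite mulVf ?gt_eqF.
Qed.
Lemma nmlK x : x != 0 -> (bn x)%:C%C *: nml x = x.
Proof.
rewrite -bn_gt0 => H; rewrite /nml scalerA -rmorphM /= mulfV ?gt_eqF//.
by rewrite rmorph1 scale1r.
Qed.
End BanachTheory.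

(* A free ultrafilter on nat replaces all extractions of subsequences. *)
Lemma free_ultrafilter : exists U : set_system nat, UltraFilter U /\ (\oo%classic : set_system nat) `<=` U.
Proof. exact: ultraFilterLemma. Qed.
(** An ultrafilter quantifier commutes with negation and finite disjunction; hence a sequence in a
    totally bounded set of a complete space converges along it, without extraction. *)
Definition ev (P : nat -> Prop) : Prop := (projT1 (cid free_ultrafilter)) P.

(** * The ultrafilter quantifier *)

Section Ev.
Let U := projT1 (cid free_ultrafilter).
Let UU : UltraFilter U. Proof. by rewrite /U; case: cid => /= ? []. Qed.
Let UF : \oo%classic `<=` U. Proof. by rewrite /U; case: cid => /= ? []. Qed.
#[local] Existing Instance UU.
Let UP : ProperFilter U. Proof. exact: @ultra_proper _ _ UU. Qed.
#[local] Existing Instance UP.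
Implicit Types P Q : nat -> Prop.

Lemma evS P Q : ev P -> (forall n, P n -> Q n) -> ev Q.
Proof. by move=> HP HPQ; apply: (filterS _ HP). Qed.
Lemma ev_and P Q : ev P -> ev Q -> ev (fun n => P n /\ Q n).
Proof. by move=> HP HQ; exact: (filterI HP HQ). Qed.
Lemma ev_all P : (forall n, P n) -> ev P.
Proof. by move=> H; apply: (filterS _ filterT). Qed.
Lemma ev_ex P : ev P -> exists n, P n.
Proof. exact: filter_ex. Qed.
Lemma ev_or P Q : ev (fun n => P n \/ Q n) -> ev P \/ ev Q.
Proof.
move=> H; have [HP|HP] := in_ultra_setVsetC P UU; [by left|right].
by apply: (evS (ev_and H HP)) => n [] [].
Qed.
Lemma ev_not P : ~ ev P -> ev (fun n => ~ P n).
Proof. by have [HP|HP] := in_ultra_setVsetC P UU. Qed.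
Lemma ev_ge N : ev (fun n => (N <= n)%N).
Proof. by apply: UF; exists N. Qed.
Lemma ev_fin m (P : nat -> nat -> Prop) :
 ev (fun n => exists2 i, (i < m)%N & P i n) -> exists2 i, (i < m)%N & ev (P i).
Proof.
elim: m => [|m IH] H; first by have [n []] := ev_ex H.
have : ev (fun n => (exists2 i, (i < m)%N & P i n) \/ P m n).
 apply: (evS H) => n []i; rewrite ltnS leq_eqVlt => /orP[/eqP-> Hm|Hi Hm].
 by right.
 by left; exists i.
case/ev_or => H1; last by exists m.
by have [i im Hi] := IH H1; exists i => //; exact: ltnW.
Qed.
End Ev.
Lemma ev_allfin m (P : nat -> nat -> Prop) :
 (forall i, (i < m)%N -> ev (P i)) -> ev (fun n => forall i, (i < m)%N -> P i n).
Proof.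
elim: m => [|m IH] H; first exact: ev_all.
have H1 := IH (fun i im => H i (ltnW im)).
apply: (evS (ev_and H1 (H m (ltnSn m)))) => n [Ha Hb] i.
by rewrite ltnS leq_eqVlt => /orP[/eqP->//|]; exact: Ha.
Qed.
Lemma ev_finT (T : finType) (f : nat -> T) : exists t, ev (fun n => f n = t).
Proof.
have : ev (fun n => exists2 i, (i < #|T|)%N & (i = enum_rank (f n) :> nat)).
 by apply: ev_all => n; exists (enum_rank (f n)).
move=> /ev_fin[i iT Hi]; exists (enum_val (Ordinal iT)).
apply: (evS Hi) => n Hn; rewrite -[f n]enum_rankK; congr enum_val.
exact: val_inj.
Qed.
Lemma inv_small (R : realType) (e : R) : 0 < e -> exists N, forall n, (N <= n)%N -> n.+1%:R^-1 < e.
Proof.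
move=> e0; exists (Num.truncn e^-1) => n Hn; rewrite invf_plt ?posrE//.
by apply: (lt_le_trans (truncnS_gt _)); rewrite ler_nat ltnS.
Qed.

(** * Decay of geometric sequences *)

Section Powers.
Variable R : realType.
Lemma bernoulli (h : R) n : 0 <= h -> 1 + n%:R * h <= (1 + h) ^+ n.
Proof.
move=> h0; elim: n => [|n IH]; first by rewrite expr0 mul0r addr0.
rewrite exprS -natr1; have : 0 <= n%:R * h * h by rewrite !mulr_ge0.
have : (1 + h) * (1 + n%:R * h) <= (1 + h) * (1 + h) ^+ n by rewrite ler_wpM2l//; lra.
set t := (1 + h) ^+ n; set m := n%:R; lra.
Qed.
Lemma expr_small (q e : R) : 0 <= q -> q < 1 -> 0 < e ->
 exists N, forall n, (N <= n)%N -> q ^+ n < e.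
Proof.
move=> q0 q1 e0; have [->|qn0] := eqVneq q 0.
 by exists 1%N => -[|n] // _; rewrite expr0n.
have q0' : 0 < q by rewrite lt_neqAle eq_sym qn0.
have h0 : 0 < q^-1 - 1 by rewrite subr_gt0 invf_gt1.
exists (Num.truncn (e^-1 / (q^-1 - 1))).+1 => n Hn.
have H1 : e^-1 / (q^-1 - 1) < n%:R.
 by apply: lt_le_trans (truncnS_gt _) _; rewrite ler_nat.
rewrite ltr_pdivrMr// in H1.
have H2 := bernoulli n (ltW h0); rewrite (_ : 1 + (q^-1 - 1) = q^-1) in H2; last by rewrite addrC subrK.
rewrite -[q ^+ n]invrK invf_plt ?posrE ?invr_gt0 ?exprn_gt0// -exprVn.
by apply: lt_le_trans H2; rewrite ltr_wpDl.
Qed.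
Lemma half_small (e : R) : 0 < e -> exists N, forall n, (N <= n)%N -> 2^-1 ^+ n < e.
Proof. by apply: expr_small; rewrite ?invr_ge0// invf_lt1// ltr1n. Qed.
Lemma natmul_expr_small (q e : R) : 0 <= q -> q < 1 -> 0 < e ->
 exists N, forall n, (N <= n)%N -> n%:R * q ^+ n < e.
Proof.
move=> q0 q1 e0; have [->|qn0] := eqVneq q 0.
 by exists 1%N => -[|n] // _; rewrite expr0n mulr0.
have q0' : 0 < q by rewrite lt_neqAle eq_sym qn0.
(* With [q = s ^+ 2] one factor [s ^+ n] absorbs [n] by Bernoulli's inequality and the other one
   tends to zero. *)
pose s := Num.sqrt q; have s0 : 0 < s by rewrite sqrtr_gt0.
have s1 : s < 1 by rewrite -sqrtr1 ltr_sqrt.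
have h0 : 0 < s^-1 - 1 by rewrite subr_gt0 invf_gt1.
have [N HN] := expr_small (ltW s0) s1 (mulr_gt0 e0 h0).
exists N => n /HN Hn; rewrite -(sqr_sqrtr q0) -/s -exprM mulnC exprM.
have H2 := bernoulli n (ltW h0); rewrite (_ : 1 + (s^-1 - 1) = s^-1) in H2; last by rewrite addrC subrK.
have sn : 0 < s ^+ n by rewrite exprn_gt0.
have H3 : n%:R * (s^-1 - 1) * s ^+ n <= 1.
 have : (n%:R * (s^-1 - 1)) * s ^+ n <= s^-1 ^+ n * s ^+ n by rewrite ler_wpM2r//; lra.
 by rewrite -exprMn mulVf ?gt_eqF// expr1n.
rewrite -(ltr_pM2r h0); apply: le_lt_trans Hn; rewrite expr2.
have : n%:R * (s^-1 - 1) * s ^+ n * s ^+ n <= 1 * s ^+ n by apply: ler_wpM2r => //; exact: ltW.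
set u := s ^+ n; set v := n%:R; set w := s^-1; lra.
Qed.
End Powers.

(** * Limits along the ultrafilter *)

Section Ulim.
Variables (R : realType) (E : banach R).
Implicit Types (u v : nat -> E) (x y l : E).

Definition ulim u l := forall e : R, 0 < e -> ev (fun n => bn (u n - l) < e).

Lemma ulim_cst l : ulim (fun _ => l) l.
Proof. by move=> e e0; apply: ev_all => n; rewrite subrr bn0. Qed.
Lemma ulimD u v l m : ulim u l -> ulim v m -> ulim (fun n => u n + v n) (l + m).
Proof.
move=> H1 H2 e e0; have e2 : 0 < e / 2 by lra.
apply: (evS (ev_and (H1 _ e2) (H2 _ e2))) => n [A B].
by rewrite opprD addrACA; have := bnD (u n - l) (v n - m); lra.
Qed.
Lemma ulimZ c u l : ulim u l -> ulim (fun n => c *: u n) (c *: l).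
Proof.
move=> H e e0; have c0 := nc_ge0 c.
have e2 : 0 < e / (nc c + 1) by apply: divr_gt0 => //; lra.
apply: (evS (H _ e2)) => n; rewrite -scalerBr bnZ ltr_pdivlMr; last by lra.
rewrite mulrDr mulr1 mulrC => Hn; have := bn_ge0 (u n - l); lra.
Qed.
Lemma ulimN u l : ulim u l -> ulim (fun n => - u n) (- l).
Proof.
by move=> /(ulimZ (-1)); rewrite scaleN1r => H e e0; apply: (evS (H e e0)) => n; rewrite scaleN1r.
Qed.
Lemma ulim_uniq u l m : ulim u l -> ulim u m -> l = m.
Proof.
move=> H1 H2; apply: subr0_eq; apply: bn_small => e e0.
have e2 : 0 < e / 2 by lra.
have [n [A B]] := ev_ex (ev_and (H1 _ e2) (H2 _ e2)).
by have := bn_tri (u n) l m; rewrite (bnC l (u n)); lra.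
Qed.
Lemma ulim_norm_le u l (c : R) : ulim u l -> ev (fun n => bn (u n) <= c) -> bn l <= c.
Proof.
move=> H1 H2; apply/ler_addgt0Pr => e e0.
have [n [A B]] := ev_ex (ev_and (H1 _ e0) H2).
by have := bnB_ge l (u n); rewrite bnC; lra.
Qed.
Lemma ulim_norm_ge u l (c : R) : ulim u l -> ev (fun n => c <= bn (u n)) -> c <= bn l.
Proof.
move=> H1 H2; apply/ler_addgt0Pr => e e0.
have [n [A B]] := ev_ex (ev_and (H1 _ e0) H2).
by have := bnB_ge (u n) l; lra.
Qed.
Lemma ulim_ext u v l : ulim u l -> (forall n, u n = v n) -> ulim v l.
Proof. by move=> H Huv e e0; apply: (evS (H e e0)) => n; rewrite Huv. Qed.
Lemma ulim_ev u v l : ulim u l -> ev (fun n => u n = v n) -> ulim v l.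
Proof. by move=> H Huv e e0; apply: (evS (ev_and Huv (H e e0))) => n [->]. Qed.
(** The centres for the radii [k.+1%:R^-1] form a Cauchy sequence because two sets of the
    ultrafilter always meet; its limit is the ultralimit. *)
Lemma ulim_exists u :
 (forall e : R, 0 < e -> exists x, ev (fun n => bn (u n - x) < e)) -> exists l, ulim u l.
Proof.
move=> H; have p (k : nat) : (0 : R) < k.+1%:R^-1 by rewrite invr_gt0.
pose x k := projT1 (cid (H _ (p k))).
have Hx k : ev (fun n => bn (u n - x k) < k.+1%:R^-1) by rewrite /x; case: cid.
have [|l Hl] := @bcomp _ E x.
 move=> e e0; have [|N HN] := @inv_small _ (e / 2); first by lra.
 exists N => m n Hm Hn; have [k [A B]] := ev_ex (ev_and (Hx m) (Hx n)).
 have := bn_tri (u k) (x m) (x n); rewrite (bnC (x m) (u k)).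
 have := lt_trans A (HN _ Hm); have := lt_trans B (HN _ Hn); lra.
exists l => e e0; have e2 : 0 < e / 2 by lra.
have [N1 H1] := inv_small e2; have [N2 H2] := Hl _ e2.
pose k := maxn N1 N2; apply: (evS (Hx k)) => n Hn.
have := lt_trans Hn (H1 k (leq_maxl _ _)); have := H2 k (leq_maxr _ _).
by have := bn_tri (x k) (u n) l; lra.
Qed.
Lemma seq_ulim u l : (forall e, 0 < e -> exists N, forall n, (N <= n)%N -> bn (u n - l) < e) ->
 ulim u l.
Proof.
move=> H e e0; have [N HN] := H e e0; exact: (evS (ev_ge N) HN).
Qed.
End Ulim.

(** * Subspaces and closures *)

Section Subspaces.
Variables (R : realType) (E : banach R).
Implicit Types (M : set E).

Record subsp M : Prop := Subsp {
 ss0 : M 0; ssD : forall x y, M x -> M y -> M (x + y);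
 ssZ : forall c x, M x -> M (c *: x) }.
Definition closd M := forall x, (forall e : R, 0 < e -> exists2 y, M y & bn (y - x) < e) -> M x.
Definition clos M : set E := fun x => forall e : R, 0 < e -> exists2 y, M y & bn (y - x) < e.

Lemma ssN M x : subsp M -> M x -> M (- x).
Proof. by move=> H Hx; rewrite -scaleN1r; apply: ssZ. Qed.
Lemma ssB M x y : subsp M -> M x -> M y -> M (x - y).
Proof. by move=> H Hx Hy; apply: ssD => //; apply: ssN. Qed.
Lemma ss_sum M (I : Type) (s : seq I) (P : pred I) (f : I -> E) : subsp M ->
 (forall i, P i -> M (f i)) -> M (\sum_(i <- s | P i) f i).
Proof. by move=> HM H; elim/big_ind: _ => //; [exact: ss0|move=> *; exact: ssD]. Qed.
Lemma subspI M N : subsp M -> subsp N -> subsp (M `&` N).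
Proof.
by move=> [M0 MD MZ] [N0 ND NZ]; split=> [//|x y [? ?] [? ?]|c x [? ?]]; split; auto.
Qed.
Lemma closd_ulim M u l : closd M -> ev (fun n => M (u n)) -> ulim u l -> M l.
Proof.
move=> HM Hu Hl; apply: HM => e e0.
by have [n [A B]] := ev_ex (ev_and Hu (Hl _ e0)); exists (u n).
Qed.
Lemma sub_clos M : M `<=` clos M.
Proof. by move=> x Hx e e0; exists x; rewrite // subrr bn0. Qed.
Lemma clos_closd M : closd (clos M).
Proof.
move=> x H e e0; have e2 : 0 < e / 2 by lra.
have [y /(_ _ e2)[z Hz zy] yx] := H _ e2; exists z => //.
by have := bn_tri y z x; lra.
Qed.
Lemma clos_min M M' : closd M' -> M `<=` M' -> clos M `<=` M'.
Proof. by move=> H S x Hx; apply: H => e /Hx[y /S My]; exists y. Qed.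
Lemma clos_subsp M : subsp M -> subsp (clos M).
Proof.
move=> HM; split.
- by apply: sub_clos; exact: ss0.
- move=> x y Hx Hy e e0; have e2 : 0 < e / 2 by lra.
 have [x' Mx xx] := Hx _ e2; have [y' My yy] := Hy _ e2.
 exists (x' + y'); first exact: ssD.
 by rewrite opprD addrACA; have := bnD (x' - x) (y' - y); lra.
- move=> c x Hx e e0; have c0 := nc_ge0 c.
 have e2 : 0 < e / (nc c + 1) by apply: divr_gt0 => //; lra.
 have [y My] := Hx _ e2; rewrite ltr_pdivlMr; last by lra.
 move=> H; exists (c *: y); first exact: ssZ.
 rewrite -scalerBr bnZ; rewrite mulrDr mulr1 mulrC in H.
 have := bn_ge0 (y - x); lra.
Qed.
Lemma clos_ulim M x : clos M x -> exists2 u, (forall n, M (u n)) & ulim u x.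
Proof.
move=> H; have p (k : nat) : (0 : R) < k.+1%:R^-1 by rewrite invr_gt0.
exists (fun k => s2val (cid2 (H _ (p k)))); first by move=> n; case: cid2.
apply: seq_ulim => e /inv_small[N HN]; exists N => n /HN h; case: cid2 => /= y My.
by move=> /lt_trans; apply.
Qed.
Definition spn (A : set E) : set E := fun x => forall M, subsp M -> A `<=` M -> M x.
Lemma spn_subsp A : subsp (spn A).
Proof.
split=> [M HM _|x y Hx Hy M HM S|c x Hx M HM S]; first exact: ss0.
- by apply: ssD => //; [apply: Hx|apply: Hy].
- by apply: ssZ => //; apply: Hx.
Qed.
Lemma spn_sub A : A `<=` spn A.
Proof. by move=> x Ax M _; apply. Qed.
Lemma spn_min A M : subsp M -> A `<=` M -> spn A `<=` M.
Proof. by move=> H S x; apply. Qed.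
End Subspaces.

(** * Bounded operators and the operator norm *)

Record bop (R : realType) (E : banach R) := Bop {
 bfun :> E -> E;
 bop_lin : forall c x y, bfun (c *: x + y) = c *: bfun x + bfun y;
 bop_bd : exists M : R, forall x, bn (bfun x) <= M * bn x }.

Lemma bop_eq (R : realType) (E : banach R) (a b : bop E) : (forall x, a x = b x) -> a = b.
Proof.
case: a b => [f fl fb] [g gl gb] /= H; have fg : f = g by exact/funext.
by subst g; congr Bop; exact: Prop_irrelevance.
Qed.

Section BopStruct.
Variables (R : realType) (E : banach R).
HB.instance Definition _ := gen_eqMixin (bop E).
HB.instance Definition _ := gen_choiceMixin (bop E).
Implicit Types a b : bop E.

Lemma bopD0 a x y : a (x + y) = a x + a y.
Proof. by have := bop_lin a 1 x y; rewrite !scale1r. Qed.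
Lemma bop00 a : a 0 = 0.
Proof. by have := bopD0 a 0 0; rewrite addr0 => /eqP; rewrite addrC -subr_eq subrr eq_sym => /eqP. Qed.
Lemma bopZ0 a c x : a (c *: x) = c *: a x.
Proof. by have := bop_lin a c x 0; rewrite !addr0 bop00 addr0. Qed.
Lemma bop_bd0 a : exists2 M : R, 0 <= M & forall x, bn (a x) <= M * bn x.
Proof.
have [M HM] := bop_bd a; exists `|M| => // x; apply: le_trans (HM x) _.
by rewrite ler_wpM2r ?bn_ge0// ler_norm.
Qed.
Lemma bop_add_lin a b c x y : a (c *: x + y) + b (c *: x + y) = c *: (a x + b x) + (a y + b y).
Proof. by rewrite !bop_lin scalerDr addrACA. Qed.
Lemma bop_add_bd a b : exists M : R, forall x, bn (a x + b x) <= M * bn x.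
Proof.
have [M HM] := bop_bd a; have [N HN] := bop_bd b; exists (M + N) => x.
by apply: le_trans (bnD _ _) _; rewrite mulrDl lerD.
Qed.
Definition bop_add a b := Bop (bop_add_lin a b) (bop_add_bd a b).
Lemma bop_zero_lin (c : R[i]) (x y : E) : (0 : E) = c *: 0 + 0.
Proof. by rewrite scaler0 addr0. Qed.
Lemma bop_zero_bd : exists M : R, forall x : E, bn (0 : E) <= M * bn x.
Proof. by exists 0 => x; rewrite bn0 mul0r. Qed.
Definition bop_zero := @Bop R E (fun _ => 0) bop_zero_lin bop_zero_bd.
Lemma bop_scale_lin k a c x y : k *: a (c *: x + y) = c *: (k *: a x) + k *: a y.
Proof. by rewrite bop_lin scalerDr !scalerA mulrC. Qed.
Lemma bop_scale_bd k a : exists M : R, forall x, bn (k *: a x) <= M * bn x.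
Proof.
have [M HM] := bop_bd a; exists (nc k * M) => x.
by rewrite bnZ -mulrA ler_wpM2l ?nc_ge0.
Qed.
Definition bop_scale k a := Bop (bop_scale_lin k a) (bop_scale_bd k a).
Definition bop_opp a := bop_scale (-1) a.
Lemma bop_one_lin (c : R[i]) (x y : E) : c *: x + y = c *: x + y. Proof. by []. Qed.
Lemma bop_one_bd : exists M : R, forall x : E, bn x <= M * bn x.
Proof. by exists 1 => x; rewrite mul1r. Qed.
Definition bop_one := @Bop R E (fun x => x) bop_one_lin bop_one_bd.
Lemma bop_mul_lin a b c x y : a (b (c *: x + y)) = c *: a (b x) + a (b y).
Proof. by rewrite !bop_lin. Qed.
Lemma bop_mul_bd a b : exists M : R, forall x, bn (a (b x)) <= M * bn x.
Proof.
have [M M0 HM] := bop_bd0 a; have [N HN] := bop_bd b; exists (M * N) => x.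
by apply: le_trans (HM _) _; rewrite -mulrA ler_wpM2l.
Qed.
Definition bop_mul a b := Bop (bop_mul_lin a b) (bop_mul_bd a b).

Lemma bop_addA : associative bop_add.
Proof. by move=> a b c; apply: bop_eq => x /=; rewrite addrA. Qed.
Lemma bop_addC : commutative bop_add.
Proof. by move=> a b; apply: bop_eq => x /=; rewrite addrC. Qed.
Lemma bop_add0 : left_id bop_zero bop_add.
Proof. by move=> a; apply: bop_eq => x /=; rewrite add0r. Qed.
Lemma bop_addN : left_inverse bop_zero bop_opp bop_add.
Proof. by move=> a; apply: bop_eq => x /=; rewrite scaleN1r addNr. Qed.
HB.instance Definition _ := GRing.isZmodule.Build (bop E) bop_addA bop_addC bop_add0 bop_addN.
Lemma bop_mulA : associative bop_mul.
Proof. by move=> a b c; apply: bop_eq. Qed.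
Lemma bop_mul1l : left_id bop_one bop_mul.
Proof. by move=> a; apply: bop_eq. Qed.
Lemma bop_mul1r : right_id bop_one bop_mul.
Proof. by move=> a; apply: bop_eq. Qed.
Lemma bop_mulDl : left_distributive bop_mul +%R.
Proof. by move=> a b c; apply: bop_eq. Qed.
Lemma bop_mulDr : right_distributive bop_mul +%R.
Proof. by move=> a b c; apply: bop_eq => x /=; rewrite bopD0. Qed.
HB.instance Definition _ := GRing.Zmodule_isPzRing.Build (bop E)
 bop_mulA bop_mul1l bop_mul1r bop_mulDl bop_mulDr.
Lemma bop_scaleA (k l : R[i]) a : bop_scale k (bop_scale l a) = bop_scale (k * l) a.
Proof. by apply: bop_eq => x /=; rewrite scalerA. Qed.
Lemma bop_scale1 : left_id 1 bop_scale.
Proof. by move=> a; apply: bop_eq => x /=; rewrite scale1r. Qed.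
Lemma bop_scaleDr : right_distributive bop_scale +%R.
Proof. by move=> k a b; apply: bop_eq => x /=; rewrite scalerDr. Qed.
Lemma bop_scaleDl a : {morph bop_scale^~ a : k l / k + l}.
Proof. by move=> k l; apply: bop_eq => x /=; rewrite scalerDl. Qed.
HB.instance Definition _ := GRing.Zmodule_isLmodule.Build R[i] (bop E)
 bop_scaleA bop_scale1 bop_scaleDr bop_scaleDl.
End BopStruct.
Notation idb := (1 : bop _).

Section BopTheory.
Variables (R : realType) (E : banach R).
Implicit Types a b : bop E.

Lemma bopD a x y : a (x + y) = a x + a y. Proof. exact: bopD0. Qed.
Lemma bop0 a : a 0 = 0. Proof. exact: bop00. Qed.
Lemma bopZ a c x : a (c *: x) = c *: a x. Proof. exact: bopZ0. Qed.
Lemma bopN a x : a (- x) = - a x. Proof. by rewrite -scaleN1r bopZ scaleN1r. Qed.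
Lemma bopB a x y : a (x - y) = a x - a y. Proof. by rewrite bopD bopN. Qed.
Lemma bop_sum a (I : Type) (s : seq I) (P : pred I) (f : I -> E) :
 a (\sum_(i <- s | P i) f i) = \sum_(i <- s | P i) a (f i).
Proof. exact: (big_morph a (bopD a) (bop0 a)). Qed.
Lemma addbE a b x : (a + b) x = a x + b x. Proof. by []. Qed.
Lemma oppbE a x : (- a) x = - a x. Proof. by rewrite -scaleN1r. Qed.
Lemma subbE a b x : (a - b) x = a x - b x. Proof. by rewrite addbE oppbE. Qed.
Lemma mulbE a b x : (a * b) x = a (b x). Proof. by []. Qed.
Lemma scalebE c a x : (c *: a) x = c *: a x. Proof. by []. Qed.
Lemma onebE x : (1 : bop E) x = x. Proof. by []. Qed.
Lemma zerobE x : (0 : bop E) x = 0. Proof. by []. Qed.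
Lemma expbSE a n x : (a ^+ n.+1) x = a ((a ^+ n) x). Proof. by rewrite exprS. Qed.
Lemma sumbE (I : Type) (s : seq I) (P : pred I) (f : I -> bop E) x :
 (\sum_(i <- s | P i) f i) x = \sum_(i <- s | P i) f i x.
Proof. by apply: (big_morph (fun a : bop E => a x)). Qed.
Definition bE := (addbE, oppbE, mulbE, scalebE, onebE, zerobE).
Lemma scAl c a b : c *: (a * b) = (c *: a) * b. Proof. exact: bop_eq. Qed.
Lemma scAr c a b : c *: (a * b) = a * (c *: b).
Proof. by apply: bop_eq => x; rewrite !bE bopZ. Qed.
(** The supremum is written as in [opnorm], so that the two norms are convertible on a concrete
    space. *)
Definition opn a : R := sup [set bn (a x) | x in [set x : E | bn x <= 1]].
Let A a : set R := [set bn (a x) | x in [set x : E | bn x <= 1]].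
Let hsA a : has_sup (A a).
Proof.
split; first by exists (bn (a 0)), 0; rewrite /= ?bn0.
have [M M0 HM] := bop_bd0 a; exists M => _ [x /= x1 <-].
by apply: le_trans (HM x) _; rewrite -{2}(mulr1 M) ler_wpM2l.
Qed.
Lemma opn_ge0 a : 0 <= opn a.
Proof.
have := sup_upper_bound (hsA a); apply; exists 0; first by rewrite /= bn0.
by rewrite bop0 bn0.
Qed.
Lemma opnP a x : bn (a x) <= opn a * bn x.
Proof.
have [->|x0] := eqVneq x 0; first by rewrite bop0 bn0 mulr0.
rewrite -{1}(nmlK x0) bopZ bnZ nc_pos ?bn_ge0// mulrC.
apply: ler_wpM2r; first exact: bn_ge0.
by apply: (sup_upper_bound (hsA a)); exists (nml x) => //=; rewrite nmlE.
Qed.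
Lemma opnP_le a x M : opn a * bn x <= M -> bn (a x) <= M.
Proof. exact/le_trans/opnP. Qed.
Lemma opn_le a M : 0 <= M -> (forall x, bn (a x) <= M * bn x) -> opn a <= M.
Proof.
move=> M0 H; apply: ge_sup; first by case: (hsA a).
move=> _ [x /= x1 <-]; apply: le_trans (H x) _.
by rewrite -{2}(mulr1 M) ler_wpM2l.
Qed.
Lemma opn_le1 a M : (forall x, bn x <= 1 -> bn (a x) <= M) -> opn a <= M.
Proof.
move=> H; apply: ge_sup; first by case: (hsA a).
by move=> _ [x /= x1 <-]; exact: H.
Qed.
Lemma opnPM a x (M : R) : opn a <= M -> bn (a x) <= M * bn x.
Proof. by move=> H; apply: le_trans (opnP _ _) _; rewrite ler_wpM2r ?bn_ge0. Qed.
Lemma opnD a b : opn (a + b) <= opn a + opn b.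
Proof.
apply: opn_le => [|x]; first by rewrite addr_ge0 ?opn_ge0.
by apply: le_trans (bnD _ _) _; rewrite mulrDl lerD ?opnP.
Qed.
Lemma opnZ c a : opn (c *: a) = nc c * opn a.
Proof.
have H k d : opn (k *: d) <= nc k * opn d.
 apply: opn_le => [|x]; first by rewrite mulr_ge0 ?nc_ge0 ?opn_ge0.
 by rewrite scalebE bnZ -mulrA ler_wpM2l ?nc_ge0 ?opnP.
apply/eqP; rewrite eq_le H /=.
have [->|c0] := eqVneq c 0; first by rewrite nc0 mul0r opn_ge0.
have := H c^-1 (c *: a); rewrite scalerA mulVf// scale1r ncV ler_pdivlMl ?nc_gt0//.
Qed.
Lemma opn_eq0 a : opn a = 0 -> a = 0.
Proof.
move=> H; apply: bop_eq => x; apply: bn_eq0; apply/eqP.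
by rewrite eq_le bn_ge0 andbT; apply: le_trans (opnP _ _) _; rewrite H mul0r.
Qed.
Lemma opnM a b : opn (a * b) <= opn a * opn b.
Proof.
apply: opn_le => [|x]; first by rewrite mulr_ge0 ?opn_ge0.
by rewrite mulbE -mulrA; apply: le_trans (opnP _ _) _; rewrite ler_wpM2l ?opn_ge0 ?opnP.
Qed.
Lemma opnM_le a b M : opn a * opn b <= M -> opn (a * b) <= M.
Proof. exact/le_trans/opnM. Qed.
Lemma opn1 : opn 1 <= 1.
Proof. by apply: opn_le => // x; rewrite mul1r. Qed.
Lemma opnX a n : opn (a ^+ n) <= opn a ^+ n.
Proof.
elim: n => [|n IH]; first by rewrite !expr0 opn1.
by rewrite !exprS; apply: opnM_le; rewrite ler_wpM2l ?opn_ge0.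
Qed.
Lemma opn_comp (u : nat -> bop E) :
 (forall e, 0 < e -> exists N, forall m n, (N <= m)%N -> (N <= n)%N -> opn (u m - u n) < e) ->
 exists l, forall e, 0 < e -> exists N, forall n, (N <= n)%N -> opn (u n - l) < e.
Proof.
move=> H.
have Hx x : exists l, forall e, 0 < e -> exists N, forall n, (N <= n)%N -> bn (u n x - l) < e.
 apply: (@bcomp _ E) => e e0; have x1 : 0 < bn x + 1 by have := bn_ge0 x; lra.
 have [|N HN] := H (e / (bn x + 1)); first exact: divr_gt0.
 exists N => m n Hm Hn; have := HN _ _ Hm Hn; rewrite -subbE ltr_pdivlMr// => H1.
 apply: le_lt_trans (opnP _ _) _; apply: le_lt_trans H1.
 by rewrite ler_wpM2l ?opn_ge0// lerDl.
pose f x := projT1 (cid (Hx x)).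
have fP x e : 0 < e -> exists N, forall n, (N <= n)%N -> bn (u n x - f x) < e.
 by rewrite /f; case: cid => l Hl; exact: Hl.
have fU x : ulim (fun n => u n x) (f x) by apply: seq_ulim => e; exact: fP.
have fl c x y : f (c *: x + y) = c *: f x + f y.
 apply: (@ulim_uniq _ _ (fun n => u n (c *: x + y))); first exact: fU.
 have := ulimD (ulimZ c (fU x)) (fU y) => /ulim_ext; apply => n.
 by rewrite bopD bopZ.
have key e : 0 < e -> exists N, forall n x, (N <= n)%N -> bn (u n x - f x) <= e * bn x.
 move=> e0; have [N HN] := H _ e0; exists N => n x Hn.
 have := ulimD (ulim_cst (u n x)) (ulimN (fU x)); move=> Hl.
 apply: (ulim_norm_le Hl); apply: (evS (ev_ge N)) => m Hm.
 by rewrite -subbE; apply: opnPM; apply: ltW; apply: HN.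
have fb : exists M : R, forall x, bn (f x) <= M * bn x.
 have [N HN] := key 1 ltr01; exists (opn (u N) + 1) => x.
 have := HN N x (leqnn N); have := opnP (u N) x; have := bnB_ge (f x) (u N x).
 by rewrite bnC mulrDl; lra.
exists (Bop fl fb) => e e0; have [|N HN] := key (e / 2); first by lra.
exists N => n Hn; apply: (@le_lt_trans _ _ (e / 2)); last by lra.
by apply: opn_le => [|x]; [lra|rewrite subbE; apply: HN].
Qed.
Definition BL : banach R := @Banach R (bop E) opn opnD opnZ opn_eq0 opn_comp.
End BopTheory.

(** Input for a quotient: a seminorm [cN], complete on a subspace [cD] of [cV]. With [cD := Y] and
    the distance to [Z] as seminorm it produces the space [Y / Z]. *)
Record cdata (R : realType) := CData {
 cV : lmodType R[i]; cD : set cV; cN : cV -> R;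
 cD0 : cD 0; cDD : forall x y, cD x -> cD y -> cD (x + y);
 cDZ : forall c x, cD x -> cD (c *: x);
 cND : forall x y, cD x -> cD y -> cN (x + y) <= cN x + cN y;
 cNZ : forall c x, cD x -> cN (c *: x) = nc c * cN x;
 cComp : forall u : nat -> cV, (forall n, cD (u n)) ->
 (forall e, 0 < e -> exists N, forall m n, (N <= m)%N -> (N <= n)%N -> cN (u m - u n) < e) ->
 exists2 l, cD l & forall e, 0 < e -> exists N, forall n, (N <= n)%N -> cN (u n - l) < e }.

(** * Separated quotient of a complete seminormed space *)

Section Completion.
Variables (R : realType) (d : cdata R).
Let V := cV d. Let D := @cD _ d. Let N := @cN _ d.
Implicit Types x y z : V.

Let Dz : D 0. Proof. exact: cD0. Qed.
Let Dadd x y : D x -> D y -> D (x + y). Proof. exact: cDD. Qed.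
Let Dscale c x : D x -> D (c *: x). Proof. exact: cDZ. Qed.
Let DN x : D x -> D (- x). Proof. by move=> H; rewrite -scaleN1r; apply: Dscale. Qed.
Let DB x y : D x -> D y -> D (x - y). Proof. by move=> H1 H2; apply: Dadd => //; apply: DN. Qed.
#[local] Hint Resolve Dz Dadd Dscale DN DB : core.
Let ND x y : D x -> D y -> N (x + y) <= N x + N y. Proof. exact: cND. Qed.
Let NZ c x : D x -> N (c *: x) = nc c * N x. Proof. exact: cNZ. Qed.
Let N0 : N 0 = 0.
Proof. by rewrite -(scale0r (0 : V)) NZ ?nc0 ?mul0r. Qed.
Let NN x : D x -> N (- x) = N x.
Proof. by move=> H; rewrite -scaleN1r NZ// ncN nc1 mul1r. Qed.
Let Nge0 x : D x -> 0 <= N x.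
Proof.
move=> H; have := ND H (DN H); rewrite subrr N0 NN//; set t := N x; lra.
Qed.
Let Nle0 x : D x -> N x <= 0 -> N x = 0.
Proof. by move=> Dx H; apply/eqP; rewrite eq_le H Nge0. Qed.
Let Ntri y x z : D x -> D y -> D z -> N (x - z) <= N (x - y) + N (y - z).
Proof. by move=> Dx Dy Dz'; rewrite -{1}(subrK y x) -addrA; apply: ND; auto. Qed.
Let NsymE x y : D x -> D y -> N (x - y) = N (y - x).
Proof. by move=> Dx Dy; rewrite -opprB NN; auto. Qed.
(** The set passed to [xget] depends only on the class of [x], so [crep] is constant on classes and
    the quotient can be taken to be the type of its fixed points. *)
Definition crep x : V := xget 0 [set y | D y /\ N (x - y) = 0].
Let crepP x : D x -> D (crep x) /\ N (x - crep x) = 0.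
Proof.
move=> H; rewrite /crep; case: xgetP => [y _ //|/(_ x)] /=; case.
by split => //; rewrite subrr.
Qed.
Let Ntr x y z : D x -> D y -> D z -> N (x - y) = 0 -> N (y - z) = 0 -> N (x - z) = 0.
Proof.
move=> Dx Dy Dz' H1 H2; apply: Nle0; first by auto.
by apply: le_trans (Ntri Dx Dy Dz') _; rewrite H1 H2 addr0.
Qed.
Let crep_eq x y : D x -> D y -> N (x - y) = 0 -> crep x = crep y.
Proof.
move=> Dx Dy H; rewrite /crep; congr (xget 0 _); apply/seteqP; split => z /= [Dz' Hz].
 by split => //; apply: (Ntr Dy Dx Dz') => //; rewrite NsymE.
by split => //; apply: (Ntr Dx Dy Dz').
Qed.
Let crepK x : D x -> crep (crep x) = crep x.
Proof.
by move=> Dx; have [D1 H1] := crepP Dx; apply: crep_eq => //; rewrite NsymE.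
Qed.
Record cq := Cq { cval : V; cvalD : D cval; cvalK : crep cval = cval }.
HB.instance Definition _ := gen_eqMixin cq.
HB.instance Definition _ := gen_choiceMixin cq.
Let cq_eq (p q : cq) : cval p = cval q -> p = q.
Proof.
case: p q => [x Dx Kx] [y Dy Ky] /= H; subst y.
by congr Cq; exact: Prop_irrelevance.
Qed.
Let crepD x : D x -> D (crep x). Proof. by move=> /crepP[]. Qed.
Definition cproj0 x (H : D x) : cq := Cq (crepD H) (crepK H).
(** Vectors outside [D] go to the class of 0, which keeps the projection total. *)
Definition cproj x : cq := match pselect (D x) with left H => cproj0 H | right _ => cproj0 Dz end.
Let cprojE x : D x -> cval (cproj x) = crep x.
Proof. by move=> H; rewrite /cproj; case: pselect. Qed.
Let cproj_eq x y : D x -> D y -> N (x - y) = 0 -> cproj x = cproj y.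
Proof. by move=> Dx Dy H; apply: cq_eq; rewrite !cprojE//; exact: crep_eq. Qed.
Let cprojK (p : cq) : cproj (cval p) = p.
Proof. by case: p => x Dx Kx; apply: cq_eq; rewrite cprojE. Qed.
Let cval_proj x : D x -> N (x - cval (cproj x)) = 0.
Proof. by move=> H; rewrite cprojE//; case: (crepP H). Qed.
Let cvD (p : cq) : D (cval p). Proof. by case: p. Qed.
#[local] Hint Resolve cvD : core.

Definition cq_add (p q : cq) := cproj (cval p + cval q).
Definition cq_scale c (p : cq) := cproj (c *: cval p).
Definition cq_opp (p : cq) := cproj (- cval p).
Let cprojD x y : D x -> D y -> cq_add (cproj x) (cproj y) = cproj (x + y).
Proof.
move=> Dx Dy; apply: cproj_eq; [by auto|by auto|].
apply: Nle0; first by auto 6.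
rewrite opprD addrACA; apply: le_trans (ND _ _) _; [by auto|by auto|].
by rewrite NsymE// cval_proj// NsymE// cval_proj// addr0.
Qed.
Let cprojZ c x : D x -> cq_scale c (cproj x) = cproj (c *: x).
Proof.
move=> Dx; apply: cproj_eq; [by auto|by auto|].
by rewrite -scalerBr NZ; [rewrite NsymE// cval_proj// mulr0|auto].
Qed.
Let cq_ind (P : cq -> Prop) : (forall x, D x -> P (cproj x)) -> forall p, P p.
Proof. by move=> H p; rewrite -(cprojK p); apply: H. Qed.

Let cq_addA : associative cq_add.
Proof.
elim/cq_ind => x Dx; elim/cq_ind => y Dy; elim/cq_ind => z Dz'.
by rewrite !cprojD ?addrA; auto.
Qed.
Let cq_addC : commutative cq_add.
Proof. by move=> p q; rewrite /cq_add addrC. Qed.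
Let cq_add0 : left_id (cproj 0) cq_add.
Proof. by elim/cq_ind => x Dx; rewrite cprojD ?add0r. Qed.
Let cq_addN : left_inverse (cproj 0) cq_opp cq_add.
Proof.
elim/cq_ind => x Dx; have -> : cq_opp (cproj x) = cproj (- x).
 by rewrite -scaleN1r -cprojZ// /cq_opp /cq_scale scaleN1r.
by rewrite cprojD ?addNr; auto.
Qed.
HB.instance Definition _ := GRing.isZmodule.Build cq cq_addA cq_addC cq_add0 cq_addN.
Let cq_scaleA c e p : cq_scale c (cq_scale e p) = cq_scale (c * e) p.
Proof. by elim/cq_ind: p => x Dx; rewrite !cprojZ ?scalerA; auto. Qed.
Let cq_scale1 : left_id 1 cq_scale.
Proof. by elim/cq_ind => x Dx; rewrite cprojZ// scale1r. Qed.
Let cq_scaleDr : right_distributive cq_scale +%R.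
Proof.
move=> c; elim/cq_ind => x Dx; elim/cq_ind => y Dy.
rewrite -[LHS]/(cq_scale c (cq_add _ _)) -[RHS]/(cq_add _ _) cprojD//.
by rewrite !cprojZ ?cprojD ?scalerDr; auto.
Qed.
Let cq_scaleDl p : {morph cq_scale^~ p : k l / k + l}.
Proof.
move=> k l; elim/cq_ind: p => x Dx.
by rewrite -[RHS]/(cq_add _ _) !cprojZ// cprojD ?scalerDl; auto.
Qed.
HB.instance Definition _ := GRing.Zmodule_isLmodule.Build R[i] cq cq_scaleA cq_scale1 cq_scaleDr cq_scaleDl.

Definition cq_norm (p : cq) : R := N (cval p).
Let cnorm_proj x : D x -> cq_norm (cproj x) = N x.
Proof.
move=> Dx; rewrite /cq_norm; have H := cval_proj Dx.
have H' := H; rewrite NsymE// in H'; apply/eqP; rewrite eq_le; apply/andP; split.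
 rewrite -{1}(subrK x (cval _)); apply: le_trans (ND _ _) _; [by auto|by []|].
 by rewrite H' add0r.
rewrite -{1}(subrK (cval (cproj x)) x); apply: le_trans (ND _ _) _; [by auto|by auto|].
by rewrite H add0r.
Qed.
Let cnD (p q : cq) : cq_norm (p + q) <= cq_norm p + cq_norm q.
Proof.
elim/cq_ind: p => x Dx; elim/cq_ind: q => y Dy.
by rewrite -[_ + _ : cq]/(cq_add _ _) cprojD// !cnorm_proj; auto.
Qed.
Let cnZ c (p : cq) : cq_norm (c *: p) = nc c * cq_norm p.
Proof.
by elim/cq_ind: p => x Dx; rewrite -[_ *: _ : cq]/(cq_scale _ _) cprojZ// !cnorm_proj; auto.
Qed.
Let cn0 (p : cq) : cq_norm p = 0 -> p = 0.
Proof.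
elim/cq_ind: p => x Dx; rewrite cnorm_proj// => H.
by apply: cproj_eq; rewrite ?subr0.
Qed.
Let cqB (p q : cq) : cq_norm (p - q) = N (cval p - cval q).
Proof.
have -> : p - q = cq_add p (cq_scale (-1) q) by rewrite -[cq_scale _ _]/(-1 *: q) scaleN1r.
rewrite -{1}(cprojK p) -{1}(cprojK q).
by rewrite cprojZ// cprojD ?scaleN1r; auto.
Qed.
Let cncomp (u : nat -> cq) :
 (forall e, 0 < e -> exists M, forall m n, (M <= m)%N -> (M <= n)%N -> cq_norm (u m - u n) < e) ->
 exists l, forall e, 0 < e -> exists M, forall n, (M <= n)%N -> cq_norm (u n - l) < e.
Proof.
move=> H; have [||l Dl Hl] := @cComp _ d (fun n => cval (u n)).
- by move=> n; exact: cvD.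
- by move=> e /H[M HM]; exists M => m n Hm Hn; rewrite -[cN _]cqB; apply: HM.
exists (cproj l) => e /Hl[M HM]; exists M => n Hn; apply: le_lt_trans (HM n Hn).
rewrite cqB; apply: le_trans (Ntri (cvD _) Dl (cvD _)) _.
by rewrite cval_proj// addr0.
Qed.
Lemma separated_quotient : exists (Q : banach R) (p : cV d -> Q),
 [/\ (forall c x y, cD x -> cD y -> p (c *: x + y) = c *: p x + p y),
 (forall q, exists2 x, cD x & p x = q) &
 (forall x, cD x -> bn (p x) = cN x)].
Proof.
exists (@Banach R cq cq_norm cnD cnZ cn0 cncomp), cproj; split.
- by move=> c x y Dx Dy; rewrite -cprojD//; [rewrite -cprojZ|apply: Dscale].
- by move=> q; exists (cval q); [exact: cvD|exact: cprojK].
- exact: cnorm_proj.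
Qed.
End Completion.

(** Dependent choice with the whole past available, as needed to build separated sequences. *)
Lemma dep_seq (T : Type) (P : seq T -> T -> Prop) :
 (forall s, exists x, P s x) -> exists u : nat -> T, forall n, P (mkseq u n) (u n).
Proof.
move=> H; pose g s := projT1 (cid (H s)).
have gP s : P s (g s) by rewrite /g; case: cid.
pose S := fix S n := if n is m.+1 then rcons (S m) (g (S m)) else [::].
exists (fun n => g (S n)) => n.
suff -> : mkseq (fun n => g (S n)) n = S n by exact: gP.
by elim: n => [//|n IH]; rewrite mkseqS IH.
Qed.
Lemma infinite_injection (T : choiceType) (A : set T) : ~ finite_set A ->
 exists f : nat -> T, (forall n, A (f n)) /\ injective f.
Proof.
move=> H; have [|u Hu] := @dep_seq _ (fun (s : seq T) x => A x /\ x \notin s).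
 move=> s; apply: contrapT => H1; apply: H; apply: (sub_finite_set _ (finite_seq s)) => x Ax /=.
 by apply: contrapT => /negP xs; apply: H1; exists x.
exists u; split=> [n|m n]; first by case: (Hu n).
have key p q : (p < q)%N -> u p <> u q.
 move=> pq e; have [_] := Hu q; rewrite -e => /negP; apply.
 by apply/mapP; exists p => //; rewrite mem_iota.
by case: (ltngtP m n) => // /key H1 e; case: H1; rewrite e.
Qed.

(** * Compact operators *)

Section Compact.
Variables (R : realType) (E : banach R).
Implicit Types (a b k : bop E) (x y : E).

Definition cpt a := forall e : R, 0 < e -> exists m (f : nat -> E),
 forall x, bn x <= 1 -> exists2 j, (j < m)%N & bn (a x - f j) < e.
Definition ucpt a := forall u : nat -> E, (forall n, bn (u n) <= 1) ->
 exists l, ulim (fun n => a (u n)) l.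

Lemma cpt_ucpt a : cpt a -> ucpt a.
Proof.
move=> H u Hu; apply: ulim_exists => e /H[m [f Hf]].
have [j _ Hj] : exists2 j, (j < m)%N & ev (fun n => bn (a (u n) - f j) < e).
 by apply: ev_fin; apply: ev_all => n; apply: Hf.
by exists (f j).
Qed.
(** If the image of the ball has no finite [e]-net, dependent choice gives an [e]-separated sequence
    of images, and such a sequence has no ultralimit because the ultrafilter is free. *)
Lemma ucpt_cpt a : ucpt a -> cpt a.
Proof.
move=> H e e0; apply: contrapT => Hn.
have [|u Hu] := @dep_seq _ (fun (s : seq E) x => bn x <= 1 /\ forall y, y \in s -> e <= bn (a x - a y)).
 move=> s; apply: contrapT => Hs; apply: Hn; exists (size s), (fun j => a (nth 0 s j)) => x x1.
 apply: contrapT => Hx; apply: Hs; exists x; split => // y ys.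
 rewrite leNgt; apply/negP => Hxy; apply: Hx; exists (index y s); first by rewrite index_mem.
 by rewrite nth_index.
have [|l Hl] := H u; first by move=> n; case: (Hu n).
have e2 : 0 < e / 2 by lra.
have [n Hn1] := ev_ex (Hl _ e2).
have [m [Hm nm]] := ev_ex (ev_and (Hl _ e2) (ev_ge n.+1)).
have : e <= bn (a (u m) - a (u n)).
 by apply: (Hu m).2; apply/mapP; exists n => //; rewrite mem_iota.
by have := bn_tri l (a (u m)) (a (u n)); rewrite (bnC l (a (u n))); lra.
Qed.
Lemma cptP a (M : R) (u : nat -> E) : cpt a -> (forall n, bn (u n) <= M) ->
 exists l, ulim (fun n => a (u n)) l.
Proof.
move=> /cpt_ucpt H Hu.
have [n|l Hl] := H (fun n => (`|M| + 1)^-1%:C%C *: u n).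
 rewrite bnZ nc_real (ger0_norm (_ : 0 <= (`|M| + 1)^-1)); last by rewrite invr_ge0 ltW.
 rewrite ler_pdivrMl// mulr1.
 by apply: le_trans (Hu n) _; have := ler_norm M; lra.
exists ((`|M| + 1)%:C%C *: l); have := ulimZ (`|M| + 1)%:C%C Hl; move/ulim_ext; apply => n.
by rewrite bopZ scalerA -rmorphM /= mulfV// rmorph1 scale1r.
Qed.
Lemma cptP_ev a (M : R) (u : nat -> E) : cpt a -> ev (fun n => bn (u n) <= M) ->
 exists l, ulim (fun n => a (u n)) l.
Proof.
move=> Ha Hu; pose v n := if `[< bn (u n) <= M >] then u n else 0.
have [n|l Hl] := @cptP a (Num.max M 0) v Ha.
 by rewrite /v; case: asboolP => H; rewrite ?bn0 le_max ?H ?lexx ?orbT.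
exists l; apply: (ulim_ev Hl); apply: (evS Hu) => n Hn.
by rewrite /v; case: asboolP.
Qed.
Lemma cpt0 : cpt 0.
Proof.
move=> e e0; exists 1%N, (fun _ => 0) => x _; exists 0%N => //.
by rewrite zerobE subrr bn0.
Qed.
Lemma cptD a b : cpt a -> cpt b -> cpt (a + b).
Proof.
move=> /cpt_ucpt Ha /cpt_ucpt Hb; apply: ucpt_cpt => u Hu.
have [l Hl] := Ha u Hu; have [m Hm] := Hb u Hu.
by exists (l + m); exact: ulimD.
Qed.
Lemma cptZ c a : cpt a -> cpt (c *: a).
Proof.
move=> /cpt_ucpt Ha; apply: ucpt_cpt => u Hu.
by have [l Hl] := Ha u Hu; exists (c *: l); exact: ulimZ.
Qed.
Lemma cptN a : cpt a -> cpt (- a).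
Proof. by move=> /(cptZ (-1)); rewrite scaleN1r. Qed.
Lemma ulim_bop a (u : nat -> E) l : ulim u l -> ulim (fun n => a (u n)) (a l).
Proof.
move=> H e e0; have c0 := opn_ge0 a.
have e2 : 0 < e / (opn a + 1) by apply: divr_gt0 => //; lra.
apply: (evS (H _ e2)) => n; rewrite -bopB ltr_pdivlMr; last by lra.
rewrite mulrDr mulr1 mulrC => Hn; have := bn_ge0 (u n - l); have := opnP a (u n - l); lra.
Qed.
Lemma cptMl a b : cpt b -> cpt (a * b).
Proof.
move=> /cpt_ucpt Hb; apply: ucpt_cpt => u Hu.
by have [l Hl] := Hb u Hu; exists (a l); exact: (ulim_bop a Hl).
Qed.
Lemma cptMr a b : cpt a -> cpt (a * b).
Proof.
move=> Ha; apply: ucpt_cpt => u Hu; apply: (@cptP a (opn b) (fun n => b (u n))) => // n.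
apply: opnP_le; rewrite -{2}(mulr1 (opn b)).
by apply: ler_wpM2l => //; exact: opn_ge0.
Qed.
Lemma cpt_lim a : (forall e : R, 0 < e -> exists2 b, cpt b & opn (a - b) < e) -> cpt a.
Proof.
move=> H; apply: ucpt_cpt => u Hu; apply: ulim_exists => e e0.
have e2 : 0 < e / 2 by lra.
have [b /cpt_ucpt Hb ab] := H _ e2; have [l Hl] := Hb u Hu; exists l.
apply: (evS (Hl _ e2)) => n Hn.
have := bn_tri (b (u n)) (a (u n)) l; have := opnP (a - b) (u n); rewrite subbE.
have : opn (a - b) * bn (u n) <= opn (a - b) * 1 by rewrite ler_wpM2l ?opn_ge0.
lra.
Qed.
End Compact.

(** * Riesz theory of compact operators *)

Section RieszTheory.
Variables (R : realType) (E : banach R).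
Implicit Types (a b k : bop E) (x y : E) (A B : set E).

Lemma not_closd_dist A x : closd A -> ~ A x -> exists2 e : R, 0 < e & forall y, A y -> e <= bn (y - x).
Proof.
move=> cA Ax; apply: contrapT => H; apply: Ax; apply: cA => e e0.
apply: contrapT => H1; apply: H; exists e => // y Ay; rewrite leNgt; apply/negP => H2.
by apply: H1; exists y.
Qed.
Lemma riesz A B : subsp A -> closd A -> subsp B -> A `<=` B -> (exists2 x, B x & ~ A x) ->
 exists y, [/\ B y, bn y = 1 & forall z, A z -> 2^-1 <= bn (y - z)].
Proof.
move=> sA cA sB AB [x Bx Ax]; have [e e0 He] := not_closd_dist cA Ax.
pose D : set R := [set bn (x - z) | z in A].
have D0 : has_inf D.
 split; first by exists (bn (x - 0)), 0 => //; exact: ss0.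
 by exists 0 => _ [a _ <-]; exact: bn_ge0.
have eD : e <= inf D.
 by apply: lb_le_inf; [exact: D0.1|move=> _ [a Aa <-]; rewrite bnC He].
have d0 : 0 < inf D by lra.
(* The infimum itself serves as tolerance, so [w] has norm below twice the distance to [A]; this is
   the origin of the constant 1/2. *)
have [_ [a0 Aa0 <-]] := inf_adherent d0 D0.
set w := x - a0 => Hw; have w0 : w != 0.
 by rewrite subr_eq0; apply/eqP => xa; apply: Ax; rewrite xa.
have bw0 : 0 < bn w by rewrite bn_gt0.
exists (nml w); split; [|exact: nmlE|].
- by apply: ssZ => //; apply: ssB => //; apply: AB.
- move=> a Aa; have Hz : nml w - a = (bn w)^-1%:C%C *: (x - (a0 + (bn w)%:C%C *: a)).
 rewrite opprD addrA -/w scalerBr scalerA -rmorphM /= mulVf ?gt_eqF//.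
 by rewrite rmorph1 scale1r.
 rewrite Hz bnZ nc_pos; last by rewrite invr_ge0 ltW.
 rewrite ler_pdivlMl//.
 have : inf D <= bn (x - (a0 + (bn w)%:C%C *: a)).
 apply: (ge_inf D0.2); exists (a0 + (bn w)%:C%C *: a) => //.
 by apply: ssD => //; apply: ssZ.
 move: Hw; set t := bn w; lra.
Qed.
(** Common core of the theory. Unit vectors of [B n] are chosen at distance at least 1/2 from [A n];
    since [lam n - k] sends [B n] into [A n], their images under [k] stay [s / 2] apart, against
    compactness. Decreasing ranges, increasing kernels and eigenvectors of distinct eigenvalues are
    the three instances. *)
Lemma riesz_pairs k (A B : nat -> set E) (lam : nat -> R[i]) (s : R) : cpt k -> 0 < s ->
 (forall n, subsp (A n)) -> (forall n, closd (A n)) -> (forall n, subsp (B n)) ->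
 (forall n, A n `<=` B n) -> (forall n, exists2 x, B n x & ~ A n x) ->
 (forall n x, B n x -> A n (lam n *: x - k x)) -> (forall n x, B n x -> B n (k x)) ->
 (forall n, s <= nc (lam n)) ->
 (forall m n, m <> n -> B m `<=` A n \/ B n `<=` A m) -> False.
Proof.
move=> ck s0 sA cA sB AB nAB H1 H2 Hs HAB.
have ex n := riesz (sA n) (cA n) (sB n) (@AB n) (nAB n).
pose y n := projT1 (cid (ex n)).
have yP n : [/\ B n (y n), bn (y n) = 1 & forall z, A n z -> 2^-1 <= bn (y n - z)].
 by rewrite /y; case: cid.
have key m n : B m `<=` A n -> s / 2 <= bn (k (y n) - k (y m)).
 move=> BA; have [By y1 Hy] := yP n; have [Bm _ _] := yP m.
 have l0 : lam n != 0 by rewrite -nc_gt0; apply: lt_le_trans (Hs n).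
 pose z := (lam n *: y n - k (y n)) + k (y m).
 have Az : A n z by apply: ssD => //; [apply: H1|apply: BA; apply: H2].
 have -> : k (y n) - k (y m) = lam n *: (y n - (lam n)^-1 *: z).
 by rewrite scalerBr scalerA mulfV// scale1r /z opprD opprB !addrA [lam n *: y n + _]addrC addrK.
 rewrite bnZ; have : 2^-1 <= bn (y n - (lam n)^-1 *: z) by apply: Hy; apply: ssZ.
 have := Hs n; set p := nc _; set q := bn _ => Hp Hq.
 by apply: ler_pM => //; lra.
have [n|l Hl] := @cptP _ _ k 1 y ck; first by case: (yP n) => _ ->.
have s4 : 0 < s / 4 by lra.
have [n Hn] := ev_ex (Hl _ s4).
have [m [Hm nm]] := ev_ex (ev_and (Hl _ s4) (ev_ge n.+1)).
have mn : m <> n by move=> e; rewrite e ltnn in nm.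
have := bn_tri l (k (y n)) (k (y m)); rewrite (bnC l (k (y m))).
by case: (HAB _ _ mn) => /key; rewrite ?(bnC (k (y m)) (k (y n))); lra.
Qed.
Definition shft (lam : R[i]) k : bop E := lam *: idb - k.
Lemma shiftE lam k x : shft lam k x = lam *: x - k x.
Proof. by rewrite /shft !bE. Qed.
Lemma shiftop_comm lam k : GRing.comm (shft lam k) k.
Proof. by rewrite /GRing.comm /shft mulrBl mulrBr -scAl -scAr mul1r mulr1. Qed.
(** If unit vectors [y n] had images tending to zero, [lam *: y n] would be asymptotic to the
    convergent [k (y n)], and the limit of [y n] would be an eigenvector of norm at least 1. *)
Lemma inj_bounded_below k lam : cpt k -> lam != 0 -> (forall x, k x = lam *: x -> x = 0) ->
 exists2 d : R, 0 < d & forall x, d * bn x <= bn (shft lam k x).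
Proof.
move=> ck l0 inj; apply: contrapT => H.
have ex n : exists y : E, bn y = 1 /\ bn (shft lam k y) <= n.+1%:R^-1.
 apply: contrapT => H1; apply: H; exists n.+1%:R^-1; first by rewrite invr_gt0.
 move=> x; have [->|x0] := eqVneq x 0; first by rewrite bn0 mulr0 bn_ge0.
 rewrite leNgt; apply/negP => H2; apply: H1; exists (nml x); split; first exact: nmlE.
 rewrite /nml bopZ bnZ nc_pos ?invr_ge0 ?bn_ge0//.
 by rewrite ler_pdivrMl ?bn_gt0// mulrC ltW.
pose y n := projT1 (cid (ex n)).
have yP n : bn (y n) = 1 /\ bn (shft lam k (y n)) <= n.+1%:R^-1 by rewrite /y; case: cid.
have [n|l Hl] := @cptP _ _ k 1 y ck; first by case: (yP n) => ->.
have HT : ulim (fun n => shft lam k (y n)) 0.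
 apply: seq_ulim => e /inv_small[N HN]; exists N => n /HN; rewrite subr0.
 exact: le_lt_trans (yP n).2.
have Hy : ulim y (lam^-1 *: l).
 have := ulimZ lam^-1 (ulimD HT Hl); rewrite add0r => /ulim_ext; apply => n.
 by rewrite shiftE subrK scalerA mulVf// scale1r.
have : lam^-1 *: l = 0.
 apply: inj; apply/eqP; rewrite eq_sym -subr_eq0 -shiftE; apply/eqP.
 exact: (ulim_uniq (ulim_bop (shft lam k) Hy) HT).
move=> E0; have : 1 <= bn (lam^-1 *: l).
 by apply: (ulim_norm_ge Hy); apply: ev_all => n; case: (yP n) => ->.
by rewrite E0 bn0 ler10.
Qed.
Lemma bounded_belowX a (d : R) n : 0 < d -> (forall x, d * bn x <= bn (a x)) ->
 forall x, d ^+ n * bn x <= bn ((a ^+ n) x).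
Proof.
move=> d0 H; elim: n => [|n IH] x; first by rewrite !expr0 mul1r.
rewrite expbSE exprS -mulrA; apply: le_trans (H _).
by apply: ler_wpM2l; [exact: ltW|exact: IH].
Qed.
Definition ran a : set E := [set a x | x in setT].
Definition kerb a : set E := [set x | a x = 0].
Lemma ran_subsp a : subsp (ran a).
Proof.
split.
- by exists 0 => //; rewrite bop0.
- by move=> _ _ [x _ <-] [y _ <-]; exists (x + y) => //; rewrite bopD.
- by move=> c _ [x _ <-]; exists (c *: x) => //; rewrite bopZ.
Qed.
Lemma kerb_subsp a : subsp (kerb a).
Proof.
split; rewrite /kerb /=.
- by rewrite bop0.
- by move=> x y Hx Hy; rewrite bopD Hx Hy addr0.
- by move=> c x Hx; rewrite bopZ Hx scaler0.
Qed.
Lemma kerb_closd a : closd (kerb a).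
Proof.
move=> x H; apply: bn_small => e e0; have c0 := opn_ge0 a.
have e2 : 0 < e / (opn a + 1) by apply: divr_gt0 => //; lra.
have [y Hy] := H _ e2; rewrite ltr_pdivlMr; last by lra.
rewrite mulrDr mulr1 mulrC => Hn; have := bn_ge0 (y - x).
have := opnP a (y - x); rewrite bopB Hy sub0r bnN; lra.
Qed.
Lemma ran_closd_bb a (d : R) : 0 < d -> (forall x, d * bn x <= bn (a x)) -> closd (ran a).
Proof.
move=> d0 H y Hy.
have [u Hu ul] := clos_ulim (Hy : clos (ran a) y).
have ex n : exists x, a x = u n by case: (Hu n) => x _ <-; exists x.
pose x n := projT1 (cid (ex n)).
have ax n : a (x n) = u n by rewrite /x; case: cid.
have [|l Hl] := @ulim_exists _ _ x.
 move=> e e0; have de : 0 < d * e / 2 by rewrite divr_gt0// mulr_gt0.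
 have [n0 Hn0] := ev_ex (ul _ de); exists (x n0); apply: (evS (ul _ de)) => n Hn.
 have := bn_tri y (u n) (u n0); rewrite (bnC y (u n0)) -!ax -bopB => H1.
 have := H (x n - x n0); rewrite !ax in Hn Hn0 H1 * => H2.
 by rewrite -(ltr_pM2l d0); lra.
exists l => //; apply: (ulim_uniq (ulim_bop a Hl)); apply: (ulim_ext ul) => n.
by rewrite ax.
Qed.
Lemma shiftopX k lam n : cpt k -> exists2 k', cpt k' & shft lam k ^+ n = shft (lam ^+ n) k'.
Proof.
move=> ck; elim: n => [|n [k' ck' IH]].
 by exists 0; [exact: cpt0|rewrite !expr0 /shft scale1r subr0].
exists (lam *: k' + k * shft (lam ^+ n) k').
 by apply: cptD; [exact: cptZ|exact: cptMr].
rewrite exprS IH {1 2 3}/shft mulrBl -scAl mul1r scalerBr scalerA -exprS.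
by rewrite opprD addrA.
Qed.
Lemma bounded_below_surj k lam (d : R) : cpt k -> lam != 0 -> 0 < d ->
 (forall x, d * bn x <= bn (shft lam k x)) -> forall y, exists x, shft lam k x = y.
Proof.
move=> ck l0 d0 H; set T := shft lam k; apply: contrapT => /existsNP[y0 Hy0].
have Tinj n x : (T ^+ n) x = 0 -> x = 0.
 move=> H1; apply: bn_eq0; apply/eqP; rewrite eq_le bn_ge0 andbT.
 have := bounded_belowX n d0 H x; rewrite -/T H1 bn0 pmulr_rle0//; exact: exprn_gt0.
apply: (@riesz_pairs k (fun n => ran (T ^+ n.+1)) (fun n => ran (T ^+ n)) (fun _ => lam) (nc lam)) => //.
- by rewrite nc_gt0.
- by move=> n; exact: ran_subsp.
- by move=> n; apply: (@ran_closd_bb _ (d ^+ n.+1)); [exact: exprn_gt0|exact: bounded_belowX].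
- by move=> n; exact: ran_subsp.
- by move=> n _ [x _ <-]; exists (T x) => //; rewrite exprSr.
- move=> n; exists ((T ^+ n) y0); first by exists y0.
 move=> [x _ Hx]; apply: Hy0; exists x; apply/eqP; rewrite -subr_eq0; apply/eqP.
 by apply: (Tinj n); rewrite bopB -Hx exprSr mulbE subrr.
- by move=> n _ [x _ <-]; exists x => //; rewrite expbSE shiftE.
- move=> n _ [x _ <-]; exists (k x) => //.
 by rewrite -!mulbE; congr (bfun _ x); apply/esym/commrX/commr_sym/shiftop_comm.
- move=> m n mn.
 have key p q : (p < q)%N -> ran (T ^+ q) `<=` ran (T ^+ p.+1).
 by move=> pq _ [x _ <-]; exists ((T ^+ (q - p.+1)) x) => //; rewrite -mulbE -exprD subnKC.
 by case: (ltngtP m n) mn => // [/key|/key]; auto.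
Qed.
Lemma bop_inverse a (d : R) : 0 < d -> (forall x, d * bn x <= bn (a x)) ->
 (forall y, exists x, a x = y) -> exists b, [/\ a * b = 1, b * a = 1 & opn b <= d^-1].
Proof.
move=> d0 H sur; pose f y := projT1 (cid (sur y)).
have fP y : a (f y) = y by rewrite /f; case: cid.
have inj x y : a x = a y -> x = y.
 move=> e; apply: subr0_eq; apply: bn_eq0; apply/eqP.
 by rewrite eq_le bn_ge0 andbT -(pmulr_rle0 _ d0); apply: le_trans (H _) _; rewrite bopB e subrr bn0.
have fl c x y : f (c *: x + y) = c *: f x + f y.
 by apply: inj; rewrite fP bopD bopZ !fP.
have fb x : bn (f x) <= d^-1 * bn x by rewrite ler_pdivlMl//; apply: le_trans (H _) _; rewrite fP.
have fb' : exists M : R, forall x, bn (f x) <= M * bn x by exists d^-1.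
exists (Bop fl fb'); split.
- by apply: bop_eq => x; rewrite mulbE fP.
- by apply: bop_eq => x; apply: inj; rewrite mulbE fP.
- by apply: opn_le => //; rewrite invr_ge0 ltW.
Qed.
Lemma riesz_inverse k lam : cpt k -> lam != 0 -> (forall x, k x = lam *: x -> x = 0) ->
 exists b, shft lam k * b = 1 /\ b * shft lam k = 1.
Proof.
move=> ck l0 inj; have [d d0 Hd] := inj_bounded_below ck l0 inj.
have [b [H1 H2 _]] := bop_inverse d0 Hd (bounded_below_surj ck l0 d0 Hd).
by exists b.
Qed.
Lemma riesz_ascent k lam : cpt k -> lam != 0 ->
 exists p, forall n x, (shft lam k ^+ n) x = 0 -> (shft lam k ^+ p) x = 0.
Proof.
move=> ck l0; set T := shft lam k.
have mon p n x : (p <= n)%N -> (T ^+ p) x = 0 -> (T ^+ n) x = 0.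
 by move=> pn H; rewrite -(subnK pn) exprD mulbE H bop0.
suff [p Hp] : exists p, forall x, (T ^+ p.+1) x = 0 -> (T ^+ p) x = 0.
 exists p => n; elim: n => [|n IH] x; first by rewrite expr0 onebE => ->; rewrite bop0.
 by rewrite exprSr mulbE => /IH H; apply: Hp; rewrite exprSr mulbE.
apply: contrapT => /forallNP H.
apply: (@riesz_pairs k (fun n => kerb (T ^+ n)) (fun n => kerb (T ^+ n.+1)) (fun _ => lam) (nc lam)) => //.
- by rewrite nc_gt0.
- by move=> n; exact: kerb_subsp.
- by move=> n; exact: kerb_closd.
- by move=> n; exact: kerb_subsp.
- by move=> n x; exact: mon.
- by move=> n; have /existsNP[x /not_implyP[H1 H2]] := H n; exists x.
- by move=> n x; rewrite /kerb /= -shiftE -mulbE -exprSr.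
- move=> n x; rewrite /kerb /= => Hx.
 have -> : (T ^+ n.+1) (k x) = k ((T ^+ n.+1) x); last by rewrite Hx bop0.
 by rewrite -!mulbE; congr (bfun _ x); apply/esym/commrX/commr_sym/shiftop_comm.
- move=> m n mn.
 have key p q : (p < q)%N -> kerb (T ^+ p.+1) `<=` kerb (T ^+ q).
 by move=> pq x; exact: mon.
 by case: (ltngtP m n) mn => // [/key|/key]; auto.
Qed.
Lemma riesz_surj_inj k lam : cpt k -> lam != 0 -> (forall y, exists x, shft lam k x = y) ->
 forall x, shft lam k x = 0 -> x = 0.
Proof.
move=> ck l0 sur x Hx; have [p Hp] := riesz_ascent ck l0.
have surX n y : exists z, (shft lam k ^+ n) z = y.
 elim: n y => [|n IH] y; first by exists y.
 by have [z <-] := sur y; have [t <-] := IH z; exists t; rewrite expbSE.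
have [y Hy] := surX p x; rewrite -Hy; apply: (Hp p.+1).
by rewrite expbSE Hy.
Qed.
Lemma ran_closd k lam : cpt k -> lam != 0 -> closd (ran (shft lam k)).
Proof.
move=> ck l0; set T := shft lam k => y Hy.
have [u Hu ul] := clos_ulim (Hy : clos (ran T) y).
(* Preimages are moved along the kernel until their norm is at most twice their distance to it. If
   they were unbounded, the normalised ones would converge to a kernel vector, which this choice
   forbids. *)
have ex n : exists x, T x = u n /\ forall z, T z = 0 -> bn x <= 2 * bn (x - z).
 case: (Hu n) => x _ <-; pose D : set R := [set bn (x - z) | z in kerb T].
 have D0 : has_inf D.
 split; first by exists (bn (x - 0)), 0 => //; exact: (ss0 (kerb_subsp T)).
 by exists 0 => _ [a _ <-]; exact: bn_ge0.
 have Dle z : T z = 0 -> inf D <= bn (x - z) by move=> Hz; apply: (ge_inf D0.2); exists z.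
 have [Ax|nAx] := EM (T x = 0).
 by exists 0; split; [rewrite bop0 Ax|move=> z _; rewrite bn0 mulr_ge0 ?bn_ge0].
 have [e e0 He] := not_closd_dist (@kerb_closd T) nAx.
 have eD : e <= inf D.
 by apply: lb_le_inf; [exact: D0.1|move=> _ [a Aa <-]; rewrite bnC He].
 have d0 : 0 < inf D by lra.
 have [_ [a0 Aa0 <-] Hw] := inf_adherent d0 D0.
 exists (x - a0); split; first by rewrite bopB Aa0 subr0.
 move=> z Hz; have := Dle (a0 + z); rewrite bopD Aa0 Hz addr0 => /(_ erefl).
 by rewrite opprD addrA; lra.
pose x n := projT1 (cid (ex n)).
have xP n : T (x n) = u n /\ forall z, T z = 0 -> bn (x n) <= 2 * bn (x n - z) by rewrite /x; case: cid.
have [[M HM]|Hunb] := EM (exists M : R, ev (fun n => bn (x n) <= M)).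
 have [l Hl] := cptP_ev ck HM.
 have Hx : ulim x (lam^-1 *: (y + l)).
 have := ulimZ lam^-1 (ulimD ul Hl) => /ulim_ext; apply => n.
 by rewrite -(xP n).1 shiftE subrK scalerA mulVf// scale1r.
 exists (lam^-1 *: (y + l)) => //; apply: (ulim_uniq (ulim_bop T Hx)).
 by apply: (ulim_ext ul) => n; rewrite (xP n).1.
have Hbig (M : R) : ev (fun n => M < bn (x n)).
 have /ev_not H : ~ ev (fun n => bn (x n) <= M) by move=> H; apply: Hunb; exists M.
 by apply: (evS H) => n /negP; rewrite -ltNge.
have Tz : ulim (fun n => T (nml (x n))) 0.
 move=> e e0; have p1 : (0 : R) < 1 by [].
 apply: (evS (ev_and (Hbig ((bn y + 1) / e)) (ul _ p1))) => n [H1 H2].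
 have b0 : 0 < bn (x n) by apply: lt_trans H1; rewrite divr_gt0//; have := bn_ge0 y; lra.
 rewrite subr0 /nml bopZ bnZ nc_pos ?invr_ge0 ?ltW// (xP n).1 ltr_pdivrMl//.
 move: H1; rewrite ltr_pdivrMr//; have := bnD (u n - y) y; rewrite subrK; lra.
have n1 n : bn (nml (x n)) <= 1.
 have [->|H] := eqVneq (x n) 0; first by rewrite /nml scaler0 bn0.
 by rewrite nmlE.
have [l Hl] := cptP ck n1.
have Hz : ulim (fun n => nml (x n)) (lam^-1 *: l).
 have := ulimZ lam^-1 (ulimD Tz Hl); rewrite add0r => /ulim_ext; apply => n.
 by rewrite shiftE subrK scalerA mulVf// scale1r.
have T0 : T (lam^-1 *: l) = 0 by exact: (ulim_uniq (ulim_bop T Hz) Tz).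
have p2 : (0 : R) < 4^-1 by rewrite invr_gt0.
have [n [H1 H2]] := ev_ex (ev_and (Hz _ p2) (Hbig 0)).
have x0 : x n != 0 by rewrite -bn_gt0.
have := (xP n).2 ((bn (x n))%:C%C *: (lam^-1 *: l)); rewrite bopZ T0 scaler0 => /(_ erefl).
rewrite -{2}(nmlK x0) -scalerBr bnZ nc_pos ?bn_ge0// mulrCA -{1}(mulr1 (bn _)).
by rewrite ler_pM2l//; lra.
Qed.
Lemma eigenvalues_finite k (s : R) : cpt k -> 0 < s ->
 finite_set [set lam : R[i] | s <= nc lam /\ exists2 x, x != 0 & k x = lam *: x].
Proof.
move=> ck s0; apply: contrapT => Hinf.
have [f [fP finj]] := infinite_injection Hinf.
(* [Q n] is the product of the [f j - k] for [j < n]; an eigenvector for [f n] lies in the kernel of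
   [Q n.+1] but not in that of [Q n]. *)
pose Q := fix Q n := if n is m.+1 then shft (f m) k * Q m else 1.
have QS n x : Q n.+1 x = shft (f n) k (Q n x) by [].
have Qk n : GRing.comm (Q n) k.
 elim: n => [|n IH] /=; first exact/commr_sym/commr1.
 by apply/commr_sym/commrM; apply/commr_sym => //; exact: shiftop_comm.
have Qs n lam : GRing.comm (Q n) (shft lam k).
 rewrite /shft; apply: commrB => //; rewrite /GRing.comm -scAl -scAr.
 by rewrite mulr1 mul1r.
have Qe n lam x : k x = lam *: x -> Q n x = (\prod_(j < n) (f j - lam)) *: x.
 move=> Hx; elim: n => [|n IH]; first by rewrite big_ord0 scale1r.
 rewrite QS IH bopZ shiftE Hx -scalerBl scalerA big_ord_recr /=.
 by rewrite mulrC.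
have Qle m n x : (m <= n)%N -> Q m x = 0 -> Q n x = 0.
 move=> /subnK <-; elim: (n - m)%N => [//|j IH] H; rewrite addSn QS.
 by rewrite IH ?bop0.
apply: (@riesz_pairs k (fun n => kerb (Q n)) (fun n => kerb (Q n.+1)) f s) => //.
- by move=> n; exact: kerb_subsp.
- by move=> n; exact: kerb_closd.
- by move=> n; exact: kerb_subsp.
- by move=> n x; exact: Qle.
- move=> n; have [_ [x x0 Hx]] := fP n; exists x; rewrite /kerb -[mkset _ _]/(_ = 0).
 by rewrite QS (Qe _ _ _ Hx) bopZ shiftE Hx subrr scaler0.
 rewrite (Qe _ _ _ Hx) => /eqP; rewrite scaler_eq0 (negbTE x0) orbF.
 rewrite prodf_seq_eq0 => /hasP[j _] /=; rewrite subr_eq0 => /eqP Hj.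
 by have := ltn_ord j; rewrite (finj _ _ Hj) ltnn.
- by move=> n x Hx; rewrite /kerb -[mkset _ _]/(_ = 0) -shiftE -mulbE Qs mulbE -QS.
- move=> n x Hx; rewrite /kerb -[mkset _ _]/(_ = 0) -mulbE (Qk n.+1) mulbE.
 by rewrite (Hx : Q n.+1 x = 0) bop0.
- by move=> n; case: (fP n).
- move=> m n mn.
 have key p q : (p < q)%N -> kerb (Q p.+1) `<=` kerb (Q q).
 by move=> pq x; exact: Qle.
 by case: (ltngtP m n) mn => // [/key|/key]; auto.
Qed.
End RieszTheory.

(** * Subquotients and induced operators *)

Section Subquotient.
Variables (R : realType) (E : banach R).
Implicit Types (a b : bop E) (x y z : E) (Y Z : set E).

(** [p] is defined on all of [E] but only its values on [Y] matter. The last three fields together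
    say that the norm of [Q] is the distance to [Z]. *)
Record subquo Y Z (Q : banach R) (p : E -> Q) : Prop := SubQuo {
 sq_lin : forall c x y, Y x -> Y y -> p (c *: x + y) = c *: p x + p y;
 sq_onto : forall q, exists2 x, Y x & p x = q;
 sq_le : forall x, Y x -> bn (p x) <= bn x;
 sq_ker : forall x, Y x -> (p x = 0 <-> Z x);
 sq_lift : forall x (e : R), Y x -> 0 < e -> exists2 z, Z z & bn (x - z) < bn (p x) + e }.

Definition dst Z x : R := inf [set bn (x - z) | z in Z].

Section Dst.
Variables (Z : set E) (sZ : subsp Z).
Lemma dst_has x : has_inf [set bn (x - z) | z in Z].
Proof.
split; first by exists (bn (x - 0)), 0 => //; exact: ss0.
by exists 0 => _ [z _ <-]; exact: bn_ge0.
Qed.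
Lemma dst_le x z : Z z -> dst Z x <= bn (x - z).
Proof. by move=> Hz; apply: (ge_inf (dst_has x).2); exists z. Qed.
Lemma dst_le0 x : dst Z x <= bn x.
Proof. by have := @dst_le x 0 (ss0 sZ); rewrite subr0. Qed.
Lemma dst_ge0 x : 0 <= dst Z x.
Proof. by apply: lb_le_inf; [exact: (dst_has x).1|move=> _ [z _ <-]; exact: bn_ge0]. Qed.
Lemma dst_ge x (d : R) : (forall z, Z z -> d <= bn (x - z)) -> d <= dst Z x.
Proof. by move=> H; apply: lb_le_inf; [exact: (dst_has x).1|move=> _ [z Hz <-]; exact: H]. Qed.
Lemma dst_lift x (e : R) : 0 < e -> exists2 z, Z z & bn (x - z) < dst Z x + e.
Proof. by move=> e0; have [_ [z Hz <-] H] := inf_adherent e0 (dst_has x); exists z. Qed.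
Lemma dstD x y : dst Z (x + y) <= dst Z x + dst Z y.
Proof.
apply/ler_addgt0Pr => e e0; have e2 : 0 < e / 2 by lra.
have [z Hz H1] := dst_lift x e2; have [w Hw H2] := dst_lift y e2.
have := @dst_le (x + y) (z + w) (ssD sZ Hz Hw); rewrite opprD addrACA.
by have := bnD (x - z) (y - w); lra.
Qed.
Lemma dstZ c x : dst Z (c *: x) = nc c * dst Z x.
Proof.
have H d y : dst Z (d *: y) <= nc d * dst Z y.
 apply/ler_addgt0Pr => e e0; have d0 := nc_ge0 d.
 have e2 : 0 < e / (nc d + 1) by apply: divr_gt0 => //; lra.
 have [z Hz H1] := dst_lift y e2.
 apply: le_trans (dst_le (d *: y) (ssZ sZ d Hz)) _; rewrite -scalerBr bnZ.
 have : nc d * bn (y - z) <= nc d * (dst Z y + e / (nc d + 1)) by rewrite ler_wpM2l// ltW.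
 move/le_trans; apply; rewrite mulrDr lerD2l mulrA ler_pdivrMr; last by lra.
 by rewrite mulrC ler_wpM2l; lra.
apply/eqP; rewrite eq_le H /=.
have [->|c0] := eqVneq c 0; first by rewrite nc0 mul0r dst_ge0.
have := H c^-1 (c *: x); rewrite scalerA mulVf// scale1r ncV ler_pdivlMl ?nc_gt0//.
Qed.
Lemma dst_eq0 x : closd Z -> dst Z x = 0 -> Z x.
Proof.
move=> cZ H; apply: cZ => e e0; have [z Hz] := dst_lift x e0.
by rewrite H add0r bnC => H1; exists z.
Qed.
Lemma dst0 x : Z x -> dst Z x = 0.
Proof. by move=> Hx; apply/eqP; rewrite eq_le dst_ge0 andbT; have := dst_le x Hx; rewrite subrr bn0. Qed.
Lemma dst_modr x z : Z z -> dst Z (x - z) = dst Z x.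
Proof.
move=> Hz; apply/eqP; rewrite eq_le; apply/andP; split.
 by apply: le_trans (dstD _ _) _; rewrite (dst0 (ssN sZ Hz)) addr0.
by rewrite -{1}(subrK z x); apply: le_trans (dstD _ _) _; rewrite (dst0 Hz) addr0.
Qed.
End Dst.

Lemma geometric_cauchy (v : nat -> E) :
 (forall k, bn (v k.+1 - v k) <= 2^-1 ^+ k) ->
 forall e, 0 < e -> exists N, forall m n, (N <= m)%N -> (N <= n)%N -> bn (v m - v n) < e.
Proof.
move=> H; have H1 k j : bn (v (k + j)%N - v k) <= 2 * 2^-1 ^+ k.
 have : bn (v (k + j)%N - v k) <= 2 * 2^-1 ^+ k - 2 * 2^-1 ^+ (k + j).
 elim: j => [|j IH]; first by rewrite addn0 subrr bn0 subrr.
 have := bn_tri (v (k + j)%N) (v (k + j.+1)%N) (v k); rewrite addnS.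
 have := H (k + j)%N; rewrite exprS; move: IH; set t := 2^-1 ^+ (k + j); lra.
 have : (0 : R) <= 2^-1 ^+ (k + j) by rewrite exprn_ge0.
 lra.
move=> e e0.
have [|N /(_ N (leqnn N)) HN] := @half_small R (e / 4); first by rewrite divr_gt0.
exists N => m n Hm Hn; have := H1 N (m - N)%N; have := H1 N (n - N)%N; rewrite !subnKC//.
have := bn_tri (v N) (v m) (v n); rewrite (bnC (v N) (v n)); lra.
Qed.
Lemma subquotient Y Z : subsp Y -> closd Y -> subsp Z -> closd Z -> Z `<=` Y ->
 exists (Q : banach R) (p : E -> Q), subquo Y Z p.
Proof.
move=> sY cY sZ cZ ZY.
have comp (u : nat -> E) : (forall n, Y (u n)) ->
 (forall e, 0 < e -> exists N, forall m n, (N <= m)%N -> (N <= n)%N -> dst Z (u m - u n) < e) ->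
 exists2 l, Y l & forall e, 0 < e -> exists N, forall n, (N <= n)%N -> dst Z (u n - l) < e.
 move=> Yu Hu; have p (k : nat) : (0 : R) < 2^-1 ^+ k by rewrite exprn_gt0// invr_gt0.
 pose N k := projT1 (cid (Hu _ (p k))).
 have NP k m n : (N k <= m)%N -> (N k <= n)%N -> dst Z (u m - u n) < 2^-1 ^+ k.
 by rewrite /N; case: cid => /= N0; apply.
 pose M k := \max_(j < k.+1) N j.
 have NM j k : (j <= k)%N -> (N j <= M k)%N.
 by move=> jk; apply: (@leq_bigmax _ (fun j : 'I_k.+1 => N j) (Ordinal (jk : (j < k.+1)%N))).
 have step k w : exists z, Z z /\ (dst Z (u (M k.+1) - w) < 2^-1 ^+ k -> bn (u (M k.+1) - w - z) < 2^-1 ^+ k).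
 have [H|H] := EM (dst Z (u (M k.+1) - w) < 2^-1 ^+ k); last by exists 0; split => //; exact: ss0.
 have e0 : 0 < 2^-1 ^+ k - dst Z (u (M k.+1) - w) by rewrite subr_gt0.
 have [z Hz H1] := dst_lift sZ (u (M k.+1) - w) e0; exists z; split => // _; lra.
 pose zz k w := projT1 (cid (step k w)).
 have zP k w : Z (zz k w) /\ (dst Z (u (M k.+1) - w) < 2^-1 ^+ k -> bn (u (M k.+1) - w - zz k w) < 2^-1 ^+ k).
 by rewrite /zz; case: cid.
 pose v := fix v k := if k is j.+1 then u (M j.+1) - zz j (v j) else u (M 0%N).
 have vZ k : Z (u (M k) - v k).
 case: k => [|k] /=; first by rewrite subrr; exact: ss0.
 by rewrite opprB addrCA subrr addr0; case: (zP k (v k)).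
 have vY k : Y (v k) by rewrite -(subKr (u (M k)) (v k)); apply: ssB => //; apply: ZY.
 have vC k : bn (v k.+1 - v k) <= 2^-1 ^+ k.
 rewrite /= addrAC; apply: ltW; apply: (zP k (v k)).2.
 have -> : u (M k.+1) - v k = (u (M k.+1) - u (M k)) - - (u (M k) - v k) by rewrite opprK addrA subrK.
 rewrite dst_modr//; last exact: ssN.
 by apply: NP; apply: NM.
 have [l Hl] := bcomp (geometric_cauchy vC).
 have Yl : Y l by apply: (closd_ulim cY (ev_all vY)); exact: seq_ulim.
 exists l => // e e0; have e2 : 0 < e / 2 by lra.
 have [N1 H1] := Hl _ e2; have [N2 H2] := Hu _ e2.
 exists (maxn N2 (M 0%N)) => n; rewrite geq_max => /andP[n2 _].
 have [k [Hk1 Hk2]] : exists k, (N1 <= k)%N /\ dst Z (u n - u (M k)) < e / 2.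
 have [N3 /(_ N3 (leqnn N3)) H3] := half_small e2.
 exists (maxn N1 N3); split; first exact: leq_maxl.
 have [le|gt] := leqP N2 (M (maxn N1 N3)); first exact: H2.
 apply: lt_trans H3; apply: NP; last by apply: NM; exact: leq_maxr.
 by apply: leq_trans n2; apply: ltnW; apply: leq_ltn_trans gt; apply: NM; exact: leq_maxr.
 have -> : u n - l = (u n - u (M k)) + (u (M k) - v k) + (v k - l).
 by rewrite !addrA !subrK.
 have h1 := dstD sZ ((u n - u (M k)) + (u (M k) - v k)) (v k - l).
 have h2 := dstD sZ (u n - u (M k)) (u (M k) - v k).
 have h3 := dst_le0 sZ (v k - l); have h4 := H1 k Hk1; rewrite (dst0 sZ (vZ k)) in h2.
 lra.
pose d := @CData R E Y (dst Z) (ss0 sY) (ssD sY) (ssZ sY) (fun x y _ _ => dstD sZ x y)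
 (fun c x _ => dstZ sZ c x) comp.
have [Q [p [H1 H2 H3]]] := separated_quotient d.
exists Q, p; split => //.
- by move=> x Yx; rewrite (H3 x)//; exact: dst_le0.
- move=> x Yx; split => [H|Zx]; last by apply: bn_eq0; rewrite (H3 x)//; exact: dst0.
 by apply: dst_eq0 => //; rewrite -[dst _ _](H3 x) // H bn0.
- by move=> x e Yx e0; rewrite (H3 x)//; exact: dst_lift.
Qed.

Section Induced.
Variables (Y Z : set E) (Q : banach R) (p : E -> Q).
Hypotheses (sY : subsp Y) (sZ : subsp Z) (ZY : Z `<=` Y) (pP : subquo Y Z p).

Lemma sq0 : p 0 = 0.
Proof. by apply/(sq_ker pP); [exact: ss0|exact: ss0]. Qed.
Lemma sqZ c x : Y x -> p (c *: x) = c *: p x.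
Proof. by move=> Yx; have := sq_lin pP c Yx (ss0 sY); rewrite sq0 !addr0. Qed.
Lemma sqD x y : Y x -> Y y -> p (x + y) = p x + p y.
Proof. by move=> Yx Yy; have := sq_lin pP 1 Yx Yy; rewrite !scale1r. Qed.
Lemma sqB x y : Y x -> Y y -> p (x - y) = p x - p y.
Proof. by move=> Yx Yy; rewrite sqD//; [rewrite -scaleN1r sqZ// scaleN1r|exact: ssN]. Qed.
Lemma sq_eq x y : Y x -> Y y -> (p x = p y <-> Z (x - y)).
Proof.
move=> Yx Yy; rewrite -(sq_ker pP (ssB sY Yx Yy)) sqB//; split=> [->|H]; first by rewrite subrr.
by apply/eqP; rewrite -subr_eq0 H.
Qed.
Lemma sq_section (q : Q) (e : R) : 0 < e -> exists2 x, Y x & p x = q /\ bn x < bn q + e.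
Proof.
move=> e0; have [x Yx <-] := sq_onto pP q; have [z Hz H] := sq_lift pP Yx e0.
exists (x - z); first by apply: ssB => //; exact: ZY.
split => //; apply/sq_eq => //; first by apply: ssB => //; exact: ZY.
by rewrite addrAC subrr add0r; exact: ssN.
Qed.
Definition stab (a : bop E) := (forall x, Y x -> Y (a x)) /\ (forall x, Z x -> Z (a x)).

Lemma induced_ex a : stab a -> exists b : bop Q,
 [/\ (forall x, Y x -> b (p x) = p (a x)), opn b <= opn a & cpt a -> cpt b].
Proof.
move=> [aY aZ]; pose s q := projT1 (cid2 (sq_onto pP q)).
have sQ q : Y (s q) by rewrite /s; case: cid2.
have ps q : p (s q) = q by rewrite /s; case: cid2.
pose f q := p (a (s q)).
have fp x : Y x -> f (p x) = p (a x).
 move=> Yx; apply/sq_eq; [exact: aY|exact: aY|].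
 by rewrite -bopB; apply: aZ; apply/sq_eq.
have fl c q1 q2 : f (c *: q1 + q2) = c *: f q1 + f q2.
 rewrite -{1}(ps q1) -{1}(ps q2) -(sq_lin pP)// fp; last by apply: ssD => //; exact: ssZ.
 by rewrite bopD bopZ (sq_lin pP)//; apply: aY.
have fb q : bn (f q) <= opn a * bn q.
 apply/ler_addgt0Pr => e e0; have a0 := opn_ge0 a.
 have e2 : 0 < e / (opn a + 1) by apply: divr_gt0 => //; lra.
 have [x Yx [<- Hx]] := sq_section q e2; rewrite fp//.
 apply: le_trans (sq_le pP (aY _ Yx)) _; apply: opnP_le.
 have : opn a * bn x <= opn a * (bn (p x) + e / (opn a + 1)) by rewrite ler_wpM2l// ltW.
 move/le_trans; apply; rewrite mulrDr lerD2l mulrA ler_pdivrMr; last by lra.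
 by rewrite mulrC ler_wpM2l; lra.
have fb' : exists M : R, forall q, bn (f q) <= M * bn q by exists (opn a).
exists (Bop fl fb'); split => //.
 by apply: opn_le; rewrite ?opn_ge0.
move=> ca; apply: ucpt_cpt => u Hu.
have ex n : exists x, [/\ Y x, p x = u n & bn x <= 2].
 have [x Yx [H1 H2]] := sq_section (u n) (ltr01 : (0 : R) < 1).
 by exists x; split => //; have := Hu n; lra.
pose v n := projT1 (cid (ex n)).
have vP n : [/\ Y (v n), p (v n) = u n & bn (v n) <= 2] by rewrite /v; case: cid.
have [n|l Hl] := @cptP _ _ a 2 v ca; first by case: (vP n).
apply: ulim_exists => e e0; have e2 : 0 < e / 2 by lra.
have [n0 Hn0] := ev_ex (Hl _ e2); exists (f (u n0)); apply: (evS (Hl _ e2)) => n Hn.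
have [Y1 p1 _] := vP n; have [Y0 p0 _] := vP n0.
rewrite -[bfun _ _]/(f (u n)) -p1 -p0 !fp// -sqB; [|exact: aY|exact: aY].
have := sq_le pP (ssB sY (aY _ Y1) (aY _ Y0)).
have := bn_tri l (a (v n)) (a (v n0)); rewrite (bnC l (a (v n0))); lra.
Qed.
(** The default 0 makes the norm bound and the preservation of compactness hold for every operator;
    algebraic identities are stated under [stab]. *)
Definition induced (a : bop E) : bop Q :=
 match pselect (stab a) with left H => projT1 (cid (induced_ex H)) | right _ => 0 end.
Lemma inducedE a x : stab a -> Y x -> induced a (p x) = p (a x).
Proof. by move=> H Yx; rewrite /induced; case: pselect => // H'; case: cid => b [] /= ->. Qed.
Lemma induced_le a : opn (induced a) <= opn a.
Proof.
rewrite /induced; case: pselect => [H|_]; first by case: cid => b [].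
apply: le_trans (opn_ge0 a); apply: opn_le => // x.
by rewrite zerobE bn0 mul0r.
Qed.
Lemma induced_cpt a : cpt a -> cpt (induced a).
Proof.
rewrite /induced; case: pselect => [H|_]; first by case: cid => b [].
by move=> _; exact: cpt0.
Qed.
Lemma induced_unique a (b : bop Q) : stab a -> (forall x, Y x -> b (p x) = p (a x)) -> induced a = b.
Proof.
move=> H Hb; apply: bop_eq => q; have [x Yx <-] := sq_onto pP q.
by rewrite inducedE// Hb.
Qed.
Lemma stab_lin c a b : stab a -> stab b -> stab (c *: a + b).
Proof.
move=> [a1 a2] [b1 b2]; split=> x Hx; rewrite !bE.
 by apply: ssD => //; [apply: ssZ => //; apply: a1|apply: b1].
by apply: ssD => //; [apply: ssZ => //; apply: a2|apply: b2].
Qed.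
Lemma stabM a b : stab a -> stab b -> stab (a * b).
Proof. by move=> [a1 a2] [b1 b2]; split=> x Hx; rewrite mulbE; [apply/a1/b1|apply/a2/b2]. Qed.
Lemma stab1 : stab 1. Proof. by []. Qed.
Lemma stab0 : stab 0. Proof. by split=> x _; exact: ss0. Qed.
Lemma stabD a b : stab a -> stab b -> stab (a + b).
Proof. by move=> Ha Hb; rewrite -(scale1r a); exact: stab_lin. Qed.
Lemma stabZ c a : stab a -> stab (c *: a).
Proof. by move=> Ha; rewrite -(addr0 (c *: a)); apply: stab_lin => //; exact: stab0. Qed.
Lemma stabB a b : stab a -> stab b -> stab (a - b).
Proof. by move=> Ha Hb; apply: stabD => //; rewrite -scaleN1r; exact: stabZ. Qed.
Lemma induced_lin c a b : stab a -> stab b -> induced (c *: a + b) = c *: induced a + induced b.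
Proof.
move=> Ha Hb; apply: induced_unique => [|x Yx]; first exact: stab_lin.
rewrite !bE !inducedE// (sq_lin pP)//; [exact: (proj1 Ha)|exact: (proj1 Hb)].
Qed.
Lemma inducedM a b : stab a -> stab b -> induced (a * b) = induced a * induced b.
Proof.
move=> Ha Hb; apply: induced_unique => [|x Yx]; first exact: stabM.
by rewrite !mulbE !inducedE//; exact: (proj1 Hb).
Qed.
Lemma induced1 : induced 1 = 1.
Proof. by apply: induced_unique => [|x Yx]; first exact: stab1. Qed.
Lemma induced0 : induced 0 = 0.
Proof. by apply: induced_unique => [|x Yx]; [exact: stab0|rewrite !zerobE sq0]. Qed.
Lemma inducedD a b : stab a -> stab b -> induced (a + b) = induced a + induced b.
Proof. by move=> Ha Hb; have := induced_lin 1 Ha Hb; rewrite !scale1r. Qed.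
Lemma inducedZ c a : stab a -> induced (c *: a) = c *: induced a.
Proof. by move=> Ha; have := induced_lin c Ha stab0; rewrite !addr0 induced0 addr0. Qed.
Lemma inducedB a b : stab a -> stab b -> induced (a - b) = induced a - induced b.
Proof.
move=> Ha Hb; rewrite -(scaleN1r b) inducedD ?inducedZ//.
by rewrite -scaleN1r; exact: stabZ.
Qed.
End Induced.

Lemma set0_subsp : subsp [set (0 : E)].
Proof. by split=> // [x y -> ->|c x ->]; rewrite /= ?addr0 ?scaler0. Qed.
Lemma set0_closd : closd [set (0 : E)].
Proof. by move=> x Hx; apply: bn_small => e /Hx[_ ->]; rewrite sub0r bnN => /ltW. Qed.
Lemma set0_sub (Y : set E) : subsp Y -> [set 0] `<=` Y.
Proof. by move=> sY _ ->; exact: ss0. Qed.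
Lemma subquo0_iso (Y : set E) (Q : banach R) (p : E -> Q) : subquo Y [set 0] p -> forall x, Y x -> bn (p x) = bn x.
Proof.
move=> pP x Yx; apply/eqP; rewrite eq_le (sq_le pP Yx)/=; apply/ler_addgt0Pr => e e0.
by have [z -> ] := sq_lift pP Yx e0; rewrite subr0 => /ltW.
Qed.
End Subquotient.

(** * Finite-dimensional subspaces *)

Section RowSpaces.
Variables (F : fieldType) (n : nat) (P : 'rV[F]_n -> Prop).
Hypotheses (P0 : P 0) (PD : forall u v, P u -> P v -> P (u + v)) (PZ : forall c u, P u -> P (c *: u)).

(** Take a matrix of maximal rank with rows in [P]: stacking a vector of [P] outside its row space
    would raise the rank. *)
Lemma rowspace_of_pred : exists m (B : 'M[F]_(m, n)), row_free B /\ forall v, P v <-> (v <= B)%MS.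
Proof.
have rowsP m (B : 'M[F]_(m, n)) v : (forall i, P (row i B)) -> (v <= B)%MS -> P v.
 move=> H /submxP[D ->]; rewrite mulmx_sum_row.
 by elim/big_ind: _ => //= i _; apply: PZ.
pose good r := `[< exists m (B : 'M[F]_(m, n)), (forall i, P (row i B)) /\ \rank B = r >].
have ex : exists r, good r.
 by exists 0%N; apply/asboolP; exists 0%N, 0; split; [case|rewrite mxrank0].
have bd r : good r -> (r <= n)%N by move=> /asboolP[m [B [_ <-]]]; exact: rank_leq_col.
case: (ex_maxnP ex bd) => r /asboolP[m [B [HB rB]]] Hmax.
exists (\rank B), (row_base B); split; first exact: row_base_free.
move=> v; rewrite eq_row_base; split=> [Pv|]; last exact: rowsP.
have : (\rank (col_mx B v) <= \rank B)%N.
 rewrite rB; apply: Hmax; apply/asboolP; exists (m + 1)%N, (col_mx B v); split=> // i.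
 case: (split_ordP i) => j ->; first by rewrite rowKu.
 by rewrite rowKd row_id.
move=> H; have : (col_mx B v <= B)%MS.
 have s : (B <= col_mx B v)%MS by rewrite -addsmxE addsmxSl.
 by rewrite -(mxrank_leqif_sup s).2 eqn_leq H mxrankS.
by rewrite col_mx_sub => /andP[].
Qed.
End RowSpaces.

Section ComplexUlim.
Variable R : realType.

Lemma real_ulim (g : nat -> R) (M : R) : ev (fun n => `|g n| <= M) ->
 exists l : R, forall e, 0 < e -> ev (fun n => `|g n - l| < e).
Proof.
move=> gM; pose S := [set t : R | ev (fun n => t < g n)].
have S0 : has_sup S.
 split; first by exists (- M - 1); apply: (evS gM) => n; rewrite ler_norml => /andP[]; lra.
 exists M => t St; have [n [H1]] := ev_ex (ev_and St gM); rewrite ler_norml => /andP[]; lra.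
exists (sup S) => e e0.
have [t St Ht] := sup_adherent e0 S0.
have : ~ ev (fun n => sup S + e / 2 < g n).
 by move=> H; have := sup_upper_bound S0 H; lra.
move=> /ev_not H; apply: (evS (ev_and St H)) => n [h1 /negP]; rewrite -leNgt => h2.
by rewrite ltr_norml; apply/andP; split; lra.
Qed.
Lemma nc_le_ReIm (c : R[i]) : nc c <= `|complex.Re c| + `|complex.Im c|.
Proof.
rewrite [in X in X <= _](complexE c); apply: le_trans (ncD _ _) _; rewrite ncM !nc_real.
suff -> : nc ('i%C : R[i]) = 1 by rewrite mul1r.
by rewrite /nc /= expr0n expr1n add0r sqrtr1.
Qed.
Lemma Re_le_nc (c : R[i]) : `|complex.Re c| <= nc c.
Proof. by have := normc_ge_Re c; rewrite nc_norm lecR. Qed.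
Lemma Im_le_nc (c : R[i]) : `|complex.Im c| <= nc c.
Proof.
case: c => p q; rewrite /nc /= -sqrtr_sqr ler_wsqrtr//; have := sqr_ge0 p; lra.
Qed.
Lemma complex_ulim (f : nat -> R[i]) (M : R) : ev (fun n => nc (f n) <= M) ->
 exists l : R[i], forall e, 0 < e -> ev (fun n => nc (f n - l) < e).
Proof.
move=> fM.
have [l1 H1] := @real_ulim (fun n => complex.Re (f n)) M (evS fM (fun n => le_trans (Re_le_nc _))).
have [l2 H2] := @real_ulim (fun n => complex.Im (f n)) M (evS fM (fun n => le_trans (Im_le_nc _))).
exists (Complex l1 l2) => e e0; have e2 : 0 < e / 2 by lra.
apply: (evS (ev_and (H1 _ e2) (H2 _ e2))) => n [h1 h2].
apply: le_lt_trans (nc_le_ReIm _) _.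
by move: h1 h2; case: (f n) => p q /= h1 h2; lra.
Qed.
End ComplexUlim.

Section FiniteDim.
Variables (R : realType) (E : banach R).
Implicit Types (a b : bop E) (x y z : E) (W V : set E).

Definition comb r (e : 'I_r -> E) (c : 'rV[R[i]]_r) : E := \sum_i c 0 i *: e i.
Lemma combD r (e : 'I_r -> E) c d : comb e (c + d) = comb e c + comb e d.
Proof. by rewrite /comb -big_split /=; apply: eq_bigr => i _; rewrite mxE scalerDl. Qed.
Lemma combZ r (e : 'I_r -> E) k c : comb e (k *: c) = k *: comb e c.
Proof. by rewrite /comb scaler_sumr; apply: eq_bigr => i _; rewrite mxE scalerA. Qed.
Lemma comb0 r (e : 'I_r -> E) : comb e 0 = 0.
Proof. by rewrite /comb big1// => i _; rewrite mxE scale0r. Qed.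
Lemma combB r (e : 'I_r -> E) c d : comb e (c - d) = comb e c - comb e d.
Proof. by rewrite combD -(scaleN1r d) combZ scaleN1r. Qed.
Lemma comb_delta r (e : 'I_r -> E) i : comb e (delta_mx 0 i) = e i.
Proof.
rewrite /comb (bigD1 i)//= mxE !eqxx scale1r big1 ?addr0// => j ji.
by rewrite mxE eqxx (negbTE ji) scale0r.
Qed.
Definition cspan r (e : 'I_r -> E) : set E := [set comb e c | c in setT].
Lemma cspan_subsp r (e : 'I_r -> E) : subsp (cspan e).
Proof.
split; first by exists 0 => //; rewrite comb0.
- by move=> _ _ [c _ <-] [d _ <-]; exists (c + d) => //; rewrite combD.
- by move=> k _ [c _ <-]; exists (k *: c) => //; rewrite combZ.
Qed.
Lemma cspan_mem r (e : 'I_r -> E) i : cspan e (e i).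
Proof. by exists (delta_mx 0 i) => //; rewrite comb_delta. Qed.
Lemma cspan_min r (e : 'I_r -> E) W : subsp W -> (forall i, W (e i)) -> cspan e `<=` W.
Proof. by move=> sW H _ [c _ <-]; apply: ss_sum => // i _; apply: ssZ. Qed.
Definition consf r (x : E) (e : 'I_r -> E) (i : 'I_r.+1) : E :=
 if unlift ord0 i is Some j then e j else x.
Lemma comb_cons r x (e : 'I_r -> E) (c : 'rV_r.+1) :
 comb (consf x e) c = c 0 ord0 *: x + comb e (\row_j c 0 (lift ord0 j)).
Proof.
rewrite /comb big_ord_recl /consf unlift_none; congr (_ + _).
by apply: eq_bigr => i _; rewrite liftK mxE.
Qed.
Lemma cspan_cons r x (e : 'I_r -> E) z :
 cspan (consf x e) z <-> exists k y, cspan e y /\ z = k *: x + y.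
Proof.
split=> [[c _ <-]|[k [_ [[c _ <-] ->]]]].
 by rewrite comb_cons; exists (c 0 ord0), (comb e (\row_j c 0 (lift ord0 j))); split => //; eexists.
exists (\row_i if unlift ord0 i is Some j then c 0 j else k) => //.
rewrite comb_cons mxE unlift_none; congr (_ + comb e _).
by apply/rowP => j; rewrite !mxE liftK.
Qed.
(** If [x] is at distance [d] from [W], the coefficient of [x] in [k *: x + y] is bounded by the
    norm divided by [d]; so it converges along the ultrafilter, and the closed [W] contains the
    limit of the rest. *)
Lemma closd_add W x : subsp W -> closd W -> closd (fun z => exists k y, W y /\ z = k *: x + y).
Proof.
move=> sW cW; have [Wx|nWx] := EM (W x).
 have -> : (fun z => exists k y, W y /\ z = k *: x + y) = W; last by [].
 apply/funext => z; apply/propext; split=> [[k [y [Wy ->]]]|Wz].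
 by apply: ssD => //; apply: ssZ.
 by exists 0, z; rewrite scale0r add0r.
have [d d0 Hd] := not_closd_dist cW nWx.
have Hd' k y : W y -> d * nc k <= bn (k *: x + y).
 move=> Wy; have [->|k0] := eqVneq k 0; first by rewrite nc0 mulr0 bn_ge0.
 have -> : k *: x + y = k *: (x - (- (k^-1 *: y))) by rewrite opprK scalerDr scalerA mulfV// scale1r.
 rewrite bnZ mulrC ler_wpM2l ?nc_ge0// bnC; apply: Hd.
 by apply: ssN => //; apply: ssZ.
move=> z Hz; have [u Hu ul] := clos_ulim (Hz : clos _ z).
have ex n : exists k, W (u n - k *: x).
 by have [k [y [Wy ->]]] := Hu n; exists k; rewrite addrAC subrr add0r.
have [k Hk] := choice ex.
have [|l Hl] := @complex_ulim _ k ((bn z + 1) / d).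
 apply: (evS (ul 1 ltr01)) => n Hn; rewrite ler_pdivlMr// mulrC.
 have := Hd' (k n) _ (Hk n); rewrite addrC subrK.
 by have := bnB_ge (u n) z; lra.
exists l, (z - l *: x); split; last by rewrite addrC subrK.
apply: (closd_ulim cW (ev_all Hk)); apply: (ulimD ul); apply: ulimN => e e0.
have x0 := bn_ge0 x; have e2 : 0 < e / (bn x + 1) by rewrite divr_gt0//; lra.
apply: (evS (Hl _ e2)) => n; rewrite -scalerBl bnZ ltr_pdivlMr; last by lra.
by have := nc_ge0 (k n - l); rewrite mulrDr mulr1; lra.
Qed.
Lemma cspan_closd r (e : 'I_r -> E) : closd (cspan e).
Proof.
elim: r e => [|r IH] e.
 have -> : cspan e = [set 0].
 apply/seteqP; split=> [_ [c _ <-]|_ ->]; first by rewrite /comb big_ord0.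
 by exists 0 => //; rewrite comb0.
 by move=> x H; apply: bn_small => d /H[y ->]; rewrite sub0r bnN => /ltW.
have -> : e = consf (e ord0) (fun j => e (lift ord0 j)).
 by apply/funext => i; rewrite /consf; case: unliftP => [j|] ->.
have := @closd_add _ (e ord0) (cspan_subsp (fun j => e (lift ord0 j))) (IH _).
by move=> H x Hx; apply/cspan_cons; apply: H => d /Hx[y /cspan_cons Hy yx]; exists y.
Qed.
Record fbasis W r (e : 'I_r -> E) : Prop := FBasis {
 fb_span : W = cspan e; fb_free : forall c, comb e c = 0 -> c = 0 }.

Lemma fbasis_ex r (e : 'I_r -> E) : exists s (f : 'I_s -> E), [/\ (s <= r)%N & fbasis (cspan e) f].
Proof.
elim: r e => [|r IH] e.
 by exists 0%N, e; split=> //; split=> // c _; apply/rowP; case.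
have -> : e = consf (e ord0) (fun j => e (lift ord0 j)).
 by apply/funext => i; rewrite /consf; case: unliftP => [j|] ->.
move: (e ord0) (fun j => e (lift ord0 j)) => x e'; have [s [f [sr [Hsp Hfr]]]] := IH e'.
have [Hx|Hx] := EM (cspan e' x).
 exists s, f; split; first exact: leqW.
 split=> //; rewrite -Hsp; apply/seteqP; split=> z.
 by move=> /cspan_cons[k [y [Hy ->]]]; have H := cspan_subsp e'; apply: (ssD H) => //; apply: (ssZ H).
 by move=> Hz; apply/cspan_cons; exists 0, z; rewrite scale0r add0r.
exists s.+1, (consf x f); split=> //; split.
 by apply/funext => z; apply/propext; rewrite !cspan_cons Hsp.
move=> c; rewrite comb_cons => H.
have c0 : c 0 ord0 = 0.
 apply: contrapT => /eqP c0; apply: Hx; rewrite Hsp.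
 have -> : x = - (c 0 ord0)^-1 *: comb f (\row_j c 0 (lift ord0 j)).
 have /eqP := H; rewrite addrC addr_eq0 => /eqP ->.
 by rewrite scalerN scaleNr opprK scalerA mulVf// scale1r.
 by rewrite -combZ; eexists.
rewrite c0 scale0r add0r in H; have /rowP H' := Hfr _ H.
by apply/rowP => i; rewrite mxE; case: (unliftP ord0 i) => [j|] ->; [have := H' j; rewrite !mxE|].
Qed.
Definition cball W := forall u : nat -> E, (forall n, W (u n) /\ bn (u n) <= 1) -> exists l, ulim u l.

(** Without a finite spanning family Riesz's lemma produces unit vectors 1/2 apart, which have no
    ultralimit. *)
Lemma fin_dim W : subsp W -> cball W -> exists r (e : 'I_r -> E), fbasis W e.
Proof.
move=> sW cW.
suff [r [e He]] : exists r (e : 'I_r -> E), W = cspan e.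
 by have [s [f [_ H]]] := fbasis_ex e; exists s, f; rewrite He.
apply: contrapT => Hn.
pose ef (s : seq E) (i : 'I_(size s)) : E := nth 0 s i.
have [|u Hu] := @dep_seq _ (fun (s : seq E) x =>
 (forall y, y \in s -> W y) -> [/\ W x, bn x = 1 & forall y, y \in s -> 2^-1 <= bn (x - y)]).
 move=> s; have [Hs|Hs] := EM (forall y, y \in s -> W y); last by exists 0.
 have WW : cspan (@ef s) `<=` W by apply: cspan_min => // i; apply: Hs; rewrite mem_nth.
 have [|x [Wx x1 Hx]] := riesz (cspan_subsp (@ef s)) (@cspan_closd _ (@ef s)) sW WW.
 apply: contrapT => H; apply: Hn; exists (size s), (@ef s); apply/seteqP; split=> // z Wz.
 by apply: contrapT => Hz; apply: H; exists z.
 exists x => _; split=> // y ys; apply: Hx.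
 have yi : (index y s < size s)%N by rewrite index_mem.
 by have := cspan_mem (@ef s) (Ordinal yi); rewrite /ef /= nth_index.
have HW n : W (u n).
 elim/ltn_ind: n => n IH; have [] // := Hu n.
 by move=> y /mapP[m]; rewrite mem_iota add0n => /= mn ->; apply: IH.
have H n : [/\ W (u n), bn (u n) = 1 & forall y, y \in mkseq u n -> 2^-1 <= bn (u n - y)].
 by apply: Hu => y /mapP[m _ ->].
have [n|l Hl] := cW u; first by have [_ -> _] := H n.
have p : (0 : R) < 4^-1 by rewrite invr_gt0.
have [n Hn1] := ev_ex (Hl _ p); have [m [Hm nm]] := ev_ex (ev_and (Hl _ p) (ev_ge n.+1)).
have [_ _ /(_ (u n))] := H m; rewrite map_f ?mem_iota// => /(_ isT).
by have := bn_tri l (u m) (u n); rewrite (bnC l (u n)); lra.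
Qed.
Lemma fbasis_sub W V r (e : 'I_r -> E) : fbasis W e -> subsp V -> V `<=` W ->
 exists s (f : 'I_s -> E), [/\ (s <= r)%N, fbasis V f & (s = r -> V = W)].
Proof.
move=> [We fr] sV VW.
have [||| m [B [fB HB]]] := @rowspace_of_pred _ r (fun c => V (comb e c)).
- by rewrite comb0; exact: ss0.
- by move=> u v Hu Hv; rewrite combD; exact: ssD.
- by move=> c u Hu; rewrite combZ; exact: ssZ.
have combf c : comb (fun i => comb e (row i B)) c = comb e (c *m B).
 rewrite mulmx_sum_row (big_morph _ (combD e) (comb0 e)).
 by apply: eq_bigr => i _; rewrite combZ.
exists m, (fun i => comb e (row i B)); split.
- by rewrite -(eqP fB) rank_leq_col.
- split=> [|c].
 apply/seteqP; split=> [x Vx|_ [c _ <-]].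
 have := VW _ Vx; rewrite We => -[c _ xc]; rewrite -xc in Vx.
 have /HB/submxP[D cD] := Vx; exists D => //.
 by rewrite combf -cD.
 by rewrite combf; apply/HB; exact: submxMl.
 rewrite combf => /fr H; apply: (row_free_inj fB); by rewrite H mul0mx.
- move=> mr; apply/seteqP; split=> // x; rewrite We => -[c _ <-]; apply/HB.
 by apply: submx_full; rewrite /row_full (eqP fB) mr.
Qed.
Lemma fin_dim_closd W r (e : 'I_r -> E) : fbasis W e -> closd W.
Proof. by move=> [-> _]; exact: cspan_closd. Qed.
Lemma cpt_idem_basis (P : bop E) : P * P = P -> cpt P -> exists r (e : 'I_r -> E), fbasis (ran P) e.
Proof.
move=> PP cP; apply: fin_dim; first exact: ran_subsp.
move=> u Hu; have [|l Hl] := cptP cP (M := 1) (u := u); first by move=> n; exact: (Hu n).2.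
exists l; apply: (ulim_ext Hl) => n; have [[y _ <-] _] := Hu n.
by rewrite -mulbE PP.
Qed.

Section MatrixOf.
Variables (V : set E) (r : nat) (e : 'I_r -> E).
Hypothesis fb : fbasis V e.
(** Coordinates are row vectors multiplied on the right, so [mxof] reverses products and changes the
    sign of brackets; this explains the order of the factors in [mxof_lb]. *)
Definition mxof a : 'M[R[i]]_r := \matrix_(i, j) (xget 0 [set c : 'rV[R[i]]_r | comb e c = a (e i)]) 0 j.
Lemma comb_inj c d : comb e c = comb e d -> c = d.
Proof. by move=> h; apply: subr0_eq; apply: (fb_free fb); rewrite combB h subrr. Qed.
Lemma fbasis_comb c : V (comb e c). Proof. by rewrite (fb_span fb); exists c. Qed.
Lemma comb_fbasis x : V x -> exists c, comb e c = x.
Proof. by rewrite (fb_span fb) => -[c _ <-]; exists c. Qed.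
Lemma mxofP a : (forall x, V x -> V (a x)) -> forall c, a (comb e c) = comb e (c *m mxof a).
Proof.
move=> Va c; rewrite {1}/comb bop_sum mulmx_sum_row.
rewrite (big_morph _ (combD e) (comb0 e)); apply: eq_bigr => i _; rewrite bopZ combZ; congr (_ *: _).
have [d dE] : exists d, comb e d = a (e i).
 by apply/comb_fbasis/Va; rewrite (fb_span fb); exact: cspan_mem.
have -> : row i (mxof a) = xget 0 [set c : 'rV[R[i]]_r | comb e c = a (e i)].
 by apply/rowP => j; rewrite !mxE.
by case: xgetP => [x _ ->|/(_ d)//].
Qed.
Lemma mxof_eq a m : (forall c, a (comb e c) = comb e (c *m m)) -> mxof a = m.
Proof.
move=> H; have Va x : V x -> V (a x) by move=> /comb_fbasis[c <-]; rewrite H; exact: fbasis_comb.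
by apply/row_matrixP => i; apply: comb_inj; rewrite !rowE -mxofP.
Qed.
End MatrixOf.
End FiniteDim.

(** * Geometric and Neumann series *)

Section Geometric.
Variables (R : realType) (E : banach R).
Lemma geometric_cauchy_gen (c q : R) (v : nat -> E) : 0 <= q -> q < 1 ->
 (forall k, bn (v k.+1 - v k) <= c * q ^+ k) ->
 forall e, 0 < e -> exists N, forall m n, (N <= m)%N -> (N <= n)%N -> bn (v m - v n) < e.
Proof.
move=> q0 q1 H; have c0 : 0 <= c by have := le_trans (bn_ge0 _) (H 0%N); rewrite expr0 mulr1.
have p : 0 < 1 - q by lra.
pose D := c / (1 - q); have D0 : 0 <= D by rewrite divr_ge0// ltW.
have cD : c = D * (1 - q) by rewrite /D mulfVK ?gt_eqF.
have H1 k j : bn (v (k + j)%N - v k) <= D * q ^+ k.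
 have : bn (v (k + j)%N - v k) <= D * q ^+ k - D * q ^+ (k + j).
 elim: j => [|j IH]; first by rewrite addn0 subrr bn0 subrr.
 have := bn_tri (v (k + j)%N) (v (k + j.+1)%N) (v k); rewrite addnS.
 have := H (k + j)%N; rewrite exprS cD; move: IH; set t := q ^+ (k + j); lra.
 have : 0 <= D * q ^+ (k + j) by rewrite mulr_ge0// exprn_ge0.
 lra.
move=> e e0; have e2 : 0 < e / 2 / (D + 1) by rewrite !divr_gt0//; lra.
have [N HN] := expr_small q0 q1 e2.
exists N => m n Hm Hn; have := H1 N (m - N)%N; have := H1 N (n - N)%N; rewrite !subnKC//.
have := HN N (leqnn N); rewrite ltr_pdivlMr; last by lra.
have : 0 <= q ^+ N by rewrite exprn_ge0.
have := bn_tri (v N) (v m) (v n); rewrite (bnC (v N) (v n)); set t := q ^+ N; lra.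
Qed.
End Geometric.

Section Inverse.
Variables (R : realType) (E : banach R).
Implicit Types (a b T : bop E) (x : E) (z : R[i]).

Definition binv a b := a * b = 1 /\ b * a = 1.
Lemma binv_uniq a b b' : binv a b -> binv a b' -> b = b'.
Proof. by move=> [H1 H2] [H3 H4]; rewrite -(mulr1 b) -H3 mulrA H2 mul1r. Qed.
Lemma binvM a b a' b' : binv a b -> binv a' b' -> binv (a * a') (b' * b).
Proof.
move=> [H1 H2] [H3 H4]; split.
 by rewrite mulrA -(mulrA a) H3 mulr1.
by rewrite mulrA -(mulrA b') H2 mulr1.
Qed.
Lemma binv_comm a b T : binv a b -> GRing.comm T a -> GRing.comm T b.
Proof.
move=> [H1 H2] H; rewrite /GRing.comm -(mul1r (T * b)) -H2 -mulrA (mulrA a) -H.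
by rewrite -!mulrA H1 mulr1.
Qed.
Lemma opnC a b : opn (a - b) = opn (b - a).
Proof. exact: (@bnC _ (BL E)). Qed.
Lemma opnB_le a b : opn (a - b) <= opn a + opn b.
Proof. exact: (@bnB _ (BL E)). Qed.
Lemma opnN a : opn (- a) = opn a.
Proof. exact: (@bnN _ (BL E)). Qed.
Lemma opnB_ge a b : opn a - opn b <= opn (a - b).
Proof. exact: (@bnB_ge _ (BL E)). Qed.
Lemma opn_tri b a c : opn (a - c) <= opn (a - b) + opn (b - c).
Proof. exact: (@bn_tri _ (BL E)). Qed.
Lemma opn_small a : (forall e, 0 < e -> opn a <= e) -> a = 0.
Proof. exact: (@bn_small _ (BL E)). Qed.
Lemma opn0 : opn (0 : bop E) = 0.
Proof. exact: (@bn0 _ (BL E)). Qed.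
Lemma neumann a : opn a <= 2^-1 -> exists2 b, binv (1 - a) b & opn b <= 2.
Proof.
move=> Ha; pose u n : bop E := \sum_(j < n) a ^+ j.
have uS n : u n.+1 - u n = a ^+ n by rewrite /u big_ord_recr /= addrAC subrr add0r.
have pa n : opn (a ^+ n) <= 2^-1 ^+ n.
 by apply: le_trans (opnX _ _) _; rewrite lerXn2r ?nnegrE ?opn_ge0// invr_ge0.
have [b Hb] : exists l, forall e, 0 < e -> exists N, forall n, (N <= n)%N -> opn (u n - l) < e.
 apply: (@bcomp _ (BL E) u); apply: (@geometric_cauchy_gen _ (BL E) 1 2^-1).
 - by rewrite invr_ge0.
 - by rewrite invf_lt1// ltr1n.
 - by move=> n; rewrite [X in bn X]uS mul1r; exact: pa.
have tel n : (1 - a) * u n = 1 - a ^+ n /\ u n * (1 - a) = 1 - a ^+ n.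
 rewrite mulrBl mulrBr mul1r mulr1 /u mulr_sumr mulr_suml.
 have e1 : \sum_(j < n) a * a ^+ j = \sum_(j < n) a ^+ j.+1 by apply: eq_bigr => j _; rewrite exprS.
 have e2 : \sum_(j < n) a ^+ j * a = \sum_(j < n) a ^+ j.+1 by apply: eq_bigr => j _; rewrite exprSr.
 rewrite e1 e2; suff -> : \sum_(j < n) a ^+ j - \sum_(j < n) a ^+ j.+1 = 1 - a ^+ n by [].
 elim: n {e1 e2} => [|n IH]; first by rewrite !big_ord0 expr0 !subrr.
 by rewrite !big_ord_recr /= opprD addrACA IH addrA subrK.
have lim0 e : 0 < e -> exists n, 2^-1 ^+ n < e /\ opn (u n - b) < e.
 move=> e0; have [N1 H1] := Hb e e0; have [N2 H2] : exists N, forall n, (N <= n)%N -> (2^-1 : R) ^+ n < e.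
 by apply: expr_small; rewrite ?invr_ge0// invf_lt1// ltr1n.
 by exists (maxn N1 N2); split; [apply: H2; exact: leq_maxr|apply: H1; exact: leq_maxl].
have n1 : opn (1 - a) <= 2.
 by apply: le_trans (opnB_le _ _) _; have := @opn1 _ E; lra.
have key (x y : bop E) : (forall e, 0 < e -> opn (x - y) <= 3 * e) -> x = y.
 move=> H; apply: subr0_eq; apply: opn_small => e e0.
 have e3 : 0 < e / 3 by lra.
 by have := H _ e3; lra.
exists b; first split.
- apply: key => e /lim0[n [h1 h2]].
 have -> : (1 - a) * b - 1 = - ((1 - a) * (u n - b)) - a ^+ n.
 by rewrite mulrBr (tel n).1 opprB -addrA -opprD subrK.
 apply: le_trans (opnB_le _ _) _; rewrite opnN.
 have := opnM (1 - a) (u n - b); have := pa n.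
 have : opn (1 - a) * opn (u n - b) <= 2 * opn (u n - b) by rewrite ler_wpM2r ?opn_ge0.
 lra.
- apply: key => e /lim0[n [h1 h2]].
 have -> : b * (1 - a) - 1 = - ((u n - b) * (1 - a)) - a ^+ n.
 by rewrite mulrBl (tel n).2 opprB -addrA -opprD subrK.
 apply: le_trans (opnB_le _ _) _; rewrite opnN.
 have := opnM (u n - b) (1 - a); have := pa n.
 have : opn (u n - b) * opn (1 - a) <= opn (u n - b) * 2 by rewrite ler_wpM2l ?opn_ge0.
 lra.
apply/ler_addgt0Pr => e /lim0[n [h1 h2]].
have : opn (u n) <= 2.
 have : opn (u n) <= 2 - 2 * 2^-1 ^+ n.
 elim: n {h1 h2} => [|n IH]; first by rewrite /u big_ord0 opn0 expr0; lra.
 rewrite /u big_ord_recr /=; apply: le_trans (opnD _ _) _; rewrite exprS.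
 have := pa n; move: IH; rewrite /u; set t := 2^-1 ^+ n; lra.
 have : (0 : R) <= 2^-1 ^+ n by rewrite exprn_ge0.
 lra.
have := opnB_ge b (u n); rewrite opnC; lra.
Qed.
Lemma binv_perturb a b a' (K : R) : binv a b -> opn b <= K -> K * opn (a - a') <= 2^-1 ->
 exists2 b', binv a' b' & opn b' <= 2 * K.
Proof.
move=> [H1 H2] bK Hd.
have [|c [c1 c2] cn] := @neumann (b * (a - a')).
 apply: opnM_le; apply: le_trans Hd; rewrite ler_wpM2r ?opn_ge0//.
have e : 1 - b * (a - a') = b * a' by rewrite mulrBr H2 opprB addrCA subrr addr0.
have a'E : a' = a * (1 - b * (a - a')) by rewrite e mulrA H1 mul1r.
exists (c * b); last first.
 by apply: opnM_le; apply: ler_pM; rewrite ?opn_ge0.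
split.
 by rewrite a'E -mulrA (mulrA _ c) c1 mul1r H1.
by rewrite -mulrA -e c2.
Qed.
End Inverse.

(** * Spectral projections by averaging over roots of unity *)

Section RootsOfUnity.
Variable R : realType.

Definition psqrt (v : R[i]) : R[i] := if 0 <= complex.Re (sqrtc v) then sqrtc v else - sqrtc v.
Lemma psqrt_sqr v : psqrt v ^+ 2 = v.
Proof. by rewrite /psqrt; case: ifP => _; rewrite ?sqrrN sqr_sqrtc. Qed.
Lemma psqrt_Re v : 0 <= complex.Re (psqrt v).
Proof.
rewrite /psqrt; case: ifP => // /negbT; rewrite -ltNge => H.
by rewrite raddfN /= oppr_ge0 ltW.
Qed.
(* [xi j] is a root of [w ^+ 2 ^ j = -1], tending to 1. *)
Fixpoint xi j : R[i] := if j is j'.+1 then psqrt (xi j') else -1.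
Lemma xi_pow j : xi j ^+ (2 ^ j) = -1.
Proof. by elim: j => [|j IH] /=; rewrite ?expr1// expnS exprM psqrt_sqr. Qed.
Lemma nc_xi j : nc (xi j) = 1.
Proof.
elim: j => [|j IH]; first by rewrite -[xi 0]/(-1) ncN nc1.
rewrite -[xi j.+1]/(psqrt (xi j)).
have : nc (psqrt (xi j)) ^+ 2 = 1 by rewrite -ncX psqrt_sqr.
by move=> /eqP; rewrite sqrf_eq1 => /orP[/eqP//|/eqP H]; have := nc_ge0 (psqrt (xi j)); rewrite H; lra.
Qed.
Lemma nc_sqr (c : R[i]) : nc c ^+ 2 = complex.Re c ^+ 2 + complex.Im c ^+ 2.
Proof. by case: c => a b; rewrite /nc /= sqr_sqrtr// addr_ge0// sqr_ge0. Qed.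
(** For [w] of modulus 1 with nonnegative real part, [w + 1] has squared modulus at least 2, and
    [w ^+ 2 - 1 = (w - 1) * (w + 1)]. So the squared distance to 1 at least halves with each root,
    and 1/2 is below the square of 3/4. *)
Lemma xi_near1 j : nc (xi j - 1) <= 2 * (3 / 4) ^+ j.
Proof.
have : nc (xi j - 1) ^+ 2 <= (2 * (3 / 4) ^+ j) ^+ 2.
 elim: j => [|j IH].
 have -> : xi 0 - 1 = - 2%:R by rewrite -[xi 0]/(-1) -opprD.
 by rewrite ncN nc_nat expr0 mulr1.
 rewrite -[xi j.+1]/(psqrt (xi j)).
 set w := psqrt (xi j).
 have Hw : nc w = 1 by exact: (nc_xi j.+1).
 have : nc (w - 1) ^+ 2 * nc (w + 1) ^+ 2 = nc (xi j - 1) ^+ 2.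
 by rewrite -exprMn -ncM -subr_sqr expr1n psqrt_sqr.
 have : 2 <= nc (w + 1) ^+ 2.
 have := congr1 (fun t => t ^+ 2) Hw; rewrite /= expr1n !nc_sqr.
 have := psqrt_Re (xi j); rewrite -/w; case: w {Hw} => a b /=; rewrite addr0.
 move: (sqr_ge0 b) => /=; nra.
 have := sqr_ge0 (nc (w - 1)); move: IH; rewrite [(3 / 4) ^+ j.+1]exprS.
 set p := nc (w - 1); set q := nc (w + 1); set t := _ ^+ j; set u := nc (xi j - 1).
 have := sqr_ge0 t; set p2 := p ^+ 2; set q2 := q ^+ 2; set u2 := u ^+ 2.
 have -> : (2 * t) ^+ 2 = 4 * t ^+ 2 by ring.
 have -> : (2 * (3 / 4 * t)) ^+ 2 = 9 / 4 * t ^+ 2 by field.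
 set t2 := t ^+ 2; nra.
by rewrite ler_pXn2r// ?nnegrE ?nc_ge0// mulr_ge0// exprn_ge0// divr_ge0.
Qed.
End RootsOfUnity.

(* Averaging the resolvent over [2 ^ j]-th roots of unity gives [(1 - (z T) ^+ 2 ^ j)^-1],
 whose limit is the spectral projection onto the part of the spectrum inside the circle. *)
Section Split.
Variables (R : realType) (E : banach R).
Local Notation C := R[i].
Implicit Types (a b T P : bop E) (x : E) (z : C).

Definition resolves T (rho K : R) (r : C -> bop E) :=
 forall z, nc z = rho -> binv (1 - z *: T) (r z) /\ opn (r z) <= K.

Fixpoint avg (r : C -> bop E) j z : bop E :=
 if j is j'.+1 then 2^-1 *: (avg r j' z + avg r j' (xi R j' * z)) else r z.

Lemma scaleb_pow c T n : (c *: T) ^+ n = c ^+ n *: T ^+ n.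
Proof.
elim: n => [|n IH]; first by rewrite !expr0 scale1r.
by rewrite !exprS IH -scAl -scAr scalerA.
Qed.
Lemma half_sum_inv a b1 b2 : binv (1 - a) b1 -> binv (1 + a) b2 ->
 binv (1 - a ^+ 2) (2^-1%:C%C *: (b1 + b2)).
Proof.
move=> [h1 h2] [h3 h4].
have e1 : 1 - a ^+ 2 = (1 - a) * (1 + a).
 by rewrite mulrDr mulr1 mulrBl mul1r -expr2 addrA subrK.
have e2 : 1 - a ^+ 2 = (1 + a) * (1 - a).
 by rewrite mulrBr mulr1 mulrDl mul1r -expr2 opprD addrA addrK.
have e3 : (1 + a) + (1 - a) = 2%:C%C *: idb.
 by rewrite addrACA subrr addr0 rmorphD /= scalerDl rmorph1 scale1r.
have e4 : (2^-1%:C%C * 2%:C%C : C) = 1 by rewrite -rmorphM /= mulVf// pnatr_eq0.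
split.
 rewrite -scAr mulrDr {1}e2 e1 -!mulrA h1 h3 !mulr1 e3 scalerA e4.
 by rewrite scale1r.
rewrite -scAl mulrDl {1}e1 e2 !mulrA h2 h4 !mul1r e3 scalerA e4.
by rewrite scale1r.
Qed.

Let half_nc : nc (2^-1 : C) = 2^-1 :> R.
Proof. by rewrite ncV nc_nat. Qed.

Section Circle.
Variables (T : bop E) (rho K : R) (r : C -> bop E).
Hypothesis Hr : resolves T rho K r.

Let nc_rot j z : nc z = rho -> nc (xi R j * z) = rho.
Proof. by move=> H; rewrite ncM nc_xi mul1r. Qed.
Lemma avg_inv j z : nc z = rho -> binv (1 - (z *: T) ^+ (2 ^ j)) (avg r j z).
Proof.
elim: j z => [|j IH] z Hz /=; first by rewrite expr1; exact: (Hr Hz).1.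
have h1 := IH z Hz; have h2 := IH _ (nc_rot j Hz).
have e : (xi R j * z *: T) ^+ (2 ^ j) = - (z *: T) ^+ (2 ^ j).
 by rewrite !scaleb_pow exprMn xi_pow mulN1r scaleNr.
rewrite e opprK in h2; have := half_sum_inv h1 h2.
by rewrite -exprM muln2 -mul2n expnS fmorphV rmorph_nat.
Qed.
Lemma avg_le j z : nc z = rho -> opn (avg r j z) <= K.
Proof.
elim: j z => [|j IH] z Hz /=; first exact: (Hr Hz).2.
rewrite opnZ half_nc; have := opnD (avg r j z) (avg r j (xi R j * z)).
by have := IH _ Hz; have := IH _ (nc_rot j Hz); lra.
Qed.
Lemma resolvent_lip z z' : nc z = rho -> nc z' = rho ->
 opn (r z - r z') <= K * K * opn T * nc (z - z').
Proof.
move=> Hz Hz'; have [[h1 h2] h3] := Hr Hz; have [[h4 h5] h6] := Hr Hz'.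
have -> : r z - r z' = r z * ((z - z') *: T) * r z'.
 have -> : (z - z') *: T = (1 - z' *: T) - (1 - z *: T).
 by rewrite opprB [RHS]addrC addrA subrK scalerBl.
 by rewrite mulrBr mulrBl -mulrA h4 mulr1 h2 mul1r.
apply: opnM_le; have := opnM (r z) ((z - z') *: T); rewrite opnZ => H.
have t0 : 0 <= nc (z - z') * opn T by rewrite mulr_ge0 ?nc_ge0 ?opn_ge0.
apply: (@le_trans _ _ (K * (nc (z - z') * opn T) * K)).
 apply: ler_pM; rewrite ?opn_ge0//; apply: le_trans H _.
 by rewrite ler_wpM2r.
by set u := nc _; set v := opn T; lra.
Qed.
Lemma avg_lip j z z' : nc z = rho -> nc z' = rho ->
 opn (avg r j z - avg r j z') <= K * K * opn T * nc (z - z').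
Proof.
elim: j z z' => [|j IH] z z' Hz Hz' /=; first exact: resolvent_lip.
rewrite -scalerBr opnZ half_nc opprD addrACA.
have := opnD (avg r j z - avg r j z') (avg r j (xi R j * z) - avg r j (xi R j * z')).
have := IH _ _ Hz Hz'; have := IH _ _ (nc_rot j Hz) (nc_rot j Hz').
by rewrite -mulrBr ncM nc_xi mul1r; lra.
Qed.
Lemma avg_step j z : nc z = rho ->
 opn (avg r j (xi R j * z) - avg r j z) <= K * K * opn T * rho * 2 * (3 / 4) ^+ j.
Proof.
move=> Hz; apply: le_trans (avg_lip j (nc_rot j Hz) Hz) _.
have -> : xi R j * z - z = (xi R j - 1) * z by rewrite mulrBl mul1r.
rewrite ncM Hz; have := xi_near1 R j => H.
have K0 : 0 <= K by apply: le_trans (Hr Hz).2; exact: opn_ge0.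
have r0 : 0 <= rho by rewrite -Hz nc_ge0.
have := ler_wpM2l (mulr_ge0 (mulr_ge0 (mulr_ge0 K0 K0) (opn_ge0 T)) r0) H.
by set t := _ ^+ j; set u := nc _; set v := opn T; lra.
Qed.
Lemma avg_cauchy z : nc z = rho ->
 exists P, forall e, 0 < e -> exists N, forall j, (N <= j)%N -> opn (avg r j z - P) < e.
Proof.
move=> Hz; apply: (@bcomp _ (BL E) (fun j => avg r j z)).
apply: (@geometric_cauchy_gen _ (BL E) (K * K * opn T * rho) (3 / 4)); [lra|lra|].
move=> j; rewrite [avg r j.+1 z]/=.
have -> : 2^-1 *: (avg r j z + avg r j (xi R j * z)) - avg r j z
 = 2^-1 *: (avg r j (xi R j * z) - avg r j z).
 have h : (2^-1 : C) + 2^-1 = 1 by rewrite -mulr2n -(mulr_natr 2^-1) mulVf// pnatr_eq0.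
 move: (avg r j z) (avg r j (xi R j * z)) => a b.
 have ha : a = 2^-1 *: a + 2^-1 *: a by rewrite -scalerDl h scale1r.
 transitivity (2^-1 *: (a + b) - (2^-1 *: a + 2^-1 *: a)); first by rewrite -ha.
 by rewrite scalerDr scalerBr opprD addrACA subrr add0r.
rewrite [bn _]opnZ half_nc; have := avg_step j Hz; set t := _ ^+ j; set u := opn _; lra.
Qed.
End Circle.

(** For [rho > 0], [P] is the Riesz projection for the part of the spectrum in the disc of radius
    [rho^-1]. It is described by the inverses alone, whose uniqueness makes it independent of the
    resolvent function used to construct it. *)
Definition is_split T (rho : R) P := forall e, 0 < e -> exists N, forall j, (N <= j)%N ->
 exists2 b, binv (1 - (rho%:C%C *: T) ^+ (2 ^ j)) b & opn (b - P) < e.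

Lemma split_ex T rho K r : 0 <= rho -> resolves T rho K r -> exists2 P, is_split T rho P & opn P <= K.
Proof.
move=> r0 Hr; have Hz : nc rho%:C%C = rho by rewrite nc_pos.
have [P HP] := avg_cauchy Hr Hz; exists P.
 move=> e /HP[N HN]; exists N => j /HN H; exists (avg r j rho%:C%C) => //.
 exact: (avg_inv Hr).
apply/ler_addgt0Pr => e /HP[N /(_ N (leqnn N)) HN].
have := avg_le Hr N Hz; have := opnB_ge P (avg r N rho%:C%C); rewrite opnC; lra.
Qed.
(** Averaging preserves closeness of two resolvents on their circles. The statement serves to
    compare projections of one operator at two radii and of two operators at one radius. *)
Lemma split_close T rho K r P T' rho' K' r' P' (D : R) : 0 <= rho -> 0 <= rho' ->
 resolves T rho K r -> resolves T' rho' K' r' -> is_split T rho P -> is_split T' rho' P' ->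
 (forall u : C, nc u = 1 -> opn (r (rho%:C%C * u) - r' (rho'%:C%C * u)) <= D) -> opn (P - P') <= D.
Proof.
move=> r0 r0' Hr Hr' HP HP' HD.
have Hu (s : R) (u : C) : 0 <= s -> nc u = 1 -> nc (s%:C%C * u) = s.
 by move=> s0 u1; rewrite ncM u1 mulr1 nc_pos.
have key j u : nc u = 1 -> opn (avg r j (rho%:C%C * u) - avg r' j (rho'%:C%C * u)) <= D.
 elim: j u => [|j IH] u u1 /=; first exact: HD.
 rewrite -scalerBr opnZ half_nc opprD addrACA.
 have xu : nc (xi R j * u) = 1 by rewrite ncM nc_xi u1 mulr1.
 have := IH _ u1; have := IH _ xu; rewrite !mulrA ![_%:C%C * xi R j]mulrC.
 have := opnD (avg r j (rho%:C%C * u) - avg r' j (rho'%:C%C * u))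
 (avg r j (xi R j * (rho%:C%C * u)) - avg r' j (xi R j * (rho'%:C%C * u))).
 by rewrite !mulrA; lra.
apply/ler_addgt0Pr => e e0; have e2 : 0 < e / 2 by lra.
have [N HN] := HP _ e2; have [N' HN'] := HP' _ e2.
have [b Hb b1] := HN _ (leq_maxl N N'); have [b' Hb' b1'] := HN' _ (leq_maxr N N').
have n1 : nc (1 : C) = 1 by exact: nc1.
have := key (maxn N N') 1 n1; rewrite !mulr1.
have Hz (s : R) : 0 <= s -> nc s%:C%C = s by move=> s0; rewrite nc_pos.
have -> : avg r (maxn N N') rho%:C%C = b by exact: (binv_uniq (avg_inv Hr _ (Hz _ r0)) Hb).
have -> : avg r' (maxn N N') rho'%:C%C = b' by exact: (binv_uniq (avg_inv Hr' _ (Hz _ r0')) Hb').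
have := opn_tri b P P'; have := opn_tri b' b P'; rewrite (opnC P b); lra.
Qed.

Section SplitTheory.
Variables (T : bop E) (rho K : R) (r : C -> bop E) (P : bop E).
Hypotheses (r0 : 0 <= rho) (Hr : resolves T rho K r) (HP : is_split T rho P).
Let S := rho%:C%C *: T.

Lemma split_comm a : GRing.comm a T -> GRing.comm a P.
Proof.
move=> H; rewrite /GRing.comm; apply: subr0_eq; apply: opn_small => e e0.
have a0 := opn_ge0 a.
have e2 : 0 < e / (2 * opn a + 1) by apply: divr_gt0 => //; lra.
have [N /(_ N (leqnn N))[b Hb bP]] := HP e2.
have Hab : a * b = b * a.
 apply: (binv_comm Hb); apply: commrB; first exact: commr1.
 by apply: commrX; rewrite /GRing.comm -scAl -scAr H.
have -> : a * P - P * a = (b - P) * a - a * (b - P).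
 by rewrite mulrBl mulrBr Hab opprB [RHS]addrC addrA subrK.
apply: le_trans (opnB_le _ _) _; have := opnM (b - P) a; have := opnM a (b - P).
have : opn (b - P) * (2 * opn a + 1) <= e by rewrite -ler_pdivlMr; [exact: ltW|lra].
have := opn_ge0 (b - P); set u := opn (b - P); nra.
Qed.
Lemma split_idem : P * P = P.
Proof.
have Hz : nc rho%:C%C = rho by rewrite nc_pos.
apply: subr0_eq; apply: opn_small => e e0.
have P0 := opn_ge0 P.
(* [(1 - s)^-1 (1 + s)^-1 = (1 - s^2)^-1] and both factors tend to [P]. *)
pose d := Num.min 1 (e / (2 * opn P + 4)).
have d0 : 0 < d by rewrite lt_min ltr01 divr_gt0//; lra.
have d1 : d <= 1 by rewrite ge_min lexx.
have de : d * (2 * opn P + 4) <= e by rewrite -ler_pdivlMr; [rewrite ge_min lexx orbT|lra].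
pose c := K * K * opn T * rho * 2.
have K0 : 0 <= K by apply: le_trans (Hr Hz).2; exact: opn_ge0.
have c0 : 0 <= c by rewrite !mulr_ge0// opn_ge0.
have dc : 0 < d / 2 / (c + 1) by rewrite !divr_gt0//; lra.
have [N1 H1] : exists N, forall n, (N <= n)%N -> (3 / 4 : R) ^+ n < d / 2 / (c + 1).
 by apply: expr_small => //; lra.
have d2 : 0 < d / 2 by lra.
have [N2 H2] := HP d2.
pose j := maxn N1 N2.
have [b Hb bP] := H2 j (leq_maxr _ _).
have eb : avg r j rho%:C%C = b by exact: (binv_uniq (avg_inv Hr j Hz) Hb).
have [b2 Hb2 bP2] := H2 j.+1 (leqW (leq_maxr _ _)).
pose b' := avg r j (xi R j * rho%:C%C).
have Hz' : nc (xi R j * rho%:C%C) = rho by rewrite ncM nc_xi mul1r.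
have Hb' : binv (1 + S ^+ (2 ^ j)) b'.
 have := avg_inv Hr j Hz'; suff -> : (xi R j * rho%:C%C *: T) ^+ (2 ^ j) = - S ^+ (2 ^ j) by rewrite opprK.
 by rewrite /S !scaleb_pow exprMn xi_pow mulN1r scaleNr.
have bb' : opn (b' - P) < d.
 have := avg_step Hr j Hz; rewrite eb -/b' -/c => h.
 have := H1 j (leq_maxl _ _); rewrite ltr_pdivlMr; last by lra.
 have : 0 <= (3 / 4 : R) ^+ j by rewrite exprn_ge0//; lra.
 have := opn_tri b b' P; move: h; set t := _ ^+ j => h; nra.
have prod : b' * b = b2.
 apply: (binv_uniq _ Hb2).
 have -> : 1 - (rho%:C%C *: T) ^+ (2 ^ j.+1) = (1 - S ^+ (2 ^ j)) * (1 + S ^+ (2 ^ j)).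
 rewrite mulrDr mulr1 mulrBl mul1r addrA subrK -exprD addnn -mul2n -expnS.
 by [].
 exact: binvM.
have -> : P * P - P = (b2 - P) - ((b' - P) * b + P * (b - P)).
 by rewrite mulrBl prod mulrBr addrA subrK opprB [RHS]addrC addrA subrK.
apply: le_trans (opnB_le _ _) _.
have := opnD ((b' - P) * b) (P * (b - P)); have := opnM (b' - P) b; have := opnM P (b - P).
have : opn b <= opn P + d.
 by have := opnB_ge b P; lra.
move: bP bb' bP2 => bP bb' bP2.
have := opn_ge0 (b' - P); have := opn_ge0 (b - P); have := opn_ge0 b; nra.
Qed.
(** With [s] the chosen power of [S] and [b] the inverse of [1 - s], the vector [y = x - s x]
    satisfies [b y = x], hence [b y - y = s x]; and [b] is close to the identity on the range of
    [P]. On the kernel, in [split_expand], [b] is close to zero instead. *)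
Lemma split_contract : exists2 n, (0 < n)%N & forall x, P x = x -> bn ((S ^+ n) x) <= 2^-1 * bn x.
Proof.
have p : (0 : R) < 4^-1 by rewrite invr_gt0.
have [N /(_ N (leqnn N))[b [h1 h2] bP]] := HP p.
exists (2 ^ N)%N; first by rewrite expn_gt0.
move=> x Px; set s := S ^+ _ in h1 h2 *; pose y := x - s x.
have by_ : b y = x by rewrite -[RHS]onebE -h2 mulbE subbE onebE.
have Py : P y = y by rewrite /y bopB Px -mulbE (_ : P * s = s * P) ?mulbE ?Px//; apply/commr_sym/split_comm/commr_sym/commrX; rewrite /GRing.comm -scAl -scAr.
have : bn (b y - y) <= 4^-1 * bn y by rewrite -{2}Py -subbE; apply: opnPM; exact: ltW.
rewrite by_ {1}/y opprB addrC subrK.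
have h : bn y - bn x <= bn (s x) by have := bnB_ge y x; rewrite {2}/y addrAC subrr add0r bnN.
move: h (bn_ge0 (s x)); set u := bn (s x); set v := bn y; lra.
Qed.
Lemma split_expand N0 : exists2 j, (N0 <= j)%N &
 forall x, P x = 0 -> 2 * bn x <= bn ((S ^+ (2 ^ j)) x).
Proof.
have p : (0 : R) < 3^-1 by rewrite invr_gt0.
have [N /(_ _ (leq_maxr N0 N))[b [h1 h2] bP]] := HP p.
exists (maxn N0 N); first exact: leq_maxl.
move=> x Px; set s := S ^+ _ in h1 h2 *; pose y := x - s x.
have by_ : b y = x by rewrite -[RHS]onebE -h2 mulbE subbE onebE.
have Py : P y = 0 by rewrite /y bopB Px -mulbE (_ : P * s = s * P) ?mulbE ?Px ?bop0 ?subr0//; apply/commr_sym/split_comm/commr_sym/commrX; rewrite /GRing.comm -scAl -scAr.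
have : bn (b y - P y) <= 3^-1 * bn y by rewrite -subbE; apply: opnPM; exact: ltW.
by rewrite by_ Py subr0; have := bnB x (s x); rewrite -/y; lra.
Qed.
(** The complement is a limit of multiples of powers of [S]; this is how compactness of [1 - P] is
    obtained when those powers are compact up to small multiples of the identity. *)
Lemma split_compl N0 e : 0 < e -> exists j b, [/\ (N0 <= j)%N, opn b <= opn P + e
 & opn ((1 - P) - (- (S ^+ (2 ^ j) * b))) <= e].
Proof.
move=> e0; have [N /(_ _ (leq_maxr N0 N))[b [h1 h2] bP]] := HP e0.
exists (maxn N0 N), b; split; first exact: leq_maxl.
 by have := opnB_ge b P; lra.
have -> : - (S ^+ (2 ^ maxn N0 N) * b) = 1 - b by rewrite -{1}h1 mulrBl mul1r addrAC subrr add0r.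
by rewrite opprB addrC addrA subrK ltW.
Qed.
End SplitTheory.

Lemma proj_near0 P : P * P = P -> opn P < 1 -> P = 0.
Proof.
move=> H P1; apply: opn_eq0; have := opnM P P; rewrite H; have := opn_ge0 P; move: P1.
set t := opn P => t1 t0 tt; apply/eqP; rewrite eq_le t0 andbT.
by clear H; rewrite leNgt; apply/negP => tp; nra.
Qed.
(* Spectral radius formula: a resolvent bounded on the whole disc forces decay of the powers. *)
Lemma spectral_decay T (rho K : R) : 0 <= rho ->
 (forall z, nc z <= rho -> exists2 b, binv (1 - z *: T) b & opn b <= K) ->
 exists2 n, (0 < n)%N & opn ((rho%:C%C *: T) ^+ n) <= 2^-1.
Proof.
move=> r0 H.
have ex z : exists b, nc z <= rho -> binv (1 - z *: T) b /\ opn b <= K.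
 have [Hz|Hz] := EM (nc z <= rho); last by exists 0.
 by have [b h1 h2] := H z Hz; exists b.
pose r z := projT1 (cid (ex z)).
have rP z : nc z <= rho -> binv (1 - z *: T) (r z) /\ opn (r z) <= K by rewrite /r; case: cid.
have Hr t : t <= rho -> resolves T t K r by move=> t1 z Hz; apply: rP; rewrite Hz.
have K0 : 0 <= K by apply: le_trans (rP 0 _).2; rewrite ?nc0 ?opn_ge0.
have lip (z z' : C) : nc z <= rho -> nc z' <= rho -> opn (r z - r z') <= K * K * opn T * nc (z - z').
 move=> Hz Hz'; have [[h1 h2] h3] := rP _ Hz; have [[h4 h5] h6] := rP _ Hz'.
 have -> : r z - r z' = r z * ((z - z') *: T) * r z'.
 have -> : (z - z') *: T = (1 - z' *: T) - (1 - z *: T).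
 by rewrite opprB [RHS]addrC addrA subrK scalerBl.
 by rewrite mulrBr mulrBl -mulrA h4 mulr1 h2 mul1r.
 apply: opnM_le; have := opnM (r z) ((z - z') *: T); rewrite opnZ => Hm.
 have t0 : 0 <= nc (z - z') * opn T by rewrite mulr_ge0 ?nc_ge0 ?opn_ge0.
 apply: (@le_trans _ _ (K * (nc (z - z') * opn T) * K)).
 apply: ler_pM; rewrite ?opn_ge0//; apply: le_trans Hm _.
 by rewrite ler_wpM2r.
 by set u := nc _; set v := opn T; lra.
pose c := K * K * opn T * rho; have c0 : 0 <= c by rewrite !mulr_ge0// opn_ge0.
(* Raising the radius from 0 to [rho] in [n > c] equal steps moves the projection by less than 1
   each time. It starts at 1, and an idempotent at distance below 1 from the identity equals it. *)
pose n := (Num.truncn c).+1; have nc1' : c < n%:R by exact: truncnS_gt.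
pose t j : R := rho * j%:R / n%:R.
have t0 j : 0 <= t j by rewrite !mulr_ge0// invr_ge0 ltW.
have t1 j : (j <= n)%N -> t j <= rho.
 by move=> jn; rewrite /t -mulrA ler_piMr// ler_pdivrMr// mul1r ler_nat.
have key j : (j <= n)%N -> is_split T (t j) 1.
 elim: j => [|j IH] jn.
 move=> e e0; exists 0%N => m _; exists 1; last by rewrite subrr opn0.
 rewrite /t mulr0 mul0r scale0r expr0n expn_eq0 /= subr0.
 by split; rewrite mulr1.
 have jn' := ltnW jn; have H1 := IH jn'; have tj := Hr _ (t1 _ jn).
 have [P HP PK] := split_ex (t0 j.+1) tj.
 have HD : opn (1 - P) <= c / n%:R.
 apply: (split_close (t0 j) (t0 j.+1) (Hr _ (t1 _ jn')) tj H1 HP) => u u1.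
 have nz i : nc ((t i)%:C%C * u) = t i by rewrite ncM u1 mulr1 nc_pos.
 apply: le_trans (lip _ _ _ _) _; rewrite ?nz ?t1//.
 rewrite -mulrBl ncM u1 mulr1 -rmorphB nc_real.
 have -> : `|t j - t j.+1| = rho / n%:R.
 rewrite distrC /t -mulrBl -mulrBr -natrB// subSn// subnn mulr1 ger0_norm//.
 by rewrite divr_ge0// ltW.
 by rewrite /c !mulrA.
 have Pi : P * P = P by exact: (split_idem (t0 _) tj HP).
 suff -> : idb = P by [].
 apply: subr0_eq; apply: proj_near0.
 by rewrite mulrBl !mulrBr !mul1r !mulr1 Pi subrr subr0.
 by apply: le_lt_trans HD _; rewrite ltr_pdivrMr// mul1r.
have tn : t n = rho by rewrite /t mulfK// gt_eqF.
have := key n (leqnn n); rewrite tn => Hn.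
have [m m0 Hm] := split_contract (Hn : is_split T rho 1).
by exists m => //; apply: opn_le => [|x]; [rewrite invr_ge0|apply: Hm].
Qed.
Lemma decay_powers (S : bop E) (n : nat) : (0 < n)%N -> opn (S ^+ n) <= 2^-1 ->
 exists2 M : R, 0 <= M & forall k, opn (S ^+ k) <= M.
Proof.
move=> n0 H; pose M := \sum_(j < n) opn (S ^+ j).
exists M; first by apply: sumr_ge0 => j _; exact: opn_ge0.
have Mi (i : 'I_n) : opn (S ^+ i) <= M.
 by rewrite /M (bigD1 i)//= lerDl; apply: sumr_ge0 => j _; exact: opn_ge0.
move=> k; rewrite (divn_eq k n) exprD mulnC exprM; apply: opnM_le.
have h1 : opn ((S ^+ n) ^+ (k %/ n)) <= 1.
 apply: le_trans (opnX _ _) _; apply: exprn_ile1; first exact: opn_ge0.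
 by apply: le_trans H _; rewrite invf_le1// ler1n.
have h2 := Mi (Ordinal (ltn_pmod k n0)); rewrite /= in h2.
rewrite -[M]mul1r; apply: ler_pM; rewrite ?opn_ge0//.
Qed.
End Split.

(** Countable sets have Lebesgue measure zero, whereas a nondegenerate interval does not. *)
Lemma avoid_countable (R : realType) (B : set R) (a b : R) : countable B -> a < b ->
 exists t, [/\ a < t, t < b & ~ B t].
Proof.
move=> cB ab; apply: contrapT => H.
have sub : `]a, b[%classic `<=` B.
 move=> t /=; rewrite in_itv /= => /andP[h1 h2]; apply: contrapT => h3; apply: H.
 by exists t.
have h0 : (lebesgue_measure (`]a, b[%classic : set R) = 0)%E.
 apply: countable_lebesgue_measure0; exact: sub_countable (subset_card_le sub) cB.
move: h0; rewrite lebesgue_measure_itv /= lte_fin ab -EFinB => /eqP.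
by rewrite eqe subr_eq0 gt_eqF.
Qed.

(** * Spectra of scalar plus compact operators; quasinilpotence *)

Section Qnil.
Variables (R : realType) (E : banach R).
Local Notation C := R[i].
Implicit Types (a b k T P : bop E) (x : E) (z : C).

Definition eigenval a z := exists2 x, x != 0 & a x = z *: x.
Definition grows_le (s : R) a := exists2 M : R, 0 <= M & forall n, opn (a ^+ n) <= M * s ^+ n.
(** Quasinilpotence as a geometric bound for every ratio, which combines with estimates more easily
    than n-th roots of norms. *)
Definition qnil a := forall e : R, 0 < e -> grows_le e a.

Lemma grows_leP (s : R) a n : 0 < s -> (0 < n)%N -> opn ((s^-1%:C%C *: a) ^+ n) <= 2^-1 -> grows_le s a.
Proof.
move=> s0 n0 H; have [M M0 HM] := decay_powers n0 H; exists M => // k.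
have := HM k; rewrite scaleb_pow opnZ ncX nc_pos ?invr_ge0; last exact: ltW.
by rewrite exprVn mulrC ler_pdivrMr ?exprn_gt0.
Qed.
(** The second hypothesis is closedness of [A]. If the inverses were unbounded, the ultralimit of
    bad points would still lie in [A], while inverses stay bounded near an invertible operator. *)
Lemma uniform_resolvent T (A : C -> Prop) (M : R) : (forall z, A z -> nc z <= M) ->
 (forall (f : nat -> C) l, (forall n, A (f n)) -> (forall e, 0 < e -> ev (fun n => nc (f n - l) < e)) -> A l) ->
 (forall z, A z -> exists b, binv (1 - z *: T) b) ->
 exists2 K : R, 0 <= K & forall z, A z -> exists2 b, binv (1 - z *: T) b & opn b <= K.
Proof.
move=> AM Acl Ainv; apply: contrapT => H.
have ex n : exists z, A z /\ forall b, binv (1 - z *: T) b -> n%:R < opn b.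
 apply: contrapT => H1; apply: H; exists n%:R => // z Az; have [b Hb] := Ainv z Az.
 exists b => //; rewrite leNgt; apply/negP => H2; apply: H1; exists z; split => // b' Hb'.
 by rewrite -(binv_uniq Hb Hb').
pose f n := projT1 (cid (ex n)).
have fP n : A (f n) /\ forall b, binv (1 - f n *: T) b -> n%:R < opn b by rewrite /f; case: cid.
have [l Hl] := complex_ulim (ev_all (fun n => AM _ (fP n).1)).
have [b Hb] := Ainv _ (Acl f l (fun n => (fP n).1) Hl).
have b0 := opn_ge0 b; have T0 := opn_ge0 T.
have e0 : 0 < 2^-1 / ((opn b + 1) * (opn T + 1)) by rewrite divr_gt0 ?mulr_gt0//; lra.
have [n [h1 h2]] := ev_ex (ev_and (Hl _ e0) (ev_ge (Num.truncn (2 * (opn b + 1))).+1)).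
have [||b' Hb' b'n] := @binv_perturb _ _ _ _ (1 - f n *: T) (opn b + 1) Hb.
- lra.
- have -> : 1 - l *: T - (1 - f n *: T) = (f n - l) *: T.
 by rewrite scalerBl opprB addrC addrA subrK.
 rewrite opnZ; move: h1; rewrite ltr_pdivlMr; last by rewrite mulr_gt0//; lra.
 have := nc_ge0 (f n - l); set u := nc _; set v := opn b in b0 *; set w := opn T in T0 *; nra.
have := (fP n).2 _ Hb'; have h3 := truncnS_gt (2 * (opn b + 1)).
have : ((Num.truncn (2 * (opn b + 1))).+1%:R : R) <= n%:R by rewrite ler_nat.
lra.
Qed.
Lemma resolvent_choice T (A : C -> Prop) (K : R) :
 (forall z, A z -> exists2 b, binv (1 - z *: T) b & opn b <= K) ->
 exists r : C -> bop E, forall z, A z -> binv (1 - z *: T) (r z) /\ opn (r z) <= K.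
Proof.
move=> H; have ex z : exists b, A z -> binv (1 - z *: T) b /\ opn b <= K.
 have [Az|nAz] := EM (A z); last by exists 0.
 by have [b h1 h2] := H z Az; exists b.
by exists (fun z => projT1 (cid (ex z))) => z; case: cid.
Qed.
Lemma disc_closed (s : R) (f : nat -> C) l : (forall n, nc (f n) <= s) ->
 (forall e, 0 < e -> ev (fun n => nc (f n - l) < e)) -> nc l <= s.
Proof.
move=> fs Hl; apply/ler_addgt0Pr => e e0; have [n Hn] := ev_ex (Hl e e0).
have := ncD (f n) (l - f n); rewrite addrCA subrr addr0 nc_distC; have := fs n; lra.
Qed.
Lemma circle_closed (s : R) (f : nat -> C) l : (forall n, nc (f n) = s) ->
 (forall e, 0 < e -> ev (fun n => nc (f n - l) < e)) -> nc l = s.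
Proof.
move=> fs Hl; apply/eqP; rewrite eq_le; apply/andP; split.
 by apply: (disc_closed _ Hl) => n; rewrite fs.
apply/ler_addgt0Pr => e e0; have [n Hn] := ev_ex (Hl e e0).
have := ncD l (f n - l); rewrite addrCA subrr addr0 fs; lra.
Qed.
(* [1 - z T] is invertible as soon as [z^-1] is no eigenvalue of [T = c + k]. *)
Lemma cpt_resolvent_ex k (c z : C) : cpt k -> z * c != 1 ->
 (z = 0 \/ ~ eigenval (c *: idb + k) z^-1) -> exists b, binv (1 - z *: (c *: idb + k)) b.
Proof.
move=> ck zc [->|H]; first by exists 1; rewrite scale0r subr0; split; rewrite mulr1.
have [->|z0] := eqVneq z 0; first by exists 1; rewrite scale0r subr0; split; rewrite mulr1.
have [||b [h1 h2]] := @riesz_inverse _ _ k (z^-1 - c) ck.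
- by rewrite subr_eq0; apply: contra zc => /eqP <-; rewrite mulfV.
- move=> x kx; apply: contrapT => /eqP x0; apply: H; exists x => //.
 by rewrite !bE kx scalerBl addrC subrK.
have e : 1 - z *: (c *: idb + k) = z *: shft (z^-1 - c) k.
 rewrite /shft scalerBr scalerA mulrBr mulfV// scalerBl scale1r scalerDr scalerA.
 by rewrite opprD addrA.
exists (z^-1 *: b); rewrite e; split.
 by rewrite -scAl -scAr scalerA mulfV// scale1r.
by rewrite -scAl -scAr scalerA mulVf// scale1r.
Qed.
Lemma cpt_decay k (s : R) : cpt k -> 0 < s -> (forall z, s <= nc z -> ~ eigenval k z) -> grows_le s k.
Proof.
move=> ck s0 H.
have kE : k = 0 *: idb + k by rewrite scale0r add0r.
have Hinv z : nc z <= s^-1 -> exists b, binv (1 - z *: k) b.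
 move=> Hz; rewrite kE; apply: cpt_resolvent_ex => //; first by rewrite mulr0 eq_sym oner_eq0.
 have [->|z0] := eqVneq z 0; [by left|right]; rewrite -kE; apply: H.
 by rewrite ncV -[s]invrK lef_pV2 ?posrE ?invr_gt0// nc_gt0.
have [K K0 HK] := uniform_resolvent (fun z (h : nc z <= s^-1) => h) (@disc_closed s^-1) Hinv.
have si : 0 <= s^-1 by rewrite invr_ge0 ltW.
have [n n0 Hn] := spectral_decay si HK.
exact: grows_leP Hn.
Qed.
Lemma qnil_no_eigen k : cpt k -> (forall z, z != 0 -> ~ eigenval k z) -> qnil k.
Proof.
move=> ck H e e0; apply: cpt_decay => // z ez; apply: H.
by rewrite -nc_gt0; apply: lt_le_trans ez.
Qed.
Lemma qnil_scale_small a (rho : R) : qnil a -> 0 <= rho -> exists N, forall n, (N <= n)%N ->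
 opn ((rho%:C%C *: a) ^+ n) <= 1.
Proof.
move=> H r0; have e0 : 0 < (2 * (rho + 1))^-1 by rewrite invr_gt0; lra.
have [M M0 HM] := H _ e0.
have m0 : 0 < (M + 1)^-1 by rewrite invr_gt0; lra.
have [N HN] := @half_small R _ m0.
exists N => n /HN Hn; rewrite scaleb_pow opnZ ncX nc_pos//.
have h1 : rho ^+ n * ((2 * (rho + 1))^-1) ^+ n <= 2^-1 ^+ n.
 rewrite -exprMn lerXn2r// ?nnegrE ?mulr_ge0//; try lra.
 rewrite ler_pdivrMr; last by lra.
 by rewrite mulrA mulVf// mul1r; lra.
apply: (@le_trans _ _ (rho ^+ n * (M * ((2 * (rho + 1))^-1) ^+ n))).
 by rewrite ler_wpM2l ?exprn_ge0.
have h2 : M * (rho ^+ n * (2 * (rho + 1))^-1 ^+ n) <= M * 2^-1 ^+ n by rewrite ler_wpM2l.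
have h3 : (M + 1) * 2^-1 ^+ n <= 1 by rewrite -ler_pdivlMl ?mulr1; [exact: ltW|lra].
have h4 : (0 : R) <= 2^-1 ^+ n by rewrite exprn_ge0.
rewrite mulrCA; move: h2 h3 h4; set p := 2^-1 ^+ n; set q := _ * _; lra.
Qed.
Lemma split_qnil a (rho K : R) r P : 0 <= rho -> resolves a rho K r -> is_split a rho P -> qnil a -> P = 1.
Proof.
move=> r0 Hr HP Ha; apply/eqP; rewrite eq_sym -subr_eq0; apply/eqP; apply: bop_eq => x.
have [N HN] := qnil_scale_small Ha r0.
have [j Nj Hj] := split_expand HP N.
have Pi := split_idem r0 Hr HP.
have /Hj : P ((1 - P) x) = 0.
 by rewrite -mulbE mulrBr mulr1 Pi subrr.
have /HN : (N <= 2 ^ j)%N by apply: leq_trans Nj _; exact: ltnW (ltn_expl _ _).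
move=> h1 h2; apply: bn_eq0; apply/eqP; rewrite eq_le bn_ge0 andbT.
have := le_trans h2 (opnPM ((1 - P) x) h1); set t := bn _; lra.
Qed.
Lemma eigen_moduli_avoid k (c : C) (a b : R) : cpt k -> nc c < a -> a < b ->
 exists s, [/\ a < s, s < b & forall z, nc z = s -> ~ eigenval (c *: idb + k) z].
Proof.
move=> ck ca ab; have d0 : 0 < a - nc c by lra.
have fin := eigenvalues_finite ck d0.
have [|s [h1 h2 h3]] := @avoid_countable R [set nc (z + c) | z in [set lam : C | a - nc c <= nc lam
 /\ exists2 x, x != 0 & k x = lam *: x]] a b _ ab.
 by apply: finite_set_countable; apply: finite_image.
exists s; split => // z zs [x x0 Hx]; apply: h3; exists (z - c); last by rewrite subrK.
split; first by have := ncD (z - c) c; rewrite subrK zs; lra.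
by exists x => //; have := Hx; rewrite !bE scalerBl => <-; rewrite addrC addKr.
Qed.
Lemma circle_resolvent k (c : C) (s : R) : cpt k -> nc c < s ->
 (forall z, nc z = s -> ~ eigenval (c *: idb + k) z) ->
 exists (K : R) (r : C -> bop E), 0 <= K /\ resolves (c *: idb + k) s^-1 K r.
Proof.
move=> ck cs Hs; have s0 : 0 < s by apply: le_lt_trans cs; exact: nc_ge0.
have Hinv z : nc z = s^-1 -> exists b, binv (1 - z *: (c *: idb + k)) b.
 move=> Hz; apply: cpt_resolvent_ex => //; last by right; apply: Hs; rewrite ncV Hz invrK.
 apply/eqP => /(congr1 (@nc R)); rewrite ncM nc1 Hz => h.
 by move: cs; rewrite -(ltr_pM2l (_ : 0 < s^-1)) ?invr_gt0// h mulVf ?ltxx// gt_eqF.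
have [K K0 HK] := uniform_resolvent (fun z (h : nc z = s^-1) => eq_ind_r (fun t => t <= s^-1) (lexx _) h)
 (@circle_closed s^-1) Hinv.
by have [r Hr] := resolvent_choice HK; exists K, r.
Qed.
(** On a circle free of eigenvalues of [k] the resolvent of a nearby quasinilpotent operator is
    close to that of [k], hence so are the projections. The quasinilpotent one has projection 1, so
    [k] has projection 1 too and its powers decay. *)
Lemma cpt_qnil_lim k : cpt k -> (forall e, 0 < e -> exists2 b, qnil b & opn (k - b) < e) -> qnil k.
Proof.
move=> ck H e e0.
have kE : 0 *: idb + k = k by rewrite scale0r add0r.
have [||s [s1 s2 Hs]] := @eigen_moduli_avoid k 0 (e / 2) e ck; rewrite ?nc0; [lra|lra|].
have s0 : 0 < s by lra.
have [||K [r [K0 Hr]]] := @circle_resolvent k 0 s ck; rewrite ?nc0//.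
rewrite kE in Hr.
have si : 0 <= s^-1 by rewrite invr_ge0 ltW.
have [P HP PK] := split_ex si Hr.
(* Small enough both for the resolvent of [b] to exist with bound [2 * K] and for the difference of
   the resolvents, at most [K * (s^-1 * d) * (2 * K)], to stay below 1/2. *)
pose d := 4^-1 / ((K + 1) * (K + 1) * (s^-1 + 1)).
have d0 : 0 < d by rewrite /d divr_gt0 ?mulr_gt0//; lra.
have [b Hb kb] := H d d0.
have kb' : opn (k - b) * ((K + 1) * (K + 1) * (s^-1 + 1)) < 4^-1.
 by rewrite -ltr_pdivlMr// !mulr_gt0//; lra.
have ob := opn_ge0 (k - b).
have rb z : nc z = s^-1 -> exists2 q, binv (1 - z *: b) q & opn q <= 2 * K.
 move=> Hz; have [h1 h2] := Hr z Hz; apply: (binv_perturb h1 h2).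
 have -> : 1 - z *: k - (1 - z *: b) = - (z *: (k - b)).
 by rewrite scalerBr !opprB addrC addrA subrK.
 rewrite opnN opnZ Hz; move: kb' ob; set u := opn _; set v := s^-1 in si *; nra.
have [r' Hr'] := resolvent_choice rb.
have Hr'' : resolves b s^-1 (2 * K) r' by move=> z Hz; exact: Hr'.
have [P' HP' _] := split_ex si Hr''.
have P1 : P' = 1 by exact: (split_qnil si Hr'' HP' Hb).
have HD : opn (P - P') <= 2^-1.
 apply: (split_close si si Hr Hr'' HP HP') => u u1.
 have Hz : nc (s^-1%:C%C * u) = s^-1 by rewrite ncM u1 mulr1 nc_pos.
 move: (s^-1%:C%C * u) Hz => z Hz.
 have [[h1 h2] h3] := Hr _ Hz; have [[h4 h5] h6] := Hr'' _ Hz.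
 have -> : r z - r' z = r z * (z *: (k - b)) * r' z.
 have -> : z *: (k - b) = (1 - z *: b) - (1 - z *: k).
 by rewrite scalerBr opprB [RHS]addrC addrA subrK.
 by rewrite mulrBr mulrBl -mulrA h4 mulr1 h2 mul1r.
 apply: opnM_le; have hm := opnM (r z) (z *: (k - b)).
 rewrite opnZ Hz in hm.
 apply: (@le_trans _ _ (K * (s^-1 * opn (k - b)) * (2 * K))).
 apply: ler_pM; rewrite ?opn_ge0//; apply: le_trans hm _.
 by rewrite ler_wpM2r// mulr_ge0.
 move: kb' ob; clear - K0 si; set u' := opn _; set v := s^-1 in si *.
 move=> h1 h2; have : K * K <= (K + 1) * (K + 1) by nra.
 have : 0 <= K * K by nra.
 have : 0 <= v * u' by nra.
 move=> h3 h4 h5; have : v * u' * (K * K) <= v * u' * ((K + 1) * (K + 1)) by rewrite ler_wpM2l.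
 have : 0 <= u' * ((K + 1) * (K + 1)) by rewrite ?mulr_ge0//; lra.
 move: h1; set q := (K + 1) * (K + 1).
 have -> : u' * (q * (v + 1)) = v * u' * q + u' * q by ring.
 have -> : K * (v * u') * (2 * K) = 2 * (v * u' * (K * K)) by ring.
 lra.
have P1' : P = 1.
 apply/eqP; rewrite eq_sym -subr_eq0; apply/eqP; apply: proj_near0.
 by rewrite mulrBl !mulrBr !mul1r !mulr1 (split_idem si Hr HP) subrr subr0.
 by rewrite -{1}P1 opnC; apply: le_lt_trans HD _; rewrite invf_lt1// ltr1n.
have [n n0 Hn] := split_contract HP.
have [M M0 HM] : grows_le s k.
 apply: (grows_leP s0 n0); apply: opn_le => [|x]; first by rewrite invr_ge0.
 by apply: Hn; rewrite P1'.
exists M => // m; apply: le_trans (HM m) _; rewrite ler_wpM2l// lerXn2r ?nnegrE; lra.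
Qed.
(** Since [s > 1], the point 1, the only one where the spectrum of [1 + k] can accumulate, lies
    inside the circle. The powers of [1 + k] divided by those of [s] are compact up to a vanishing
    multiple of the identity, which makes [1 - P] compact. *)
Lemma dominated_splitting k (s : R) : cpt k -> 1 < s ->
 (forall z, nc z = s -> ~ eigenval (1 + k) z) ->
 exists P, [/\ (forall a, GRing.comm a (1 + k) -> GRing.comm a P), P * P = P, cpt (1 - P) &
 exists2 N, (0 < N)%N & forall x, (P x = x -> bn (((1 + k) ^+ N) x) <= 2^-1 * s ^+ N * bn x) /\
 (P x = 0 -> 2 * s ^+ N * bn x <= bn (((1 + k) ^+ N) x))].
Proof.
move=> ck s1 Hs; have s0 : 0 < s by lra.
have gE : 1 *: idb + k = 1 + k by rewrite scale1r.
have si : 0 <= s^-1 by rewrite invr_ge0 ltW.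
have [||K [r [K0 Hr]]] := @circle_resolvent k 1 s ck; rewrite ?nc1 ?gE//.
rewrite gE in Hr.
have [P HP PK] := split_ex si Hr; exists P.
set g := 1 + k in Hr HP *.
have Scale n x : bn (((s^-1%:C%C *: g) ^+ n) x) = bn ((g ^+ n) x) / s ^+ n.
 by rewrite scaleb_pow scalebE bnZ ncX nc_pos// exprVn mulrC.
have kN n : exists2 k', cpt k' & g ^+ n = 1 + k'.
 elim: n => [|n [k' ck' IH]]; first by exists 0; [exact: cpt0|rewrite expr0 addr0].
 exists (k' + k * g ^+ n); first by apply: cptD => //; exact: cptMr.
 by rewrite exprS {1}/g mulrDl mul1r {1}IH addrA.
split.
- by move=> a Ha; exact: (split_comm HP).
- exact: (split_idem si Hr HP).
- apply: cpt_lim => e e0; have e4 : 0 < Num.min (e / 4) 1 by rewrite lt_min ltr01 andbT; lra.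
 have K1 : 0 < e / 4 / (K + 1) by rewrite !divr_gt0//; lra.
 have [N0 HN0] := @expr_small R s^-1 _ si ltac:(by rewrite invf_lt1) K1.
 have [j [b [Nj bK Hb]]] := split_compl HP N0 e4.
 have [k' ck' gk'] := kN (2 ^ j)%N.
 exists (- (s^-1%:C%C ^+ (2 ^ j) *: (k' * b))).
 by apply: cptN; apply: cptZ; apply: cptMr.
 apply: le_lt_trans (opn_tri (- ((s^-1%:C%C *: g) ^+ (2 ^ j) * b)) _ _) _.
 have h1 : opn (- ((s^-1%:C%C *: g) ^+ (2 ^ j) * b) - - (s^-1%:C%C ^+ (2 ^ j) *: (k' * b))) <= e / 4.
 rewrite scaleb_pow -scAl gk' mulrDl mul1r scalerDr opprK opprD addrNK opnN opnZ ncX nc_pos//.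
 have := HN0 (2 ^ j)%N (leq_trans Nj (ltnW (ltn_expl _ _))) => //.
 rewrite ltr_pdivlMr; last by lra.
 have : opn b <= K + 1 by apply: le_trans bK _; rewrite lerD// ge_min lexx orbT.
 have : 0 <= s^-1 ^+ (2 ^ j) by rewrite exprn_ge0.
 have := opn_ge0 b.
 set t := s^-1 ^+ _; set u := opn b => u0 t0 h1 h2.
 clear - u0 t0 h1 h2; have : t * u <= t * (K + 1) by rewrite ler_wpM2l.
 by have := h2 isT; lra.
 have : opn (1 - P - - ((s^-1%:C%C *: g) ^+ (2 ^ j) * b)) <= e / 4.
 by apply: le_trans Hb _; rewrite ge_min lexx.
 lra.
- have [n n0 Hn] := split_contract HP.
 have [j _ Hj] := split_expand HP 0.
 (* A common multiple of the exponent [n] of contraction and the exponent [2 ^ j] of expansion, so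
    that one power serves on both summands. *)
 exists (n * 2 ^ j)%N; first by rewrite muln_gt0 n0 expn_gt0.
 set S := s^-1%:C%C *: g in Hn Hj.
 have PS m : P * S ^+ m = S ^+ m * P.
 by apply/commr_sym/(split_comm HP)/commr_sym/commrX; rewrite /GRing.comm /S -scAl -scAr.
 have cN m x : P x = x -> bn (((S ^+ n) ^+ m) x) <= 2^-1 ^+ m * bn x.
 move=> Px; elim: m => [|m IH]; first by rewrite !expr0 mul1r.
 rewrite expbSE exprS -mulrA; apply: le_trans (Hn _ _) _; last by rewrite ler_wpM2l.
 by rewrite -mulbE -exprM PS mulbE Px.
 have eN m x : P x = 0 -> 2 ^+ m * bn x <= bn (((S ^+ (2 ^ j)) ^+ m) x).
 move=> Px; elim: m => [|m IH]; first by rewrite !expr0 mul1r.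
 rewrite expbSE exprS -mulrA; apply: le_trans (Hj _ _); first by rewrite ler_wpM2l.
 by rewrite -mulbE -exprM PS mulbE Px bop0.
 have sp m : 0 < s ^+ m by rewrite exprn_gt0.
 move=> x; split=> Px.
 have := cN (2 ^ j)%N x Px; rewrite -exprM Scale ler_pdivrMr// => h.
 apply: le_trans h _; rewrite mulrAC; apply: ler_wpM2r; first exact: bn_ge0.
 apply: ler_wpM2r; first exact: ltW.
 have : (2^-1 : R) ^+ (2 ^ j) <= 2^-1 ^+ 1.
 by apply: ler_wiXn2l; rewrite ?invr_ge0 ?invf_le1 ?ler1n ?expn_gt0.
 by rewrite expr1.
 have := eN n x Px; rewrite -exprM mulnC Scale ler_pdivlMr// => h.
 apply: le_trans h; rewrite mulrAC; apply: ler_wpM2r; first exact: ltW.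
 apply: ler_wpM2r; first exact: bn_ge0.
 have : (2 : R) ^+ 1 <= 2 ^+ n by apply: ler_weXn2l; rewrite ?ler1n.
 by rewrite expr1.
Qed.
End Qnil.

(** * Exponentials of operators *)

Section ExpSeries.
Variables (R : realType) (E : banach R).
Local Notation C := R[i].
Implicit Types (a b x y : bop E).

Lemma factorial_decay (t : nat -> R) (M : R) : 0 <= M -> (forall j, 0 <= t j) ->
 (forall j, j.+1%:R * t j.+1 <= M * t j) -> exists2 K : R, 0 <= K & forall j, t j <= K * 4^-1 ^+ j.
Proof.
move=> M0 t0 H; pose N := (Num.truncn (4 * M)).+1.
pose K := \sum_(i < N.+1) t i * 4 ^+ i.
have K0 : 0 <= K by apply: sumr_ge0 => i _; rewrite mulr_ge0.
exists K => // j.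
have le_N i : (i <= N)%N -> t i <= K * 4^-1 ^+ i.
 move=> iN; rewrite exprVn ler_pdivlMr// /K (bigD1 (inord i))//= inordK//.
 by rewrite lerDl; apply: sumr_ge0 => l _; rewrite mulr_ge0.
elim: j => [|j IH]; first exact: le_N.
have [jN|Nj] := leqP j.+1 N; first exact: le_N.
have h1 : 4 * M <= j.+1%:R.
 apply: le_trans (ltW (truncnS_gt _)) _; by rewrite ler_nat ltnW.
rewrite exprS mulrCA; apply: (@le_trans _ _ (4^-1 * t j)); last by rewrite ler_wpM2l// ltW.
rewrite mulrC ler_pdivlMr//.
have p : (0 : R) < j.+1%:R by rewrite ltr0n.
rewrite -(ler_pM2l p); apply: (@le_trans _ _ (4 * M * t j)); last by rewrite ler_wpM2r.
have -> : j.+1%:R * (t j.+1 * 4) = 4 * (j.+1%:R * t j.+1) by ring.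
by rewrite -mulrA ler_wpM2l.
Qed.
Lemma series_ex (f : nat -> bop E) (K : R) : (forall j, opn (f j) <= K * 4^-1 ^+ j) ->
 exists s, forall n, opn (\sum_(j < n) f j - s) <= 2 * K * 4^-1 ^+ n.
Proof.
move=> H; have q0 : (0 : R) < 4^-1 by rewrite invr_gt0.
have q1 : (4^-1 : R) < 1 by rewrite invf_lt1// ltr1n.
pose u n := \sum_(j < n) f j.
have K0 : 0 <= K by have := le_trans (opn_ge0 _) (H 0%N); rewrite expr0 mulr1.
have uS n : u n.+1 = u n + f n by rewrite /u big_ord_recr.
have [l Hl] : exists l : BL E, forall e, 0 < e -> exists N, forall n, (N <= n)%N -> bn ((u n : BL E) - l) < e.
 apply: (@bcomp _ (BL E) u); apply: (@geometric_cauchy_gen _ (BL E) K 4^-1 u (ltW q0) q1) => k.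
 by rewrite uS addrC addKr; exact: H.
exists l => n.
have tail m : opn (u n - u (n + m)%N) <= (2 - 2 * 4^-1 ^+ m) * K * 4^-1 ^+ n.
 elim: m => [|m IH]; first by rewrite addn0 subrr expr0 opn0; apply: mulr_ge0; [lra|rewrite exprn_ge0// ltW].
 rewrite addnS uS opprD addrA; apply: le_trans (opnB_le _ _) _.
 apply: le_trans (lerD IH (H _)) _; rewrite exprD [_ ^+ m.+1]exprS.
 have : 0 <= K * 4^-1 ^+ n * 4^-1 ^+ m by rewrite !mulr_ge0.
 lra.
apply/ler_addgt0Pr => e e0; have [N /(_ (n + N)%N (leq_addl _ _)) HN] := Hl e e0.
apply: le_trans (opn_tri (u (n + N)%N) _ _) _.
apply: lerD; last exact: ltW.
apply: le_trans (tail N) _; rewrite ler_wpM2r// ler_wpM2r//.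
by rewrite lerBlDr lerDl mulr_ge0// exprn_ge0// ltW.
Qed.
(* Taylor coefficients of [e^(t a) x e^(- t b)]. *)
Fixpoint dseq a b x j : bop E :=
 if j is j'.+1 then (j'.+1%:R : C)^-1 *: (a * dseq a b x j' - dseq a b x j' * b) else x.
Lemma dseqS a b x j : (j.+1%:R : C) *: dseq a b x j.+1 = a * dseq a b x j - dseq a b x j * b.
Proof. by rewrite /= scalerA mulfV// scale1r. Qed.
Lemma dseq_expS a j : dseq a 0 1 j.+1 = (j.+1%:R : C)^-1 *: (a * dseq a 0 1 j).
Proof. by rewrite [LHS]/= mulr0 subr0. Qed.
Lemma dseq_decay a b x : exists2 K : R, 0 <= K & forall j, opn (dseq a b x j) <= K * 4^-1 ^+ j.
Proof.
apply: (@factorial_decay _ (opn a + opn b)); first by rewrite addr_ge0 ?opn_ge0.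
 by move=> j; exact: opn_ge0.
move=> j; have <- : opn ((j.+1%:R : C) *: dseq a b x j.+1) = j.+1%:R * opn (dseq a b x j.+1).
 by rewrite opnZ nc_nat.
rewrite dseqS; apply: le_trans (opnB_le _ _) _; rewrite mulrDl lerD ?opnM//.
by rewrite [opn b * _]mulrC opnM.
Qed.
Lemma expser_ex a b x : exists s, exists2 K : R, 0 <= K &
 forall n, opn (\sum_(j < n) dseq a b x j - s) <= K * 4^-1 ^+ n.
Proof.
have [K K0 HK] := dseq_decay a b x; have [s Hs] := series_ex HK.
by exists s, (2 * K) => //; rewrite mulr_ge0.
Qed.
Definition expser a b x : bop E := projT1 (cid (expser_ex a b x)).
Lemma expserP a b x : exists2 K : R, 0 <= K &
 forall n, opn (\sum_(j < n) dseq a b x j - expser a b x) <= K * 4^-1 ^+ n.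
Proof. by rewrite /expser; case: cid. Qed.
Lemma geometric_limit (f : nat -> bop E) (s : bop E) (K : R) : 0 <= K ->
 (forall n, opn (f n - s) <= K * 4^-1 ^+ n) -> forall e, 0 < e -> exists N, forall n, (N <= n)%N -> opn (f n - s) < e.
Proof.
move=> K0 H e e0; have q0 : (0 : R) <= 4^-1 by rewrite invr_ge0.
have q1 : (4^-1 : R) < 1 by rewrite invf_lt1// ltr1n.
have e1 : 0 < e / (K + 1) by rewrite divr_gt0//; lra.
have [N HN] := expr_small q0 q1 e1; exists N => n /HN; rewrite ltr_pdivlMr; last by lra.
apply: le_lt_trans; apply: le_trans (H n) _; rewrite mulrC ler_wpM2l//; lra.
Qed.
Lemma expser_lim a b x e : 0 < e -> exists N, forall n, (N <= n)%N ->
 opn (\sum_(j < n) dseq a b x j - expser a b x) < e.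
Proof. by move=> e0; have [K K0 HK] := expserP a b x; exact: (geometric_limit K0 HK). Qed.
Lemma expser_uniq a b x s : (forall e, 0 < e -> exists N, forall n, (N <= n)%N ->
 opn (\sum_(j < n) dseq a b x j - s) < e) -> expser a b x = s.
Proof.
move=> H; apply: subr0_eq; apply: opn_small => e e0.
have e2 : 0 < e / 2 by lra.
have [N1 H1] := H _ e2; have [N2 H2] := expser_lim a b x e2.
have := H1 _ (leq_maxl N1 N2); have := H2 _ (leq_maxr N1 N2).
have := opn_tri (\sum_(j < maxn N1 N2) dseq a b x j) (expser a b x) s.
rewrite (opnC (expser a b x) (\sum_(j < _) _)); lra.
Qed.
(** Leibniz rule: [a * (x * y) - (x * y) * c] is [(a * x - x * b) * y + x * (b * y - y * c)].
    Multiplying the sum by [n.+1] and splitting that factor as [i + (n.+1 - i)] lets the rule act on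
    either factor. *)
Lemma dseq_cauchy_product a b c x y n :
 \sum_(j < n.+1) dseq a b x j * dseq b c y (n - j) = dseq a c (x * y) n.
Proof.
elim: n => [|n IH]; first by rewrite big_ord_recr big_ord0 [LHS]add0r.
have p : (n.+1%:R : C) != 0 by rewrite pnatr_eq0.
apply: (scalerI p); rewrite dseqS -IH scaler_sumr mulr_sumr mulr_suml -sumrB.
have -> : \sum_(i < n.+2) (n.+1%:R : C) *: (dseq a b x i * dseq b c y (n.+1 - i)) =
 \sum_(i < n.+2) (i%:R : C) *: (dseq a b x i * dseq b c y (n.+1 - i)) +
 \sum_(i < n.+2) ((n.+1 - i)%N%:R : C) *: (dseq a b x i * dseq b c y (n.+1 - i)).
 rewrite -big_split /=; apply: eq_bigr => i _; rewrite -scalerDl -natrD subnKC//.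
 by rewrite -ltnS.
rewrite big_ord_recl scale0r add0r [X in _ + X]big_ord_recr /= subnn scale0r addr0 -big_split /=.
apply: eq_bigr => i _; rewrite /bump /= add1n subSS scAl.
rewrite -[_ *: (_ *: _)]/((i.+1%:R : C) *: dseq a b x i.+1) dseqS.
rewrite subSn; last by rewrite -ltnS.
by rewrite scAr dseqS mulrBl mulrBr !mulrA addrA subrK.
Qed.
(** One product rule yields all exponential laws: the exponential is [expser a 0 1], its inverse
    [expser 0 a 1], and conjugation by it [expser a a x]. *)
Lemma expserM a b c x y : expser a b x * expser b c y = expser a c (x * y).
Proof.
symmetry; apply: expser_uniq.
have [K1 K10 H1] := dseq_decay a b x; have [K2 K20 H2] := expserP b c y.
have HE n : \sum_(m < n) dseq a c (x * y) m =
 \sum_(j < n) dseq a b x j * \sum_(k < n - j) dseq b c y k.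
 elim: n => [|n IH]; first by rewrite !big_ord0.
 rewrite big_ord_recr /= IH -(dseq_cauchy_product a b c x y n) [in RHS]big_ord_recr /= subSn// subnn.
 rewrite big_ord1 [X in _ + X = _]big_ord_recr /= subnn.
 rewrite addrA -[X in X + _ = _]big_split /=; congr (_ + _).
 by apply: eq_bigr => i _; rewrite subSn 1?ltnW// big_ord_recr /= mulrDr.
move=> e e0; have e2 : 0 < e / 2 by lra.
set G := expser b c y; set F := expser a b x.
have q0 : (0 : R) <= 4^-1 by rewrite invr_ge0.
have q1 : (4^-1 : R) < 1 by rewrite invf_lt1// ltr1n.
have e3 : 0 < e / 2 / (K1 * K2 + 1).
 by rewrite divr_gt0// ltr_wpDl// mulr_ge0.
have G0 := opn_ge0 G; have e4 : 0 < e / 2 / (opn G + 1) by rewrite divr_gt0//; lra.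
have [N1 HN1] := natmul_expr_small q0 q1 e3.
have [N2 HN2] := expser_lim a b x e4.
exists (maxn N1 N2) => n; rewrite geq_max => /andP[n1 n2].
apply: le_lt_trans (opn_tri ((\sum_(j < n) dseq a b x j) * G) _ _) _.
have h2 : opn ((\sum_(j < n) dseq a b x j) * G - F * G) < e / 2.
 rewrite -mulrBl; apply: le_lt_trans (opnM _ _) _.
 have := HN2 n n2; rewrite ltr_pdivlMr; last by lra.
 apply: le_lt_trans; rewrite ler_wpM2l ?opn_ge0//; lra.
have h1 : opn (\sum_(j < n) dseq a c (x * y) j - (\sum_(j < n) dseq a b x j) * G) < e / 2.
 rewrite HE mulr_suml -sumrB.
 apply: (@le_lt_trans _ _ (\sum_(i < n) K1 * K2 * 4^-1 ^+ n)).
 apply: le_trans (@bn_sum _ (BL E) _ _ _ _) _; apply: ler_sum => i _.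
 rewrite -mulrBr; apply: opnM_le.
 have -> : 4^-1 ^+ n = 4^-1 ^+ i * 4^-1 ^+ (n - i) :> R by rewrite -exprD subnKC// ltnW.
 by rewrite mulrACA; apply: ler_pM; rewrite ?opn_ge0.
 rewrite sumr_const card_ord -[X in X < _]mulr_natr.
 have := HN1 n n1; rewrite ltr_pdivlMr; last by rewrite ltr_wpDl// mulr_ge0.
 apply: le_lt_trans; rewrite mulrC mulrCA [leRHS]mulrC mulrDl mul1r -[leLHS]addr0 lerD//.
lra.
Qed.
Lemma expser_comm a x : GRing.comm a x -> expser a a x = x.
Proof.
move=> ax; have D j : dseq a a x j.+1 = 0.
 by elim: j => [|j IH]; rewrite [LHS]/= ?ax ?subrr ?scaler0// -/(dseq a a x j.+1) IH mulr0 mul0r subrr scaler0.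
apply: expser_uniq => e e0; exists 1%N => [[//|n] _].
by rewrite big_ord_recl big1 => [|i _]; rewrite ?addr0 ?subrr ?opn0// D.
Qed.
Definition expb a : bop E := expser a 0 1.

Lemma dseq_expN a j : dseq 0 a 1 j = dseq (- a) 0 1 j.
Proof.
have cm i : GRing.comm a (dseq (- a) 0 1 i).
 elim: i => [|i IH]; first exact: commr1.
 rewrite /= mulr0 subr0 mulNr /GRing.comm -scAr -scAl; congr (_ *: _).
 by rewrite mulrN mulNr -mulrA -IH.
elim: j => //= j ->; congr (_ *: _); rewrite mul0r mulr0 subr0 sub0r mulNr.
by rewrite (cm j).
Qed.
Lemma expb_opp a : expb (- a) = expser 0 a 1.
Proof.
apply: expser_uniq => e e0; have [N HN] := expser_lim 0 a 1 e0; exists N => n /HN.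
by under eq_bigr do rewrite dseq_expN.
Qed.
Lemma expbK a : expb a * expb (- a) = 1.
Proof. by rewrite expb_opp expserM mulr1 expser_comm//; exact: commr1. Qed.
Lemma expb_conj a x : expb a * x * expb (- a) = expser a a x.
Proof.
rewrite expb_opp -{1}(expser_comm (commr_sym (commr0 x))) expserM mul1r expserM mulr1//.
Qed.
Lemma expser_mem (M : set (BL E)) a x : subsp M -> closd M -> M x ->
 (forall y, M y -> M (a * y - y * a)) -> M (expser a a x).
Proof.
move=> sM cM Mx H; have D j : M (dseq a a x j) by elim: j => //= j IH; apply: (ssZ sM); exact: H.
apply: cM => e e0; have [N HN] := expser_lim a a x e0.
by exists (\sum_(j < N) dseq a a x j); [exact: (@ss_sum _ (BL E) _ _ _ _ (fun j : 'I_N => dseq a a x j) sM)|exact: HN].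
Qed.
Lemma expb_conj_mem (M : set (BL E)) a x : subsp M -> closd M -> M x ->
 (forall y, M y -> M (a * y - y * a)) -> M (expb a * x * expb (- a)).
Proof. by rewrite expb_conj; exact: expser_mem. Qed.
Lemma expb_cpt a : cpt a -> cpt (expb a - 1).
Proof.
move=> ca; apply: cpt_lim => e e0; have [N HN] := expser_lim a 0 1 e0.
have D j : cpt (dseq a 0 1 j.+1).
 by rewrite /= mulr0 subr0; apply: cptZ; exact: cptMr.
have S n : cpt (\sum_(j < n) dseq a 0 1 j.+1).
 by elim: n => [|n IH]; rewrite ?big_ord0 ?big_ord_recr; [exact: cpt0|exact: cptD].
exists (\sum_(j < N) dseq a 0 1 j.+1) => //.
have -> : expb a - 1 - \sum_(j < N) dseq a 0 1 j.+1 = - (\sum_(j < N.+1) dseq a 0 1 j - expb a).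
 by rewrite big_ord_recl opprB -[dseq _ _ _ ord0]/idb opprD addrA.
by rewrite opnN; exact: HN.
Qed.
Lemma dseq_scale (c : C) a j : dseq (c *: a) 0 1 j = c ^+ j *: dseq a 0 1 j.
Proof.
elim: j => [|j IH]; first by rewrite expr0 scale1r.
by rewrite /= IH !mulr0 !subr0 -scAl -scAr !scalerA exprS mulrC mulrAC.
Qed.
(* Averaging [e^(zeta a)] over the [zeta] with [zeta ^ 2^j = 1] against [zeta^-1]
 keeps the terms of index [1] modulo [2^j]. *)
Fixpoint favg (f : C -> bop E) j (z : C) : bop E :=
 if j is j'.+1 then 2^-1 *: (favg f j' z + (xi R j')^-1 *: favg f j' (xi R j' * z)) else f z.

(** If [m = (2 ^ j * l).+1], the next averaging multiplies the monomial by half of [1 + (-1) ^+ l],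
    that is, by 0 or 1. The case [j = 0], [m = 0] records the constant term, which the first
    averaging removes. *)
Lemma favg_mono (d : bop E) m j :
 (forall z, favg (fun w => w ^+ m *: d) j z = 0) \/
 ((forall z, favg (fun w => w ^+ m *: d) j z = z ^+ m *: d) /\
 ((exists l, m = (2 ^ j * l).+1) \/ (j = 0 /\ m = 0)%N)).
Proof.
elim: j => [|j [IH|[IH IH2]]].
- right; split=> //; case: m => [|m]; [by right|by left; exists m; rewrite expn0 mul1n].
- by left=> z; rewrite [favg _ _ _]/= !IH scaler0 addr0 scaler0.
have F z : favg (fun w => w ^+ m *: d) j.+1 z = (2^-1 * (1 + (xi R j)^-1 * xi R j ^+ m) * z ^+ m) *: d.
 rewrite [favg _ _ _]/= !IH exprMn !scalerA -scalerDl scalerA; congr (_ *: _).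
 by rewrite -!mulrA mulrDl mul1r !mulrA.
have x0 : xi R j != 0.
 by rewrite -(nc_gt0 (xi R j)) nc_xi.
case: IH2 => [[l ml]|[j0 m0]]; last first.
 by left=> z; rewrite F j0 m0 !expr0 -[xi R 0]/(-1) invrN invr1 !mulr1 subrr mulr0 scale0r.
have xm : (xi R j)^-1 * xi R j ^+ m = (-1) ^+ l.
 by rewrite ml exprS mulKf// exprM xi_pow.
have [lo|le] := boolP (odd l); [left=> z|right; split=> [z|]].
- by rewrite F xm -signr_odd lo expr1 subrr mulr0 mul0r scale0r.
- by rewrite F xm -signr_odd (negbTE le) expr0 mulVf ?mul1r// pnatr_eq0.
- left; exists l./2; rewrite ml expnSr -mulnA mul2n; congr (_ * _).+1.
 by rewrite -{1}(odd_double_half l) (negbTE le).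
Qed.
Lemma favg_id (d : bop E) j z : favg (fun w => w ^+ 1 *: d) j z = z *: d.
Proof.
have x0 l : xi R l != 0 by rewrite -(nc_gt0 (xi R l)) nc_xi.
elim: j z => [|j IH] z //; rewrite [LHS]/= !IH !scalerA mulKf//.
have -> : z *: d + z *: d = (2 : C) *: (z *: d) by rewrite scaler_nat mulr2n.
by rewrite [LHS]scalerA mulVf ?scale1r// pnatr_eq0.
Qed.
Lemma favg_le (f g : C -> bop E) (D : R) j z : (forall w, nc w = nc z -> opn (f w - g w) <= D) ->
 opn (favg f j z - favg g j z) <= D.
Proof.
elim: j z => [|j IH] z H; first exact: H.
have hz : nc (xi R j * z) = nc z by rewrite ncM nc_xi mul1r.
have IH1 := IH z H; have {IH} IH2 := IH (xi R j * z).
rewrite hz in IH2; have {}IH2 := IH2 H.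
rewrite [favg f _ _]/= [favg g _ _]/= -scalerBr opprD addrACA -scalerBr opnZ ncV nc_nat.
rewrite ler_pdivrMl//; apply: le_trans (opnD _ _) _; rewrite mulr_natl mulr2n lerD//.
by rewrite opnZ ncV nc_xi invr1 mul1r.
Qed.
Lemma favg_sum (f : nat -> C -> bop E) n j z :
 favg (fun w => \sum_(m < n) f m w) j z = \sum_(m < n) favg (f m) j z.
Proof.
elim: j z => [|j IH] z //=.
by rewrite !IH !scaler_sumr -big_split scaler_sumr.
Qed.
Lemma favg_comb (f : C -> bop E) j z : exists2 s : seq (C * C), \sum_(p <- s) nc p.1 <= 1 &
 favg f j z = \sum_(p <- s) p.1 *: f p.2.
Proof.
elim: j z => [|j IH] z; first by exists [:: (1, z)]; rewrite !big_seq1 ?nc1 ?scale1r.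
have [s1 h1 e1] := IH z; have [s2 h2 e2] := IH (xi R j * z).
exists ([seq (2^-1 * p.1, p.2) | p <- s1] ++ [seq (2^-1 * (xi R j)^-1 * p.1, p.2) | p <- s2]).
 rewrite big_cat !big_map /=.
 under eq_bigr do rewrite ncM ncV nc_nat.
 under [X in _ + X]eq_bigr do rewrite !ncM !ncV nc_xi invr1 mulr1 nc_nat.
 rewrite -!mulr_sumr; lra.
rewrite [LHS]/= e1 e2 big_cat !big_map /= scalerDr !scaler_sumr; congr (_ + _).
 by apply: eq_bigr => p _; rewrite scalerA.
by apply: eq_bigr => p _; rewrite !scalerA.
Qed.
(** The point is the total weight, which is as small as the error. Extracting the linear term from
    the exponential of [eta^-1 *: a] costs weight at most 1 with error at most 1, and both are then
    multiplied by [eta]. *)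
Lemma exp_average a (eta : R) : 0 < eta -> exists2 s : seq (C * C), \sum_(p <- s) nc p.1 <= eta &
 opn (a - \sum_(p <- s) p.1 *: expb (p.2 *: a)) <= eta.
Proof.
move=> h0; pose t : C := (eta^-1)%:C%C; pose b := t *: a.
have t0 : t != 0 by rewrite -nc_gt0 nc_pos ?invr_gt0// ltW// invr_gt0.
have nt : nc t^-1 = eta by rewrite ncV nc_pos ?invrK ?invr_ge0// ltW.
have [K K0 HK] := dseq_decay b 0 1.
pose d m := dseq b 0 1 m.
have dK u m : nc u = 1 -> opn (u ^+ m *: d m) <= K * 4^-1 ^+ m.
 by move=> u1; rewrite opnZ ncX u1 expr1n mul1r.
have HS u n : nc u = 1 -> opn (\sum_(m < n) u ^+ m *: d m - expb (u *: b)) <= 2 * K * 4^-1 ^+ n.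
 move=> u1; have [s Hs] := series_ex (fun m => dK u m u1).
 suff -> : expb (u *: b) = s by [].
 apply: expser_uniq => e e0; have K2 : 0 <= 2 * K by rewrite mulr_ge0.
 have [N HN] := geometric_limit K2 Hs e0; exists N => n' /HN.
 by under [in X in _ -> X]eq_bigr do rewrite dseq_scale.
have e1 : 0 < (2 * K + 1)^-1 by rewrite invr_gt0; lra.
have [N HN] := @expr_small R 4^-1 _ ltac:(by rewrite invr_ge0) ltac:(by rewrite invf_lt1// ltr1n) e1.
have [j jN] : exists j, j = N.+1 by exists N.+1.
pose n := (2 ^ j).+1.
have Nn : (N <= n)%N by rewrite /n jN; apply: leqW; apply: leq_trans (leqnSn N) _; exact: ltnW (ltn_expl _ _).
have err : 2 * K * 4^-1 ^+ n <= 1.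
 have h := ltW (HN n Nn); have p : (0 : R) <= 4^-1 ^+ n by rewrite exprn_ge0.
 apply: (@le_trans _ _ ((2 * K + 1) * 4^-1 ^+ n)); first by rewrite ler_wpM2r//; lra.
 by rewrite -ler_pdivlMl//; lra.
have sel : favg (fun w => \sum_(m < n) w ^+ m *: d m) j 1 = b.
 have n2 : (1 < n)%N by rewrite /n ltnS expn_gt0.
 rewrite (favg_sum (fun m w => w ^+ m *: d m)) (bigD1 (Ordinal n2))//= big1 => [|i i1].
 rewrite addr0; have d1 : d 1%N = b by rewrite /d /= invr1 scale1r mulr1 mulr0 subr0.
 by rewrite [LHS](favg_id (d 1%N)) scale1r; exact: d1.
 have [H|[H [[l ml]|[j0 _]]]] := favg_mono (d i) i j; [exact: H| |by rewrite j0 in jN].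
 case: l ml => [|l] ml; first by rewrite muln0 in ml; case/eqP: i1; exact: val_inj.
 have := ltn_ord i; rewrite {2}/n ml ltnS mulnS -addn1 -addnA leqNgt -{1}[(2 ^ j)%N]addn0 ltn_add2l.
 by rewrite addn1.
have app : opn (b - favg (fun w => expb (w *: b)) j 1) <= 1.
 rewrite -{1}sel; apply: favg_le => w; rewrite nc1 => w1.
 exact: le_trans (HS w n w1) err.
have [s s1 es] := favg_comb (fun w => expb (w *: b)) j 1.
exists [seq (t^-1 * p.1, p.2 * t) | p <- s].
 rewrite big_map /=; under eq_bigr do rewrite ncM nt.
 by rewrite -mulr_sumr -[leRHS]mulr1 ler_wpM2l// ltW.
rewrite big_map /= (eq_bigr (fun p => t^-1 *: (p.1 *: expb (p.2 *: b)))) => [|p _]; last by rewrite !scalerA.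
have ab : a = t^-1 *: b by rewrite /b scalerA mulVf// scale1r.
rewrite -scaler_sumr -es {1}ab -scalerBr opnZ nt.
by rewrite -[leRHS]mulr1; apply: ler_wpM2l; [exact: ltW|exact: app].
Qed.

End ExpSeries.

Lemma expb_intertwine (R : realType) (E F : banach R) (p : E -> F) (a : bop E) (b : bop F) (M : R) :
 (forall x y, p (x + y) = p x + p y) -> (forall c x, p (c *: x) = c *: p x) ->
 (forall x, bn (p x) <= M * bn x) -> (forall x, p (a x) = b (p x)) -> forall x, p (expb a x) = expb b (p x).
Proof.
move=> pD pZ pM pab x; have p0 : p 0 = 0 by rewrite -(scale0r (0 : E)) pZ scale0r.
have pB y z : p (y - z) = p y - p z by rewrite -scaleN1r pD pZ scaleN1r.
have D j : forall y, p (dseq a 0 1 j y) = dseq b 0 1 j (p y).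
 elim: j => [|j IH] y //.
 by rewrite !dseq_expS !scalebE pZ !mulbE pab IH.
have S n : p ((\sum_(j < n) dseq a 0 1 j) x) = (\sum_(j < n) dseq b 0 1 j) (p x).
 by rewrite !sumbE (big_morph p pD p0); apply: eq_bigr => i _; exact: D.
apply: subr0_eq; apply: bn_small => e e0.
have M0 : 0 <= `|M| by []; have x0 := bn_ge0 x; have px0 := bn_ge0 (p x).
have e1 : 0 < e / 2 / (`|M| * bn x + 1) by rewrite divr_gt0 ?ltr_wpDl ?mulr_ge0//; lra.
have e2 : 0 < e / 2 / (bn (p x) + 1) by rewrite divr_gt0//; lra.
have [N1 H1] := expser_lim a 0 1 e1; have [N2 H2] := expser_lim b 0 1 e2.
have {}H1 := H1 _ (leq_maxl N1 N2); have {}H2 := H2 _ (leq_maxr N1 N2).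
set n := maxn N1 N2 in H1 H2.
apply: le_trans (bn_tri (p ((\sum_(j < n) dseq a 0 1 j) x)) _ _) _.
rewrite -pB -subbE S -subbE.
have h1 : bn (p ((expb a - \sum_(j < n) dseq a 0 1 j) x)) <= e / 2.
 apply: le_trans (pM _) _; apply: (@le_trans _ _ (`|M| * (opn (expb a - \sum_(j < n) dseq a 0 1 j) * bn x))).
 apply: (@le_trans _ _ (`|M| * bn ((expb a - \sum_(j < n) dseq a 0 1 j) x))).
 by rewrite ler_wpM2r ?bn_ge0 ?ler_norm.
 by rewrite ler_wpM2l// opnP.
 rewrite opnC; move: H1; rewrite ltr_pdivlMr ?ltr_wpDl ?mulr_ge0//.
 have := opn_ge0 (\sum_(j < n) dseq a 0 1 j - expb a); rewrite -/(expb a).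
 set u := opn _; set v := `|M| in M0 *; set w := bn x in x0 *; move=> u0 h; nra.
have h2 : bn (((\sum_(j < n) dseq b 0 1 j) - expb b) (p x)) <= e / 2.
 apply: opnP_le; move: H2; rewrite ltr_pdivlMr ?ltr_wpDl// -/(expb b).
 have := opn_ge0 (\sum_(j < n) dseq b 0 1 j - expb b).
 set u := opn _; set w := bn (p x) in px0 *; move=> u0 h; nra.
lra.
Qed.

(** * Limits in operator norm *)

Section OperatorLimits.
Variables (R : realType) (E : banach R).
Implicit Types (a b : bop E) (A B : nat -> bop E).

Definition olim A a := forall e : R, 0 < e -> ev (fun n => opn (A n - a) < e).
Lemma olim_cst a : olim (fun _ => a) a. Proof. exact: (@ulim_cst R (BL E) a). Qed.
Lemma olimD A B a b : olim A a -> olim B b -> olim (fun n => A n + B n) (a + b).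
Proof. exact: (@ulimD R (BL E) A B a b). Qed.
Lemma olimZ c A a : olim A a -> olim (fun n => c *: A n) (c *: a).
Proof. exact: (@ulimZ R (BL E) c A a). Qed.
Lemma olim_uniq A a b : olim A a -> olim A b -> a = b.
Proof. exact: (@ulim_uniq R (BL E) A a b). Qed.
Lemma olim_ev A B a : olim A a -> ev (fun n => A n = B n) -> olim B a.
Proof. exact: (@ulim_ev R (BL E) A B a). Qed.
Lemma olim_ext A B a : olim A a -> (forall n, A n = B n) -> olim B a.
Proof. exact: (@ulim_ext R (BL E) A B a). Qed.
Lemma olim_le A a (c : R) : olim A a -> ev (fun n => opn (A n) <= c) -> opn a <= c.
Proof. exact: (@ulim_norm_le R (BL E) A a c). Qed.
Lemma olim_ge A a (c : R) : olim A a -> ev (fun n => c <= opn (A n)) -> c <= opn a.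
Proof. exact: (@ulim_norm_ge R (BL E) A a c). Qed.
Lemma olim_exists A : (forall e : R, 0 < e -> exists b, ev (fun n => opn (A n - b) < e)) -> exists a, olim A a.
Proof. exact: (@ulim_exists R (BL E) A). Qed.
Lemma olim_bd A a : olim A a -> ev (fun n => opn (A n) <= opn a + 1).
Proof.
move=> H; apply: (evS (H 1 ltr01)) => n; have := opn_tri (A n) 0 0; rewrite subr0 => _ h.
by have := opnB_ge (A n) a; lra.
Qed.
Lemma olimM A B a b : olim A a -> olim B b -> olim (fun n => A n * B n) (a * b).
Proof.
move=> HA HB e e0; have a0 := opn_ge0 a; have b0 := opn_ge0 b.
have e1 : 0 < e / 2 / (opn a + 1) by rewrite divr_gt0//; lra.
have e2 : 0 < e / 2 / (opn b + 1) by rewrite divr_gt0//; lra.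
apply: (evS (ev_and (olim_bd HA) (ev_and (HA _ e2) (HB _ e1)))) => n [h0 [h2 h1]].
apply: le_lt_trans (opn_tri (A n * b) _ _) _; rewrite -mulrBr -mulrBl.
have := opnM (A n) (B n - b); have := opnM (A n - a) b.
move: h0 h1 h2; rewrite !ltr_pdivlMr ?ltr_wpDl//.
have := opn_ge0 (B n - b); have := opn_ge0 (A n - a).
set p := opn (A n); set q := opn (B n - b); set r := opn (A n - a).
set u := opn a in a0 *; set v := opn b in b0 *; set s := opn (_ * _); set t := opn (_ * _).
clear - a0 b0 e0; move=> r0 q0 h0 h1 h2 h3 h4.
have : p * q <= (u + 1) * q by rewrite ler_wpM2r.
have : r * v <= r * (v + 1) by rewrite ler_wpM2l//; lra.
lra.
Qed.
Lemma strong_limit A (M : R) : 0 <= M -> (forall n, opn (A n) <= M) -> (forall x, exists l, ulim (fun n => A n x) l) ->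
 exists a, forall x, ulim (fun n => A n x) (a x).
Proof.
move=> M0 AM H; pose f x := projT1 (cid (H x)).
have fP x : ulim (fun n => A n x) (f x) by rewrite /f; case: cid.
have fl c x y : f (c *: x + y) = c *: f x + f y.
 apply: (ulim_uniq (fP _)); apply: (ulim_ext (ulimD (ulimZ c (fP x)) (fP y))) => n.
 by rewrite bopD bopZ.
have fb : exists M : R, forall x, bn (f x) <= M * bn x.
 by exists M => x; apply: (ulim_norm_le (fP x)); apply: ev_all => n; exact: opnPM.
by exists (Bop fl fb).
Qed.
(* Compactness on both sides upgrades strong convergence to norm convergence. *)
Lemma compact_sandwich A (M : R) k k' : 0 <= M -> (forall n, opn (A n) <= M) -> cpt k -> cpt k' ->
 exists a, olim (fun n => k * A n * k') a.
Proof.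
move=> M0 AM ck ck'; have k0 := opn_ge0 k.
have KM n : opn (k * A n) <= opn k * M.
 by apply: opnM_le; rewrite ler_wpM2l.
have [x|T HT] := @strong_limit (fun n => k * A n) (opn k * M) (mulr_ge0 k0 M0) KM.
 apply: (@cptP R E k (M * bn x) (fun n => A n x)) => // n; exact: opnPM.
have Tb : opn T <= opn k * M.
 apply: opn_le => [|x]; first exact: mulr_ge0.
 by apply: (ulim_norm_le (HT x)); apply: ev_all => n; exact: opnPM.
exists (T * k') => e e0.
have kM0 : 0 <= opn k * M by exact: mulr_ge0.
have e1 : 0 < e / 4 / (opn k * M + 1) by rewrite divr_gt0//; lra.
have e4 : 0 < e / 4 by lra.
have [m [f Hf]] := ck' _ e1.
have Hev : ev (fun n => forall i, (i < m)%N -> bn ((k * A n) (f i) - T (f i)) < e / 4).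
 by apply: ev_allfin => i _; exact: HT.
apply: (evS Hev) => n Hn; apply: (@le_lt_trans _ _ (3 * (e / 4))); last by lra.
apply: opn_le1 => x x1; have [i im Hi] := Hf x x1.
rewrite subbE !(mulbE _ k').
apply: le_trans (bn_tri ((k * A n) (f i)) _ _) _; rewrite -bopB.
have h1 : bn ((k * A n) (k' x - f i)) <= e / 4.
 apply: le_trans (opnPM _ (KM n)) _; move: Hi; rewrite ltr_pdivlMr ?ltr_wpDl//.
 have := bn_ge0 (k' x - f i); set p := bn _; set q := opn k * M in kM0 *; clear - kM0.
 by move=> p0 h; have : q * p <= p * (q + 1); lra.
have h2 : bn (T (f i - k' x)) <= e / 4.
 apply: le_trans (opnPM _ Tb) _; move: Hi; rewrite ltr_pdivlMr ?ltr_wpDl// bnC.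
 have := bn_ge0 (f i - k' x); set p := bn _; set q := opn k * M in kM0 *; clear - kM0.
 by move=> p0 h; have : q * p <= p * (q + 1); lra.
have := bn_tri (T (f i)) ((k * A n) (f i)) (T (k' x)); rewrite -bopB.
have := Hn i im; lra.
Qed.
(** The cone where [z - a z] is at most [a z] in norm contains the range of [a]. An operator [p]
    close enough to the idempotent [a] maps this cone into itself and at most halves the norm of
    [a z], which bounds the powers of [p] from below. *)
Lemma idempotent_cone a p (n : nat) : a * a = a -> opn (p - a) * (4 * (1 + opn a)) <= 1 -> forall x,
 opn a * bn ((p ^+ n) (a x)) * 2 ^+ n >= bn (a x).
Proof.
move=> aa pa x; have a0 := opn_ge0 a; have d0 := opn_ge0 (p - a).
set d := opn (p - a) in pa d0 *; set u := opn a in pa a0 *.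
pose cone z := bn (z - a z) <= bn (a z).
have step z : cone z -> cone (p z) /\ bn (a z) <= 2 * bn (a (p z)).
 rewrite /cone => cz.
 have z2 : bn z <= 2 * bn (a z) by have := bnD (z - a z) (a z); rewrite subrK; lra.
 have h1 : bn ((p - a) z) <= d * (2 * bn (a z)).
 by apply: opnP_le; rewrite ler_wpM2l.
 have h2 : bn (a ((p - a) z)) <= u * (d * (2 * bn (a z))).
 by apply: opnP_le; rewrite ler_wpM2l.
 have e1 : a (p z) = a z + a ((p - a) z) by rewrite subbE bopB -(mulbE a a) aa addrC subrK.
 have e2 : p z - a (p z) = (p - a) z - a ((p - a) z).
 by rewrite e1 subbE opprD addrA.
 have h3 := bnD_ge (a z) (a ((p - a) z)); rewrite -e1 in h3.
 have h4 := bnB ((p - a) z) (a ((p - a) z)); rewrite -e2 in h4.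
 have az := bn_ge0 (a z).
 move: h1 h2 h3 h4 az cz; set s := bn (a z); set t1 := bn _; set t2 := bn _; set t3 := bn _; set t4 := bn _.
 clear - pa a0 d0; move=> h1 h2 h3 h4 az cz.
 have hs : (d * (4 * (1 + u))) * s <= s by rewrite -[leRHS]mul1r ler_wpM2r.
 have ds : 0 <= d * s by rewrite mulr_ge0.
 split; lra.
have cx : cone (a x) by rewrite /cone -(mulbE a a) aa subrr bn0 bn_ge0.
have pn : cone ((p ^+ n) (a x)) /\ bn (a x) <= 2 ^+ n * bn (a ((p ^+ n) (a x))).
 elim: n => [|n [IH1 IH2]]; first by rewrite !expr0 mul1r onebE -(mulbE a a) aa.
 have [s1 s2] := step _ IH1; rewrite expbSE; split=> //.
 apply: le_trans IH2 _; rewrite exprSr -mulrA ler_wpM2l//.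
case: pn => _ h; apply: le_trans h _; rewrite mulrC ler_wpM2r//.
exact: opnP.
Qed.
End OperatorLimits.

(** * Limits of long words with scalar plus compact letters *)

Section Words.
Variables (R : realType) (E : banach R) (I : finType).
Implicit Types (a b : bop E) (w s : seq I).

Fixpoint wd (g : I -> bop E) w : bop E := if w is i :: w' then g i * wd g w' else 1.
Lemma wd_cat g w s : wd g (w ++ s) = wd g w * wd g s.
Proof. by elim: w => [|i w IH] /=; rewrite ?mul1r// IH mulrA. Qed.
Lemma wd_rcons g w i : wd g (rcons w i) = wd g w * g i.
Proof. by rewrite -cats1 wd_cat /= mulr1. Qed.
Lemma wd_bound (g : I -> bop E) : exists2 B : R, 1 <= B & forall w, opn (wd g w) <= B ^+ size w.
Proof.
pose B := 1 + \sum_i opn (g i).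
have s0 : 0 <= \sum_i opn (g i) by apply: sumr_ge0 => i _; exact: opn_ge0.
have B1 : 1 <= B by rewrite lerDl.
exists B => // w; elim: w => [|i w IH] /=; first by rewrite expr0 opn1.
apply: opnM_le; rewrite exprS; apply: ler_pM; rewrite ?opn_ge0//.
by rewrite /B (bigD1 i)//= addrCA lerDl addr_ge0// sumr_ge0// => j _; exact: opn_ge0.
Qed.

Variables (c0 : R) (k : I -> bop E).
Hypotheses (c00 : 0 < c0) (c01 : c0 < 1) (ck : forall i, cpt (k i)).
Local Notation m := (fun i => c0%:C%C *: idb + k i).
Local Notation p := (wd m).

(** All factors of [g n], not only the whole word, are bounded by [M * mu n]; this property survives
    the removal of letters at both ends. *)
Definition adm (mu : nat -> R) (M : R) (g : nat -> seq I) :=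
 forall n (a s b : seq I), g n = a ++ s ++ b -> opn (p s) <= M * mu n.
Definition longer (g : nat -> seq I) := forall N, ev (fun n => (N <= size (g n))%N).

Lemma adm_behead mu M g : adm mu M g -> adm mu M (fun n => behead (g n)).
Proof.
move=> H n a s b; case e: (g n) => [|i w] /= h; first by apply: (H n a s b); rewrite e.
by apply: (H n (i :: a) s b); rewrite e h.
Qed.
Definition belast' w := rev (behead (rev w)).
Lemma adm_belast mu M g : adm mu M g -> adm mu M (fun n => belast' (g n)).
Proof.
move=> H n a s b; rewrite /belast'; case/lastP e: (g n) => [|w i] h.
 by apply: (H n a s b); rewrite e.
rewrite rev_rcons /= revK in h; apply: (H n a s (rcons b i)).
by rewrite e h !rcons_cat.
Qed.
Lemma longer_behead g : longer g -> longer (fun n => behead (g n)).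
Proof. by move=> H N; apply: (evS (H N.+1)) => n; rewrite size_behead; case: (size _). Qed.
Lemma longer_belast g : longer g -> longer (fun n => belast' (g n)).
Proof. by move=> H N; apply: (evS (H N.+1)) => n; rewrite size_rev size_behead size_rev; case: (size _). Qed.
Lemma longer_head g : longer g -> exists i, ev (fun n => g n = i :: behead (g n)).
Proof.
move=> H; have [[i|] Hi] := ev_finT (fun n => ohead (g n)).
 by exists i; apply: (evS Hi) => n; case: (g n) => //= j w [->].
by have [n []] := ev_ex (ev_and Hi (H 1%N)); case: (g n).
Qed.
Lemma longer_last g : longer g -> exists i, ev (fun n => g n = rcons (belast' (g n)) i).
Proof.
move=> H; have [|i Hi] := @longer_head (fun n => rev (g n)).
 by move=> N; apply: (evS (H N)) => n; rewrite size_rev.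
exists i; apply: (evS Hi) => n e.
by rewrite /belast' -[LHS]revK {1}e rev_cons.
Qed.
Lemma adm_self mu M g n : adm mu M g -> opn (p (g n)) <= M * mu n.
Proof. by move=> H; apply: (H n [::] (g n) [::]); rewrite cats0. Qed.

Section Limits.
Variables (mu : nat -> R) (M : R).
Hypotheses (mu0 : forall n, 0 < mu n) (M0 : 0 <= M).
Local Notation nw g n := (((mu n)^-1)%:C%C *: p (g n)).

Lemma nw_le g n : adm mu M g -> opn (nw g n) <= M.
Proof.
move=> H; rewrite opnZ nc_pos ?invr_ge0 ?(ltW (mu0 n))// mulrC ler_pdivrMr//.
exact: adm_self.
Qed.
(** Split off the last letter [c0 + k i]: the term with [k i] lies between two compact operators and
    converges by [compact_sandwich], the other carries a factor [c0 < 1]. After [J] letters the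
    undetermined part is of order [c0 ^+ J]. *)
Lemma word_approx_right a g J : cpt a -> adm mu M g -> longer g ->
 exists B b, olim B b /\ ev (fun n => opn (a * nw g n - B n) <= opn a * M * c0 ^+ J).
Proof.
move=> ca; elim: J g => [|J IH] g Hg Lg.
 exists (fun _ => 0), 0; split; first exact: olim_cst.
 apply: ev_all => n; rewrite subr0 expr0 mulr1; apply: opnM_le.
 by rewrite ler_wpM2l ?opn_ge0// nw_le.
have [i Hi] := longer_last Lg; pose g' n := belast' (g n).
have Hg' := adm_belast Hg; have Lg' := longer_belast Lg.
have [B [b [Bb HB]]] := IH g' Hg' Lg'.
have [d Hd] := compact_sandwich M0 (fun n => nw_le n Hg') ca (ck i).
exists (fun n => c0%:C%C *: B n + a * nw g' n * k i), (c0%:C%C *: b + d).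
split; first by apply: olimD => //; exact: olimZ.
apply: (evS (ev_and HB Hi)) => n [h e]; rewrite {1}e wd_rcons -/(g' n).
have -> : a * ((mu n)^-1%:C%C *: (p (g' n) * m i)) = c0%:C%C *: (a * nw g' n) + a * nw g' n * k i.
 rewrite scAl mulrDr -[X in X + _]scAr mulr1 mulrDr mulrA -[X in X + _]scAr; congr (_ + _).
rewrite opprD addrACA subrr addr0 -scalerBr opnZ nc_pos ?(ltW c00)//.
by rewrite exprS mulrCA ler_wpM2l// ltW.
Qed.
Lemma olim_of_approx A (f : nat -> R) : (forall e, 0 < e -> exists J, f J < e) ->
 (forall J, exists B b, olim B b /\ ev (fun n => opn (A n - B n) <= f J)) -> exists a, olim A a.
Proof.
move=> f0 H; apply: olim_exists => e e0; have e2 : 0 < e / 2 by lra.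
have [J HJ] := f0 _ e2; have [B [b [Bb HB]]] := H J.
exists b; apply: (evS (ev_and HB (Bb _ e2))) => n [h1 h2].
apply: le_lt_trans (opn_tri (B n) _ _) _; lra.
Qed.
Lemma geom_small (K e : R) : 0 <= K -> 0 < e -> exists J, K * c0 ^+ J < e.
Proof.
move=> K0 e0; have e1 : 0 < e / (K + 1) by rewrite divr_gt0 ?ltr_wpDl.
have [J /(_ J (leqnn J))] := expr_small (ltW c00) c01 e1; rewrite ltr_pdivlMr ?ltr_wpDl// => h.
exists J; apply: le_lt_trans h; rewrite mulrC ler_wpM2l ?exprn_ge0 ?(ltW c00)//; lra.
Qed.
Lemma word_limit_right a g : cpt a -> adm mu M g -> longer g -> exists b, olim (fun n => a * nw g n) b.
Proof.
move=> ca Hg Lg; apply: (@olim_of_approx _ (fun J => opn a * M * c0 ^+ J)).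
 by move=> e; apply: geom_small; rewrite mulr_ge0 ?opn_ge0.
by move=> J; exact: word_approx_right.
Qed.
(** The same expansion at the front of the word. The term [k i] now stands on the left of a shorter
    word and is covered by [word_limit_right]; the rest again gains a factor [c0] per letter. *)
Lemma word_approx g J : adm mu M g -> longer g ->
 exists B b, olim B b /\ ev (fun n => opn (nw g n - B n) <= M * c0 ^+ J).
Proof.
elim: J g => [|J IH] g Hg Lg.
 exists (fun _ => 0), 0; split; first exact: olim_cst.
 by apply: ev_all => n; rewrite subr0 expr0 mulr1; exact: nw_le.
have [i Hi] := longer_head Lg; pose g' n := behead (g n).
have Hg' := adm_behead Hg; have Lg' := longer_behead Lg.
have [B [b [Bb HB]]] := IH g' Hg' Lg'.
have [d Hd] := word_limit_right (ck i) Hg' Lg'.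
exists (fun n => c0%:C%C *: B n + k i * nw g' n), (c0%:C%C *: b + d).
split; first by apply: olimD => //; exact: olimZ.
apply: (evS (ev_and HB Hi)) => n [h e]; rewrite {1}e [p (i :: _)]/= -/(g' n).
have -> : (mu n)^-1%:C%C *: (m i * p (g' n)) = c0%:C%C *: nw g' n + k i * nw g' n.
 by rewrite scAr mulrDl -scAl mul1r.
rewrite opprD addrACA subrr addr0 -scalerBr opnZ nc_pos ?(ltW c00)//.
by rewrite exprS mulrCA ler_wpM2l// ltW.
Qed.
Lemma word_limit g : adm mu M g -> longer g -> exists b, olim (fun n => nw g n) b.
Proof.
move=> Hg Lg; apply: (@olim_of_approx _ (fun J => M * c0 ^+ J)).
 by move=> e; apply: geom_small.
by move=> J; exact: word_approx.
Qed.
End Limits.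
End Words.

Section Preimages.
Variables (R : realType) (E : banach R) (U : set E) (a : bop E).
Lemma pre_subsp : subsp U -> subsp (fun x => U (a x)).
Proof.
by move=> sU; split=> [|x y Ux Uy|c x Ux]; rewrite ?bop0 ?bopD ?bopZ; [exact: ss0|exact: ssD|exact: ssZ].
Qed.
Lemma pre_closd : closd U -> closd (fun x => U (a x)).
Proof.
move=> cU x Hx; apply: cU => e e0; have a0 := opn_ge0 a.
have e1 : 0 < e / (opn a + 1) by rewrite divr_gt0 ?ltr_wpDl.
have [y Uy yx] := Hx _ e1; exists (a y) => //; rewrite -bopB.
apply: le_lt_trans (opnP _ _) _; move: yx; rewrite ltr_pdivlMr ?ltr_wpDl//.
apply: le_lt_trans; rewrite mulrC ler_wpM2l ?bn_ge0//; lra.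
Qed.
End Preimages.

Lemma exp1B_ge (R : realType) (x : R) n : 0 <= x -> x <= 1 -> 1 - n%:R * x <= (1 - x) ^+ n.
Proof.
move=> x0 x1; elim: n => [|n IH]; first by rewrite mul0r subr0 expr0.
have n0 : 0 <= n%:R * x * x by rewrite !mulr_ge0.
rewrite exprS -natr1; have : (1 - x) * (1 - n%:R * x) <= (1 - x) * (1 - x) ^+ n by rewrite ler_wpM2l// subr_ge0.
move: n0; set u := n%:R; set v := (1 - x) ^+ n; lra.
Qed.

(** * Core of the Berger-Wang alternative *)

Section Contract.
Variables (R : realType) (E : banach R) (I : finType) (g : I -> bop E).
Lemma short_contract n (b : R) : (0 < n)%N -> b < 1 -> (forall w, size w = n -> opn (wd g w) <= b) ->
 exists C t : R, [/\ 0 <= C, 0 < t, t < 1 & forall w, opn (wd g w) <= C * t ^+ size w].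
Proof.
move=> n0 b1 H; have [B B1 HB] := wd_bound g.
pose b' := Num.max b 2^-1; have b'1 : b' < 1 by rewrite gt_max b1 invf_lt1// ltr1n.
have b'0 : 0 < b' by rewrite lt_max invr_gt0 ltr0n orbT.
have nR : (0 : R) < n%:R by rewrite ltr0n.
have n1 : (1 : R) <= n%:R by rewrite ler1n.
(* Bernoulli's inequality gives [b' <= (1 - x) ^+ n], so a block of [n] letters contracts at least
   at rate [1 - x] per letter. *)
pose x := (1 - b') / n%:R.
have x0 : 0 < x by rewrite divr_gt0// subr_gt0.
have x1 : x < 1 by rewrite ltr_pdivrMr//; lra.
have tn : b' <= (1 - x) ^+ n.
 have := exp1B_ge n (ltW x0) (ltW x1); rewrite [n%:R * x]mulrC mulfVK//; lra.
have t0 : 0 < 1 - x by lra.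
exists (B ^+ n / (1 - x) ^+ n), (1 - x); split=> //.
- by rewrite divr_ge0 ?exprn_ge0//; lra.
- lra.
move=> w; have [N] := ubnP (size w); elim: N w => // N IH w; rewrite ltnS => wN.
have [wn|nw] := ltnP (size w) n.
 apply: le_trans (HB w) _; apply: (@le_trans _ _ (B ^+ n)); first by rewrite ler_weXn2l// ltnW.
 rewrite -[leLHS]mulr1 -mulrA ler_wpM2l ?exprn_ge0//; first lra.
 rewrite mulrC ler_pdivlMr ?exprn_gt0// mul1r; apply: ler_wiXn2l; [exact: ltW|lra|exact: ltnW].
rewrite -{1}(cat_take_drop n w) wd_cat; apply: opnM_le.
have h1 : opn (wd g (take n w)) <= (1 - x) ^+ n.
 apply: le_trans tn; apply: (@le_trans _ _ b); first by apply: H; rewrite size_takel.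
 by rewrite le_max lexx.
have h2 : opn (wd g (drop n w)) <= B ^+ n / (1 - x) ^+ n * (1 - x) ^+ (size w - n).
 rewrite -size_drop; apply: IH; rewrite size_drop; apply: leq_trans wN.
 by rewrite ltn_subLR// -addn1 addnC leq_add2r.
have -> : (1 - x) ^+ size w = (1 - x) ^+ n * (1 - x) ^+ (size w - n) by rewrite -exprD subnKC.
by rewrite mulrCA; apply: ler_pM; rewrite ?opn_ge0.
Qed.
End Contract.

Section BergerWangCore.
Variables (R : realType) (E : banach R) (I : finType) (c0 : R) (k : I -> bop E).
Hypotheses (c00 : 0 < c0) (c01 : c0 < 1) (ck : forall i, cpt (k i)).
Implicit Types (w : seq I) (U : set E).
Local Notation m := (fun i => c0%:C%C *: idb + k i).
Local Notation p := (wd m).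

Definition dec U := exists C t : R, [/\ 0 <= C, 0 <= t, t < 1 &
 forall w x, U x -> bn (p w x) <= C * t ^+ size w * bn x].
Definition invsub U := [/\ subsp U, closd U & forall i x, U x -> U (m i x)].

Hypothesis sub1 : forall t : R, 0 < t -> t < 1 -> exists C, forall w, opn (p w) * t ^+ size w <= C.
Hypothesis nd : ~ dec setT.

Lemma long_word n (b : R) : b < 1 -> exists w, size w = n.+1 /\ b < opn (p w).
Proof.
move=> b1; apply: contrapT => H; apply: nd.
have [|C [t [C0 t0 t1 Ht]]] := @short_contract R E I m n.+1 b isT b1.
 by move=> w wn; rewrite leNgt; apply/negP => h; apply: H; exists w.
by exists C, t; split=> // [|w x _]; [exact: ltW|exact: opnPM].
Qed.
(** Damping by a factor [t < 1] per letter makes the supremum finite by [sub1]. The factor depends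
    on a word [w0] of large norm, whose total damping is at least 1/2, so the supremum exceeds
    [2 * (K%:R + 1)]; a word reaching half of it is taken. *)
Lemma max_word (K : nat) : (forall B : R, exists w, B < opn (p w)) ->
 exists tw : R * seq I, [/\ 2^-1 <= tw.1, tw.1 < 1, K%:R <= tw.1 ^+ size tw.2 * opn (p tw.2) &
 forall s, opn (p s) * tw.1 ^+ size s <= 2 * (tw.1 ^+ size tw.2 * opn (p tw.2))].
Proof.
move=> unb; have [w0 Hw0] := unb (4 * (K%:R + 1)); set n := size w0.
have K0 : (0 : R) <= K%:R by rewrite ler0n.
pose x : R := (2 * n.+1%:R)^-1; have n1 : (1 : R) <= n.+1%:R by rewrite ler1n.
have x0 : 0 < x by rewrite invr_gt0; lra.
have x2 : x <= 2^-1 by rewrite lef_pV2 ?posrE//; lra.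
have t2 : 2^-1 <= 1 - x by lra.
have tn : 2^-1 <= (1 - x) ^+ n.
 have := @exp1B_ge R x n (ltW x0) ltac:(lra).
 have : n%:R * x <= 2^-1.
 rewrite /x ler_pdivrMr; last by lra.
 by rewrite mulrA mulVf// mul1r ler_nat.
 lra.
have t0 : 0 < 1 - x by lra.
have [C HC] := sub1 t0 ltac:(lra).
pose S : set R := [set opn (p w) * (1 - x) ^+ size w | w in setT].
have hS : has_sup S.
 split; first by exists (opn (p w0) * (1 - x) ^+ n), w0.
 by exists C => _ [w _ <-].
have SA : 2 * (K%:R + 1) < sup S.
 apply: (@lt_le_trans _ _ (opn (p w0) * (1 - x) ^+ n)); last by apply: sup_upper_bound => //; exists w0.
 move: tn Hw0; set u := (1 - x) ^+ n; set v := opn _; move=> h1 h2; nra.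
have S2 : 0 < sup S / 2 by lra.
have [_ [w _ <-] Hw] := sup_adherent S2 hS.
exists (1 - x, w) => /=; rewrite [_ * opn _]mulrC; split=> //; [lra|lra|move=> s].
have : opn (p s) * (1 - x) ^+ size s <= sup S by apply: sup_upper_bound => //; exists s.
lra.
Qed.

Hypothesis mini : forall U, invsub U -> (exists x, ~ U x) -> dec U.

(** Normalised tails of nearly maximal damped words converge to operators [u l], and products of two
    of them with any word in between vanish. The ranges of the [u l] thus generate an invariant
    subspace killed by the nonzero [u 0]; by minimality words decay on it, which is incompatible
    with the norm of [u 0]. *)
Lemma unbounded_false : ~ (forall B : R, exists w, B < opn (p w)).
Proof.
move=> unb; have [tw Htw] := choice (fun K => @max_word K.+1 unb).
pose t n := (tw n).1; pose w n := (tw n).2; pose lam n := opn (p (w n)).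
have t2 n : 2^-1 <= t n by have [] := Htw n.
have t1 n : t n < 1 by have [] := Htw n.
have wK n : n.+1%:R <= t n ^+ size (w n) * lam n by have [] := Htw n.
have wM n s : opn (p s) * t n ^+ size s <= 2 * (t n ^+ size (w n) * lam n) by have [_ _ _] := Htw n; apply.
have t0 n : 0 < t n by apply: lt_le_trans (t2 n); rewrite invr_gt0.
have tx n l : 0 < t n ^+ l by rewrite exprn_gt0.
have tx1 n l : t n ^+ l <= 1 by rewrite exprn_ile1// ltW.
have l0 n : 0 < lam n.
 have := wK n; have : (0 : R) < n.+1%:R by rewrite ltr0n.
 move=> h1 h2; have := lt_le_trans h1 h2; by rewrite pmulr_rgt0.
have wl n : n.+1%:R <= lam n.
 apply: le_trans (wK n) _; rewrite -[leRHS]mul1r ler_wpM2r//; exact: ltW.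
have [B B1 HB] := wd_bound m.
pose g l n := drop l (w n).
have sizes N : ev (fun n => (N <= size (w n))%N).
 apply: (evS (ev_ge (Num.truncn (B ^+ N)).+1)) => n Hn; rewrite leqNgt; apply/negP => h.
 have h1 := le_trans (wl n) (HB (w n)).
 have h2 : B ^+ size (w n) <= B ^+ N by rewrite ler_weXn2l// ltnW.
 have h3 := truncnS_gt (B ^+ N); have : ((Num.truncn (B ^+ N)).+1%:R : R) <= n%:R by rewrite ler_nat.
 by rewrite -natr1 in h1; lra.
have Lg l : longer (g l).
 by move=> N; apply: (evS (sizes (l + N)%N)) => n h; rewrite size_drop leq_subRL// (leq_trans _ h)// leq_addr.
have Hg l : adm c0 k lam 2 (g l).
 move=> n a s b e; have we : w n = (take l (w n) ++ a) ++ s ++ b.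
 by rewrite -catA -e cat_take_drop.
 have sw : (size s <= size (w n))%N by rewrite we !size_cat addnCA leq_addr.
 rewrite -(ler_pM2r (tx n (size s))); apply: le_trans (wM n s) _.
 rewrite -[size (w n)](subnK sw) exprD -!mulrA ler_wpM2l// mulrCA [_ * lam n]mulrC.
 rewrite mulrCA; apply: ler_wpM2l; first exact: ltW.
 rewrite -[leRHS]mulr1; apply: ler_wpM2l => //; exact: ltW.
have [u Hu] := choice (fun l => word_limit c00 c01 ck l0 (ler0n R 2) (Hg l) (Lg l)).
have ub l : opn (u l) <= 2.
 by apply: (olim_le (Hu l)); apply: ev_all => n; exact: (nw_le l0 n (Hg l)).
have u1 : 1 <= opn (u 0%N).
 apply: (olim_ge (Hu 0%N)); apply: ev_all => n.
 by rewrite /g drop0 opnZ nc_pos ?invr_ge0 ?(ltW (l0 n))// mulVf ?gt_eqF.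
have uS l : exists i, u l = m i * u l.+1.
 have [i Hi] := longer_head (Lg l); exists i.
 apply: (olim_uniq (Hu l)); apply: (olim_ev (olimM (olim_cst (m i)) (Hu l.+1))).
 apply: (evS Hi) => n e; rewrite -scAr [in RHS]e /=; congr (_ *: (_ * p _)).
 by rewrite /g -drop1 drop_drop add1n.
have uv l : exists v, size v = l /\ u 0%N = p v * u l.
 elim: l => [|l [v [vl e]]]; first by exists [::]; rewrite mul1r.
 have [i ui] := uS l; exists (rcons v i); rewrite size_rcons vl; split=> //.
 by rewrite wd_rcons -mulrA -ui.
(* The damped norm of the joined word is at most twice the damped maximum, which is itself at least
   [n.+1%:R]. Dividing by [lam n] twice, instead of once, therefore leaves a quantity of order
   [n.+1%:R^-1]. *)
have usu l l' s : u l * p s * u l' = 0.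
 apply: opn_eq0; apply/eqP; rewrite eq_le opn_ge0 andbT; apply/ler_addgt0Pr => e e0; rewrite add0r.
 apply: (olim_le (olimM (olimM (Hu l) (olim_cst (p s))) (Hu l'))).
 have e1 : 0 < e / (2 * 2 ^+ size s + 1) by rewrite divr_gt0// ltr_wpDl// mulr_ge0// exprn_ge0.
 apply: (evS (ev_and (ev_ge (Num.truncn (2 * 2 ^+ size s / e)).+1) (sizes (l + l')%N))) => n [Hn Sn].
 rewrite -!scAl -scAr scalerA -!wd_cat opnZ ncM nc_pos ?invr_ge0 ?(ltW (l0 n))//.
 rewrite -invfM mulrC ler_pdivrMr ?mulr_gt0//.
 set W := _ ++ g l' n; set N := size W.
 have NE : (N + (l + l') = size (w n) + size (w n) + size s)%N.
 have s1 : (l <= size (w n))%N by apply: leq_trans Sn; exact: leq_addr.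
 have s2 : (l' <= size (w n))%N by apply: leq_trans Sn; exact: leq_addl.
 rewrite /N /W /g !size_cat !size_drop addnACA [(_ + size s + l)%N]addnAC subnK//.
 by rewrite -addnA subnK// -addnA [(size s + _)%N]addnC addnA.
 have nK : 2 * 2 ^+ size s <= e * n.+1%:R.
 rewrite [leRHS]mulrC -ler_pdivrMr//; apply: le_trans (ltW (truncnS_gt _)) _; rewrite ler_nat.
 exact: leq_trans Hn (leqnSn _).
 have H2 : opn (p W) * t n ^+ N * n.+1%:R <= 2 * (t n ^+ size (w n) * lam n) * (t n ^+ size (w n) * lam n).
 by apply: ler_pM => //; rewrite mulr_ge0 ?opn_ge0// ltW.
 have H3 : t n ^+ size (w n) * t n ^+ size (w n) * t n ^+ size s <= t n ^+ N.
 by rewrite -!exprD -NE exprD -[leRHS]mulr1 ler_wpM2l// ltW.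
 have H4 : 1 <= 2 ^+ size s * t n ^+ size s.
 rewrite -exprMn exprn_ege1//; have := t2 n; lra.
 have H5 : t n ^+ size (w n) * t n ^+ size (w n) <= 2 ^+ size s * t n ^+ N.
 apply: (@le_trans _ _ (2 ^+ size s * (t n ^+ size (w n) * t n ^+ size (w n) * t n ^+ size s))).
 by rewrite -[leLHS]mulr1 mulrCA ler_wpM2l// mulr_ge0// ltW.
 by rewrite ler_wpM2l// exprn_ge0.
 have nR : (0 : R) < n.+1%:R by rewrite ltr0n.
 have L0 : 0 <= lam n * lam n by rewrite mulr_ge0// ltW.
 rewrite -(ler_pM2r (mulr_gt0 (tx n N) nR)).
 have := ler_wpM2l L0 H5; have := ler_wpM2l (mulr_ge0 L0 (ltW (tx n N))) nK.
 move: H2; set q := lam n; set r := t n ^+ size (w n); set v := t n ^+ N; set z := opn _; set y := n.+1%:R; lra.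
pose A : set E := [set z | exists s l y, z = p s (u l y)].
pose U := clos (spn A).
have sU : subsp U by apply: clos_subsp; exact: spn_subsp.
have AU : A `<=` U by apply: subset_trans (@sub_clos _ _ _); exact: spn_sub.
have iU : invsub U.
 split=> //; first exact: clos_closd.
 move=> i; pose V z := U (m i z).
 have cV : closd V by apply: pre_closd; exact: clos_closd.
 have sV : subsp V by exact: pre_subsp.
 have : clos (spn A) `<=` V.
 apply: clos_min => //; apply: spn_min => // _ [s [l [y ->]]].
 by apply: AU; exists (i :: s), l, y.
 by [].
have U0 z : U z -> u 0%N z = 0.
 have : clos (spn A) `<=` kerb (u 0%N); last by apply.
 apply: clos_min; first exact: kerb_closd.
 apply: spn_min; first exact: kerb_subsp.
 by move=> _ [s [l [y ->]]]; exact: (congr1 (fun q : bop E => q y) (usu 0%N l s)).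
(* Decay holds on the range of every [u l]. As [u 0] is a word of length [l] times [u l], its norm
   is at most [C * th ^+ l * 2], below 1 for large [l]. *)
have [|C [th [C0 th0 th1 HC]]] := mini iU.
 apply: contrapT => H; have u00 : u 0%N = 0.
 by apply: bop_eq => z; apply: U0; apply: contrapT => Uz; apply: H; exists z.
 by move: u1; rewrite u00 opn0; lra.
have e1 : 0 < (2 * C + 1)^-1 / 2 by rewrite divr_gt0// invr_gt0; lra.
have [l /(_ l (leqnn l))] := expr_small th0 th1 e1.
rewrite ltr_pdivlMr// -[_^-1]mul1r ltr_pdivlMr; last by lra.
move=> hl; have [v [vl uE]] := uv l.
have : opn (u 0%N) <= C * th ^+ l * 2.
 apply: opn_le => [|x]; first by rewrite !mulr_ge0 ?exprn_ge0.
 rewrite uE mulbE -vl; apply: le_trans (HC _ _ _) _; first by apply: AU; exists [::], (size v), x.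
 rewrite -[leRHS]mulrA; apply: ler_wpM2l; first by rewrite mulr_ge0 ?exprn_ge0.
 exact: opnPM.
have : 0 <= th ^+ l by rewrite exprn_ge0.
move: hl u1; set q := th ^+ l; lra.
Qed.
(** Successive first letters of long words define an infinite word [x]. With [F i] the limit of its
    factors starting at position [i], a diagonal choice gives a limit [e] of the [F i] with
    [F i * e = F i], so [e] is idempotent. It is nonzero because the long words have norm above
    1/2. *)
Lemma bounded_idempotent (B : R) : (forall w, opn (p w) <= B) ->
 exists e, [/\ e != 0, e * e = e & forall N (d : R), 0 < d -> exists2 w, (N <= size w)%N & opn (p w - e) < d].
Proof.
move=> HB; have B0 : 0 <= B by apply: le_trans (HB [::]); exact: opn_ge0.
have h21 : (2^-1 : R) < 1 by rewrite invf_lt1// ltr1n.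
have [w Hw] := choice (fun n => long_word n h21).
have wlim (g : nat -> seq I) : longer g -> exists b, olim (fun n => p (g n)) b.
 move=> Lg; have Hg : adm c0 k (fun _ => 1) B g by move=> n a s b _; rewrite mulr1.
 have [b Hb] := word_limit c00 c01 ck (fun _ : nat => @ltr01 R) B0 Hg Lg.
 by exists b; apply: (olim_ext Hb) => n; rewrite invr1 scale1r.
have sizes N : ev (fun n => (N <= size (w n))%N).
 by apply: (evS (ev_ge N)) => n Nn; rewrite (Hw n).1 leqW.
pose g l n := drop l (w n).
have Lg l : longer (g l).
 by move=> N; apply: (evS (sizes (l + N)%N)) => n h; rewrite size_drop leq_subRL// (leq_trans _ h)// leq_addr.
have [v Hv] := choice (fun l => wlim _ (Lg l)).
have [x Hx] := choice (fun l => longer_head (Lg l)).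
have vS l : v l = m (x l) * v l.+1.
 apply: (olim_uniq (Hv l)); apply: (olim_ev (olimM (olim_cst (m (x l))) (Hv l.+1))).
 apply: (evS (Hx l)) => n e; rewrite [in RHS]e /=; congr (_ * p _).
 by rewrite /g -drop1 drop_drop add1n.
pose xw i d := [seq x l | l <- iota i d].
have v0 j : v 0%N = p (xw 0%N j) * v j.
 elim: j => [|j IH]; first by rewrite mul1r.
 rewrite IH vS mulrA; have -> : xw 0%N j.+1 = rcons (xw 0%N j) (x j).
 by rewrite /xw -addn1 iotaD map_cat cats1.
 by rewrite wd_rcons.
have vB j : opn (v j) <= B by apply: (olim_le (Hv j)); apply: ev_all => n; exact: HB.
have v02 : 2^-1 <= opn (v 0%N).
 by apply: (olim_ge (Hv 0%N)); apply: ev_all => n; rewrite /g drop0; exact: ltW (Hw n).2.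
have Lx i : longer (fun n => xw i (n - i)%N).
 by move=> N; apply: (evS (ev_ge (N + i)%N)) => n h; rewrite size_map size_iota leq_subRL 1?addnC// (leq_trans _ h)// leq_addl.
have [F HF] := choice (fun i => wlim _ (Lx i)).
have xF i j : (i <= j)%N -> p (xw i (j - i)%N) * F j = F i.
 move=> ij; apply: (olim_uniq _ (HF i)).
 apply: (olim_ev (olimM (olim_cst _) (HF j))); apply: (evS (ev_ge j)) => n jn.
 rewrite -wd_cat /xw -map_cat; congr (p (map x _)).
 by rewrite -{2}(subnKC ij) -iotaD addnC addnBA// subnK.
have dn i : exists n, (i + i <= n)%N /\ opn (p (xw i (n - i)%N) - F i) < i.+1%:R^-1.
 have p0 : (0 : R) < i.+1%:R^-1 by rewrite invr_gt0.
 by have [n Hn] := ev_ex (ev_and (ev_ge (i + i)%N) (HF i _ p0)); exists n.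
have [nn Hnn] := choice dn.
pose G i := xw i (nn i - i)%N.
have LG : longer G.
 move=> N; apply: (evS (ev_ge N)) => i Ni; rewrite size_map size_iota.
 rewrite leq_subRL; first by apply: leq_trans (Hnn i).1; rewrite leq_add2l.
 by apply: leq_trans (Hnn i).1; exact: leq_addr.
have [e He] := wlim _ LG.
have Fe : olim F e.
 move=> d d0; have d2 : 0 < d / 2 by lra.
 have [M HM] := inv_small d2.
 apply: (evS (ev_and (He _ d2) (ev_ge M))) => i [h1 /HM h2].
 apply: le_lt_trans (opn_tri (p (G i)) _ _) _; rewrite opnC.
 by apply: lt_le_trans (ltrD (lt_trans (Hnn i).2 h2) h1) _; lra.
have FF i : F i * e = F i.
 apply: (olim_uniq (olimM (HF i) Fe)); apply: (olim_ev (olim_cst (F i))).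
 by apply: (evS (ev_ge i)) => j ij; rewrite xF.
have ee : e * e = e.
 apply: (olim_uniq (olimM Fe (olim_cst e))); apply: (olim_ext Fe) => i; by rewrite FF.
have F0 : F 0%N != 0.
 apply/eqP => F0; have p0 : 0 < (4 * (B + 1))^-1 by rewrite invr_gt0; lra.
 have [n] := ev_ex (HF 0%N _ p0); rewrite F0 subr0 subn0 -[_^-1]mul1r ltr_pdivlMr; last by lra.
 have := opnM (p (xw 0%N n)) (v n); rewrite -v0; have := vB n; move: v02.
 have := opn_ge0 (v n); have := opn_ge0 (p (xw 0%N n)).
 set q := opn (v 0%N); set r := opn (v n); set s := opn _.
 move=> s0 r0 h1 h2 h3 h4; have : s * r <= s * B by rewrite ler_wpM2l.
 have : (2^-1 : R) * 2 = 1 by rewrite mulVf.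
 lra.
exists e; split=> //.
 by apply: contra F0 => /eqP e0; rewrite -(FF 0%N) e0 mulr0.
move=> N d d0; have [i [h1 h2]] := ev_ex (ev_and (LG N) (He d d0)).
by exists (G i).
Qed.
Lemma core_word N : exists w (c : R), [/\ (N <= size w)%N, 0 < c & forall n, c * 2^-1 ^+ n <= opn (p w ^+ n)].
Proof.
have [B HB] : exists B : R, forall w, opn (p w) <= B.
 apply: contrapT => H; apply: unbounded_false => B; apply: contrapT => H1; apply: H.
 by exists B => w; rewrite leNgt; apply/negP => h; apply: H1; exists w.
have [e [e0 ee He]] := bounded_idempotent HB.
have eo : 0 < opn e by rewrite lt_neqAle opn_ge0 andbT eq_sym; apply: contra e0 => /eqP/opn_eq0 ->.
have d0 : 0 < (4 * (1 + opn e))^-1 by rewrite invr_gt0; lra.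
have [w Nw we] := He N _ d0; exists w, (opn e)^-1; split=> //; first by rewrite invr_gt0.
have [x ex] : exists x, e x != 0.
 apply: contrapT => H; case/eqP: e0; apply: bop_eq => x.
 by apply: contrapT => /eqP h; apply: H; exists x.
move=> n; have := @idempotent_cone R E e (p w) n ee _ x.
rewrite -ler_pdivlMr ?mul1r; last by lra.
move=> /(_ (ltW we)) h.
have exp : 0 < bn (e x) by rewrite bn_gt0.
have h1 := opnP (p w ^+ n) (e x).
have h2 : 1 <= opn e * opn (p w ^+ n) * 2 ^+ n.
 rewrite -(ler_pM2r exp) mul1r; apply: le_trans h _.
 have -> : opn e * opn (p w ^+ n) * 2 ^+ n * bn (e x) = opn e * (opn (p w ^+ n) * bn (e x)) * 2 ^+ n by ring.
 by rewrite ler_wpM2r// ler_wpM2l// opn_ge0.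
rewrite exprVn ler_pdivrMr// -[leLHS]mulr1 ler_pdivrMl//.
by rewrite mulrA.
Qed.
End BergerWangCore.

(** * Chains of invariant subspaces and reduction to a minimal one *)

Section ChainCompactness.
Variables (R : realType) (E : banach R).
Implicit Types (a : bop E) (U V : set E) (F : set (set E)).

(* A compact operator nearly maps the unit ball of some member of a chain of
 invariant closed subspaces into their intersection. *)
Lemma chain_compact F a (eta : R) : cpt a -> (forall U, F U -> closd U) ->
 (forall U x, F U -> U x -> U (a x)) -> total_on F subset -> (exists U, F U) -> 0 < eta ->
 exists U, F U /\ forall x, U x -> bn x <= 1 -> exists2 z, (forall V, F V -> V z) & bn (a x - z) < eta.
Proof.
move=> ca cF aF tF [U0 FU0] eta0; apply: contrapT => H.
pose S U := [set y | exists x, [/\ U x, bn x <= 1, y = a x &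
 forall z, (forall V, F V -> V z) -> eta <= bn (a x - z)]].
have S0 U : F U -> S U !=set0.
 move=> FU; apply: contrapT => H1; apply: H; exists U; split=> // x Ux x1.
 apply: contrapT => H2; apply: H1; exists (a x), x; split=> // z Hz.
 by rewrite leNgt; apply/negP => h; apply: H2; exists z.
have Smono U V : U `<=` V -> S U `<=` S V.
 by move=> UV _ [x [Ux x1 -> Hx]]; exists x; split=> //; exact: UV.
(* The chain may have no countable coinitial part, so the limit is taken along an ultrafilter on [E]
   containing all the sets [S U]. *)
have Filt : Filter (filter_from F S).
 apply: filter_from_filter; first by exists U0.
 move=> U V FU FV; case: (tF U V FU FV) => h; [exists U|exists V] => // y Sy; split=> //; exact: Smono Sy.
have PF := filter_from_proper Filt S0.
have [G [GU FG]] := ultraFilterLemma PF.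
have GS U : F U -> G (S U) by move=> FU; apply: FG; exists U.
have Gfin m (B : nat -> set E) : G [set y | exists2 j, (j < m)%N & B j y] -> exists j, G (B j).
 elim: m => [|m IH] h; first by have [y []] := filter_ex h.
 have [h1|h1] := in_ultra_setVsetC (B m) GU; first by exists m.
 apply: IH; apply: (filterS _ (filterI h h1)) => y [[j]].
 by rewrite ltnS leq_eqVlt => /orP[/eqP->//|jm Bj _]; exists j.
have ball (e : R) : 0 < e -> exists c, G [set y | bn (y - c) < e].
 move=> e0; have [m [f Hf]] := ca e e0.
 have [|j Gj] := @Gfin m (fun j => [set y | bn (y - f j) < e]); last by exists (f j).
 apply: (filterS _ (GS _ FU0)) => _ [x [_ x1 -> _]] /=; exact: Hf.
have pn (n : nat) : (0 : R) < n.+1%:R^-1 by rewrite invr_gt0.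
have [c Hc] := choice (fun n => ball _ (pn n)).
have [|l Hl] := @bcomp _ E c.
 move=> e e0; have [|N HN] := @inv_small _ (e / 2); first by lra.
 exists N => m n Hm Hn; have [y [h1 h2]] := filter_ex (filterI (Hc m) (Hc n)).
 have := bn_tri y (c m) (c n); rewrite (bnC (c m) y).
 have := lt_trans h1 (HN _ Hm); have := lt_trans h2 (HN _ Hn); lra.
have Gl (e : R) : 0 < e -> G [set y | bn (y - l) < e].
 move=> e0; have e2 : 0 < e / 2 by lra.
 have [N1 H1] := inv_small e2; have [N2 H2] := Hl _ e2.
 apply: (filterS _ (Hc (maxn N1 N2))) => y /= h.
 have := lt_trans h (H1 _ (leq_maxl _ _)); have := H2 _ (leq_maxr N1 N2).
 have := bn_tri (c (maxn N1 N2)) y l; lra.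
have capl V : F V -> V l.
 move=> FV; apply: (cF V FV) => e e0.
 have [y [[x [Vx _ -> _]] h]] := filter_ex (filterI (GS V FV) (Gl e e0)).
 by exists (a x) => //; exact: aF.
have [y [[x [_ _ -> Hx]] h]] := filter_ex (filterI (GS _ FU0) (Gl eta eta0)).
by have := Hx l capl; rewrite leNgt h.
Qed.
Lemma sub_le a U (M : R) : subsp U -> 0 <= M -> (forall x, U x -> bn x <= 1 -> bn (a x) <= M) ->
 forall x, U x -> bn (a x) <= M * bn x.
Proof.
move=> sU M0 H x Ux; have [->|x0] := eqVneq x 0; first by rewrite bop0 bn0 mulr0.
rewrite -{1}(nmlK x0) bopZ bnZ nc_pos ?bn_ge0// mulrC ler_wpM2r ?bn_ge0//.
by apply: H; [exact: ssZ|rewrite nmlE].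
Qed.
End ChainCompactness.

Lemma half_sum1 (R : realType) (c : R) : 0 < c -> c < 1 -> (1 + c) / 2 < 1 /\ 0 <= (1 + c) / 2.
Proof. by move=> c0 c1; split; lra. Qed.

Section BergerWang.
Variables (R : realType) (E : banach R) (I : finType) (c0 : R) (k : I -> bop E).
Hypotheses (c00 : 0 < c0) (c01 : c0 < 1) (ck : forall i, cpt (k i)).
Implicit Types (w : seq I) (U : set E) (F : set (set E)).
Local Notation m := (fun i => c0%:C%C *: idb + k i).
Local Notation p := (wd m).

Lemma invsub_k U i x : invsub c0 k U -> U x -> U (k i x).
Proof.
move=> [sU _ iU] Ux; have -> : k i x = m i x - c0%:C%C *: x by rewrite !bE addrC addKr.
by apply: ssB => //; [exact: iU|exact: ssZ].
Qed.
Lemma invsub_wd U w x : invsub c0 k U -> U x -> U (p w x).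
Proof. by move=> [_ _ iU] Ux; elim: w => //= i w IH; exact: iU. Qed.
(** On a suitable member each [k i x] is within [h] of the intersection, where words already decay.
    In the induction on the last letter the remainder yields the rate [c0 + 2 * h], and
    [h = (1 - c0) / 4] makes this [(1 + c0) / 2 < 1]. *)
Lemma chain_dec F : (forall U, F U -> invsub c0 k U) -> total_on F subset -> (exists U, F U) ->
 dec c0 k [set x | forall U, F U -> U x] -> exists U, F U /\ dec c0 k U.
Proof.
have [hc hc0] := half_sum1 c00 c01.
move=> iF tF F0 [C [t [C0 t0 t1 Ht]]]; pose h : R := (1 - c0) / 4.
have h0 : 0 < h by rewrite /h divr_gt0 ?subr_gt0.
pose good U i := forall x, U x -> bn x <= 1 -> exists2 z, (forall V, F V -> V z) & bn (k i x - z) < h.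
have gmono U V i : U `<=` V -> good V i -> good U i by move=> UV gV x /UV; exact: gV.
have [U [FU gU]] : exists U, F U /\ forall i, i \in enum I -> good U i.
 elim: (enum I) => [|i s [U [FU gU]]]; first by have [U FU] := F0; exists U.
 have [||V [FV gV]] := @chain_compact _ _ F (k i) h (ck i) _ _ tF F0 h0.
 - by move=> V /iF[].
 - by move=> V x FV; apply: invsub_k; exact: iF.
 case: (tF U V FU FV) => UV.
 exists U; split=> // j; rewrite inE => /orP[/eqP->|]; [exact: gmono gV|exact: gU].
 exists V; split=> // j; rewrite inE => /orP[/eqP->//|/gU]; exact: gmono.
exists U; split=> //; have iU := iF U FU; have [sU _ mU] := iU.
pose K := \sum_i opn (k i) + h.
have s0 : 0 <= \sum_i opn (k i) by apply: sumr_ge0 => i _; exact: opn_ge0.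
have K0 : 0 <= K by rewrite /K; lra.
have kK i : opn (k i) + h <= K.
 by rewrite lerD2r (bigD1 i)//= lerDl sumr_ge0// => j _; exact: opn_ge0.
(* The constant [D] is so large that the contribution [C * K] of the intersection is at most
   [D * h], a second error of the same size as that of the remainder. *)
pose t' := Num.max t ((1 + c0) / 2); pose D := 1 + C * K / h.
have tt' : t <= t' by rewrite le_max lexx.
have ct' : (1 + c0) / 2 <= t' by rewrite le_max lexx orbT.
have t'1 : t' < 1 by rewrite /t' gt_max t1 hc.
have D1 : 1 <= D by rewrite lerDl divr_ge0 ?mulr_ge0//; lra.
have Dh : C * K <= D * h.
 by rewrite /D mulrDl mulfVK ?gt_eqF//; lra.
have t'0 : 0 <= t' by lra.
exists D, t'; split=> //; first lra.
elim/last_ind => [|w i IH]; first by move=> x _ /=; rewrite expr0 mulr1 -[leLHS]mul1r ler_wpM2r ?bn_ge0.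
have tn : 0 <= t' ^+ size w by rewrite exprn_ge0.
have ttn : t ^+ size w <= t' ^+ size w by rewrite lerXn2r.
apply: sub_le => // [|x Ux x1]; first by rewrite mulr_ge0 ?exprn_ge0//; lra.
rewrite wd_rcons size_rcons mulbE addbE scalebE onebE bopD bopZ.
apply: le_trans (bnD _ _) _; rewrite bnZ nc_pos ?(ltW c00)//.
have i_in : i \in enum I by rewrite mem_enum.
have [z Fz rh] := gU i i_in x Ux x1.
have h1 : bn (p w x) <= D * t' ^+ size w.
 by apply: le_trans (IH x Ux) _; rewrite -[leRHS]mulr1 ler_wpM2l// mulr_ge0//; lra.
have h2 : bn (p w z) <= C * t' ^+ size w * K.
 apply: le_trans (Ht w z Fz) _; apply: ler_pM; rewrite ?mulr_ge0 ?exprn_ge0 ?bn_ge0//.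
 by rewrite ler_wpM2l.
 apply: le_trans (kK i); have := opnP (k i) x; have := opn_ge0 (k i); have := bnB_ge z (k i x).
 rewrite (bnC z); move: x1 rh; set q := bn x; set r := opn _; nra.
have h3 : bn (p w (k i x - z)) <= D * t' ^+ size w * h.
 apply: le_trans (IH _ _) _; first by apply: ssB => //; [exact: invsub_k iU Ux|exact: Fz].
 by rewrite ler_wpM2l ?mulr_ge0 ?exprn_ge0 ?(ltW rh)//; lra.
have -> : p w (k i x) = p w (k i x - z) + p w z by rewrite -bopD subrK.
have h4 := bnD (p w (k i x - z)) (p w z).
rewrite exprS; set T := t' ^+ size w in tn h1 h2 h3 *.
have a1 : c0 * bn (p w x) <= c0 * (D * T) by rewrite ler_wpM2l// ltW.
have a2 : C * T * K <= D * h * T by rewrite mulrAC ler_wpM2r.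
have a3 : D * (c0 + h + h) * T <= D * t' * T.
 by rewrite ler_wpM2r// ler_wpM2l; rewrite /h; lra.
have a4 : c0 * (D * T) + (D * T * h + D * h * T) = D * (c0 + h + h) * T by ring.
move: h2 h3 h4 a1 a2 a3 a4; set b1 := bn _; set b2 := bn _; set b3 := bn _; lra.
Qed.
Lemma invsub_cap F : (forall U, F U -> invsub c0 k U) -> invsub c0 k [set x | forall U, F U -> U x].
Proof.
move=> H; split.
- split=> [U FU|x y Hx Hy U FU|c x Hx U FU]; have [sU _ _] := H U FU.
 + exact: ss0.
 + by apply: ssD => //; [exact: Hx|exact: Hy].
 + by apply: ssZ => //; exact: Hx.
- move=> x Hx U FU; have [_ cU _] := H U FU; apply: cU => e /Hx[y Hy yx]; exists y => //; exact: Hy.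
- by move=> i x Hx U FU; have [_ _] := H U FU; apply; exact: Hx.
Qed.
Lemma invsubT : invsub c0 k setT. Proof. by split. Qed.
(** [Zorn_bigcup] works with unions, hence the passage to complements; by [chain_dec] the
    intersection of a chain of non-decaying subspaces is again non-decaying. *)
Lemma minimal_nondec : ~ dec c0 k setT -> exists Y, [/\ invsub c0 k Y, ~ dec c0 k Y &
 forall U, invsub c0 k U -> U `<=` Y -> (exists x, Y x /\ ~ U x) -> dec c0 k U].
Proof.
move=> nd; pose P (A : set E) := invsub c0 k (~` A) /\ ~ dec c0 k (~` A).
have [F FP tF|A [[iA nA] HA]] := @Zorn_bigcup E P.
 have [[A FA]|F0] := EM (exists A, F A); last first.
 rewrite /P; have -> : ~` (\bigcup_(X in F) X) = setT; last by split=> //; exact: invsubT.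
 by apply/seteqP; split=> // x _ [A FA _]; apply: F0; exists A.
 pose F' : set (set E) := [set ~` A | A in F].
 have E' : ~` (\bigcup_(X in F) X) = [set x | forall U, F' U -> U x].
 apply/seteqP; split=> [x Hx _ [B FB <-] Bx|x Hx [B FB Bx]]; first by apply: Hx; exists B.
 by apply: (Hx (~` B)) => //; exists B.
 have iF' U : F' U -> invsub c0 k U by move=> [B FB <-]; have [] := FP B FB.
 rewrite /P E'; split; first exact: invsub_cap.
 move=> dF; have [||U [[B FB <-] dU]] := @chain_dec F' iF' _ _ dF.
 - move=> _ _ [B FB <-] [D FD <-]; case: (tF B D FB FD) => h; [right|left]; exact: subsetC.
 - by exists (~` A), A.
 by have [] := FP B FB.
exists (~` A); split=> // U iU UA [x [Ax nUx]]; apply: contrapT => nU.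
apply: (HA (~` U)); last by rewrite /P setCK.
split; last by move=> h; apply: (Ax); apply: h.
by move=> y Ay Uy; exact: UA Uy Ay.
Qed.
(** The core argument wants all proper invariant subspaces to decay; so it is run on a minimal
    non-decaying subspace, made into a space of its own as the subquotient by zero. *)
Lemma growing_word : (forall t : R, 0 < t -> t < 1 -> exists C, forall w, opn (p w) * t ^+ size w <= C) ->
 ~ dec c0 k setT -> forall N, exists w (c : R), [/\ (N <= size w)%N, 0 < c & forall n, c * 2^-1 ^+ n <= opn (p w ^+ n)].
Proof.
move=> sub1 nd N; have [Y [iY nY mY]] := minimal_nondec nd; have [sY cY mYi] := iY.
have s0 := @set0_subsp R E; have ZY := set0_sub sY.
have [Q [pi pP]] := subquotient sY cY s0 (@set0_closd R E) ZY.
have iso := subquo0_iso pP.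
have stk i : stab Y [set 0] (k i).
 split=> [x|_ ->]; [exact: invsub_k|by rewrite /= bop0].
have st1 : stab Y [set 0] 1 by split.
have stm i : stab Y [set 0] (m i) by apply: stabD => //; exact: stabZ.
have stp w : stab Y [set 0] (p w) by elim: w => //= i w IH; apply: stabM.
pose kQ i : bop Q := induced sY s0 ZY pP (k i).
pose mQ i := c0%:C%C *: (1 : bop Q) + kQ i.
have ckQ i : cpt (kQ i) by apply: induced_cpt.
have mE i : induced sY s0 ZY pP (m i) = mQ i.
 by rewrite inducedD// ?inducedZ ?induced1//; exact: stabZ.
have pE w : wd mQ w = induced sY s0 ZY pP (p w).
 elim: w => [|i w IH]; first by rewrite [RHS]induced1.
 by rewrite [LHS]/= IH -mE -inducedM.
have pn w n : wd mQ w ^+ n = induced sY s0 ZY pP (p w ^+ n).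
 elim: n => [|n IH]; first by rewrite !expr0 induced1.
 rewrite !exprS IH pE inducedM//; elim: (n) => [|l IHl]; first by rewrite expr0.
 by rewrite exprS; apply: stabM.
have [|||w [c [Nw c1 Hw]]] := @core_word R Q I c0 kQ c00 c01 ckQ _ _ _ N.
- move=> t t0 t1; have [C HC] := sub1 t t0 t1; exists C => w; apply: le_trans (HC w).
 by rewrite ler_wpM2r ?exprn_ge0 ?(ltW t0)// pE induced_le.
- move=> [C [t [C0 t0 t1 Ht]]]; apply: nY; exists C, t; split=> // w x Yx.
 have Ypx : Y (p w x) by exact: invsub_wd.
 by rewrite -(iso _ Ypx) -(iso _ Yx) -(inducedE sY s0 ZY pP (stp w) Yx) -pE; exact: Ht.
- move=> U [sU cU iU] [q nUq]; pose V x := Y x /\ U (pi x).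
 have iV : invsub c0 k V.
 split.
 + split; first by split; [exact: ss0|rewrite (sq0 sY s0 pP); exact: ss0].
 by move=> x y [Yx Ux] [Yy Uy]; split; [exact: ssD|rewrite (sqD pP)//; exact: ssD].
 by move=> c x [Yx Ux]; split; [exact: ssZ|rewrite (sqZ sY s0 pP)//; exact: ssZ].
 + move=> x Hx; have Yx : Y x by apply: cY => e /Hx[y [Yy _] yx]; exists y.
 split=> //; apply: cU => e /Hx[y [Yy Uy] yx]; exists (pi y) => //.
 by rewrite -(sqB sY s0 pP)// iso//; exact: ssB.
 + move=> i x [Yx Ux]; split; first exact: mYi.
 by rewrite -(inducedE sY s0 ZY pP (stm i) Yx) mE; exact: iU.
 have [C [t [C0 t0 t1 Ht]]] : dec c0 k V.
 apply: mY => // [x []//|]; have [x Yx xq] := sq_onto pP q.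
 by exists x; split=> // -[_]; rewrite xq.
 exists C, t; split=> // w q' Uq'; have [x Yx xq'] := sq_onto pP q'.
 rewrite -xq' pE (inducedE sY s0 ZY pP (stp w) Yx) !iso//; last exact: invsub_wd.
 by apply: Ht; split=> //; rewrite xq'.
exists w, c; split=> // n; apply: le_trans (Hw n) _.
by rewrite -/mQ pn induced_le.
Qed.
End BergerWang.

Lemma wd_scale (R : realType) (E : banach R) (I : finType) (g : I -> bop E) (c : R[i]) w :
 wd (fun i => c *: g i) w = c ^+ size w *: wd g w.
Proof.
elim: w => [|i w IH] /=; first by rewrite expr0 scale1r.
by rewrite IH -scAl -scAr scalerA exprS.
Qed.
(* Berger-Wang alternative: rescaling by the joint spectral radius [rho > 1]
 gives letters [rho^-1 + compact] to which [growing_word] applies. *)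
Lemma berger_wang (R : realType) (E : banach R) (I : finType) (k : I -> bop E) : (forall i, cpt (k i)) ->
 (forall e : R, 0 < e -> exists C, forall w, opn (wd (fun i => 1 + k i) w) <= C * (1 + e) ^+ size w) \/
 exists w (c : R), 0 < c /\ forall n, c * 2 ^+ n <= opn (wd (fun i => 1 + k i) w ^+ n).
Proof.
move=> ck; set W := wd _.
have [|nH] := EM (forall e : R, 0 < e -> exists C, forall w, opn (W w) <= C * (1 + e) ^+ size w); [by left|right].
have [e0 [e00 He]] : exists e : R, 0 < e /\ forall C, exists w, C * (1 + e) ^+ size w < opn (W w).
 apply: contrapT => H; apply: nH => e e0; apply: contrapT => H1; apply: H; exists e; split=> // C.
 apply: contrapT => H2; apply: H1; exists C => w; rewrite leNgt; apply/negP => h; apply: H2; by exists w.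
have [B B1 HB] := wd_bound (fun i => 1 + k i).
pose S : set R := [set r | 0 < r /\ forall C, exists w, C * r ^+ size w < opn (W w)].
have S1 : S (1 + e0) by split=> //; lra.
have hS : has_sup S.
 split; first by exists (1 + e0).
 exists B => r [r0 /(_ 1)[w]]; rewrite mul1r => h; rewrite leNgt; apply/negP => Br.
 have := lt_le_trans h (HB w); rewrite ltNge; apply/negP/negPn.
 by rewrite lerXn2r ?nnegrE ?(ltW r0) ?(ltW Br)//; lra.
pose rho := sup S; have rho1 : 1 < rho.
 by apply: lt_le_trans (sup_upper_bound hS S1); lra.
have rho0 : 0 < rho by lra.
pose c0 := rho^-1; have c00 : 0 < c0 by rewrite invr_gt0.
have c01 : c0 < 1 by rewrite invf_lt1.
pose k' i := c0%:C%C *: k i; have ck' i : cpt (k' i) by exact: cptZ.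
have pW w : wd (fun i => c0%:C%C *: idb + k' i) w = c0%:C%C ^+ size w *: W w.
 by rewrite -wd_scale; congr (wd _ w); apply/funext => i; rewrite scalerDr.
have nX w : nc (c0%:C%C ^+ size w) = c0 ^+ size w by rewrite ncX nc_pos// ltW.
(* Words of length at least [N] are rescaled by less than 1/4, which turns the lower bound
   [2^-1 ^+ n] for the rescaled powers into [2 ^+ n]. *)
have [|N HN] := @expr_small R c0 4^-1 (ltW c00) c01; first by rewrite invr_gt0.
have [||w [c [Nw cp Hw]]] := growing_word c00 c01 ck' _ _ N.
- move=> t t0 t1; have nS : ~ S (rho / t).
 move=> /(sup_upper_bound hS); rewrite -/rho ler_pdivrMr//; nra.
 have rt : 0 < rho / t by rewrite divr_gt0.
 have [C HC] : exists C, forall w, opn (W w) <= C * (rho / t) ^+ size w.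
 apply: contrapT => H1; apply: nS; split=> // C.
 apply: contrapT => H2; apply: H1; exists C => w; rewrite leNgt; apply/negP => h; apply: H2; by exists w.
 exists C => w; rewrite pW opnZ nX.
 have := HC w; rewrite expr_div_n mulrA ler_pdivlMr ?exprn_gt0// => h.
 rewrite /c0 exprVn mulrAC -mulrA mulrC ler_pdivrMr ?exprn_gt0//; by rewrite mulrC.
- move=> [C [t [C0 t0 t1 Ht]]].
 have d0 : 0 < rho - t * rho by rewrite subr_gt0 -[X in _ < X]mul1r ltr_pM2r.
 have [r [r0 Hr]] := sup_adherent d0 hS; rewrite -/rho opprB addrC subrK => tr.
 have [w] := Hr C; rewrite ltNge => /negP; apply.
 have := @opn_le _ _ (c0%:C%C ^+ size w *: W w) (C * t ^+ size w).
 rewrite mulr_ge0 ?exprn_ge0// => /(_ isT (fun x => _)) h.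
 have {}h : opn (c0%:C%C ^+ size w *: W w) <= C * t ^+ size w.
 by apply: h => x; rewrite -pW; exact: Ht.
 rewrite opnZ nX /c0 exprVn mulrC ler_pdivrMr ?exprn_gt0// in h.
 apply: le_trans h _; rewrite -mulrA -exprMn ler_wpM2l// lerXn2r ?nnegrE ?mulr_ge0 ?(ltW r0) ?(ltW tr) ?(ltW rho0)//.
exists w, c; split=> // n; have := Hw n; rewrite pW.
have -> : (c0%:C%C ^+ size w *: W w) ^+ n = (c0%:C%C ^+ size w) ^+ n *: W w ^+ n by exact: scaleb_pow.
rewrite opnZ ncX nX; set q := c0 ^+ size w.
have q0 : 0 < q by rewrite exprn_gt0.
have q4 : q < 4^-1 by exact: HN.
move=> h; have qn : q ^+ n <= 4^-1 ^+ n by rewrite lerXn2r ?nnegrE ?invr_ge0 ?(ltW q0) ?(ltW q4).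
have : c * 2^-1 ^+ n <= 4^-1 ^+ n * opn (W w ^+ n).
 by apply: le_trans h _; rewrite ler_wpM2r ?opn_ge0.
have -> : (2^-1 : R) ^+ n = 4^-1 ^+ n * 2 ^+ n.
 by rewrite -exprMn; congr (_ ^+ n); field.
by rewrite mulrCA ler_pM2l// exprn_gt0// invr_gt0.
Qed.
Lemma exists_near_one (R : realType) D : exists2 e : R, 0 < e & (1 + e) ^+ D <= 2.
Proof.
have D1 : (1 : R) <= D.+1%:R by rewrite ler1n.
have e0 : 0 < (2 * D.+1%:R : R)^-1 by rewrite invr_gt0; lra.
have e2 : (2 * D.+1%:R : R)^-1 <= 2^-1 by rewrite lef_pV2 ?posrE//; lra.
have De : D%:R * (2 * D.+1%:R : R)^-1 <= 2^-1.
 by rewrite ler_pdivrMr; [rewrite mulrA mulVf ?pnatr_eq0// mul1r ler_nat|lra].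
exists (2 * D.+1%:R)^-1 => //; move: e0 e2 De; set e := _^-1 => e0 e2 De.
have h1 := @exp1B_ge R e D (ltW e0) ltac:(lra).
have h2 : ((1 + e) * (1 - e)) ^+ D <= 1 by apply: exprn_ile1; nra.
have h3 : 0 <= (1 + e) ^+ D by rewrite exprn_ge0//; lra.
rewrite exprMn in h2; move: h1 h2 h3 De; set u := (1 + e) ^+ D; set v := (1 - e) ^+ D.
move=> h1 h2 h3 De; have : u * (1 - D%:R * e) <= u * v by rewrite ler_wpM2l.
have : u * 2^-1 <= u * (1 - D%:R * e) by rewrite ler_wpM2l//; lra.
lra.
Qed.

(** * Hilden's argument for products of exponentials *)

Section Hilden.
Variables (R : realType) (E : banach R).
Implicit Types (a b T : bop E) (w L : seq (bop E)) (s : seq (R[i] * seq (bop E))) (M : set E).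

Definition irred (S : bop E -> Prop) := forall M, subsp M -> closd M ->
 (forall a x, S a -> M x -> M (a x)) -> (forall x, M x -> x = 0) \/ (forall x, M x).

Definition wx w : bop E := foldr (fun a b => expb a * b) 1 w.
Lemma wx_cat w1 w2 : wx (w1 ++ w2) = wx w1 * wx w2.
Proof. by elim: w1 => [|a w IH] /=; rewrite ?mul1r// IH mulrA. Qed.
Definition cmb s : bop E := \sum_(p <- s) p.1 *: wx p.2.
Definition cw s : R := \sum_(p <- s) nc p.1.
Lemma cw_ge0 s : 0 <= cw s. Proof. by apply: sumr_ge0 => p _; exact: nc_ge0. Qed.
(** Bookkeeping for norms: a growth bound for words in [L] of length at most [D] bounds [T] by [c]
    times as much. Under products weights multiply and lengths add. *)
Definition weighted L (c : R) D T := exists s, [/\ T = cmb s, cw s <= c &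
 forall p, p \in s -> (size p.2 <= D)%N /\ {subset p.2 <= L}].

Lemma weightedM L c D T c' D' T' : 0 <= c' ->
 weighted L c D T -> weighted L c' D' T' -> weighted L (c * c') (D + D')%N (T * T').
Proof.
move=> c'0 [s [-> h1 h2]] [s' [-> h1' h2']].
exists [seq (p.1 * q.1, p.2 ++ q.2) | p <- s, q <- s']; split.
- rewrite /cmb mulr_suml big_allpairs_dep /=; apply: eq_bigr => p _.
 rewrite mulr_sumr; apply: eq_bigr => q _.
 by rewrite wx_cat -scAl -scAr scalerA.
- rewrite /cw big_allpairs_dep /=; apply: (@le_trans _ _ (cw s * cw s')).
 rewrite /cw mulr_suml; apply: ler_sum => p _; rewrite mulr_sumr; apply: ler_sum => q _.
 by rewrite ncM.
 by apply: ler_pM => //; exact: cw_ge0.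
- move=> _ /allpairsP[[p q] /= [/h2[p1 p2] /h2'[q1 q2] ->]] /=; split.
 by rewrite size_cat leq_add.
 by move=> a; rewrite mem_cat => /orP[/p2|/q2].
Qed.
Lemma weighted_le L c D T L' c' D' : weighted L c D T -> {subset L <= L'} -> c <= c' -> (D <= D')%N ->
 weighted L' c' D' T.
Proof.
move=> [s [-> h1 h2]] LL cc DD; exists s; split=> //; first exact: le_trans cc.
by move=> p /h2[p1 p2]; split; [exact: leq_trans DD|move=> a /p2/LL].
Qed.
Lemma weighted_norm L c D T (K q : R) : 0 <= K -> 1 <= q -> weighted L c D T ->
 (forall w, {subset w <= L} -> opn (wx w) <= K * q ^+ size w) -> opn T <= c * (K * q ^+ D).
Proof.
move=> K0 q1 [s [-> h1 h2]] H; apply: (@le_trans _ _ (cw s * (K * q ^+ D))); last first.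
 by rewrite ler_wpM2r// mulr_ge0// exprn_ge0//; lra.
rewrite /cmb /cw mulr_suml big_seq_cond [leRHS]big_seq_cond.
apply: le_trans (@bn_sum _ (BL E) _ _ _ _) _; apply: ler_sum => p; rewrite andbT => /h2[p1 p2].
rewrite [bn _]opnZ ler_wpM2l ?nc_ge0//; apply: le_trans (H _ p2) _.
by rewrite ler_wpM2l// ler_weXn2l.
Qed.

Section Orbit.
Variable S : bop E -> Prop.
Hypothesis SZ : forall c a, S a -> S (c *: a).
Definition expalg T := exists s, T = cmb s /\ forall p a, p \in s -> a \in p.2 -> S a.

Lemma expalg_weighted T : expalg T -> exists L c D, [/\ (forall a, a \in L -> S a), 0 <= c & weighted L c D T].
Proof.
move=> [s [Ts HS]]; exists (flatten [seq p.2 | p <- s]), (cw s), (\max_(p <- s) size p.2).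
split; [|exact: cw_ge0|exists s; split=> // p ps; split].
- by move=> a /flattenP[_ /mapP[p ps ->] ap]; exact: HS ap.
- by rewrite (big_rem p)//= leq_maxl.
- by move=> a ap; apply/flattenP; exists p.2 => //; apply/mapP; exists p.
Qed.
Definition orbit z : set E := clos (fun x => exists2 T, expalg T & x = T z).
Lemma orbit_subsp z : subsp (orbit z).
Proof.
apply: clos_subsp; split.
- exists 0; last by rewrite zerobE.
 by exists [::]; split=> //; rewrite /cmb big_nil.
- move=> _ _ [_ [s [-> Hs]] ->] [_ [s' [-> Hs']] ->]; exists (cmb s + cmb s') => //.
 exists (s ++ s'); split; first by rewrite /cmb big_cat.
 by move=> p a; rewrite mem_cat => /orP[/Hs|/Hs']; apply.
- move=> c _ [_ [s [-> Hs]] ->]; exists (c *: cmb s) => //.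
 exists [seq (c * p.1, p.2) | p <- s]; split.
 by rewrite /cmb big_map scaler_sumr; apply: eq_bigr => p _; rewrite scalerA.
 by move=> q a /mapP[p ps ->] /=; exact: Hs.
Qed.
Lemma orbit_self z : orbit z z.
Proof.
apply: sub_clos; exists 1 => //; exists [:: (1, [::])]; split.
 by rewrite /cmb big_seq1 scale1r.
by move=> p a; rewrite inE => /eqP->.
Qed.
Lemma orbit_expb z a x : S a -> orbit z x -> orbit z (expb a x).
Proof.
move=> Sa; have cV : closd (fun x => orbit z (expb a x)) by apply: pre_closd; exact: clos_closd.
move: x; apply: clos_min => // _ [_ [s [-> Hs]] ->]; apply: sub_clos.
exists (expb a * cmb s) => //; exists [seq (p.1, a :: p.2) | p <- s]; split.
 by rewrite /cmb big_map mulr_sumr; apply: eq_bigr => p _; rewrite scAr.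
by move=> _ b /mapP[p ps ->]; rewrite inE => /orP[/eqP->//|]; exact: Hs.
Qed.
(** The orbit is generated by exponentials, and [a] itself is a norm limit of combinations of
    exponentials of its multiples. *)
Lemma orbit_stable z a x : S a -> orbit z x -> orbit z (a x).
Proof.
move=> Sa Hx; apply: (@clos_closd _ _ _) => e e0; have x0 := bn_ge0 x.
have e1 : 0 < e / (bn x + 1) by rewrite divr_gt0 ?ltr_wpDl.
have e2 : 0 < e / (bn x + 1) / 2 by lra.
have [s _ Hs] := exp_average a e2.
have Hz : orbit z ((\sum_(p <- s) p.1 *: expb (p.2 *: a)) x).
 have so := orbit_subsp z; rewrite sumbE; elim/big_ind: _ => [|u v Hu Hv|p _]; [exact: (ss0 so)|exact: (ssD so Hu Hv)|].
 rewrite scalebE; apply: (ssZ so).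
 by apply: orbit_expb => //; exact: SZ.
exists ((\sum_(p <- s) p.1 *: expb (p.2 *: a)) x) => //.
rewrite bnC -subbE; apply: le_lt_trans (opnPM x Hs) _.
have : e / (bn x + 1) * (bn x + 1) = e by rewrite mulfVK// gt_eqF// ltr_wpDl.
move: e1; set u := e / _; set v := bn x in x0 *; nra.
Qed.
Lemma orbit_full z x : irred S -> z != 0 -> orbit z x.
Proof.
move=> irr z0; have [|||H|] := irr (orbit z); last exact.
- exact: orbit_subsp.
- exact: clos_closd.
- by move=> a y Sa; exact: orbit_stable.
- by move: z0; rewrite (H z (orbit_self z)) eqxx.
Qed.
(* Lebesgue number of the cover of [K (ball x0 1)] by the sets where an element of [expalg]
 maps into the ball of radius [1/2] about [x0]. *)
Lemma finite_return K x0 : irred S -> cpt K -> opn K < bn (K x0) ->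
 exists m (T : nat -> bop E), (forall j, (j < m)%N -> expalg (T j)) /\
 forall y, bn (y - x0) <= 1 -> exists2 j, (j < m)%N & bn (T j (K y) - x0) <= 3 / 4.
Proof.
move=> irr cK Kx; pose B y := bn (y - x0) <= 1.
have KB y : B y -> bn (K x0) - opn K <= bn (K y).
 move=> By; have h1 := opnP K (y - x0); have h0 := opn_ge0 K.
 have h2 := bnB_ge (K x0) (K y); rewrite bnC -bopB in h2.
 by move: By h1 h0 h2; rewrite /B; set p := bn (y - x0); set q := opn K; nra.
pose works T z (r : R) := forall z', bn (z' - z) < r -> bn (T z' - x0) <= 3 / 4.
have [n Hn] : exists n : nat, forall y, B y -> exists2 T, expalg T & works T (K y) n.+1%:R^-1.
 apply: contrapT => H; have H1 n : exists y, B y /\ forall T, expalg T -> ~ works T (K y) n.+1%:R^-1.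
 apply: contrapT => H2; apply: H; exists n => y By; apply: contrapT => H3; apply: H2.
 by exists y; split=> // T AT wT; apply: H3; exists T.
 have [y Hy] := choice H1.
 have yb n : bn (y n) <= bn x0 + 1.
 by have := bnD (y n - x0) x0; rewrite subrK; have := (Hy n).1; rewrite /B; lra.
 have [l Hl] := cptP cK yb.
 have l0 : l != 0.
 apply/eqP => l0; have := ulim_norm_ge Hl (ev_all (fun n => KB _ (Hy n).1)); rewrite l0 bn0; lra.
 have e2 : (0 : R) < 2^-1 by rewrite invr_gt0.
 have [_ [T AT ->] Tl] := orbit_full x0 irr l0 e2.
 have T0 := opn_ge0 T.
 have e1 : 0 < (16 * (opn T + 1))^-1 by rewrite invr_gt0; lra.
 have [n [h1 h2]] := ev_ex (ev_and (Hl _ e1) (ev_ge (Num.truncn (16 * (opn T + 1))).+1)).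
 apply: ((Hy n).2 T AT) => z' zn.
 have n1 : n.+1%:R^-1 < (16 * (opn T + 1))^-1.
 rewrite ltf_pV2 ?posrE//; last by lra.
 by apply: lt_le_trans (truncnS_gt _) _; rewrite ler_nat (leq_trans h2).
 have h3 : bn (z' - l) < 2 * (16 * (opn T + 1))^-1.
 apply: le_lt_trans (bn_tri (K (y n)) _ _) _.
 move: (lt_trans zn n1) h1; set p := bn (z' - _); set q := bn (_ - l); set r := _^-1 => u v.
 apply: lt_le_trans (ltrD u v) _; lra.
 have h4 : bn (T (z' - l)) <= 8^-1.
 apply: opnP_le.
 have : (16 * (opn T + 1))^-1 * (16 * (opn T + 1)) = 1 by rewrite mulVf// gt_eqF//; lra.
 move: h3 (bn_ge0 (z' - l)) T0; set u := _^-1; set p := bn _; set q := opn T; nra.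
 have := bn_tri (T l) (T z') x0; rewrite -bopB; lra.
have n0 : (0 : R) < n.+1%:R^-1 / 2 by rewrite divr_gt0 ?invr_gt0 ?ltr0n.
have r0 : 0 < bn x0 + 1 by rewrite ltr_wpDl ?bn_ge0.
have n1 : 0 < n.+1%:R^-1 / 2 / (bn x0 + 1) by rewrite divr_gt0.
have [m [f Hf]] := cK _ n1.
pose good j T := expalg T /\ forall y, B y -> bn (K y - (bn x0 + 1)%:C%C *: f j) < n.+1%:R^-1 / 2 -> bn (T (K y) - x0) <= 3 / 4.
have ex j : exists T, good j T.
 have [[y [By yf]]|H] := EM (exists y, B y /\ bn (K y - (bn x0 + 1)%:C%C *: f j) < n.+1%:R^-1 / 2); last first.
 exists 0; split; last by move=> y By yf; case: H; exists y.
 by exists [::]; split=> //; rewrite /cmb big_nil.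
 have [T AT wT] := Hn y By; exists T; split=> // y' By' yf'; apply: wT.
 apply: le_lt_trans (bn_tri ((bn x0 + 1)%:C%C *: f j) _ _) _.
 by rewrite (bnC (_ *: _) (K y)); apply: lt_le_trans (ltrD yf' yf) _; rewrite -splitr.
have [T HT] := choice ex.
exists m, T; split; first by move=> j _; have [] := HT j.
move=> y By; pose y' := ((bn x0 + 1)^-1)%:C%C *: y.
have y'1 : bn y' <= 1.
 rewrite bnZ nc_pos ?invr_ge0 ?(ltW r0)// ler_pdivrMl// mulr1.
 by have := bnD (y - x0) x0; rewrite subrK; move: By; rewrite /B; lra.
have [j jm Hj] := Hf y' y'1; exists j => //; apply: (HT j).2 => //.
have -> : K y - (bn x0 + 1)%:C%C *: f j = (bn x0 + 1)%:C%C *: (K y' - f j).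
 rewrite scalerBr /y' bopZ scalerA -rmorphM mulfV ?gt_eqF//= scale1r.
 by [].
rewrite bnZ nc_pos ?(ltW r0)//; by move: Hj; rewrite ltr_pdivlMr// mulrC.
Qed.
Definition subexp := forall L, (forall a, a \in L -> S a) -> forall e : R, 0 < e ->
 exists K, forall w, {subset w <= L} -> opn (wx w) <= K * (1 + e) ^+ size w.

Lemma small_scalar (A B : R) : 0 <= A -> 0 <= B ->
 exists2 h, 0 < h & A * h <= 4^-1 /\ B * h <= 4^-1.
Proof.
move=> A0 B0; have P : 0 < 4 * (A + B + 1) by lra.
by exists (4 * (A + B + 1))^-1; rewrite ?invr_gt0//; split; rewrite ler_pdivrMr//; lra.
Qed.
(** Finitely many operators [T j] bring the image under [K] of the ball around [x0] back into that
    ball. With [K] replaced by an approximation of weight [eta], one return has weight at most 1/4,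
    while subexponential growth charges a factor at most 2 for its length. After [N] returns the
    norm is of order [2^-1 ^+ N], yet [x0] is still mapped into a ball that misses zero. *)
Lemma hilden K : irred S -> S K -> cpt K -> K != 0 -> ~ subexp.
Proof.
move=> irr SK cK K0 sub.
have [x1 Kx1] : exists x, K x != 0.
 apply: contrapT => H; case/eqP: K0; apply: bop_eq => x.
 by apply: contrapT => /eqP h; apply: H; exists x.
have k1 : 0 < bn (K x1) by rewrite bn_gt0.
have k0 := opn_ge0 K.
(* The scaling makes [K x0] larger than [opn K]: the image under [K] of the unit ball around [x0]
   stays away from zero, and the ball does not contain zero either. *)
pose x0 := ((opn K + 1) / bn (K x1))%:C%C *: x1.
have Kx0 : opn K < bn (K x0).
 rewrite /x0 bopZ bnZ nc_pos ?divr_ge0 ?bn_ge0 ?mulfVK ?gt_eqF//; lra.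
have x01 : 1 < bn x0.
 have h := opnP K x0; rewrite ltNge; apply/negP => h1; have : opn K * bn x0 <= opn K * 1 by rewrite ler_wpM2l.
 lra.
have [m [T [AT HT]]] := finite_return irr cK Kx0.
have [L [c [D [LS c0 HW]]]] : exists L c D, [/\ (forall a, a \in L -> S a), 0 <= c &
 forall j, (j < m)%N -> weighted L c D (T j)].
 elim: m AT {HT} => [|m IH] AT; first by exists [::], 0, 0%N.
 have [L [c [D [LS c0 HW]]]] := IH (fun j jm => AT j (ltnW jm)).
 have [L' [c' [D' [LS' c0' HW']]]] := expalg_weighted (AT m (ltnSn m)).
 exists (L ++ L'), (c + c'), (D + D')%N; split; last first.
 - move=> j; rewrite ltnS leq_eqVlt => /orP[/eqP->|/HW h].
 apply: (weighted_le HW'); rewrite ?lerDr ?leq_addl// => a; by rewrite mem_cat => ->; rewrite orbT.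
 apply: (weighted_le h); rewrite ?lerDl ?leq_addr// => a; by rewrite mem_cat => ->.
 - by rewrite addr_ge0.
 - by move=> a; rewrite mem_cat => /orP[/LS|/LS'].
have [Tm Tm0 HTm] : exists2 q : R, 0 <= q & forall j, (j < m)%N -> opn (T j) <= q.
 exists (\sum_(j < m) opn (T j)); first by apply: sumr_ge0 => j _; exact: opn_ge0.
 move=> j jm; rewrite (bigD1 (Ordinal jm))//= lerDl; apply: sumr_ge0 => i _; exact: opn_ge0.
have [|eta eta0 [eT ec]] := small_scalar (A := Tm * (bn x0 + 1)) _ c0.
 by rewrite mulr_ge0// addr_ge0 ?bn_ge0.
have [s s1 Hs] := exp_average K eta0.
pose K' := \sum_(p <- s) p.1 *: expb (p.2 *: K).
pose L' := L ++ [seq p.2 *: K | p <- s].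
have L'S a : a \in L' -> S a.
 by rewrite mem_cat => /orP[/LS//|/mapP[p _ ->]]; exact: SZ.
have K'W : weighted L' eta 1 K'.
 exists [seq (p.1, [:: p.2 *: K]) | p <- s]; split.
 - by rewrite /cmb big_map; apply: eq_bigr => p _; rewrite /= mulr1.
 - by rewrite /cw big_map.
 - move=> _ /mapP[p ps ->] /=; split=> // a; rewrite inE => /eqP->.
 by rewrite mem_cat; apply/orP; right; apply/mapP; exists p.
have TW j : (j < m)%N -> weighted L' 4^-1 D.+1 (T j * K').
 move=> jm; have h : weighted L' c D (T j).
 by apply: (weighted_le (HW j jm)) => // a aL; rewrite mem_cat aL.
 rewrite -[D.+1]addn1; by apply: (weighted_le (weightedM (ltW eta0) h K'W)).
have step y : bn (y - x0) <= 1 -> exists2 j, (j < m)%N & bn ((T j * K') y - x0) <= 1.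
 move=> By; have [j jm Hj] := HT y By; exists j => //.
 have yb : bn y <= bn x0 + 1 by have := bnD (y - x0) x0; rewrite subrK; lra.
 have h1 : bn (T j (K' y) - T j (K y)) <= 4^-1.
 rewrite -bopB -subbE; apply: le_trans (opnPM _ (HTm j jm)) _.
 have h2 : bn ((K' - K) y) <= eta * (bn x0 + 1).
 apply: opnP_le; rewrite opnC; apply: ler_pM; rewrite ?opn_ge0 ?bn_ge0//.
 by apply: le_trans (ler_wpM2l Tm0 h2) _; rewrite mulrCA mulrC.
 have := bn_tri (T j (K y)) (T j (K' y)) x0; rewrite mulbE; lra.
have iter n : exists2 W, weighted L' (4^-1 ^+ n) (n * D.+1)%N W & bn (W x0 - x0) <= 1.
 elim: n => [|n [W HWn WB]].
 exists 1; last by rewrite onebE subrr bn0.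
 exists [:: (1, [::])]; split; [by rewrite /cmb big_seq1 scale1r|by rewrite /cw big_seq1 nc1 expr0|].
 by move=> p; rewrite inE => /eqP->.
 have [j jm Hj] := step _ WB; exists (T j * K' * W) => //.
 rewrite exprS mulSn; apply: weightedM => //; last exact: TW.
have [e1 e10 qD] := exists_near_one R D.+1.
have [K1 HK1] := sub L' L'S _ e10; set q := 1 + _ in HK1 qD.
have q1 : 1 <= q by rewrite lerDl ltW.
have K10 : 0 <= K1 by have := HK1 [::]; rewrite expr0 mulr1 => /(_ (fun _ => _)) h; apply: le_trans (opn_ge0 _) (h _).
have d0 : 0 < (bn x0 - 1) / (K1 * bn x0 + 1).
 by apply: divr_gt0; rewrite ?subr_gt0// ltr_wpDl ?mulr_ge0 ?bn_ge0.
have [N /(_ N (leqnn N)) HN] := @half_small R _ d0.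
have [W HWN WB] := iter N.
have h1 := weighted_norm K10 q1 HWN HK1.
have h2 : opn W <= K1 * 2^-1 ^+ N.
 apply: le_trans h1 _; rewrite mulrCA ler_wpM2l// mulnC exprM.
 have -> : (2^-1 : R) ^+ N = 4^-1 ^+ N * 2 ^+ N by rewrite -exprMn; congr (_ ^+ N); field.
 by rewrite ler_wpM2l ?exprn_ge0 ?invr_ge0// lerXn2r ?nnegrE ?exprn_ge0//; lra.
have h3 := opnPM x0 h2; have h4 := bnB_ge x0 (W x0); rewrite bnC in h4.
have h5 : K1 * 2^-1 ^+ N * bn x0 < bn x0 - 1.
 have P1 : 0 < K1 * bn x0 + 1 by rewrite ltr_wpDl ?mulr_ge0 ?bn_ge0.
 move: HN; rewrite (ltr_pdivlMr _ _ P1) => hN; apply: le_lt_trans hN.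
 have : (0 : R) <= 2^-1 ^+ N by rewrite exprn_ge0// invr_ge0.
 set p := 2^-1 ^+ N; lra.
lra.
Qed.
Lemma growing_exp_word K : irred S -> (forall a, S a -> cpt a) -> S K -> K != 0 ->
 exists w (c : R), [/\ (forall a, a \in w -> S a), 0 < c & forall n, c * 2 ^+ n <= opn (wx w ^+ n)].
Proof.
move=> irr cS SK K0; apply: contrapT => H; apply: (hilden irr SK (cS K SK) K0) => L LS.
pose k (i : 'I_(size L)) := expb (tnth (in_tuple L) i) - 1.
have ck i : cpt (k i) by apply: expb_cpt; apply: cS; apply: LS; exact: mem_tnth.
have wE (v : seq 'I_(size L)) : wd (fun i => 1 + k i) v = wx [seq tnth (in_tuple L) i | i <- v].
 elim: v => [|i v IH] //=; rewrite IH; congr (_ * _).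
 by rewrite /k addrC subrK.
have [Hs|[v [c [c0 Hc]]]] := berger_wang ck.
 move=> e /Hs[K1 HK1]; exists K1 => w wL.
 have [v wv] : exists v : seq 'I_(size L), w = [seq tnth (in_tuple L) i | i <- v].
 elim: w wL => [|a w IH] wL; first by exists [::].
 have [|v ->] := IH; first by move=> b bw; apply: wL; rewrite inE bw orbT.
 have /tnthP[i ->] : a \in in_tuple L by apply: wL; rewrite inE eqxx.
 by exists (i :: v).
 by have := HK1 v; rewrite wE -wv wv size_map.
case: H; exists [seq tnth (in_tuple L) i | i <- v], c; split=> // [a /mapP[i _ ->]|n].
 by apply: LS; exact: mem_tnth.
by rewrite -wE.
Qed.
End Orbit.
End Hilden.

(** * Conjugation by an operator of the form identity plus compact *)

Lemma image_countable (T U : Type) (f : T -> U) (A : set T) : countable A -> countable (f @` A).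
Proof. by move=> cA; apply: (sub_countable (card_image_le f A)). Qed.
Lemma setU_countable (T : Type) (A B : set T) : countable A -> countable B -> countable (A `|` B).
Proof.
move=> cA cB; have -> : A `|` B = \bigcup_(b in [set: bool]) (if b then A else B).
 apply/seteqP; split=> [x [Ax|Bx]|x [[] _ H]]; [by exists true|by exists false|by left|by right].
by apply: bigcup_countable => [|[]]; rewrite ?setT_bool; [exact: finite_set_countable| |].
Qed.
Lemma eigenval_countable (R : realType) (E : banach R) (k : bop E) (c : R[i]) : cpt k ->
 countable [set z | eigenval (c *: idb + k) z].
Proof.
move=> ck; pose F (n : nat) := [set lam : R[i] | n.+1%:R^-1 <= nc lam /\ exists2 x, x != 0 & k x = lam *: x].
have fF n : finite_set (F n) by apply: eigenvalues_finite => //; rewrite invr_gt0.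
pose B := [set (0 : R[i])] `|` \bigcup_(n in [set: nat]) F n.
have cB : countable B.
 apply: setU_countable; first by apply: finite_set_countable; exact: finite_set1.
 by apply: bigcup_countable => // n _; exact: finite_set_countable.
apply: (@sub_countable _ _ _ [set lam + c | lam in B]); last exact: image_countable.
apply: subset_card_le => z [x x0 Hx]; exists (z - c); last by rewrite subrK.
have kx : k x = (z - c) *: x.
 by have := Hx; rewrite !bE scalerBl => <-; rewrite addrC addKr.
have [->|zc] := eqVneq (z - c) 0; [by left|right].
rewrite -nc_gt0 in zc; exists (Num.truncn (nc (z - c))^-1) => //; split; last by exists x.
rewrite invf_ple ?posrE ?invr_gt0//; apply: ltW; exact: truncnS_gt.
Qed.

Section Conjugation.
Variables (R : realType) (E : banach R) (k k' : bop E).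
Hypotheses (ck : cpt k) (ck' : cpt k').
Local Notation g := (1 + k).
Local Notation g' := (1 + k').
Hypotheses (gg' : g * g' = 1) (g'g : g' * g = 1).
Implicit Types (v x : bop E) (z : R[i]) (L : seq R[i]).

Lemma generic_level (a b : R) : a < b -> exists s, [/\ a < s, s < b &
 forall z, nc z = s -> ~ eigenval g z /\ ~ eigenval g' z].
Proof.
move=> ab; have c1 := eigenval_countable 1 ck; have c2 := eigenval_countable 1 ck'.
have [|s [s1 s2 Hs]] := @avoid_countable R
 ((@nc R) @` ([set z | eigenval (1 *: idb + k) z] `|` [set z | eigenval (1 *: idb + k') z])) a b _ ab.
 by apply: image_countable; exact: setU_countable.
exists s; split=> // z zs; split=> Hz; apply: Hs; exists z => //; [left|right]; by rewrite /= scale1r.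
Qed.
(** [Q] combines the spectral projections of [g] and of its inverse, so it belongs to the part of
    the spectrum of [g] between [s^-1] and [s] in modulus; a common multiple of the exponents
    controls both operators on its range. *)
Lemma two_sided_splitting (s : R) : 1 < s -> (forall z, nc z = s -> ~ eigenval g z /\ ~ eigenval g' z) ->
 exists Q N, [/\ Q * Q = Q, GRing.comm g Q, GRing.comm g' Q, cpt (1 - Q) & (0 < N)%N] /\
 opn (g ^+ N * Q) <= 2^-1 * s ^+ N /\ opn (g' ^+ N * Q) <= 2^-1 * s ^+ N.
Proof.
move=> s1 Hs; have s0 : 0 < s by lra.
have [P1 [cm1 i1 c1 [N1 N10 H1]]] := dominated_splitting ck s1 (fun z h => (Hs z h).1).
have [P2 [cm2 i2 c2 [N2 N20 H2]]] := dominated_splitting ck' s1 (fun z h => (Hs z h).2).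
have g_g' : GRing.comm g g' by rewrite /GRing.comm gg' g'g.
have gP1 : GRing.comm g P1 by apply: cm1.
have g'P1 : GRing.comm g' P1 by apply: cm1; exact: commr_sym.
have g'P2 : GRing.comm g' P2 by apply: cm2.
have gP2 : GRing.comm g P2 by apply: cm2.
have P12 : P1 * P2 = P2 * P1 by apply: cm2; exact: commr_sym.
pose Q := P1 * P2.
have q0 : (0 : R) <= 2^-1 by rewrite invr_ge0.
have e0 : 0 < 2^-1 / (opn Q + 1) by rewrite divr_gt0 ?invr_gt0// ltr_wpDl ?opn_ge0.
have [M HM] := half_small e0.
have it (a P : bop E) n : GRing.comm a P -> (forall x : E, P x = x -> bn ((a ^+ n) x) <= 2^-1 * s ^+ n * bn x) ->
 forall m (x : E), P x = x -> bn ((a ^+ (n * m)) x) <= 2^-1 ^+ m * s ^+ (n * m) * bn x.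
 move=> aP H; elim=> [|m IH] x Px; first by rewrite muln0 !expr0 !mul1r.
 rewrite mulnS exprD mulbE; apply: le_trans (H _ _) _.
 by rewrite -mulbE (commrX _ (commr_sym aP)) mulbE Px.
 rewrite exprS [s ^+ (n + _)]exprD.
 apply: (@le_trans _ _ (2^-1 * s ^+ n * (2^-1 ^+ m * s ^+ (n * m) * bn x))).
 by rewrite ler_wpM2l ?mulr_ge0 ?exprn_ge0 ?IH// ltW.
 by rewrite !mulrA [2^-1 * s ^+ n * _]mulrAC.
have fin (a P : bop E) n m : GRing.comm a P -> (forall x : E, P x = x -> bn ((a ^+ n) x) <= 2^-1 * s ^+ n * bn x) ->
 P * Q = Q -> (M <= m)%N -> opn (a ^+ (n * m) * Q) <= 2^-1 * s ^+ (n * m).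
 move=> aP H PQ Mm; have sn : 0 <= s ^+ (n * m) by rewrite exprn_ge0// ltW.
 apply: opn_le => [|x]; first by rewrite mulr_ge0.
 rewrite mulbE; apply: le_trans (it _ _ _ aP H m _ _) _; first by rewrite -mulbE PQ.
 apply: (@le_trans _ _ (2^-1 ^+ m * s ^+ (n * m) * (opn Q * bn x))).
 by apply: ler_wpM2l; [rewrite mulr_ge0// exprn_ge0|exact: opnP].
 have hm := ltW (HM m Mm); rewrite ler_pdivlMr ?ltr_wpDl ?opn_ge0// in hm.
 have hm' : 2^-1 ^+ m * opn Q <= 2^-1.
 by apply: le_trans hm; rewrite ler_wpM2l ?exprn_ge0//; lra.
 have -> : 2^-1 ^+ m * s ^+ (n * m) * (opn Q * bn x) = 2^-1 ^+ m * opn Q * (s ^+ (n * m) * bn x) by ring.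
 by rewrite -[leRHS]mulrA; apply: ler_wpM2r => //; rewrite mulr_ge0// bn_ge0.
exists Q, (N1 * (N2 * M.+1))%N; split; [split|].
- by rewrite /Q -mulrA (mulrA P2) -P12 -mulrA i2 mulrA i1.
- exact: commrM.
- exact: commrM.
- have -> : 1 - Q = (1 - P1) + P1 * (1 - P2) by rewrite mulrBr mulr1 addrA subrK.
 by apply: cptD => //; exact: cptMl.
- by rewrite !muln_gt0 N10 N20.
split.
- apply: (fin g P1) => // [x Px| |]; [exact: (H1 x).1|by rewrite /Q mulrA i1|].
 by apply: leq_trans (leqnSn M) _; rewrite leq_pmull.
- rewrite mulnCA; apply: (fin g' P2) => // [x Px| |]; [exact: (H2 x).1| |].
 by rewrite /Q P12 mulrA i2.
 by apply: leq_trans (leqnSn M) _; rewrite leq_pmull.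
Qed.
(** The operator [1 - z Ad] for the conjugation [Ad] that sends [x] to [g' * x * g]; the following
    lemmas bound it from below. *)
Definition adc z x : bop E := x - z *: (g' * x * g).

Lemma telescope_bound z n : exists2 K : R, 0 <= K &
 forall v, opn (v - z ^+ n *: (g' ^+ n * v * g ^+ n)) <= K * opn (adc z v).
Proof.
elim: n => [|n [K K0 IH]].
 by exists 0 => // v; rewrite !expr0 scale1r mul1r mulr1 subrr opn0 mul0r.
exists (1 + nc z * (opn g' * K * opn g)) => [|v].
 by rewrite addr_ge0// !mulr_ge0 ?nc_ge0 ?opn_ge0.
have -> : v - z ^+ n.+1 *: (g' ^+ n.+1 * v * g ^+ n.+1) =
 adc z v + z *: (g' * (v - z ^+ n *: (g' ^+ n * v * g ^+ n)) * g).
 rewrite /adc mulrBr mulrBl scalerBr addrA subrK; congr (_ - _).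
 by rewrite -scAr -scAl scalerA [z ^+ _]exprS [g' ^+ _]exprS [g ^+ n.+1]exprSr !mulrA.
apply: le_trans (opnD _ _) _; rewrite [leRHS]mulrDl mul1r; apply: lerD => //.
rewrite opnZ -[leRHS]mulrA; apply: ler_wpM2l; first exact: nc_ge0.
apply: opnM_le; apply: (@le_trans _ _ (opn g' * (K * opn (adc z v)) * opn g)).
 rewrite ler_wpM2r ?opn_ge0//; apply: opnM_le.
 by rewrite ler_wpM2l ?opn_ge0.
by rewrite -!mulrA [opn g * _]mulrC.
Qed.
(** On the corner [Q * v * Q] the powers of [g] and [g'] contribute at most [2^-1 * s ^+ N] each, so
    the condition on [z] leaves the [N]-th iterate of [z Ad] with norm at most 1/4; the telescoping
    sum compares it with [adc z]. *)
Lemma middle_bound z (s : R) Q N : 0 < s -> nc z * s ^+ 2 <= 1 -> GRing.comm g Q -> GRing.comm g' Q ->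
 opn (g ^+ N * Q) <= 2^-1 * s ^+ N -> opn (g' ^+ N * Q) <= 2^-1 * s ^+ N ->
 exists2 K : R, 0 <= K & forall v, v = Q * v * Q -> opn v <= K * opn (adc z v).
Proof.
move=> s0 zs gQ g'Q H1 H2; have [K K0 HK] := telescope_bound z N.
exists (2 * K) => [|v vQ]; first by rewrite mulr_ge0.
have h : opn (z ^+ N *: (g' ^+ N * v * g ^+ N)) <= 2^-1 * opn v.
 have e : g' ^+ N * v * g ^+ N = (g' ^+ N * Q) * v * (g ^+ N * Q).
 by rewrite {1}vQ -!mulrA (commrX N (commr_sym gQ)).
 have sN : 0 <= s ^+ N by rewrite exprn_ge0// ltW.
 have hn : opn (g' ^+ N * v * g ^+ N) <= 2^-1 * s ^+ N * opn v * (2^-1 * s ^+ N).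
 rewrite e; apply: opnM_le; apply: ler_pM; rewrite ?opn_ge0//.
 apply: opnM_le; by rewrite ler_wpM2r ?opn_ge0.
 rewrite opnZ ncX; apply: le_trans (ler_wpM2l (exprn_ge0 _ (nc_ge0 z)) hn) _.
 have -> : nc z ^+ N * (2^-1 * s ^+ N * opn v * (2^-1 * s ^+ N)) = (nc z * s ^+ 2) ^+ N * (4^-1 * opn v).
 rewrite expr2 !exprMn; have -> : (4^-1 : R) = 2^-1 * 2^-1 by field.
 ring.
 have : (nc z * s ^+ 2) ^+ N <= 1 by apply: exprn_ile1 => //; rewrite mulr_ge0 ?nc_ge0 ?exprn_ge0// ltW.
 have := opn_ge0 v; set u := _ ^+ N; set w := opn v => w0 u1.
 have : u * (4^-1 * w) <= 1 * (4^-1 * w) by rewrite ler_wpM2r// mulr_ge0// invr_ge0.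
 lra.
have h2 := HK v; have := opnB_ge v (z ^+ N *: (g' ^+ N * v * g ^+ N)); lra.
Qed.
(** The parameters at which a root in [L] resonates with the spectrum of [g]. A zero root causes no
    resonance since [g] is invertible. *)
Definition bad L z := z != 0 /\ exists lam, [/\ lam \in L, lam != 0 &
 (lam / z = 1 \/ eigenval g (lam / z)) \/ (z * lam = 1 \/ eigenval g (z * lam))].

Lemma bad_countable L : countable (bad L).
Proof.
pose S := [set (1 : R[i])] `|` [set z | eigenval (1 *: idb + k) z].
have cS : countable S.
 apply: setU_countable; first by apply: finite_set_countable; exact: finite_set1.
 exact: eigenval_countable.
pose F lam : set R[i] := ((fun m => lam / m) @` S) `|` ((fun m => m / lam) @` S).
apply: (@sub_countable _ _ _ (\bigcup_(lam in [set` L]) F lam)); last first.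
 apply: bigcup_countable; first by apply: finite_set_countable; exact: finite_seq.
 by move=> lam _; apply: setU_countable; exact: image_countable.
apply: subset_card_le => z [z0 [lam [lL l0 H]]]; exists lam => //; case: H => H.
 left; exists (lam / z); first by case: H => H; [left|right; rewrite /= scale1r].
 by rewrite invf_div mulrCA mulfV// mulr1.
right; exists (z * lam); first by case: H => H; [left|right; rewrite /= scale1r].
by rewrite mulfK.
Qed.
Lemma resolvent_g (m : R[i]) : m <> 1 -> ~ eigenval g m -> exists b, binv (g - m *: idb) b.
Proof.
move=> m1 Hm; have [->|m0] := eqVneq m 0; first by exists g'; rewrite scale0r subr0.
have [||b Hb] := @cpt_resolvent_ex R E k 1 m^-1 ck.
- by rewrite mulr1 invr_eq1; apply/eqP.
- by right; rewrite invrK scale1r.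
rewrite scale1r in Hb; have e : g - m *: idb = (- m) *: (1 - m^-1 *: g).
 by rewrite scalerBr scalerA mulNr mulfV// scaleN1r scaleNr opprK addrC.
case: Hb => b1 b2; exists ((- m)^-1 *: b); rewrite e; split.
 by rewrite -scAl -scAr scalerA mulfV ?oppr_eq0// scale1r.
by rewrite -scAl -scAr scalerA mulVf ?oppr_eq0// scale1r.
Qed.
Definition aprod L (a : bop E) : bop E := foldr (fun lam b => b * (a - lam *: idb)) 1 L.

(** Induction on the roots: [u' = (g - lam *: idb) * u] satisfies the shorter equation, and
    [u * (z *: g - lam *: idb)] equals [u'] minus the defect [g * u - z *: (u * g)], with an
    invertible factor for the admissible [z]. *)
Lemma left_bound L z : z != 0 -> (forall lam, lam \in L -> lam != 0 -> lam / z <> 1 /\ ~ eigenval g (lam / z)) ->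
 exists2 K : R, 0 <= K & forall u, aprod L g * u = 0 -> opn u <= K * opn (g * u - z *: (u * g)).
Proof.
move=> z0; elim: L => [|lam L IH] H; first by exists 0 => // u; rewrite mul1r => ->; rewrite opn0 mul0r.
have [|K K0 HK] := IH; first by move=> l lL; apply: H; rewrite inE lL orbT.
have [b [b1 b2]] : exists b, binv (z *: g - lam *: idb) b.
 have [b [b1 b2]] : exists b, binv (g - (lam / z) *: idb) b.
 have [l0|l0] := eqVneq lam 0.
 by exists g'; rewrite l0 mul0r scale0r subr0.
 by have [h1 h2] := H lam (mem_head _ _) l0; exact: resolvent_g.
 exists (z^-1 *: b); have -> : z *: g - lam *: idb = z *: (g - (lam / z) *: idb).
 by rewrite scalerBr scalerA mulrCA mulfV// mulr1.
 by split; rewrite -scAl -scAr scalerA ?mulfV ?mulVf// scale1r.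
exists ((K * opn (g - lam *: idb) + 1) * opn b) => [|u Hu].
 by rewrite mulr_ge0 ?opn_ge0// addr_ge0// mulr_ge0 ?opn_ge0.
set f := g * u - _; pose u' := (g - lam *: idb) * u.
have Hu' : aprod L g * u' = 0 by rewrite mulrA.
have gl : (g - lam *: idb) * g = g * (g - lam *: idb).
 by rewrite mulrBl mulrBr -scAl -scAr mul1r mulr1.
have h1 : opn u' <= K * (opn (g - lam *: idb) * opn f).
 apply: le_trans (HK u' Hu') _; rewrite ler_wpM2l//.
 have -> : g * u' - z *: (u' * g) = (g - lam *: idb) * f; last exact: opnM.
 by rewrite /f mulrBr mulrA -gl -scAr !mulrA.
have h2 : u = (u' - f) * b.
 have -> : u' - f = u * (z *: g - lam *: idb).
 rewrite /f /u' mulrBl mulrBr -scAl mul1r -!scAr mulr1 opprB.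
 by rewrite addrC addrA subrK.
 by rewrite -mulrA b1 mulr1.
rewrite h2; apply: opnM_le; rewrite mulrAC ler_wpM2r ?opn_ge0//.
apply: le_trans (opnB_le _ _) _; rewrite mulrDl mul1r lerD// -mulrA//.
Qed.
Lemma right_bound L z : z != 0 -> (forall lam, lam \in L -> lam != 0 -> z * lam <> 1 /\ ~ eigenval g (z * lam)) ->
 exists2 K : R, 0 <= K & forall u, u * aprod L g = 0 -> opn u <= K * opn (g * u - z *: (u * g)).
Proof.
move=> z0; elim: L => [|lam L IH] H; first by exists 0 => // u; rewrite mulr1 => ->; rewrite opn0 mul0r.
have [|K K0 HK] := IH; first by move=> l lL; apply: H; rewrite inE lL orbT.
have [b [b1 b2]] : exists b, binv (g - (z * lam) *: idb) b.
 have [l0|l0] := eqVneq lam 0; first by exists g'; rewrite l0 mulr0 scale0r subr0.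
 by have [h1 h2] := H lam (mem_head _ _) l0; exact: resolvent_g.
exists (opn b * (nc z * K * opn (g - lam *: idb) + 1)) => [|u Hu].
 by rewrite mulr_ge0 ?opn_ge0// addr_ge0// !mulr_ge0 ?nc_ge0 ?opn_ge0.
set f := g * u - _; pose u' := u * (g - lam *: idb).
have gl : (g - lam *: idb) * g = g * (g - lam *: idb).
 by rewrite mulrBl mulrBr -scAl -scAr mul1r mulr1.
have Hu' : u' * aprod L g = 0.
 have cm : (g - lam *: idb) * aprod L g = aprod L g * (g - lam *: idb).
 elim: (L) => [|l L' IHL] /=; first by rewrite mul1r mulr1.
 rewrite mulrA IHL -!mulrA; congr (_ * _).
 by rewrite mulrBr gl -scAr mulr1 mulrBl -scAl mul1r.
 by rewrite /u' -mulrA cm.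
have h1 : opn u' <= K * (opn (g - lam *: idb) * opn f).
 apply: le_trans (HK u' Hu') _; rewrite ler_wpM2l// mulrC.
 have -> : g * u' - z *: (u' * g) = f * (g - lam *: idb); last exact: opnM.
 by rewrite /f mulrBl !mulrA -scAl -!mulrA gl.
have h2 : u = b * (z *: u' + f).
 have -> : z *: u' + f = (g - (z * lam) *: idb) * u.
 rewrite /f /u' mulrBr scalerBr -scAr mulr1 scalerA mulrBl -scAl mul1r.
 by rewrite addrC addrA subrK.
 by rewrite mulrA b2 mul1r.
rewrite {1}h2; apply: opnM_le; rewrite -mulrA ler_wpM2l ?opn_ge0//.
apply: le_trans (opnD _ _) _; rewrite mulrDl mul1r lerD// opnZ -!mulrA ler_wpM2l ?nc_ge0//.
Qed.
(** With [P = 1 - Q], decompose [x] into [Q * x * Q], [P * x] and [Q * x * P]. Slow growth handles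
    the first term; the other two are annihilated by the polynomial [aprod L g] from one side. *)
Lemma adc_lower L (s : R) Q N z : 0 < s -> nc z * s ^+ 2 <= 1 -> Q * Q = Q -> GRing.comm g Q -> GRing.comm g' Q ->
 opn (g ^+ N * Q) <= 2^-1 * s ^+ N -> opn (g' ^+ N * Q) <= 2^-1 * s ^+ N ->
 aprod L g * (1 - Q) = 0 -> z != 0 -> ~ bad L z ->
 exists2 d : R, 0 < d & forall x, d * opn x <= opn (adc z x).
Proof.
move=> s0 zs QQ gQ g'Q H1 H2 HL z0 nb.
have [K1 K10 HK1] := middle_bound s0 zs gQ g'Q H1 H2.
have [|K2 K20 HK2] := @left_bound L z z0.
 by move=> l lL l0; split=> h; apply: nb; split=> //; exists l; split=> //; left; [left|right].
have [|K3 K30 HK3] := @right_bound L z z0.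
 by move=> l lL l0; split=> h; apply: nb; split=> //; exists l; split=> //; right; [left|right].
have gP : g * (1 - Q) = (1 - Q) * g by rewrite mulrBr mulrBl mulr1 mul1r gQ.
have PL : (1 - Q) * aprod L g = 0.
 rewrite -HL; elim: (L) => [|l L' IH] /=; first by rewrite mul1r mulr1.
 rewrite mulrA IH -!mulrA; congr (_ * _).
 by rewrite (mulrBr (1 - Q)) (mulrBl (1 - Q)) gP -scAr -scAl mulr1 mul1r.
have Afl x : g * x - z *: (x * g) = g * adc z x.
 by rewrite /adc mulrBr -scAr !mulrA gg' mul1r.
pose P := 1 - Q; pose D := K1 * (opn Q * opn Q) + K2 * (opn P * opn g) + K3 * (opn Q * opn g * opn P).
have D0 : 0 <= D by rewrite !addr_ge0// !mulr_ge0 ?opn_ge0.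
have HD x : opn x <= D * opn (adc z x).
 set f := adc z x; have f0 := opn_ge0 f.
 have e : x = Q * x * Q + P * x + Q * x * P.
 have QP : Q + P = 1 by rewrite /P addrC subrK.
 by rewrite addrAC -mulrDr QP mulr1 -mulrDl QP mul1r.
 have b1 : opn (Q * x * Q) <= K1 * (opn Q * opn f * opn Q).
 apply: le_trans (HK1 _ _) _; first by rewrite !mulrA QQ -!mulrA QQ.
 rewrite ler_wpM2l//; have -> : adc z (Q * x * Q) = Q * f * Q.
 rewrite /f /adc mulrBr mulrBl -scAr -scAl !mulrA (g'Q : g' * Q = Q * g'); congr (_ - _ *: _).
 by rewrite -!mulrA (gQ : g * Q = Q * g).
 apply: opnM_le; by rewrite ler_wpM2r ?opn_ge0// opnM.
 have b2 : opn (P * x) <= K2 * (opn P * (opn g * opn f)).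
 apply: le_trans (HK2 _ _) _; first by rewrite mulrA HL mul0r.
 rewrite ler_wpM2l//; have -> : g * (P * x) - z *: (P * x * g) = P * (g * f).
 by rewrite -Afl mulrBr -scAr !mulrA gP.
 apply: opnM_le; by rewrite ler_wpM2l ?opn_ge0// opnM.
 have b3 : opn (Q * x * P) <= K3 * (opn Q * (opn g * opn f) * opn P).
 apply: le_trans (HK3 _ _) _; first by rewrite -mulrA PL mulr0.
 rewrite ler_wpM2l//; have -> : g * (Q * x * P) - z *: (Q * x * P * g) = Q * (g * f) * P.
 rewrite -Afl (mulrBr Q) (mulrBl P) -scAr -scAl !mulrA (gQ : g * Q = Q * g); congr (_ - _ *: _).
 by rewrite -!mulrA -[g * P]/(g * (1 - Q)) gP.
 apply: opnM_le; rewrite ler_wpM2r ?opn_ge0//.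
 apply: opnM_le; by rewrite ler_wpM2l ?opn_ge0// opnM.
 rewrite {1}e; apply: le_trans (opnD _ _) _; apply: le_trans (lerD (opnD _ _) (lexx _)) _.
 apply: le_trans (lerD (lerD b1 b2) b3) _; rewrite /D.
 by rewrite le_eqVlt; apply/orP; left; apply/eqP; ring.
exists (D + 1)^-1 => [|x]; first by rewrite invr_gt0; lra.
rewrite ler_pdivrMl; last by lra.
by apply: le_trans (HD x) _; rewrite ler_wpM2r ?opn_ge0//; lra.
Qed.
(** [g] acts on the range of [P], which has finite dimension; the roots of the characteristic
    polynomial of this action serve, by Cayley-Hamilton. *)
Lemma finite_annihilator P : P * P = P -> cpt P -> GRing.comm g P -> exists L, aprod L g * P = 0.
Proof.
move=> PP cP gP; have [r [e fb]] := cpt_idem_basis PP cP.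
pose B := mxof e g; have gB c : g (comb e c) = comb e (c *m B).
 by apply: (mxofP fb) => _ [y _ <-]; exists (g y) => //; rewrite -!mulbE gP.
have [L HL] : exists L : seq R[i], forall c : 'rV[R[i]]_r, foldr (fun lam c => c *m (B - lam%:M)) c L = 0.
 case: r e fb B gB => [|r] e fb B gB.
 by exists [::] => c; apply/rowP; case.
 have [L HL] := closed_field_poly_normal (char_poly B : {poly R[i]}).
 exists L => c.
 have -> : foldr (fun lam c => c *m (B - lam%:M)) c L = c *m horner_mx B (\prod_(z <- L) ('X - z%:P)).
 elim: {HL} L => [|l L IH]; first by rewrite big_nil rmorph1 mulmx1.
 have e1 : B - l%:M = horner_mx B ('X - l%:P) by rewrite rmorphB /= horner_mx_X horner_mx_C.
 by rewrite big_cons [LHS]/= IH e1 -mulmxA [_ * \prod_(_ <- _) _]mulrC rmorphM.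
 have := Cayley_Hamilton B; rewrite HL (monicP (char_poly_monic B)) scale1r => ->.
 by rewrite mulmx0.
have key L' c : aprod L' g (comb e c) = comb e (foldr (fun lam c => c *m (B - lam%:M)) c (rev L')).
 elim: L' c => [|l L' IH] c; first by [].
 rewrite -[aprod (l :: L') g]/(aprod L' g * (g - l *: idb)) mulbE rev_cons foldr_rcons -IH; congr (aprod _ _ _).
 rewrite subbE scalebE onebE gB mulmxBr mul_mx_scalar combB combZ//.
exists (rev L); apply: bop_eq => x; rewrite mulbE zerobE.
have [|c <-] := comb_fbasis fb (x := P x); first by exists x.
by rewrite key revK HL comb0.
Qed.
End Conjugation.

(** * Finite rank operators and two-sided multiplications *)

Section ZeroSubspace.
Variables (R : realType) (E : banach R).
Definition finrk (a : bop E) := exists r (e : 'I_r -> E), forall x, cspan e (a x).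
Lemma finrkMr a b : finrk a -> finrk (a * b).
Proof. by move=> [r [e H]]; exists r, e => x; exact: H. Qed.
Lemma finrkMl a b : finrk b -> finrk (a * b).
Proof.
move=> [r [e H]]; exists r, (fun i => a (e i)) => x; have [c _ Hc] := H x.
exists c => //; rewrite mulbE -Hc /comb bop_sum; apply: eq_bigr => i _; by rewrite bopZ.
Qed.
Lemma finrkD a b : finrk a -> finrk b -> finrk (a + b).
Proof.
move=> [r [e H]] [s [f H']]; pose h (i : 'I_(r + s)) := match fintype.split i with inl j => e j | inr j => f j end.
have hs := cspan_subsp h; exists (r + s)%N, h => x; rewrite addbE; apply: (ssD hs).
- have : cspan e `<=` cspan h; last by apply.
 apply: cspan_min => // i; have -> : e i = h (lshift s i) by rewrite /h (unsplitK (inl i)).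
 exact: cspan_mem.
- have : cspan f `<=` cspan h; last by apply.
 apply: cspan_min => // i; have -> : f i = h (rshift r i) by rewrite /h (unsplitK (inr i)).
 exact: cspan_mem.
Qed.
Lemma cpt_idem_finrk P : P * P = P -> cpt P -> finrk P.
Proof.
move=> PP cP; have [r [e [We _]]] := cpt_idem_basis PP cP.
by exists r, e => x; rewrite -We; exists x.
Qed.
Lemma conj_op_lin (a b : bop E) (c : R[i]) (x y : BL E) : (a * (c *: x + y : bop E) * b : BL E) = c *: (a * x * b : BL E) + (a * y * b : BL E).
Proof. by rewrite mulrDr mulrDl -scAr -scAl. Qed.
Lemma conj_op_bd (a b : bop E) : exists M : R, forall x : BL E, bn (a * x * b : BL E) <= M * bn x.
Proof.
exists (opn a * opn b) => x; apply: opnM_le; rewrite mulrAC ler_wpM2r ?opn_ge0//.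
exact: opnM.
Qed.
Definition conj_op (a b : bop E) : bop (BL E) := Bop (conj_op_lin a b) (conj_op_bd a b).
End ZeroSubspace.

(** * Continuation of invertibility along paths *)

Section Continuation.
Variable R : realType.
Lemma interval_induction (P : R -> Prop) : P 0 ->
 (forall t, 0 <= t -> t <= 1 -> exists2 e : R, 0 < e & forall t1 t2, 0 <= t1 -> t1 <= 1 -> 0 <= t2 -> t2 <= 1 ->
 `|t1 - t| < e -> `|t2 - t| < e -> P t1 -> P t2) -> P 1.
Proof.
move=> P0 H; pose S : set R := [set t | 0 <= t /\ t <= 1 /\ P t].
have hS : has_sup S by split; [exists 0; rewrite /S /= lexx ler01|exists 1 => t [_ []]].
pose s := sup S; have s0 : 0 <= s by apply: sup_upper_bound => //; rewrite /S /= lexx ler01.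
have s1 : s <= 1 by apply: ge_sup; [exact: hS.1|move=> t [_ []]].
have [e e0 He] := H s s0 s1.
have [t [t0 [t1 Pt]] ts] := sup_adherent e0 hS.
have tls : t <= s by apply: sup_upper_bound.
have d : `|t - s| < e by rewrite ltr_norml; rewrite -/s in ts; apply/andP; split; lra.
have [h|h] := leP (1 - s) (e / 2).
 by apply: (He t 1) => //; rewrite ltr_norml; apply/andP; split; lra.
have Pn : P (s + e / 2).
 by apply: (He t) => //; try lra; rewrite ltr_norml; apply/andP; split; lra.
have : s + e / 2 <= s by apply: sup_upper_bound => //; rewrite /S /=; split; [lra|split=> //; lra].
lra.
Qed.

Variables (F : banach R) (T : bop F).
Local Notation C := R[i].
(** A lower bound [d] at [t] persists nearby with a factor 1/2 and bounds any inverse there by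
    [2 / d]. Invertibility therefore spreads over a neighbourhood whose size depends on [t]
    alone. *)
Lemma path_inverse (f : R -> C) (K : R) : 0 <= K -> (forall t t', nc (f t - f t') <= K * `|t - t'|) ->
 (forall t, 0 <= t -> t <= 1 -> exists2 d : R, 0 < d & forall q, d * bn q <= bn ((1 - f t *: T) q)) ->
 (exists b, binv (1 - f 0 *: T) b) -> exists b, binv (1 - f 1 *: T) b.
Proof.
move=> K0 Hf Hd H0; apply: (interval_induction (P := fun t => exists b, binv (1 - f t *: T) b)) => // t t0 t1.
have [d d0 Hdt] := Hd t t0 t1; have T0 := opn_ge0 T.
have p : 0 < K * opn T + 1 by rewrite ltr_wpDl// mulr_ge0.
exists (d / 8 / (K * opn T + 1)) => [|t1' t2 _ _ _ _ h1 h2 [b Hb]]; first by rewrite !divr_gt0.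
have diff t' : `|t' - t| < d / 8 / (K * opn T + 1) -> opn ((f t' - f t) *: T) <= d / 8.
 rewrite ltr_pdivlMr// => h; rewrite opnZ; have := Hf t' t; have := normr_ge0 (t' - t).
 move: h; set u := `|_|; set v := nc _ => h u0 hv.
 have : v * opn T <= K * u * opn T by rewrite ler_wpM2r.
 lra.
have low q : d / 2 * bn q <= bn ((1 - f t1' *: T) q).
 have e1 : (1 - f t1' *: T) q = (1 - f t *: T) q - ((f t1' - f t) *: T) q.
 by rewrite -subbE; congr (_ q); rewrite scalerBl opprB addrA subrK.
 have h3 := opnPM q (diff _ h1); have h4 := bnB_ge ((1 - f t *: T) q) (((f t1' - f t) *: T) q).
 rewrite -e1 in h4; have := Hdt q; have := mulr_ge0 (ltW d0) (bn_ge0 q); lra.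
have bb : opn b <= 2 / d.
 apply: opn_le => [|q]; first by rewrite divr_ge0// ltW.
 have e2 : (1 - f t1' *: T) (b q) = q by rewrite -[LHS]/(((1 - f t1' *: T) * b) q) Hb.1.
 have := low (b q); rewrite e2 => h.
 rewrite mulrAC ler_pdivlMr//; lra.
have [|b' Hb' _] := binv_perturb Hb bb (a' := 1 - f t2 *: T); last by exists b'.
have -> : 1 - f t1' *: T - (1 - f t2 *: T) = (f t2 - f t) *: T - (f t1' - f t) *: T.
 rewrite -scalerBl opprB addrC addrA subrK -scalerBl; congr (_ *: _).
 by rewrite opprB addrA subrK.
have h3 := opnB_le ((f t2 - f t) *: T) ((f t1' - f t) *: T).
have h4 : opn ((f t2 - f t) *: T - (f t1' - f t) *: T) <= d / 4.
 have := diff _ h1; have := diff _ h2; lra.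
apply: le_trans (ler_wpM2l (_ : 0 <= 2 / d) h4) _; first by rewrite divr_ge0// ltW.
have -> : 2 / d * (d / 4) = 2^-1 by field; rewrite gt_eqF.
by [].
Qed.
(* Almost all broken lines [0 -> z (1/2 + i t) -> z] avoid a given countable set. *)
Lemma countable_detour (B : set C) (z : C) (rho : R) : countable B -> z != 0 -> nc z <= rho -> ~ B z ->
 (forall w, nc w <= rho -> (w = 0 \/ ~ B w) -> exists2 d : R, 0 < d & forall q, d * bn q <= bn ((1 - w *: T) q)) ->
 exists b, binv (1 - z *: T) b.
Proof.
move=> cB z0 zr nBz low.
(* For [w] on the broken line of parameter [t], other than its end points, [tt (w / z)] equals [t];
   so each point of [B] spoils at most one line. *)
pose tt (w : C) : R := complex.Im w / (2 * Num.min (complex.Re w) (1 - complex.Re w)).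
pose B' : set R := (fun w => tt (w / z)) @` B.
have cB' : countable B' by exact: image_countable.
have [|t [t0 t1 Ht]] := @avoid_countable R B' 0 2^-1 cB'; first by rewrite invr_gt0.
pose c := z * Complex 2^-1 t.
have nz := nc_ge0 z.
have cle (a b : R) : 0 <= a -> 0 <= b -> a + b <= 1 -> nc (z * Complex a b) <= rho.
 move=> a0 b0 ab; rewrite ncM; apply: le_trans zr; rewrite -[leRHS]mulr1 ler_wpM2l//.
 by apply: le_trans (nc_le_ReIm _) _; rewrite /= !ger0_norm.
have nB (a b : R) : tt (Complex a b) = t -> ~ B (z * Complex a b).
 move=> h Hb; apply: Ht; exists (z * Complex a b) => //.
 by rewrite mulrAC mulfV// mul1r.
have lip (u v : C) : forall s s' : R, nc (u + s%:C%C * v - (u + s'%:C%C * v)) <= nc v * `|s - s'|.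
 move=> s s'; rewrite opprD addrACA subrr add0r -mulrBl ncM -rmorphB nc_real mulrC//.
have step1 : exists b, binv (1 - c *: T) b.
 have := @path_inverse (fun s => 0 + s%:C%C * c) (nc c) (nc_ge0 c) (lip 0 c).
 rewrite !add0r mul1r mul0r; apply; last by exists 1; rewrite scale0r subr0; split; rewrite mulr1.
 move=> s s0 s1; rewrite add0r.
 have e : s%:C%C * c = z * Complex (s / 2) (s * t).
 by rewrite mulrCA; congr (_ * _); apply/eqP; rewrite eq_complex /= !mul0r subr0 addr0 !eqxx.
 rewrite e; apply: low.
 apply: cle; [lra|by rewrite mulr_ge0// ltW|]; have : s * t <= s * 2^-1 by rewrite ler_wpM2l// ltW.
 lra.
 have [->|sn0] := eqVneq s 0.
 by left; apply/eqP; rewrite !mul0r mulf_eq0; apply/orP; right; rewrite eq_complex /= !eqxx.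
 right; apply: nB; rewrite /tt /= min_l; last by lra.
 by field; rewrite sn0.
have := @path_inverse (fun s => c + s%:C%C * (z - c)) (nc (z - c)) (nc_ge0 _) (lip c (z - c)).
rewrite mul1r mul0r addr0 [c + (z - c)]addrC subrK; apply; last exact: step1.
move=> s s0 s1.
have e : c + s%:C%C * (z - c) = z * Complex ((1 + s) / 2) ((1 - s) * t).
 have -> : c + s%:C%C * (z - c) = z * (Complex 2^-1 t + s%:C%C * (1 - Complex 2^-1 t)).
 by rewrite /c; ring.
 congr (_ * _); apply/eqP; rewrite eq_complex /=; apply/andP; split; apply/eqP; by field.
rewrite e; apply: low.
 apply: cle; [lra|by rewrite mulr_ge0 ?subr_ge0// ltW|].
 have : (1 - s) * t <= (1 - s) * 2^-1 by rewrite ler_wpM2l ?subr_ge0// ltW.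
 lra.
have [->|sn1] := eqVneq s 1.
 right; have -> : Complex ((1 + 1) / 2) ((1 - 1) * t) = 1 :> C.
 by apply/eqP; rewrite eq_complex /= subrr mul0r eqxx andbT; apply/eqP; field.
 by rewrite mulr1.
right; apply: nB; rewrite /tt /= min_r; last by lra.
have -> : 2 * (1 - (1 + s) / 2) = 1 - s :> R by field.
by rewrite mulrAC mulfV ?mul1r// subr_eq0 eq_sym.
Qed.
End Continuation.

(** * Growth of conjugation and invariant spectral subspaces *)

Section ConjugationGrowth.
Variables (R : realType) (E : banach R) (k k' : bop E).
Hypotheses (ck : cpt k) (ck' : cpt k').
Local Notation g := (1 + k).
Local Notation g' := (1 + k').
Hypotheses (gg' : g * g' = 1) (g'g : g' * g = 1).
Variable CL : set (BL E).
Hypotheses (sCL : subsp CL) (cCL : closd CL).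
Hypotheses (CL1 : forall x : bop E, CL x -> CL (g' * x * g)) (CL2 : forall x : bop E, CL x -> CL (g * x * g')).
Hypothesis nofin : forall x : bop E, CL x -> finrk x -> x = 0.

Let s0 := set0_subsp (BL E).
Let ZY := set0_sub sCL.

(** Conjugation expands on the kernel of [P], so the backward iterates of [y] decay. Together with
    the bounds for the powers of [g] and [g'] on [Q] and with [rho * s ^+ 2 <= 1] this gives
    [Q * y * Q = 0]. As [1 - Q] has finite rank so has [y], and [nofin] applies. *)
Lemma split_trivial (Q0 : banach R) (p : BL E -> Q0) (pP : subquo CL [set 0] p) (rho K s : R) r P Q N :
 let T := induced sCL s0 ZY pP (conj_op g' g) in
 0 < rho -> resolves T rho K r -> is_split T rho P -> 0 < s -> rho * s ^+ 2 <= 1 ->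
 Q * Q = Q -> GRing.comm g Q -> GRing.comm g' Q -> cpt (1 - Q) -> (0 < N)%N ->
 opn (g ^+ N * Q) <= 2^-1 * s ^+ N -> opn (g' ^+ N * Q) <= 2^-1 * s ^+ N -> P = 1.
Proof.
move=> T r0 Hr HP sp rs QQ gQ g'Q cQ N0 H1 H2.
pose T1 := induced sCL s0 ZY pP (conj_op g g').
have iso := subquo0_iso pP.
have st : stab CL [set 0] (conj_op g' g) by split=> [x|_ ->]; [exact: CL1|rewrite /= mulr0 mul0r].
have st1 : stab CL [set 0] (conj_op g g') by split=> [x|_ ->]; [exact: CL2|rewrite /= mulr0 mul0r].
have TT1 : T * T1 = 1.
 rewrite -inducedM// -(induced1 sCL s0 ZY pP); congr induced; apply: bop_eq => x.
 by rewrite /= !mulrA g'g mul1r -mulrA g'g mulr1.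
have T1T : T1 * T = 1.
 rewrite -inducedM// -(induced1 sCL s0 ZY pP); congr induced; apply: bop_eq => x.
 by rewrite /= !mulrA gg' mul1r -mulrA gg' mulr1.
have Pi := split_idem (ltW r0) Hr HP.
have T1P : GRing.comm T1 P by apply: (split_comm HP); rewrite /GRing.comm TT1 T1T.
apply/eqP; rewrite eq_sym -subr_eq0; apply/eqP; apply: bop_eq => q.
set q0 := (1 - P) q; have Pq0 : P q0 = 0 by rewrite -mulbE mulrBr mulr1 Pi subrr.
have [y Yy yq] := sq_onto pP q0.
have [j _ Hj] := split_expand HP 0.
pose M := (2 ^ j)%N.
pose u n := (T1 ^+ n) q0; pose yy n : bop E := g ^+ n * y * g' ^+ n.
have Yyy n : CL (yy n).
 elim: n => [|n IH]; first by rewrite /yy !expr0 mul1r mulr1.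
 by have := CL2 IH; rewrite /yy !mulrA -exprS -!mulrA -exprSr.
have uy n : u n = p (yy n).
 elim: n => [|n IH]; first by rewrite /u /yy !expr0 mul1r mulr1 onebE yq.
 rewrite /u expbSE -/(u n) IH inducedE//; congr p.
 by rewrite /yy /= !mulrA -exprS -!mulrA -exprSr.
have Pu n : P (u n) = 0.
 by rewrite /u -mulbE (commrX n (commr_sym T1P)) mulbE Pq0 bop0.
have ug m : bn (u (M * m)%N) <= rho ^+ (M * m) * 2^-1 ^+ m * bn q0.
 elim: m => [|m IH]; first by rewrite muln0 !expr0 !mul1r /u expr0 onebE.
 have := Hj (u (M * m.+1)%N) (Pu _); rewrite -/M scaleb_pow scalebE bnZ ncX nc_pos ?(ltW r0)//.
 have -> : (T ^+ M) (u (M * m.+1)%N) = u (M * m)%N.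
 have TX n x : (T ^+ n) ((T1 ^+ n) x) = x.
 elim: n x => [|n IHn] x; first by rewrite !expr0 !onebE.
 by rewrite exprSr mulbE expbSE -[T (T1 _)]mulbE TT1 onebE IHn.
 by rewrite /u mulnS exprD mulbE TX.
 move=> h; rewrite [rho ^+ _](_ : _ = rho ^+ M * rho ^+ (M * m)); last by rewrite mulnS exprD.
 rewrite [2^-1 ^+ m.+1]exprS.
 have rM : 0 <= rho ^+ M by rewrite exprn_ge0// ltW.
 have := ler_wpM2l rM IH; set A := rho ^+ (M * m) in IH *; set B := 2^-1 ^+ m in IH *.
 move: h; set b1 := bn _; set b2 := bn _ in IH *; set b3 := bn q0; set D := rho ^+ M in rM *.
 move=> h h'; have -> : D * A * (2^-1 * B) * b3 = 2^-1 * (D * (A * B * b3)) by ring.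
 lra.
have powQ (a : bop E) : GRing.comm a Q -> opn (a ^+ N * Q) <= 2^-1 * s ^+ N -> forall m, opn (a ^+ (N * m) * Q) <= opn Q * s ^+ (N * m).
 move=> aQ H; elim=> [|m IH]; first by rewrite muln0 !expr0 mul1r mulr1.
 have -> : a ^+ (N * m.+1) * Q = (a ^+ N * Q) * (a ^+ (N * m) * Q).
 by rewrite mulnS exprD -!mulrA; congr (_ * _); rewrite mulrA (commrX _ (commr_sym aQ)) -mulrA QQ.
 apply: opnM_le; rewrite mulnS exprD mulrCA; apply: ler_pM; rewrite ?opn_ge0//.
 by apply: le_trans H _; rewrite ler_piMl ?exprn_ge0 ?(ltW sp)// invf_le1// ler1n.
have sm m : opn (Q * y * Q) <= opn Q * opn Q * 2^-1 ^+ (N * m) * bn q0.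
 pose n := (M * (N * m))%N.
 have e : Q * y * Q = (g' ^+ n * Q) * yy n * (g ^+ n * Q).
 have cX (a b : bop E) l : a * b = 1 -> b * a = 1 -> a ^+ l * b ^+ l = 1.
 move=> ab ba; elim: l => [|l IH]; first by rewrite !expr0 mul1r.
 by rewrite exprSr exprS -mulrA (mulrA a) ab mul1r.
 have c1 := cX _ _ n g'g gg'; rewrite /yy -(commrX n (commr_sym g'Q)).
 transitivity (Q * (g' ^+ n * g ^+ n) * y * (g' ^+ n * g ^+ n) * Q); first by rewrite c1 !mulr1.
 by rewrite !mulrA.
 have sn : 0 <= s ^+ n by rewrite exprn_ge0// ltW.
 have nE : n = (N * (M * m))%N by rewrite /n mulnCA.
 have h1 := powQ g gQ H1 (M * m)%N; have h2 := powQ g' g'Q H2 (M * m)%N; rewrite -nE in h1 h2.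
 have h3 : opn (yy n) <= rho ^+ n * 2^-1 ^+ (N * m) * bn q0.
 by have := ug (N * m)%N; rewrite -/n uy [bn (p _)]iso.
 rewrite e; apply: (@le_trans _ _ (opn Q * s ^+ n * (rho ^+ n * 2^-1 ^+ (N * m) * bn q0) * (opn Q * s ^+ n))).
 apply: opnM_le; apply: ler_pM; rewrite ?opn_ge0//.
 by apply: opnM_le; apply: ler_pM; rewrite ?opn_ge0.
 have -> : opn Q * s ^+ n * (rho ^+ n * 2^-1 ^+ (N * m) * bn q0) * (opn Q * s ^+ n) =
 (rho * s ^+ 2) ^+ n * (opn Q * opn Q * 2^-1 ^+ (N * m) * bn q0).
 by rewrite expr2 !exprMn; ring.
 rewrite -[leRHS]mul1r ler_wpM2r ?mulr_ge0 ?opn_ge0 ?bn_ge0 ?exprn_ge0 ?invr_ge0//.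
 by apply: exprn_ile1 => //; rewrite mulr_ge0 ?exprn_ge0// ltW.
have QyQ : Q * y * Q = 0.
 apply: opn_small => e e0; have p0 : 0 <= opn Q * opn Q * bn q0 by rewrite !mulr_ge0 ?opn_ge0 ?bn_ge0.
 have e1 : 0 < e / (opn Q * opn Q * bn q0 + 1) by rewrite divr_gt0// ltr_wpDl.
 have [m0 Hm] := @half_small R _ e1.
 have := Hm (N * m0)%N; rewrite leq_pmull// ltr_pdivlMr ?ltr_wpDl// => /(_ isT) h.
 apply: le_trans (sm m0) _; move: h; have : (0 : R) <= 2^-1 ^+ (N * m0) by rewrite exprn_ge0 ?invr_ge0.
 move: p0; set a := opn Q; set b := bn q0; set t := 2^-1 ^+ _; lra.
have y0 : (y : bop E) = 0.
 apply: nofin => //; have -> : (y : bop E) = (1 - Q) * y + Q * y * (1 - Q).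
 by rewrite mulrBl mul1r mulrBr mulr1 QyQ subr0 subrK.
 have iP : (1 - Q) * (1 - Q) = 1 - Q by rewrite mulrBr mulr1 mulrBl mul1r QQ subrr subr0.
 have fP := cpt_idem_finrk iP cQ.
 by apply: finrkD; [exact: finrkMr|exact: finrkMl].
by rewrite -yq y0 (sq0 sCL s0 pP).
Qed.
(** Outside a countable set of [z] the operator [1 - z Ad] is bounded below, which does not yet make
    it onto; invertibility is carried from [z = 0] along a path avoiding that set. The spectral
    projection is then 1 by [split_trivial], so the rescaled powers are bounded on all of [CL]. *)
Lemma conj_growth (e : R) : 0 < e -> exists2 K : R, 0 <= K &
 forall n (x : bop E), CL x -> opn (g' ^+ n * x * g ^+ n) <= K * (1 + e) ^+ n * opn x.
Proof.
(* From [s < 1 + h] follows [s ^+ 2 <= 1 + 3 * h], which leaves room for a radius [R1] between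
   [1 + 3 * h] and [1 + 4 * h <= 1 + e]. *)
move=> e0; pose h : R := Num.min e 1 / 4.
have h0 : 0 < h by rewrite /h divr_gt0// lt_min e0 ltr01.
have he : 4 * h <= e by rewrite /h mulrC mulfVK ?pnatr_eq0// ge_min lexx.
have h1 : 4 * h <= 1 by rewrite /h mulrC mulfVK ?pnatr_eq0// ge_min lexx orbT.
have [|s [s1 s2 Hs]] := @generic_level R E k k' ck ck' 1 (1 + h); first lra.
have sp : 0 < s by lra.
have ss : s ^+ 2 <= 1 + 3 * h by rewrite expr2; nra.
have [Q [N [[QQ gQ g'Q cQ N0] [H1 H2]]]] := two_sided_splitting ck ck' gg' g'g s1 Hs.
have gP : GRing.comm g (1 - Q) by rewrite /GRing.comm mulrBr (mulrBl g) mulr1 mul1r gQ.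
have iP : (1 - Q) * (1 - Q) = 1 - Q by rewrite mulrBr mulr1 mulrBl mul1r QQ subrr subr0.
have [L HL] := finite_annihilator iP cQ gP.
have cB := bad_countable ck L.
pose B' : set R := (fun z => (nc z)^-1) @` bad k L.
have cB' : countable B' by exact: image_countable.
have [|R1 [R1l R1u HR1]] := @avoid_countable R B' (1 + 3 * h) (1 + 4 * h) cB'; first lra.
have R10 : 0 < R1 by lra.
pose rho := R1^-1; have r0 : 0 < rho by rewrite invr_gt0.
have rs : rho * s ^+ 2 <= 1 by rewrite mulrC ler_pdivrMr// mul1r; lra.
have cl0 := @set0_closd R (BL E).
have [Q0 [p pP]] := subquotient sCL cCL s0 cl0 ZY.
have iso := subquo0_iso pP.
have st : stab CL [set 0] (conj_op g' g) by split=> [x|_ ->]; [exact: CL1|rewrite /= mulr0 mul0r].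
pose T := induced sCL s0 ZY pP (conj_op g' g).
have low z : nc z <= rho -> (z = 0 \/ ~ bad k L z) -> exists2 d : R, 0 < d & forall q, d * bn q <= bn ((1 - z *: T) q).
 move=> zr Hz; have [->|z0] := eqVneq z 0.
 by exists 1 => // q; rewrite scale0r subr0 mul1r.
 case: Hz => [z00|nb]; first by rewrite z00 eqxx in z0.
 have zs : nc z * s ^+ 2 <= 1 by apply: le_trans rs; rewrite ler_wpM2r ?exprn_ge0// ltW.
 have [d d0 Hd] := adc_lower ck gg' g'g sp zs QQ gQ g'Q H1 H2 HL z0 nb.
 exists d => // q; have [x Yx <-] := sq_onto pP q; rewrite subbE onebE scalebE inducedE//.
 have Yc := CL1 Yx; rewrite -(sqZ sCL s0 pP)// -(sqB sCL s0 pP)//; last exact: ssZ.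
 by rewrite !iso//; [exact: Hd|apply: ssB => //; exact: ssZ].
have circ z : nc z = rho -> exists b, binv (1 - z *: T) b.
 move=> zr; have z0 : z != 0 by rewrite -nc_gt0 zr.
 have nb : ~ bad k L z by move=> Bz; apply: HR1; exists z => //; rewrite zr invrK.
 apply: (countable_detour (rho := rho) cB z0 _ nb low); by rewrite zr.
have [K K0 HK] := uniform_resolvent (fun z (hz : nc z = rho) => eq_ind_r (fun t => t <= rho) (lexx _) hz)
 (@circle_closed R rho) circ.
have [r Hr] := resolvent_choice HK.
have [P HP _] := split_ex (ltW r0) Hr.
have P1 : P = 1 := split_trivial r0 Hr HP sp rs QQ gQ g'Q cQ N0 H1 H2.
have [n n0 Hn] := split_contract HP.
have [M M0 HM] : grows_le R1 T.
 apply: (grows_leP R10 n0); apply: opn_le => [|q]; first by rewrite invr_ge0.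
 by apply: Hn; rewrite P1 onebE.
exists M => // m x Yx.
have key : p (g' ^+ m * x * g ^+ m) = (T ^+ m) (p x) /\ CL (g' ^+ m * x * g ^+ m).
 elim: m => [|m [IH1 IH2]]; first by rewrite !expr0 mul1r mulr1.
 have eq : g' ^+ m.+1 * x * g ^+ m.+1 = g' * (g' ^+ m * x * g ^+ m) * g by rewrite exprS exprSr !mulrA.
 by rewrite eq; split; [rewrite expbSE -IH1 inducedE|exact: CL1].
case: key => k1 k2; rewrite -[opn _]/(bn (_ : BL E)) -(iso _ k2) k1 -[opn x]/(bn (x : BL E)) -(iso _ Yx).
apply: le_trans (opnPM _ (HM m)) _; rewrite ler_wpM2r ?bn_ge0// ler_wpM2l//.
by rewrite lerXn2r ?nnegrE ?(ltW R10)//; lra.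
Qed.
(** [W] is the spectral subspace of [g] outside a circle of radius [s < 2], nonzero by the growth of
    the powers. For [y] in [W] write [y] as [g ^+ n] applied to [w]: expansion makes [w] small,
    [P (x y)] lies where [g ^+ n] contracts, and conjugating [x] by [g ^+ n] costs only
    [(1 + e) ^+ n]. Letting [n] grow gives [P (x y) = 0]. *)
Lemma invariant_fin_dim (c : R) : 0 < c -> (forall n, c * 2 ^+ n <= opn (g ^+ n)) ->
 exists W, [/\ subsp W, (exists r (e : 'I_r -> E), fbasis W e), (exists2 x, x != 0 & W x) &
 forall (x : bop E) y, CL x -> W y -> W (x y)].
Proof.
move=> c0 Hc; have [|s [s1 s2 Hs]] := @generic_level R E k k' ck ck' 1 2; first lra.
have sp : 0 < s by lra.
have [P [cm Pi cP [N N0 HN]]] := dominated_splitting ck s1 (fun z h => (Hs z h).1).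
have iP : (1 - P) * (1 - P) = 1 - P by rewrite mulrBr mulr1 mulrBl mul1r Pi subrr subr0.
have kr x : ran (1 - P) x <-> P x = 0.
 split=> [[y _ <-]|Px]; first by rewrite -mulbE mulrBr mulr1 Pi subrr.
 by exists x => //; rewrite subbE Px subr0.
have g'P : GRing.comm g' P by apply: cm; rewrite /GRing.comm g'g gg'.
exists (ran (1 - P)); split; [exact: ran_subsp|exact: cpt_idem_basis| |].
- apply: contrapT => H.
 have P1 x : P x = x.
 apply/eqP; rewrite eq_sym -subr_eq0 -[_ == _]negbK; apply/negP => h; apply: H.
 by exists (x - P x) => //; exists x => //; rewrite subbE onebE.
 have [M M0 HM] : grows_le s g.
 apply: (grows_leP sp N0); apply: opn_le => [|x]; first by rewrite invr_ge0.
 rewrite scaleb_pow scalebE bnZ ncX nc_pos ?invr_ge0 ?(ltW sp)// exprVn ler_pdivrMl ?exprn_gt0//.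
 by apply: le_trans ((HN x).1 (P1 x)) _; rewrite mulrCA mulrA.
 have M1 : 0 < c / (M + 1) by rewrite divr_gt0//; lra.
 have [n Hn] := @expr_small R (s / 2) _ ltac:(by rewrite divr_ge0// ltW) ltac:(by rewrite ltr_pdivrMr//; lra) M1.
 have := Hn n (leqnn n); rewrite ltr_pdivlMr; last by lra.
 rewrite expr_div_n mulrAC ltr_pdivrMr ?exprn_gt0// => h.
 have h2 := le_trans (Hc n) (HM n); have : 0 < s ^+ n by rewrite exprn_gt0.
 move: h h2; set a := s ^+ n; set b := 2 ^+ n; lra.
- move=> x y Yx /kr Py; apply/kr; set z := P (x y).
 have [e e0 He] := exists_near_one R N.
 have [K K0 HK] := conj_growth e0.
 have cX (a b : bop E) l : a * b = 1 -> b * a = 1 -> a ^+ l * b ^+ l = 1.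
 move=> ab ba; elim: l => [|l IH]; first by rewrite !expr0 mul1r.
 by rewrite exprSr exprS -mulrA (mulrA a) ab mul1r.
 have g'Pn n : P * g' ^+ n = g' ^+ n * P by exact: (commrX n (commr_sym g'P)).
 have gPn n : P * g ^+ n = g ^+ n * P by apply: (commrX n); apply: commr_sym; exact: cm.
 have expd m v : P v = 0 -> (2 * s ^+ N) ^+ m * bn v <= bn ((g ^+ (N * m)) v).
 move=> Pv; elim: m => [|m IH]; first by rewrite muln0 !expr0 mul1r.
 rewrite mulnS exprD mulbE; apply: le_trans ((HN _).2 _); last by rewrite -mulbE gPn mulbE Pv bop0.
 by rewrite exprS -mulrA ler_wpM2l// mulr_ge0// exprn_ge0// ltW.
 have cont m v : P v = v -> bn ((g ^+ (N * m)) v) <= (2^-1 * s ^+ N) ^+ m * bn v.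
 move=> Pv; elim: m => [|m IH]; first by rewrite muln0 !expr0 mul1r.
 rewrite mulnS exprD mulbE; apply: le_trans ((HN _).1 _) _; first by rewrite -mulbE gPn mulbE Pv.
 rewrite exprS -[leRHS]mulrA; apply: ler_wpM2l => //.
 by rewrite mulr_ge0 ?invr_ge0// exprn_ge0// ltW.
 have main m : bn z <= opn P * K * opn x * bn y * 2^-1 ^+ m.
 pose n := (N * m)%N; pose w := (g' ^+ n) y.
 have gw : (g ^+ n) w = y by rewrite /w -mulbE (cX _ _ n gg' g'g).
 have Pw : P w = 0 by rewrite /w -mulbE g'Pn mulbE Py bop0.
 have zE : P ((g' ^+ n * x * g ^+ n) w) = (g' ^+ n) z.
 by rewrite !mulbE gw -mulbE g'Pn mulbE.
 have Pz : P ((g' ^+ n) z) = (g' ^+ n) z by rewrite -mulbE g'Pn mulbE /z -(mulbE P P) Pi.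
 have h1 := cont m _ Pz; rewrite -/n -mulbE (cX _ _ n gg' g'g) onebE in h1.
 have h2 := expd m _ Pw; rewrite -/n gw in h2.
 have h3 : bn ((g' ^+ n) z) <= opn P * (K * (1 + e) ^+ n * opn x * bn w).
 rewrite -zE; apply: opnP_le; rewrite ler_wpM2l ?opn_ge0//.
 exact: opnPM (HK n x Yx).
 have h4 : (1 + e) ^+ n <= 2 ^+ m.
 by rewrite /n exprM lerXn2r ?nnegrE ?exprn_ge0//; lra.
 have sN : 0 < s ^+ N by rewrite exprn_gt0.
 have t1 : 0 <= (2^-1 * s ^+ N) ^+ m by rewrite exprn_ge0// mulr_ge0 ?invr_ge0// ltW.
 have t2 : (2^-1 * s ^+ N) ^+ m * 2 ^+ m * (2 ^+ m) = (2 * s ^+ N) ^+ m.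
 by rewrite -!exprMn; congr (_ ^+ m); field.
 have a0 : 0 <= opn P * K * opn x by rewrite !mulr_ge0 ?opn_ge0.
 have h5 : bn z <= opn P * K * opn x * ((2^-1 * s ^+ N) ^+ m * 2 ^+ m * bn w).
 apply: le_trans h1 _; apply: le_trans (ler_wpM2l t1 h3) _.
 have -> : (2^-1 * s ^+ N) ^+ m * (opn P * (K * (1 + e) ^+ n * opn x * bn w)) =
 opn P * K * opn x * ((2^-1 * s ^+ N) ^+ m * (1 + e) ^+ n * bn w) by ring.
 by rewrite ler_wpM2l// ler_wpM2r ?bn_ge0// ler_wpM2l.
 apply: le_trans h5 _; rewrite -[leRHS]mulrA ler_wpM2l// exprVn ler_pdivlMr ?exprn_gt0//.
 by rewrite mulrAC t2.
 apply: bn_small => d d0; have a0 : 0 <= opn P * K * opn x * bn y by rewrite !mulr_ge0 ?opn_ge0 ?bn_ge0.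
 have d1 : 0 < d / (opn P * K * opn x * bn y + 1) by rewrite divr_gt0// ltr_wpDl.
 have [m Hm] := @half_small R _ d1.
 have := Hm m (leqnn m); rewrite ltr_pdivlMr ?ltr_wpDl// => h.
 apply: le_trans (main m) _; move: h a0; have : (0 : R) <= 2^-1 ^+ m by rewrite exprn_ge0 ?invr_ge0.
 set a := opn P * _ * _ * _; set t := 2^-1 ^+ _; lra.
Qed.
End ConjugationGrowth.

(** * Exponential words and the adjoint action *)

Section ExpWords.
Variables (R : realType) (E : banach R).
Implicit Types (a b x : bop E) (w : seq (bop E)).
Lemma wx_inverse w : (forall a, a \in w -> cpt a) -> exists k k', [/\ cpt k, cpt k', wx w = 1 + k,
 (1 + k) * (1 + k') = 1 & (1 + k') * (1 + k) = 1] /\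
 forall M : set (BL E), subsp M -> closd M -> (forall a x, a \in w -> M x -> M (a * x - x * a)) ->
 forall x, M x -> M ((1 + k') * x * (1 + k)) /\ M ((1 + k) * x * (1 + k')).
Proof.
elim: w => [|a w IH] H.
 exists 0, 0; split; first by rewrite !addr0 mulr1; split=> //; exact: cpt0.
 by move=> M _ _ _ x Mx; rewrite !addr0 !mulr1 !mul1r.
have [|k [k' [[ck ck' wk kk' k'k] HM]]] := IH; first by move=> b bw; apply: H; rewrite inE bw orbT.
have ca : cpt a by apply: H; rewrite inE eqxx.
pose e := expb a - 1; pose e' := expb (- a) - 1.
have ce : cpt e by exact: expb_cpt.
have ce' : cpt e' by apply: expb_cpt; exact: cptN.
have eE : expb a = 1 + e by rewrite addrC subrK.
have e'E : expb (- a) = 1 + e' by rewrite addrC subrK.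
have ee' : expb a * expb (- a) = 1 by exact: expbK.
have e'e : expb (- a) * expb a = 1 by have := expbK (- a); rewrite opprK.
exists (k + e * (1 + k)), (e' + k' * (1 + e')).
have k1 : 1 + (k + e * (1 + k)) = expb a * (1 + k) by rewrite eE addrA [RHS]mulrDl mul1r.
have k2 : 1 + (e' + k' * (1 + e')) = (1 + k') * expb (- a) by rewrite e'E addrA [RHS]mulrDl mul1r.
rewrite k1 k2; split; first split.
- by apply: cptD => //; exact: cptMr.
- by apply: cptD => //; exact: cptMr.
- by rewrite /= wk.
- by rewrite mulrA -(mulrA (expb a)) kk' mulr1.
- by rewrite mulrA -(mulrA (1 + k')) e'e mulr1.
move=> M sM cM HMa x Mx.
have Ma y : M y -> M (a * y - y * a) by apply: HMa; rewrite inE eqxx.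
have Ma' (y : bop E) : M y -> M (- a * y - y * - a).
 move=> My; have -> : - a * y - y * - a = - (a * y - y * a) by rewrite mulNr mulrN opprB opprK addrC.
 by apply: (ssN sM); exact: Ma.
have Mw b y : b \in w -> M y -> M (b * y - y * b) by move=> bw; apply: HMa; rewrite inE bw orbT.
split.
- have -> : (1 + k') * expb (- a) * x * (expb a * (1 + k)) = (1 + k') * (expb (- a) * x * expb a) * (1 + k).
 by rewrite !mulrA.
 apply: (HM M sM cM Mw _ _).1; have := expb_conj_mem sM cM Mx Ma'; by rewrite opprK.
- have -> : expb a * (1 + k) * x * ((1 + k') * expb (- a)) = expb a * ((1 + k) * x * (1 + k')) * expb (- a).
 by rewrite !mulrA.
 apply: expb_conj_mem => //; exact: (HM M sM cM Mw _ Mx).2.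
Qed.
Definition liebr a : bop (BL E) := conj_op a 1 - conj_op 1 a.
Lemma liebrE a (x : BL E) : liebr a x = a * x - x * a :> bop E.
Proof. by rewrite /liebr subbE /= mulr1 mul1r. Qed.
End ExpWords.

(** * Graded operators on functions from the group to the space *)

Section DirectSum.
Variables (R : realType) (X : banach R) (G : finZmodType).
Implicit Types (a b : bop X) (g h : G) (x : X).

Local Notation V := {ffun G -> X}.
Definition dnorm (x : V) : R := \sum_g bn (x g).
Lemma dnorm_comp (x : V) g : bn (x g) <= dnorm x.
Proof. by rewrite /dnorm (bigD1 g)//= lerDl; apply: sumr_ge0 => h _; exact: bn_ge0. Qed.
Lemma dnormD (x y : V) : dnorm (x + y) <= dnorm x + dnorm y.
Proof. by rewrite /dnorm -big_split; apply: ler_sum => g _; rewrite ffunE bnD. Qed.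
Lemma dnormZ (c : R[i]) (x : V) : dnorm (c *: x) = nc c * dnorm x.
Proof. by rewrite /dnorm mulr_sumr; apply: eq_bigr => g _; rewrite ffunE bnZ. Qed.
Lemma dnorm_eq0 (x : V) : dnorm x = 0 -> x = 0.
Proof.
move=> H; apply/ffunP => g; rewrite ffunE; apply: bn_eq0; apply/eqP.
by rewrite eq_le bn_ge0 andbT -H dnorm_comp.
Qed.
Lemma dnorm_lt (x : V) (e : R) : 0 < e -> (forall g, bn (x g) < e / #|G|.+1%:R) -> dnorm x < e.
Proof.
move=> e0 H; have n0 : (0 : R) < #|G|.+1%:R by rewrite ltr0n.
apply: (@le_lt_trans _ _ (\sum_(g : G) e / #|G|.+1%:R)); first by apply: ler_sum => g _; exact: ltW.
rewrite sumr_const -[_ *+ #|_|]mulr_natr mulrAC ltr_pdivrMr// ltr_pM2l// ltr_nat //.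
Qed.
Lemma dcomp (u : nat -> V) :
 (forall e, 0 < e -> exists N, forall m n, (N <= m)%N -> (N <= n)%N -> dnorm (u m - u n) < e) ->
 exists l, forall e, 0 < e -> exists N, forall n, (N <= n)%N -> dnorm (u n - l) < e.
Proof.
move=> H; have ex g : exists l, forall e, 0 < e -> exists N, forall n, (N <= n)%N -> bn (u n g - l) < e.
 apply: bcomp => e /H[N HN]; exists N => m n Nm Nn; apply: le_lt_trans (HN m n Nm Nn).
 by have := dnorm_comp (u m - u n) g; rewrite !ffunE.
have [l Hl] := choice ex; exists [ffun g => l g] => e e0.
have e1 : 0 < e / #|G|.+1%:R by rewrite divr_gt0 ?ltr0n.
have [N HN] := choice (fun g => Hl g _ e1).
exists (\max_g N g) => n Hn; apply: dnorm_lt => // g; rewrite !ffunE; apply: HN.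
by apply: leq_trans Hn; exact: (leq_bigmax g).
Qed.
Definition dsum : banach R := @Banach R V dnorm dnormD dnormZ dnorm_eq0 dcomp.
Implicit Types (T : bop dsum) (y : dsum).

Lemma dsum_ulim (u : nat -> dsum) (l : dsum) : (forall g, ulim (fun n => (u n : V) g) ((l : V) g)) -> ulim u l.
Proof.
move=> H e e0; have e1 : 0 < e / #|G|.+1%:R by rewrite divr_gt0 ?ltr0n.
have : ev (fun n => forall i, (i < #|G|)%N -> forall g, enum_rank g = i :> nat -> bn ((u n : V) g - (l : V) g) < e / #|G|.+1%:R).
 apply: ev_allfin => i iG; apply: (evS (H (enum_val (Ordinal iG)) _ e1)) => n Hn g gi.
 have -> : g = enum_val (Ordinal iG) by rewrite -[g]enum_rankK; congr enum_val; exact: val_inj.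
 exact: Hn.
move=> He; apply: (evS He) => n Hn; apply: dnorm_lt => // g; rewrite !ffunE.
by apply: (Hn (enum_rank g)).
Qed.
Lemma hat_lin g a (c : R[i]) (x y : dsum) :
 ([ffun h => a ((c *: x + y : V) (h - g))] : dsum) = c *: ([ffun h => a ((x : V) (h - g))] : dsum) + [ffun h => a ((y : V) (h - g))].
Proof. by apply/ffunP => h; rewrite !ffunE bopD bopZ. Qed.
Lemma hat_le g a (x : dsum) : bn ([ffun h => a ((x : V) (h - g))] : dsum) <= opn a * bn x.
Proof.
rewrite /bn /= /dnorm; apply: (@le_trans _ _ (\sum_h opn a * bn ((x : V) (h - g)))).
 by apply: ler_sum => h _; rewrite ffunE opnP.
rewrite -mulr_sumr ler_wpM2l ?opn_ge0// [leRHS](reindex_inj (addIr (- g)))//.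
Qed.
(** [a] applied pointwise, followed by translation by [g]. Operators of distinct degrees become
    independent even where the components of [L] overlap. *)
Definition hat g a : bop dsum := Bop (hat_lin g a) (ex_intro _ (opn a) (hat_le g a)).
Lemma hatE g a y h : (hat g a y : V) h = a ((y : V) (h - g)).
Proof. by rewrite /hat /= ffunE. Qed.
Lemma dsum_eq (y z : dsum) : (forall h, (y : V) h = (z : V) h) -> y = z.
Proof. by move=> H; exact/ffunP. Qed.
Lemma hatD g a b : hat g (a + b) = hat g a + hat g b.
Proof. by apply: bop_eq => y; apply: dsum_eq => h; rewrite addbE !ffunE. Qed.
Lemma hatB g a b : hat g (a - b) = hat g a - hat g b.
Proof. by apply: bop_eq => y; apply: dsum_eq => h; rewrite subbE !ffunE subbE. Qed.
Lemma hat0 g : hat g 0 = 0.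
Proof. by apply: bop_eq => y; apply: dsum_eq => h; rewrite zerobE !ffunE. Qed.
Lemma hatM g h a b : hat g a * hat h b = hat (g + h) (a * b).
Proof. by apply: bop_eq => y; apply: dsum_eq => l; rewrite mulbE !hatE mulbE opprD addrA. Qed.
Lemma opn_hat g a : opn (hat g a) <= opn a.
Proof. by apply: opn_le => [|y]; [exact: opn_ge0|exact: hat_le]. Qed.
Lemma hat_cpt g a : cpt a -> cpt (hat g a).
Proof.
move=> ca; apply: ucpt_cpt => u Hu.
have ex h : exists l, ulim (fun n => a ((u n : V) (h - g))) l.
 by apply: (cptP ca (M := 1)) => n; apply: le_trans (Hu n); exact: dnorm_comp.
have [l Hl] := choice ex; exists [ffun h => l h]; apply: dsum_ulim => h.
by rewrite ffunE; apply: (ulim_ext (Hl h)) => n; rewrite hatE.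
Qed.
Definition del x : dsum := [ffun h => if h == 0 then x else 0].
Lemma bn_del x : bn (del x) = bn x.
Proof.
rewrite /bn /= /dnorm (bigD1 0)//= big1 ?addr0 => [|h h0]; rewrite ffunE ?eqxx//.
by rewrite (negbTE h0) bn0.
Qed.
Lemma cmp_lin T g (c : R[i]) (x y : X) : (T (del (c *: x + y)) : V) g = c *: (T (del x) : V) g + (T (del y) : V) g.
Proof.
have -> : del (c *: x + y) = c *: del x + del y.
 by apply: dsum_eq => h; rewrite !ffunE; case: eqP => // _; rewrite scaler0 addr0.
by rewrite bopD bopZ !ffunE.
Qed.
Lemma cmp_le T g x : bn ((T (del x) : V) g) <= opn T * bn x.
Proof. by apply: le_trans (dnorm_comp _ _) _; rewrite -(bn_del x); exact: (@opnP R dsum T (del x)). Qed.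
(** Reads the component of degree [g] off vectors supported at 0. It does not increase the norm, so
    components pass to limits. *)
Definition cmp g T : bop X := Bop (cmp_lin T g) (ex_intro _ (opn T) (cmp_le T g)).
Lemma cmpE g T x : cmp g T x = (T (del x) : V) g. Proof. by []. Qed.
Lemma opn_cmp g T : opn (cmp g T) <= opn T.
Proof. by apply: opn_le => [|x]; [exact: opn_ge0|exact: cmp_le]. Qed.
Lemma cmpD g T T' : cmp g (T + T') = cmp g T + cmp g T'.
Proof. by apply: bop_eq => x; rewrite addbE !cmpE addbE ffunE. Qed.
Lemma cmpZ g c T : cmp g (c *: T) = c *: cmp g T.
Proof. by apply: bop_eq => x; rewrite scalebE !cmpE scalebE ffunE. Qed.
Lemma cmpB g T T' : cmp g (T - T') = cmp g T - cmp g T'.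
Proof. by rewrite cmpD -(scaleN1r T') cmpZ scaleN1r. Qed.
Lemma cmp0 g : cmp g 0 = 0.
Proof. by apply: bop_eq => x; rewrite cmpE !zerobE ffunE. Qed.
Lemma cmp_hat g h a : cmp g (hat h a) = if g == h then a else 0.
Proof.
apply: bop_eq => x; rewrite cmpE hatE ffunE subr_eq0.
by case: eqP => // _; rewrite bop0.
Qed.
Lemma cmp_sum g (a : G -> bop X) : cmp g (\sum_h hat h (a h)) = a g.
Proof.
rewrite (big_morph _ (cmpD g) (cmp0 g)) (bigD1 g)//= cmp_hat eqxx big1 ?addr0// => h hg.
by rewrite cmp_hat eq_sym (negbTE hg).
Qed.
Lemma finrk_cmp g T : finrk T -> finrk (cmp g T).
Proof.
move=> [r [e H]]; exists r, (fun i => (e i : V) g) => x.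
have [c _ Hc] := H (del x); exists c => //; rewrite cmpE -Hc /comb.
by rewrite sum_ffunE; apply: eq_bigr => i _; rewrite ffunE.
Qed.
Definition dtot (y : dsum) : X := \sum_h (y : V) h.
Lemma dtotD y z : dtot (y + z) = dtot y + dtot z.
Proof. by rewrite /dtot -big_split; apply: eq_bigr => h _; rewrite ffunE. Qed.
Lemma dtotZ c y : dtot (c *: y) = c *: dtot y.
Proof. by rewrite /dtot scaler_sumr; apply: eq_bigr => h _; rewrite ffunE. Qed.
Lemma dtot_le y : bn (dtot y) <= 1 * bn y.
Proof. by rewrite mul1r; exact: bn_sum. Qed.
Lemma dtot_hat g a y : dtot (hat g a y) = a (dtot y).
Proof.
rewrite /dtot bop_sum [RHS](reindex_inj (addIr (- g))); apply: eq_bigr => h _.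
by rewrite hatE.
Qed.
Lemma dtot_del x : dtot (del x) = x.
Proof.
rewrite /dtot (bigD1 0)//= big1 ?addr0 => [|h h0]; rewrite ffunE ?eqxx//.
by rewrite (negbTE h0).
Qed.
Record graded (Lg : G -> set (BL X)) : Prop := Graded {
 gr_sub : forall g, subsp (Lg g);
 gr_lie : forall g h (a b : bop X), Lg g a -> Lg h b -> Lg (g + h) (a * b - b * a);
 gr_cpt : forall g (a : bop X), Lg g a -> cpt a }.

Section GradedExtract.
Variable Lg : G -> set (BL X).
Hypothesis gr : graded Lg.
Definition homog (a : bop X) := exists g, Lg g a.

Lemma clos_lie g h (a x : bop X) : Lg g a -> clos (Lg h) x -> clos (Lg (g + h)) (a * x - x * a).
Proof.
move=> La; rewrite -liebrE; move: x.
have cV : closd (fun x : BL X => clos (Lg (g + h)) (liebr a x)) by apply: pre_closd; exact: clos_closd.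
have sub : Lg h `<=` (fun x : BL X => clos (Lg (g + h)) (liebr a x)).
 by move=> x Lx; apply: (@sub_clos R (BL X) (Lg (g + h))); have := gr_lie gr La Lx; rewrite -liebrE.
exact: (clos_min cV sub).
Qed.
(** The graded algebra lifted to the sum, with closed components. It is norm closed, and a finite
    rank member has components of finite rank, which is the purpose of the lift. *)
Definition hcl : set (BL dsum) := fun T => (forall g, clos (Lg g) (cmp g T)) /\ (T : bop dsum) = \sum_g hat g (cmp g T).
Lemma hcl_sum (a : G -> bop X) : (forall g, clos (Lg g) (a g)) -> hcl (\sum_g hat g (a g)).
Proof.
by move=> H; split=> [g|]; [rewrite cmp_sum|apply: eq_bigr => g _; rewrite cmp_sum].
Qed.
Lemma sclos g : subsp (clos (Lg g)). Proof. by apply: clos_subsp; exact: (gr_sub gr). Qed.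
Lemma hcl_subsp : subsp hcl.
Proof.
split.
- have -> : (0 : bop dsum) = \sum_g hat g 0 by rewrite big1// => g _; rewrite hat0.
 by apply: hcl_sum => g; exact: (ss0 (sclos g)).
- move=> T T' [H1 H2] [H1' H2'].
 have -> : (T + T' : bop dsum) = \sum_g hat g (cmp g T + cmp g T').
 by rewrite [in LHS]H2 [in LHS]H2' -big_split; apply: eq_bigr => g _; rewrite hatD.
 by apply: hcl_sum => g; exact: (ssD (sclos g)).
- move=> c T [H1 H2].
 have -> : (c *: T : bop dsum) = \sum_g hat g (c *: cmp g T).
 rewrite [in LHS]H2 scaler_sumr; apply: eq_bigr => g _.
 by apply: bop_eq => y; apply: dsum_eq => h; rewrite scalebE ffunE !hatE.
 by apply: hcl_sum => g; exact: (ssZ (sclos g)).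
Qed.
Lemma hcl_closd : closd hcl.
Proof.
move=> T HT; split=> [g|].
 apply: clos_closd => e /HT[T' [H _] h]; exists (cmp g T') => //.
 by apply: le_lt_trans h; rewrite -[_ - _]cmpB; exact: opn_cmp.
apply: subr0_eq; apply: opn_small => e e0.
have n0 : (0 : R) < #|G|.+1%:R + 1 by rewrite ltr_wpDl.
have e1 : 0 < e / (#|G|.+1%:R + 1) by rewrite divr_gt0.
have [T' [H H2] h] := HT _ e1.
have -> : T - \sum_g hat g (cmp g T) = (T - T') - \sum_g hat g (cmp g (T - T')).
 under [in RHS]eq_bigr do rewrite cmpB hatB.
 by rewrite sumrB -H2 opprB addrA subrK.
rewrite [bn _]opnC in h.
apply: le_trans (opnB_le _ _) _; apply: (@le_trans _ _ (opn (T - T') + \sum_(g : G) opn (T - T'))).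
 rewrite lerD2l; apply: le_trans (@bn_sum _ (BL dsum) _ _ _ _) _; apply: ler_sum => g _.
 by apply: le_trans (opn_hat _ _) _; exact: opn_cmp.
rewrite sumr_const -[_ *+ #|_|]mulr_natr; apply: (@le_trans _ _ (opn (T - T') * (#|G|.+1%:R + 1))).
 rewrite -{1}[opn _]mulr1 -mulrDr ler_wpM2l ?opn_ge0// addrC lerD2r ler_nat//.
by rewrite -ler_pdivlMr// ltW.
Qed.
Lemma hcl_lie g (a : bop X) (T : bop dsum) : Lg g a -> hcl T -> hcl (hat g a * T - T * hat g a).
Proof.
move=> La [H1 H2].
have -> : hat g a * T - T * hat g a = \sum_h hat h (a * cmp (h - g) T - cmp (h - g) T * a).
 rewrite {1 2}H2 mulr_sumr mulr_suml -sumrB (reindex_inj (addIr (- g))); apply: eq_bigr => h _.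
 by rewrite !hatM -[h - g + g]addrC [g + (h - g)]addrCA subrr addr0 hatB.
apply: hcl_sum => h; have := clos_lie La (H1 (h - g)).
by rewrite [g + (h - g)]addrCA subrr addr0.
Qed.
Lemma lift_word w : (forall a, a \in w -> homog a) -> exists w' : seq (bop dsum),
 (forall T, T \in w' -> exists g (a : bop X), Lg g a /\ T = hat g a) /\
 forall y, dtot (wx w' y) = wx w (dtot y).
Proof.
elim: w => [|a w IH] H; first by exists [::]; split.
have [|w' [H1 H2]] := IH; first by move=> b bw; apply: H; rewrite inE bw orbT.
have [g La] := H a (mem_head _ _); exists (hat g a :: w'); split.
 move=> T; rewrite inE => /orP[/eqP->|/H1//]; by exists g, a.
move=> y; rewrite -[wx (_ :: w')]/(expb (hat g a) * wx w') -[wx (a :: w)]/(expb a * wx w) !mulbE -H2; apply: expb_intertwine; [exact: dtotD|exact: dtotZ|exact: dtot_le|exact: dtot_hat].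
Qed.
(** A growing word lifts to the sum, and [dtot] shows that the lift grows as well. A nonzero finite
    rank member of [hcl] has a nonzero component, which is homogeneous. If there is none,
    [invariant_fin_dim] gives a finite-dimensional subspace of the sum, and all values of its basis
    vectors span an invariant subspace of [X]. *)
Lemma extraction K : irred homog -> homog K -> K != 0 ->
 (exists W, [/\ subsp W, (exists r (e : 'I_r -> X), fbasis W e), (exists2 x, x != 0 & W x) &
 forall a x, homog a -> W x -> W (a x)]) \/
 (exists g F, [/\ F != 0, finrk F & clos (Lg g) F]).
Proof.
move=> irr HK K0.
have hZ (c : R[i]) (a : bop X) : homog a -> homog (c *: a).
 by move=> [g La]; exists g; exact: (ssZ (gr_sub gr g)).
have hc (a : bop X) : homog a -> cpt a by move=> [g]; exact: (gr_cpt gr).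
have [w [c [Hw c0 Hc]]] := growing_exp_word hZ irr hc HK K0.
have [w' [Hw' sw]] := lift_word Hw.
have cw' T : T \in w' -> cpt T by move=> /Hw'[g [a [La ->]]]; apply: hat_cpt; exact: (gr_cpt gr La).
have [k [k' [[ck ck' wk kk' k'k] HM]]] := wx_inverse cw'.
have [nofin|] := EM (forall T : bop dsum, hcl T -> finrk T -> T = 0); last first.
 move=> nf; right; have [T [HT fT T0]] : exists T : bop dsum, [/\ hcl T, finrk T & T <> 0].
 apply: contrapT => H; apply: nf => T HT fT; apply: contrapT => T0; apply: H; by exists T.
 have [g gT] : exists g, cmp g T != 0.
 apply: contrapT => H; apply: T0; case: HT => _ ->; rewrite big1// => g _.
 suff -> : cmp g T = 0 by rewrite hat0.
 by apply: contrapT => /eqP h; apply: H; exists g.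
 by exists g, (cmp g T); split=> //; [exact: finrk_cmp|exact: HT.1].
left; have Hc' n : c * 2 ^+ n <= opn ((1 + k) ^+ n).
 apply: le_trans (Hc n) _; apply: opn_le => [|x]; first exact: opn_ge0.
 have swn m y : dtot ((wx w' ^+ m) y) = (wx w ^+ m) (dtot y).
 elim: m y => [|m IH] y; first by rewrite !expr0 !onebE.
 by rewrite !expbSE sw IH.
 rewrite -{1}(dtot_del x) -swn -(bn_del x) wk; apply: le_trans (dtot_le _) _; rewrite mul1r; exact: opnP.
have Hst (T : bop dsum) : hcl T -> hcl ((1 + k') * T * (1 + k)) /\ hcl ((1 + k) * T * (1 + k')).
 apply: HM; [exact: hcl_subsp|exact: hcl_closd|].
 by move=> _ T' /Hw'[g [a [La ->]]]; exact: hcl_lie.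
have [W [sW [r [e [We fr]]] [y0 y00 Wy0] HW]] := invariant_fin_dim ck ck' kk' k'k hcl_subsp hcl_closd
 (fun T HT => (Hst T HT).1) (fun T HT => (Hst T HT).2) nofin c0 Hc'.
pose f (i : 'I_#|{: 'I_r * G}|) : X := (e (enum_val i).1 : V) (enum_val i).2.
have fE i h : cspan f ((e i : V) h).
 have -> : (e i : V) h = f (enum_rank (i, h)) by rewrite /f enum_rankK.
 exact: cspan_mem.
have sf := cspan_subsp f.
have cW y h : W y -> cspan f ((y : V) h).
 rewrite We => -[d _ <-]; rewrite /comb sum_ffunE; apply: (ss_sum _ sf) => i _.
 by rewrite ffunE; apply: (ssZ sf); exact: fE.
exists (cspan f); split=> //.
- by have [s [b [_ bb]]] := fbasis_ex f; exists s, b.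
- have [h hy] : exists h, (y0 : V) h != 0.
 apply: contrapT => H; case/eqP: y00; apply: dsum_eq => h; rewrite ffunE.
 by apply: contrapT => /eqP h'; apply: H; exists h.
 by exists ((y0 : V) h) => //; exact: cW.
- move=> a x [g La] [d _ <-]; rewrite /comb bop_sum; apply: (ss_sum _ sf) => i _.
 rewrite bopZ; apply: (ssZ sf); rewrite /f; case: (enum_val i) => j h /=.
 have -> : a ((e j : V) h) = (hat g a (e j) : V) (h + g) by rewrite hatE addrK.
 apply: cW; apply: HW; last by rewrite We; exact: cspan_mem.
 have -> : hat g a = \sum_l hat l (if l == g then a else 0).
 rewrite (bigD1 g)//= eqxx big1 ?addr0// => l /negbTE ->; exact: hat0.
 apply: hcl_sum => l; case: eqP => [->|_]; first exact: sub_clos.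
 exact: (ss0 (sclos l)).
Qed.
End GradedExtract.
End DirectSum.

(** * Weakly closed sets of nilpotent matrices *)

Section EngelJacobson.
Variables (C : fieldType) (n : nat).
Implicit Types (a b c x : 'M[C]_n) (v : 'rV[C]_n) (w : seq 'M[C]_n) (W : set 'M[C]_n).

Definition lb a b : 'M[C]_n := a * b - b * a.
Definition nilm a := exists k, a ^+ k = 0.
Definition wprod w : 'M[C]_n := foldr (fun a b => a * b) 1 w.
Lemma wprod_cat w1 w2 : wprod (w1 ++ w2) = wprod w1 * wprod w2.
Proof. by elim: w1 => [|a w IH] /=; rewrite ?mul1r// IH mulrA. Qed.
Lemma wprod_rcons w a : wprod (rcons w a) = wprod w * a.
Proof. by rewrite -cats1 wprod_cat; congr (_ * _); rewrite /= mulr1. Qed.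
(** Jacobson's setting: brackets are required, sums are not, so that the union of the components of
    a grading qualifies. *)
Definition weakly_closed W := forall a b, W a -> W b -> W (lb a b).
Definition letters W w := forall a, a \in w -> W a.

(** The ascending annihilator series. Unlike a bound on the length of nonzero words it adapts easily
    when [W] is enlarged, by its linear span or by a normalising element. *)
Fixpoint ann W j : set 'rV[C]_n := if j is i.+1 then [set v | forall a, W a -> ann W i (v *m a)] else [set 0].
Lemma ann0 W j : ann W j 0.
Proof. by elim: j => //= j IH a _; rewrite mul0mx. Qed.
Lemma annD W j u v : ann W j u -> ann W j v -> ann W j (u + v).
Proof.
elim: j u v => [|j IH] u v /=; first by move=> -> ->; rewrite addr0.
by move=> Hu Hv a Wa; rewrite mulmxDl; apply: IH; auto.
Qed.
Lemma annZ W j (c : C) v : ann W j v -> ann W j (c *: v).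
Proof.
elim: j v => [|j IH] v /=; first by move=> ->; rewrite scaler0.
by move=> Hv a Wa; rewrite -scalemxAl; apply: IH; auto.
Qed.
Lemma annS W j v : ann W j v -> ann W j.+1 v.
Proof.
elim: j v => [|j IH] v /=; first by move=> -> a _; rewrite mul0mx.
by move=> Hv a Wa; apply: IH; exact: Hv.
Qed.
Lemma ann_le W i j v : (i <= j)%N -> ann W i v -> ann W j v.
Proof. by move=> /subnK <-; elim: (j - i)%N => // k IH /IH; exact: annS. Qed.
Lemma ann_word W w v : letters W w -> ann W (size w) v -> v *m wprod w = 0.
Proof.
elim: w v => [|a w IH] v Lw; first by rewrite /= mulmx1.
move=> Hv; rewrite /= -[_ * _]/(_ *m _) mulmxA IH//; first by move=> b bw; apply: Lw; rewrite inE bw orbT.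
by apply: Hv; apply: Lw; rewrite inE eqxx.
Qed.
Lemma ann_sub W W' j v : W `<=` W' -> ann W' j v -> ann W j v.
Proof. by move=> WW'; elim: j v => //= j IH v Hv a Wa; apply/IH/Hv/WW'. Qed.
Lemma ann_total W N w : (forall v, ann W N v) -> letters W w -> (N <= size w)%N -> wprod w = 0.
Proof.
move=> WN Lw Nw; apply/row_matrixP => i; rewrite row0 rowE; apply: (ann_word Lw).
exact: ann_le Nw (WN _).
Qed.
Lemma ann_span (l : seq 'M[C]_n) j v : ann [set` l] j v -> ann [set a | a \in span l] j v.
Proof.
elim: j v => [//|j IH] v Hv a Va; rewrite (coord_span (X := in_tuple l) Va) mulmx_sumr.
elim/big_rec: _ => [|i u _ Hu]; first exact: ann0.
by apply: annD => //; rewrite -scalemxAr; apply/annZ/IH/Hv; exact: mem_nth.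
Qed.
(** As [x] normalises [V], it preserves every level of the series of [V]; being nilpotent of index
    [k], it lengthens the series by at most [k] steps per level. *)
Lemma ann_extend (V : {vspace 'M[C]_n}) x N : nilm x -> (forall a, a \in V -> lb x a \in V) ->
 (forall v, ann [set a | a \in V] N v) -> exists N', forall v, ann [set a | a \in (V + <[x]>)%VS] N' v.
Proof.
move=> [k xk] xV VN; set W := [set a | a \in V]; set W' := [set a | _].
have xann j v : ann W j v -> ann W j (v *m x).
 elim: j v => [|j IH] v /=; first by move=> ->; rewrite mul0mx.
 move=> Hv a Va; have -> : v *m x *m a = v *m a *m x + v *m lb x a.
 by rewrite /lb mulmxBr [x * a]/(x *m a) [a * x]/(a *m x) !mulmxA addrC subrK.
 by apply: annD; [apply/IH/Hv|apply/Hv/xV].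
have step j M : (forall v, ann W j v -> ann W' M v) -> forall i v, ann W j.+1 v -> ann W j (v *m x ^+ i) -> ann W' (M + i) v.
 move=> jM; elim=> [|i IH] v v1; first by rewrite expr0 mulmx1 addn0; exact: jM.
 rewrite addnS => vi /= a /memv_addP[b Vb [_ /vlineP[c ->] ->]]; rewrite mulmxDr -scalemxAr.
 apply: annD; first by apply: (ann_le (leq_addr i M)); apply/jM/v1.
 by apply/annZ/IH; [exact: xann|rewrite -mulmxA -[x *m _]/(x * _) -exprS].
have [M HM] : exists M, forall v, ann W N v -> ann W' M v.
 elim: {VN}N => [|j [M HM]]; first by exists 0%N.
 by exists (M + k)%N => v v1; apply: (step j) => //; rewrite xk mulmx0; exact: ann0.
by exists M => v; exact: HM.
Qed.
(* Jacobson: among the free lists in [W] spanning a space with a finite annihilator series, one of maximal length spans [W]. *)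
Lemma engel_words W : weakly_closed W -> (forall a, W a -> nilm a) ->
 exists N, forall v, ann W N v.
Proof.
move=> wW nW; pose P d := `[< exists l : seq 'M[C]_n, [/\ size l = d, free l, letters W l & exists N, forall v, ann [set` l] N v] >].
have P0 : P 0%N.
 by apply/asboolP; exists [::]; split; rewrite ?nil_free//; exists 1%N.
have bd d : P d -> (d <= \dim {: 'M[C]_n})%N.
 by move=> /asboolP[l [<- fl _ _]]; rewrite -(eqP fl) dimvS// subvf.
case: (@ex_maxnP P _ (ex_intro (fun i => P i) 0%N P0) bd) => d /asboolP[l [sl fl Ll [N HN]]] maxd.
set V := span l; have VN v : ann [set a | a \in V] N v by exact: ann_span.
have [WV|nWV] := EM (forall a, W a -> a \in V).
 by exists N => v; exact: ann_sub WV (VN v).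
have [x0 [Wx0 x0V]] : exists x, W x /\ x \notin V.
 apply: contrapT => H; apply: nWV => a Wa; rewrite -[_ \in _]negbK; apply/negP => h; apply: H.
 by exists a.
have [x [Wx xV xl]] : exists x, [/\ W x, x \notin V & forall a, a \in l -> lb x a \in V].
 (* Products [u x v] vanish when [u] and [v] together are long. If [x] does not normalise the span,
    some bracket of [x] with a list element lies outside [V] and has the vanishing property for
    length one less; at length zero [x] itself would be zero. *)
 suff Q m : forall x, W x -> x \notin V -> (forall u v : seq 'M[C]_n, letters [set` l] u -> letters [set` l] v ->
 (size u + size v)%N = m -> wprod u * x * wprod v = 0) ->
 exists x, [/\ W x, x \notin V & forall a, a \in l -> lb x a \in V].
 apply: (Q (N + N)%N x0) => // u v Lu Lv suv; have [Nu|uN] := leqP N (size u).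
 by rewrite (ann_total HN Lu Nu) !mul0r.
 by rewrite (ann_total HN Lv) ?mulr0// -(leq_add2l (size u)) suv leq_add2r ltnW.
 elim: m => [|m IH] x Wx xV H.
 by have := H [::] [::]; rewrite mul1r mulr1 => x1; move: xV; rewrite x1 ?mem0v.
 have [nrm|] := EM (forall a, a \in l -> lb x a \in V); first by exists x.
 move=> /existsNP[a /not_implyP[al /negP xaV]]; apply: (IH (lb x a)) => //; first by apply: wW => //; exact: Ll.
 move=> u v Lu Lv suv.
 have -> : wprod u * lb x a * wprod v = wprod u * x * wprod (a :: v) - wprod (rcons u a) * x * wprod v.
 by rewrite /lb mulrBr mulrBl wprod_rcons [wprod (a :: v)]/(a * wprod v) !mulrA.
 rewrite !H ?subr0//= ?size_rcons ?addnS ?addSn ?suv//.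
 - by move=> b; rewrite mem_rcons inE => /orP[/eqP->|/Lu].
 - by move=> b; rewrite inE => /orP[/eqP->|/Lv].
have xVV a : a \in V -> lb x a \in V.
 move=> Va; rewrite (coord_span (X := in_tuple l) Va) /lb mulr_sumr mulr_suml -sumrB; apply: memv_suml => i _.
 rewrite -[x * _]/(x *m _) -scalemxAr -[_ * x]/(_ *m x) -scalemxAl -scalerBr memvZ//.
 by apply: xl; exact: mem_nth.
have [N' HN'] := ann_extend (nW x Wx) xVV VN.
have : P d.+1.
 apply/asboolP; exists (x :: l); split; rewrite /= ?sl ?free_cons ?xV//.
 by move=> a; rewrite inE => /orP[/eqP->|/Ll].
 exists N' => v; apply: ann_sub (HN' v) => a /=; rewrite inE => /orP[/eqP->|al].
 by apply: (subvP (addvSr V <[x]>)); exact: memv_line.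
 by apply: (subvP (addvSl V <[x]>)); exact: memv_span.
by move=> /maxd; rewrite ltnn.
Qed.
Lemma common_kernel W : (0 < n)%N -> weakly_closed W -> (forall a, W a -> nilm a) ->
 exists2 v : 'rV[C]_n, v != 0 & forall a, W a -> v *m a = 0.
Proof.
move=> n0 wW nW; have [N HN] := engel_words wW nW.
apply: contrapT => H; have K j v : ann W j v -> v = 0.
 elim: j v => [//|j IH] v Hv; apply: contrapT => /eqP v0; apply: H.
 by exists v => // a /Hv/IH.
have := K N _ (HN (delta_mx 0 (Ordinal n0))) => /matrixP /(_ 0 (Ordinal n0)).
by rewrite !mxE !eqxx => /eqP; rewrite oner_eq0.
Qed.
End EngelJacobson.

(** * Polynomials in a linear operator and interpolation *)

Section PolyAction.
Variables (C : fieldType) (V : lmodType C).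
Implicit Types (T : {linear V -> V}) (p q : {poly C}) (v : V).

Definition pev T p v : V := \sum_(i < size p) p`_i *: iter i T v.

Lemma pev_widen T p v k : (size p <= k)%N -> pev T p v = \sum_(i < k) p`_i *: iter i T v.
Proof.
move=> pk; rewrite /pev (big_ord_widen k (fun i => p`_i *: iter i T v) pk) big_mkcond /=.
by apply: eq_bigr => i _; case: ltnP => // h; rewrite nth_default ?scale0r.
Qed.
Lemma pevD T p q v : pev T (p + q) v = pev T p v + pev T q v.
Proof.
rewrite (pev_widen _ _ (size_polyD p q)) (pev_widen _ _ (leq_maxl (size p) (size q))).
rewrite (pev_widen _ _ (leq_maxr (size p) (size q))) -big_split /=.
by apply: eq_bigr => i _; rewrite coefD scalerDl.
Qed.
Lemma pevC T c v : pev T c%:P v = c *: v.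
Proof. by rewrite (@pev_widen T _ v 1) ?size_polyC_leq1// big_ord1 coefC. Qed.
Lemma pevMX T p v : pev T (p * 'X) v = pev T p (T v).
Proof.
rewrite (@pev_widen T _ v (size p).+1); last by apply: leq_trans (size_polyMleq _ _) _; rewrite size_polyX addn2.
rewrite big_ord_recl coefMX eqxx scale0r add0r.
by apply: eq_bigr => i _; rewrite coefMX lift0 /= -iterSr iterS.
Qed.
Lemma pev_linear T p : linear (pev T p).
Proof.
have it i c u v : iter i T (c *: u + v) = c *: iter i T u + iter i T v.
 by elim: i => // i IH; rewrite !iterS IH linearP.
move=> c u v; rewrite /pev scaler_sumr -big_split /=; apply: eq_bigr => i _.
by rewrite it scalerDr !scalerA mulrC.
Qed.
Lemma pevM T p q v : pev T (p * q) v = pev T p (pev T q v).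
Proof.
elim/poly_ind: p v => [|p c IH] v.
 by rewrite mul0r -polyC0 !pevC !scale0r.
have lin := pev_linear T.
rewrite mulrDl -mulrA [_ * q]mulrC mulrA !pevD !pevMX IH [_%:P * q]mulrC.
congr (_ + _).
 congr (pev T p _); elim/poly_ind: q v {IH} => [|q d IH] v.
 by rewrite -polyC0 !pevC !scale0r linear0.
 by rewrite !pevD !pevMX !pevC linearD IH linearZ.
rewrite pevC; elim/poly_ind: q v {IH} => [|q d IH] v.
 by rewrite mul0r -polyC0 !pevC !scale0r scaler0.
by rewrite mulrDl -mulrA ['X * _]mulrC mulrA !pevD !pevMX IH -polyCM !pevC scalerDr scalerA mulrC.
Qed.
Lemma pev0 T p : pev T p 0 = 0.
Proof. by have := pev_linear T p (-1) 0 0; rewrite !scaleN1r oppr0 addr0 addNr. Qed.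
Lemma pev_add T p u v : pev T p (u + v) = pev T p u + pev T p v.
Proof. by have := pev_linear T p 1 u v; rewrite !scale1r. Qed.
Lemma pev_sum T p I r (P : pred I) (F : I -> V) : pev T p (\sum_(i <- r | P i) F i) = \sum_(i <- r | P i) pev T p (F i).
Proof. exact: (big_morph _ (pev_add T p) (pev0 T p)). Qed.
Lemma pev_dvd T p q v : p %| q -> pev T p v = 0 -> pev T q v = 0.
Proof. by move=> /dvdpP[r ->] h; rewrite pevM h pev0. Qed.
Lemma pev_XsubC T c v : pev T ('X - c%:P) v = T v - c *: v.
Proof. by rewrite -[- _]/(- (c%:P)) -polyCN pevD -['X]mul1r pevMX -polyC1 !pevC scale1r scaleNr. Qed.
Lemma pev_const' T p c d v k : ('X - c%:P) ^+ k %| p - d%:P -> pev T (('X - c%:P) ^+ k) v = 0 -> pev T p v = d *: v.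
Proof.
move=> dv h; have := pev_dvd dv h; rewrite -polyCN pevD pevC scaleNr.
by move=> /eqP; rewrite subr_eq0 => /eqP.
Qed.
End PolyAction.

Section Interpolation.
Variable (C : fieldType).
Implicit Types (s : seq C) (F : C -> C).

Lemma coprime_pow_prod c s K : c \notin s -> coprimep (('X - c%:P) ^+ K) (\prod_(d <- s) ('X - d%:P) ^+ K).
Proof.
elim: s => [|d s IH]; first by rewrite big_nil coprimep1.
rewrite inE negb_or => /andP[cd cs]; rewrite big_cons coprimepMr IH// andbT.
apply: coprimep_expl; apply: coprimep_expr; rewrite coprimep_XsubC root_XsubC.
by rewrite eq_sym.
Qed.
(** Chinese remainder theorem for coprime powers: a Bezout relation corrects [p] at the new root by
    a multiple of the product over the old ones. *)
Lemma interpolation s F K : uniq s -> exists p : {poly C}, forall c, c \in s -> ('X - c%:P) ^+ K %| p - (F c)%:P.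
Proof.
elim: s => [|c s IH] /=; first by exists 0.
move=> /andP[cs us]; have [p Hp] := IH us.
pose M := \prod_(d <- s) ('X - d%:P) ^+ K.
have cop : coprimep M (('X - c%:P) ^+ K).
 by rewrite coprimep_sym coprime_pow_prod.
have [[u v] /= /eqpP[[k1 k2] /= /andP[k10 k20] huv]] := Bezout_coprimepP _ _ cop.
have huv' : (k2^-1 * k1) *: (u * M) = 1 - (k2^-1 * k1) *: (v * ('X - c%:P) ^+ K).
 rewrite [RHS](_ : _ = (k2^-1 * k1) *: (u * M + v * ('X - c%:P) ^+ K) - (k2^-1 * k1) *: (v * ('X - c%:P) ^+ K)).
 by rewrite scalerDr addrK.
 by congr (_ - _); rewrite -scalerA huv scalerA mulVf// scale1r.
exists (p + ((k2^-1 * k1) *: (u * M)) * ((F c)%:P - p)) => d; rewrite inE => /orP[/eqP->|ds].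
 rewrite huv' mulrBl mul1r addrA [p + _]addrC subrK addrAC subrr add0r.
 by rewrite -scalerAl dvdpNr dvdpZr ?mulf_neq0 ?invr_eq0// -mulrA dvdp_mull// dvdp_mulr.
rewrite addrAC dvdp_addr ?Hp// -scalerAl dvdpZr ?mulf_neq0 ?invr_eq0// -mulrA dvdp_mull// dvdp_mulr//.
by rewrite /M (big_rem d)//= dvdp_mulIl.
Qed.
Lemma dvd_prod_XsubC s K (r : {poly C}) : uniq s -> (forall c, c \in s -> ('X - c%:P) ^+ K %| r) ->
 \prod_(c <- s) ('X - c%:P) ^+ K %| r.
Proof.
elim: s => [|c s IH] /=; first by rewrite big_nil dvd1p.
move=> /andP[cs us] H; rewrite big_cons Gauss_dvdp ?H ?mem_head//= ?IH// => [d ds|].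
 by apply: H; rewrite inE ds orbT.
exact: coprime_pow_prod.
Qed.
End Interpolation.

(** * Traces, brackets and the conjugate part of a matrix *)

Section TraceRank.
Variables (C : numFieldType).
(** Through a rank factorisation [a = c *m r] the trace of [a] is that of [r *m c], whose nilpotency
    index is one less. *)
Lemma mxtrace_nilm n (a : 'M[C]_n) : nilm a -> \tr a = 0.
Proof.
move=> [k]; elim: k n a => [|k IH] n a.
 by rewrite expr0 => h; rewrite -[a]mul1r h mul0r mxtrace0.
move=> ak; have [q [c [r [acr fr fc]]]] : exists q (c : 'M[C]_(n, q)) (r : 'M[C]_(q, n)), [/\ a = c *m r, row_free r & row_full c].
 by exists (\rank a), (col_base a), (row_base a); rewrite mulmx_base row_base_free col_base_full.
have pw j : a ^+ j.+1 = c *m (r *m c) ^+ j *m r.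
 elim: j => [|j IHj]; first by rewrite expr1 expr0 mulmx1.
 rewrite exprSr IHj [(r *m c) ^+ _.+1]exprSr [_ * a]/(_ *m a) [X in _ *m X = _]acr.
 by rewrite [_ * (r *m c)]/(_ *m (r *m c)) !mulmxA.
rewrite acr mxtrace_mulC IH//; have := pw k; rewrite ak => h.
have h1 : c *m (r *m c) ^+ k = 0 by apply: (row_free_inj fr); rewrite mul0mx -h.
by apply: (row_full_inj fc); rewrite mulmx0.
Qed.
Lemma mxtrace_idem n (a : 'M[C]_n) : a * a = a -> \tr a = (\rank a)%:R.
Proof.
move=> aa; pose c := col_base a; pose r := row_base a.
have acr : a = c *m r by rewrite mulmx_base.
have fr : row_free r by exact: row_base_free.
have fc : row_full c by exact: col_base_full.
have h : r *m c = 1%:M.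
 apply: (row_free_inj fr); apply: (row_full_inj fc); rewrite mul1mx.
 have -> : c *m (r *m c *m r) = (c *m r) *m (c *m r) by rewrite !mulmxA.
 by rewrite -acr.
by rewrite {1}acr mxtrace_mulC h mxtrace1.
Qed.
End TraceRank.

Section Brackets.
Variables (C : fieldType) (n : nat).
Implicit Types (a b c v w : 'M[C]_n) (p q : {poly C}).
Lemma lbE a b : lb a b = a *m b - b *m a. Proof. by []. Qed.
Lemma mulsl (l : C) b : l%:M * b = l *: b. Proof. exact: mul_scalar_mx. Qed.
Lemma mulsr b (l : C) : b * l%:M = l *: b. Proof. exact: mul_mx_scalar. Qed.
Lemma lb_linear a : linear (lb a).
Proof. by move=> k u v; rewrite !lbE linearP /= mulmxDl -scalemxAl opprD addrACA scalerBr. Qed.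
HB.instance Definition _ a := GRing.isLinear.Build C 'M[C]_n 'M[C]_n _ (lb a) (lb_linear a).

Definition pm c p : 'M[C]_n := pev (mulmx c) p 1%:M.
Lemma pev_mulmx c p v : pev (mulmx c) p v = pm c p *m v.
Proof.
rewrite /pm /pev mulmx_suml; apply: eq_bigr => i _; rewrite -scalemxAl; congr (_ *: _).
by elim: (i : nat) => [|j IH]; rewrite ?mul1mx// !iterS /= IH mulmxA.
Qed.
Lemma pmM c p q : pm c (p * q) = pm c p * pm c q.
Proof. by rewrite {1}/pm pevM pev_mulmx. Qed.
Lemma pmC c d : pm c d%:P = d%:M.
Proof. by rewrite /pm pevC scalemx1. Qed.
Lemma pmX c p k : pm c (p ^+ k) = pm c p ^+ k.
Proof. by elim: k => [|k IH]; rewrite ?expr0 ?exprS ?pmM ?IH// -polyC1 pmC. Qed.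
Lemma pm_XsubC c d : pm c ('X - d%:P) = c - d%:M.
Proof. by rewrite /pm pev_XsubC /= mulmx1 scalemx1. Qed.
Lemma pm_X c : pm c 'X = c.
Proof. by have := pm_XsubC c 0; rewrite polyC0 subr0 => ->; rewrite raddf0 subr0. Qed.
Lemma pmD c p q : pm c (p + q) = pm c p + pm c q. Proof. exact: pevD. Qed.
Lemma lb_pm_comm a c p : lb a c = 0 -> lb a (pm c p) = 0.
Proof.
move=> h; elim/poly_ind: p => [|p d IH].
 by rewrite -polyC0 pmC lbE mul_scalar_mx mul_mx_scalar subrr.
rewrite pmD pmC linearD pmM pm_X /= [lb a _%:M]lbE mul_scalar_mx mul_mx_scalar subrr addr0.
move/eqP: h; move/eqP: IH; rewrite /lb !subr_eq0 => /eqP IH /eqP h.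
by rewrite mulrA IH -mulrA h mulrA subrr.
Qed.
(** [lb c] minus the scalar [l - m] is left multiplication by [c - l%:M] minus right multiplication
    by [c - m%:M]. These commute, so in a power of exponent at least [i + j] every term kills
    [b]. *)
Lemma ad_split c (l m : C) i j k b : (i + j <= k)%N -> (c - l%:M) ^+ i * b = 0 -> b * (c - m%:M) ^+ j = 0 ->
 pev (lb c) (('X - (l - m)%:P) ^+ k) b = 0.
Proof.
elim: k i j b => [|k IH] i j b.
 by rewrite leqn0 addn_eq0 => /andP[/eqP-> /eqP->]; rewrite expr0 mul1r => -> _; rewrite pev0.
move=> ijk; case: i ijk => [|i] ijk; first by rewrite expr0 mul1r => -> _; rewrite pev0.
case: j ijk => [|j] ijk; first by rewrite expr0 mulr1 => _ ->; rewrite pev0.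
move=> h1 h2; rewrite exprSr pevM pev_XsubC.
have -> : lb c b - (l - m) *: b = (c - l%:M) * b + -1 *: (b * (c - m%:M)).
 rewrite scaleN1r mulrBl mulrBr /lb scalerBl.
 rewrite mulsl mulsr !opprB.
 by rewrite -!addrA; congr (_ + _); rewrite addrCA [RHS]addrCA; congr (_ + _); rewrite addrC.
have lin := pev_linear (lb c) (('X - (l - m)%:P) ^+ k); rewrite pev_add.
rewrite (IH i j.+1) ?add0r; last 3 first.
- by rewrite -ltnS; apply: leq_trans ijk; rewrite addSn.
- by rewrite mulrA -exprSr.
- by rewrite -mulrA h2 mulr0.
have := lin (-1) (b * (c - m%:M)) 0; rewrite !addr0 pev0 addr0 => ->.
rewrite (IH i.+1 j) ?scaler0//.
- by rewrite -ltnS; apply: leq_trans ijk; rewrite addnS.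
- by rewrite mulrA h1 mul0r.
- by rewrite -mulrA -exprS.
Qed.
End Brackets.

Section Spectral.
Variables (C : numClosedFieldType) (n : nat).
Implicit Types (a b c v w : 'M[C]_n) (p q : {poly C}).

Lemma annihilator c : exists (s : seq C) K, [/\ uniq s, (0 < K)%N & forall p, \prod_(d <- s) ('X - d%:P) ^+ K %| p -> pm c p = 0].
Proof.
have pd p q : p %| q -> pm c p = 0 -> pm c q = 0 by exact: pev_dvd.
case: n c pd => [|m] c pd.
 by exists [::], 1%N; split=> // p _; apply/matrixP => -[].
have [r rE] := closed_field_poly_normal (char_poly c).
have hm p : pm c p = horner_mx c p.
 elim/poly_ind: p => [|p d IH]; first by rewrite rmorph0 -polyC0 pmC raddf0.
 rewrite pmD pmM pmC IH rmorphD rmorphM /= horner_mx_X horner_mx_C pm_X.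
 by [].
exists (undup r), (size r).+1; split=> //; first exact: undup_uniq.
move=> p dv; apply: (pd _ _ dv); apply: (pd (char_poly c)); last by rewrite hm Cayley_Hamilton.
rewrite rE (monicP (char_poly_monic c)) scale1r prodrXl.
apply: (@dvdp_trans _ ((\prod_(d <- undup r) ('X - d%:P)) ^+ size r)); last by rewrite exprSr dvdp_mulIl.
have G r' : {subset r' <= undup r} -> \prod_(z <- r') ('X - z%:P) %| (\prod_(d <- undup r) ('X - d%:P)) ^+ size r'.
 elim: r' => [|x r' IH] sub; first by rewrite big_nil dvd1p.
 rewrite big_cons /= exprS; apply: dvdp_mul; last first.
 by apply: IH => y yr; apply: sub; rewrite inE yr orbT.
 by rewrite (big_rem x) ?dvdp_mulIl//=; apply: sub; rewrite mem_head.
by apply: G => x; rewrite mem_undup.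
Qed.
(* [pm c p] plays the role of the complex conjugate of the semisimple part of [c]. *)
Lemma conjugate_part c : exists p, (\tr (c * pm c p) = 0 -> nilm c) /\ forall b, exists q, lb (pm c p) b = pev (lb c) q b.
Proof.
have [s [K [us K0 an]]] := annihilator c.
have ch p : (forall d, d \in s -> ('X - d%:P) ^+ K %| p) -> pm c p = 0.
 by move=> H; apply: an; exact: dvd_prod_XsubC.
have [e He] := choice (fun d => interpolation (fun x => (x == d)%:R) K us).
have [p Hp] := interpolation (fun x => x^*) K us.
(* The spectral idempotents of [c], obtained as polynomials in [c] so that they commute with it and
   with each other. *)
pose P d := pm c (e d).
have e0 d x : x \in s -> x != d -> ('X - x%:P) ^+ K %| e d.
 by move=> xs xd; have := He d x xs; rewrite (negbTE xd) mulr0n polyC0 subr0.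
have e1 d : d \in s -> ('X - d%:P) ^+ K %| e d - 1.
 by move=> ds; have := He d d ds; rewrite eqxx.
have sum1 : \sum_(d <- s) P d = 1.
 apply/eqP; rewrite -subr_eq0; apply/eqP.
 have -> : \sum_(d <- s) P d - 1 = pm c (\sum_(d <- s) e d - 1).
 rewrite pmD -polyC1 -polyCN pmC raddfN; congr (_ - _).
 rewrite (big_morph (pm c) (pmD c) (_ : _ = 0)) //.
 by rewrite -polyC0 pmC raddf0.
 apply: ch => d ds; rewrite (big_rem d)//= addrAC dvdp_addr ?e1//.
 rewrite big_seq; apply: (big_ind (fun f => _ %| f)) => [|f g|x]; [by rewrite dvdp0|exact: dvdp_add|].
 by rewrite mem_rem_uniq// inE => /andP[xd xs]; apply: e0; rewrite // eq_sym.
have idem d : d \in s -> P d * P d = P d.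
 move=> ds; apply/eqP; rewrite -subr_eq0 -pmM; apply/eqP.
 have -> : pm c (e d * e d) - pm c (e d) = pm c (e d * (e d - 1)).
 rewrite mulrBr mulr1 pmD -[- e d]mulN1r !pmM -polyC1 -polyCN pmC.
 by rewrite mulsl scaleN1r.
 apply: ch => x xs; have [->|xd] := eqVneq x d; first by rewrite dvdp_mull ?e1.
 by rewrite dvdp_mulr ?e0.
have kill d : d \in s -> (c - d%:M) ^+ K * P d = 0.
 move=> ds; rewrite -pm_XsubC -pmX -pmM; apply: ch => x xs.
 by have [->|xd] := eqVneq x d; [rewrite dvdp_mulIl|rewrite dvdp_mull ?e0].
have killr d : d \in s -> P d * (c - d%:M) ^+ K = 0.
 move=> ds; rewrite -(kill d ds) -pm_XsubC -pmX /P -!pmM mulrC//.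
have pP d v : d \in s -> (c - d%:M) ^+ K * v = 0 -> pm c p * v = d^* *: v.
 move=> ds h; rewrite -[_ * v]/(_ *m v) -pev_mulmx; apply: (pev_const' (Hp d ds)).
 by rewrite pev_mulmx pmX pm_XsubC.
have Pp d v : d \in s -> v * (c - d%:M) ^+ K = 0 -> v * pm c p = d^* *: v.
 move=> ds h; have /dvdpP[q] := Hp d ds => /(congr1 (pm c)).
 rewrite pmM pmX pm_XsubC pmD -polyCN pmC raddfN /= => /eqP; rewrite subr_eq => /eqP ->.
 rewrite mulrDr mulsr.
 have -> : pm c q * (c - d%:M) ^+ K = (c - d%:M) ^+ K * pm c q.
 by rewrite -pm_XsubC -pmX -!pmM mulrC.
 by rewrite mulrA h mul0r add0r.
exists p; split.
 move=> tr0.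
 (* On the generalised eigenspace of [d] the matrix [pm c p] is the conjugate of [d], and [c] is [d]
    plus a nilpotent. The total trace is a sum of nonnegative terms, so its vanishing leaves only
    the eigenvalue 0. *)
 have trP d : d \in s -> \tr (c * pm c p * P d) = `|d| ^+ 2 * (\rank (P d))%:R.
 move=> ds; rewrite -mulrA (pP d)// ?kill// -[c * _]/(c *m _) -scalemxAr mxtraceZ.
 have -> : \tr (c * P d) = d * (\rank (P d))%:R.
 rewrite -(mxtrace_idem (idem d ds)) -mxtraceZ -[d *: _]mulsl.
 apply/eqP; rewrite -subr_eq0 -raddfB /= -mulrBl.
 rewrite mxtrace_nilm//; exists K.
 have -> : (c - d%:M) * P d = pm c (('X - d%:P) * e d) by rewrite pmM pm_XsubC.
 rewrite -pmX exprMn pmM pmX pm_XsubC pmX -/(P d).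
 by rewrite -(prednK K0) exprS [P d ^+ _]exprS mulrA -exprS prednK// kill// mul0r.
 by rewrite mulrA [d^* * d]mulrC -normCK.
 have z d : d \in s -> `|d| ^+ 2 * (\rank (P d))%:R = 0 :> C.
 move: tr0; rewrite -[c * _]mulr1 -sum1 mulr_sumr raddf_sum /= => tr0 ds.
 have := tr0; rewrite (eq_big_seq _ trP) => /eqP.
 rewrite psumr_eq0 => [/allP /(_ d ds) /eqP//|x _].
 by rewrite mulr_ge0// ?exprn_ge0.
 exists K; rewrite -[c]subr0 -[0 in LHS](raddf0 (@scalar_mx C n)) -[LHS]mulr1 -sum1 mulr_sumr big_seq.
 apply: big1 => d ds; have /eqP := z d ds; rewrite mulf_eq0 expf_eq0 /= normr_eq0 => /orP[/eqP d0|].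
 by have := kill d ds; rewrite d0.
 by rewrite pnatr_eq0 mxrank_eq0 => /eqP->; rewrite mulr0.
move=> b; pose dif := undup [seq x - y | x <- s, y <- s].
have [q Hq] := interpolation (fun x => x^*) (K + K) (undup_uniq [seq x - y | x <- s, y <- s]).
exists q.
have be : b = \sum_(x <- s) \sum_(y <- s) P x * b * P y.
 under eq_bigr do rewrite -mulr_sumr sum1 mulr1.
 by rewrite -mulr_suml sum1 mul1r.
rewrite [LHS](congr1 _ be) [RHS](congr1 _ be) pev_sum raddf_sum /= big_seq [RHS]big_seq; apply: eq_bigr => x xs.
rewrite pev_sum raddf_sum /= big_seq [RHS]big_seq; apply: eq_bigr => y ys.
have k1 : (c - x%:M) ^+ K * (P x * b * P y) = 0 by rewrite !mulrA kill// !mul0r.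
have k2 : (P x * b * P y) * (c - y%:M) ^+ K = 0 by rewrite -mulrA killr// mulr0.
rewrite /lb (pP x)// (Pp y)// -scalerBl -rmorphB.
rewrite (pev_const' (Hq (x - y) _))//; first by rewrite mem_undup; apply/allpairsP; exists (x, y).
exact: ad_split (leqnn _) k1 k2.
Qed.
End Spectral.

Section Hat.
Variables (C : numFieldType) (n : nat) (G : finZmodType).
Implicit Types (a b : 'M[C]_n) (g h : G).

(* The block matrix of a degree [g] operator acting on [C^n] tensored with the group algebra of [G]. *)
Definition hatm g a : 'M[C]_#|{: 'I_n * G}| :=
 \matrix_(i, j) (if (enum_val j).2 == (enum_val i).2 + g then a (enum_val i).1 (enum_val j).1 else 0).

Lemma hatmD g a b : hatm g (a + b) = hatm g a + hatm g b.
Proof. by apply/matrixP => i j; rewrite !mxE; case: ifP; rewrite ?addr0. Qed.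
Lemma hatmZ g c a : hatm g (c *: a) = c *: hatm g a.
Proof. by apply/matrixP => i j; rewrite !mxE; case: ifP; rewrite ?mulr0. Qed.
Lemma hatm0 g : hatm g 0 = 0.
Proof. by have := hatmZ g 0 0; rewrite !scale0r. Qed.
Lemma hatmM g h a b : hatm g a * hatm h b = hatm (g + h) (a * b).
Proof.
apply/matrixP => i j; rewrite !mxE; under eq_bigr do rewrite !mxE.
rewrite -(big_enum_val (A := {: 'I_n * G}) (fun x => (if x.2 == (enum_val i).2 + g then a (enum_val i).1 x.1 else 0) *
 (if (enum_val j).2 == x.2 + h then b x.1 (enum_val j).1 else 0))) /=.
rewrite (eq_bigl xpredT)// -(pair_bigA _ (fun p k => (if k == (enum_val i).2 + g then a (enum_val i).1 p else 0) *
 (if (enum_val j).2 == k + h then b p (enum_val j).1 else 0))) /=.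
transitivity (\sum_p (if (enum_val j).2 == (enum_val i).2 + g + h then a (enum_val i).1 p * b p (enum_val j).1 else 0)).
 apply: eq_bigr => p _; rewrite (bigD1 ((enum_val i).2 + g))//= eqxx big1 ?addr0.
 by case: ifP; rewrite ?mulr0.
 by move=> k /negbTE ->; rewrite mul0r.
by rewrite addrA; case: ifP => // _; rewrite ?mxE// big1.
Qed.
Lemma hatm_tr g a : \tr (hatm g a) = if g == 0 then #|G|%:R * \tr a else 0.
Proof.
rewrite /mxtrace; under eq_bigr do rewrite !mxE.
rewrite -(big_enum_val (A := {: 'I_n * G}) (fun x => if x.2 == x.2 + g then a x.1 x.1 else 0)) /=.
rewrite (eq_bigl xpredT)// -(pair_bigA _ (fun p k => if k == k + g then a p p else 0)) /=.
have e k : (k == k + g) = (g == 0) by rewrite -{1}[k]addr0 (inj_eq (addrI k)) eq_sym.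
case: ifP => g0; last by rewrite big1// => p _; rewrite big1// => k _; rewrite e g0.
rewrite mulr_sumr; apply: eq_bigr => p _; under eq_bigr do rewrite e g0.
by rewrite sumr_const mulr_natl cardT -cardE.
Qed.
Lemma hatm_lb g h a b : lb (hatm g a) (hatm h b) = hatm (g + h) (lb a b).
Proof. by rewrite /lb !hatmM hatmD [h + g]addrC -[- (b * a)]scaleN1r hatmZ scaleN1r. Qed.
Lemma hatm_eq0 g a : hatm g a = 0 -> a = 0.
Proof.
move=> h; apply/matrixP => p q; rewrite mxE.
have := congr1 (fun M : 'M[C]_#|{: 'I_n * G}| => M (enum_rank (p, 0)) (enum_rank (q, g))) h.
by rewrite !mxE !enum_rankK /= add0r eqxx.
Qed.
Lemma hatm_nilm g a : nilm (hatm g a) -> nilm a.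
Proof.
move=> [k hk]; have H j : hatm g a ^+ j.+1 = hatm (g *+ j.+1) (a ^+ j.+1).
 by elim: j => [|j IH]; rewrite ?expr1// exprS IH hatmM -mulrS -exprS.
exists k.+1; apply: (@hatm_eq0 (g *+ k.+1)); rewrite -H exprS hk mulr0//.
Qed.
End Hat.

(** * Irreducible graded Lie algebras of matrices *)

Section MatrixLie.
Variables (C : numClosedFieldType) (n : nat) (G : finZmodType).
Implicit Types (a b x y : 'M[C]_n) (g h : G) (S J M : G -> set 'M[C]_n).

Record mgr S : Prop := Mgr { mg0 : forall g, S g 0; mgD : forall g a b, S g a -> S g b -> S g (a + b);
 mgZ : forall g c a, S g a -> S g (c *: a); mgL : forall g h a b, S g a -> S h b -> S (g + h) (lb a b) }.
Definition mirr S := forall U : 'M[C]_n, (forall g a, S g a -> (U *m a <= U)%MS) -> U = 0 \/ (1%:M <= U)%MS.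
Definition mideal S J := [/\ mgr J, forall g, J g `<=` S g & forall g h a b, S g a -> J h b -> J (g + h) (lb a b)].
(** Matrices with a single eigenvalue: this is all that an Engel condition can give, since the
    adjoint action does not see scalars. *)
Definition snil a := exists l, nilm (a - l%:M).

Lemma lb_anti a b : lb a b = - lb b a. Proof. by rewrite /lb opprB. Qed.
Lemma lb_jacobi a b y : lb y (lb a b) = lb (lb y a) b + lb a (lb y b).
Proof. rewrite /lb !mulrBr !mulrBl !mulrA; set X1 := y * a * b; set X2 := y * b * a; set X3 := a * b * y; set X4 := b * a * y.
set X5 := a * y * b; set X6 := b * y * a;
by move: X1 X2 X3 X4 X5 X6 => X1 X2 X3 X4 X5 X6; apply/matrixP => i j; rewrite !mxE; ring. Qed.
(** Jacobson's theorem gives a nonzero common kernel; it is invariant because [S] normalises [W],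
    and irreducibility makes it everything. *)
Lemma normalized_nil_zero S (W : set 'M[C]_n) : mirr S -> weakly_closed W -> (forall a, W a -> nilm a) ->
 (forall g s w, S g s -> W w -> W (lb s w)) -> forall w, W w -> w = 0.
Proof.
move=> irr wW nW SW w Ww.
have [n0|n0] := posnP n; first by apply/matrixP => i; have := ltn_ord i; rewrite {2}n0.
have [v v0 vW] := common_kernel n0 wW nW.
have [||| m [B [_ HB]]] := @rowspace_of_pred C n (fun v => forall a, W a -> v *m a = 0).
- by move=> a _; rewrite mul0mx.
- by move=> u u' h h' a Wa; rewrite mulmxDl h// h'// addr0.
- by move=> c u h a Wa; rewrite -scalemxAl h// scaler0.
have BE : (<<B>> :=: B)%MS by exact: genmxE.
have [|h|h] := irr <<B>>%MS.
- move=> g s Ss; rewrite BE; have h : (<<B>> *m s <= B *m s)%MS by rewrite submxMr// BE.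
 apply: submx_trans h _; apply/rV_subP => u /submxP[D ->]; apply/HB => a Wa.
 have hD : D *m B *m a = 0 by exact: ((HB (D *m B)).2 (submxMl _ _)).
 have hD' : D *m B *m lb s a = 0 by apply: ((HB (D *m B)).2 (submxMl _ _)); exact: SW Ss Wa.
 move: hD'; rewrite lbE mulmxBr !mulmxA hD mul0mx subr0 => hD'.
 exact: hD'.
- by move/HB: vW; rewrite -BE h submx0 (negbTE v0).
- apply/row_matrixP => i; rewrite row0 rowE; apply: (HB _).2 => //.
 by rewrite -BE; exact: submx_trans (submx1 _) h.
Qed.

Inductive mder S : G -> 'M[C]_n -> Prop :=
| mder0 g : mder S g 0
| mderD g a b : mder S g a -> mder S g b -> mder S g (a + b)
| mderZ g c a : mder S g a -> mder S g (c *: a)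
| mderL g h a b : S g a -> S h b -> mder S (g + h) (lb a b).

Lemma mder_sub S : mgr S -> forall g a, mder S g a -> S g a.
Proof. by move=> [s0 sD sZ sL] g a; elim=> *; auto. Qed.
Lemma mder_ideal S J : mgr S -> mideal S J -> mideal S (mder J).
Proof.
move=> gS [gJ JS SJ]; have dJ := mder_sub gJ; split.
- split; [exact: mder0|exact: mderD|exact: mderZ|move=> g h a b Ja Jb; apply: mderL; exact: dJ].
- by move=> g a /dJ/JS.
- move=> g h a b Sa; elim=> {h b} [h|h b c _ IHb _ IHc|h c b _ IHb|h k b c Jb Jc].
 + by rewrite linear0; exact: mder0.
 + by rewrite linearD; exact: mderD.
 + by rewrite linearZ; exact: mderZ.
 + rewrite lb_jacobi; apply: mderD; first by rewrite addrA; apply: mderL => //; exact: SJ.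
 by rewrite addrCA; apply: mderL => //; exact: SJ.
Qed.
Lemma ideal_refl S : mgr S -> mideal S S.
Proof. by move=> gS; split=> [//|g a//|g h a b]; exact: (mgL gS). Qed.
Lemma central_scalar S a : mirr S -> (forall g s, S g s -> lb s a = 0) -> exists l, a = l%:M.
Proof.
move=> irr cen; have [n0|n0] := posnP n.
 by exists 0; apply/matrixP => i; have := ltn_ord i; rewrite {2}n0.
have /closed_rootP[l] : size (char_poly a) != 1%N by rewrite size_char_poly eqSS -lt0n.
rewrite -eigenvalue_root_char => /eigenvalueP[v va v0]; exists l.
have [g s Ss|h|h] := irr (eigenspace a l).
- apply/eigenspaceP; have := cen g s Ss; rewrite lbE => /eqP; rewrite subr_eq0 => /eqP h.
 by rewrite -mulmxA h mulmxA (eigenspaceP (submx_refl _)) -scalemxAl.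
- by move/eigenspaceP: va; rewrite h submx0 (negbTE v0).
- by move/eigenspaceP: h; rewrite mul1mx => ->; rewrite scalemx1.
Qed.
(** For [w = lb s b] the trace of [w] against its conjugate part becomes a trace against the bracket
    of [b] with that part, a polynomial in [w], and this bracket vanishes in an abelian ideal. So
    these [w] are nilpotent, hence zero; the ideal is central, scalar by Schur's lemma, and zero by
    [tr0]. *)
Lemma abelian_ideal_zero S J : mgr S -> mirr S -> (forall g a, S g a -> \tr a = 0) -> mideal S J ->
 (forall g h a b, J g a -> J h b -> lb a b = 0) -> forall g a, J g a -> a = 0.
Proof.
move=> gS irr tr0 [gJ JS SJ] ab g a Ja.
pose W : set 'M[C]_n := [set w | exists g h s b, [/\ S g s, J h b & w = lb s b]].
have WJ w : W w -> exists k, J k w by move=> [k [h [s [b [Ss Jb ->]]]]]; exists (k + h); exact: SJ.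
have W0 : forall w, W w -> w = 0.
 apply: (normalized_nil_zero irr).
 - move=> u v /WJ[k Ju] /WJ[k' Jv]; rewrite (ab _ _ _ _ Ju Jv); exists 0, 0, 0, 0.
 by split; [exact: mg0|exact: mg0|rewrite linear0].
 - move=> w Ww; have [k Jw] := WJ w Ww; have [k' [h [s [b [Ss Jb wE]]]]] := Ww.
 have [p [Hp _]] := conjugate_part w; apply: Hp.
 have cb := lb_pm_comm p (ab _ _ _ _ Jb Jw); move/eqP: cb; rewrite lbE subr_eq0 => /eqP cb.
 rewrite -[w * _]/(w *m _) {1}wE lbE mulmxBl raddfB /= -mulmxA cb mulmxA.
 by rewrite -[b *m s *m _]mulmxA [\tr (b *m _)]mxtrace_mulC subrr.
 - by move=> k s w Ss /WJ[h Jw]; exists k, h, s, w.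
have [l al] : exists l, a = l%:M.
 by apply: (central_scalar irr) => h s Ss; apply: W0; exists h, g, s, a.
have := tr0 g a (JS g a Ja); rewrite al mxtrace_scalar => /eqP; rewrite mulrn_eq0 => /orP[/eqP n0|/eqP->]; last by rewrite raddf0.
by apply/matrixP => i; have := ltn_ord i; rewrite {2}n0.
Qed.
(** A graded form of Cartan's criterion. The hypothesis concerns opposite degrees only; for the
    block matrices [hatm] traces in all other degrees vanish automatically, so the conjugate part,
    whose adjoint action mixes degrees, can be inserted. *)
Lemma trace_radical_derived M : mgr M -> (forall g a b, M g a -> M (- g) b -> \tr (a * b) = 0) ->
 forall g c, mder M g c -> nilm c.
Proof.
move=> gM tr0 g c dc; apply: (@hatm_nilm _ _ G g).
have [p [Hp Hq]] := conjugate_part (hatm g c); apply: Hp.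
have trh g1 g2 a b : M g1 a -> M g2 b -> \tr (hatm g1 a * hatm g2 b) = 0.
 move=> Ma Mb; rewrite hatmM hatm_tr; case: ifP => // /eqP e.
 by rewrite (tr0 g1)// ?mulr0//; move/eqP: e; rewrite addrC addr_eq0 => /eqP <-.
have Mc : M g c by exact: mder_sub.
set y := pm (hatm g c) p in Hq *.
have H h d : mder M h d -> \tr (hatm h d * y) = 0.
 elim=> {h d} [h|h a b _ IHa _ IHb|h k a _ IHa|g1 g2 a b Ma Mb].
 - by rewrite hatm0 mul0r mxtrace0.
 - by rewrite hatmD mulrDl raddfD /= IHa IHb addr0.
 - by rewrite hatmZ -[_ * y]/(_ *m y) -scalemxAl mxtraceZ IHa mulr0.
 - rewrite -hatm_lb; have [q qE] := Hq (hatm g2 b).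
 transitivity (- \tr (hatm g1 a * lb y (hatm g2 b))).
 rewrite /lb mulrBl mulrBr !raddfB /= opprK [RHS]addrC !mulrA; congr (_ - _).
 by rewrite -[in LHS]mulrA; exact: mxtrace_mulC.
 rewrite qE /pev -[hatm g1 a * _]/(hatm g1 a *m _) mulmx_sumr (big_morph (@mxtrace C _) (@mxtraceD C _) (mxtrace0 C _)) big1 ?oppr0// => i _.
 rewrite -scalemxAr mxtraceZ.
 have [k [e [Me ->]]] : exists k e, M k e /\ iter i (lb (hatm g c)) (hatm g2 b) = hatm k e.
 elim: (i : nat) => [|j [k [e [Me IH]]]]; first by exists g2, b.
 by exists (g + k), (lb c e); split; [exact: mgL|rewrite iterS IH hatm_lb].
 by rewrite (trh g1 k) ?mulr0.
exact: H.
Qed.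
Fixpoint derN i M := if i is i'.+1 then mder (derN i' M) else M.
Lemma derN_mgr i M : mgr M -> mgr (derN i M).
Proof. by elim: i => // i IH gM; have [] := mder_ideal (IH gM) (ideal_refl (IH gM)). Qed.
Lemma derN_sub i M : mgr M -> forall g a, derN i M g a -> M g a.
Proof. by move=> gM; elim: i => // i IH g a /(mder_sub (derN_mgr i gM)); exact: IH. Qed.
Lemma derN_add i j M : derN (i + j) M = derN i (derN j M).
Proof. by elim: i => // i; rewrite addSn /= => ->. Qed.

(** * Kreknin's theorem *)

Section Kreknin.
Variables (g0 : G) (N : nat).
Hypotheses (N0 : (0 < N)%N) (Ng0 : g0 *+ N = 0) (gen0 : forall g, exists k, g = g0 *+ k).

(** Homogeneous elements of the subalgebra generated by the components of indices [k] to [N - 1].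
    For [k = N] there are no generators and only 0 remains, which ends the induction. *)
Inductive mgen M (k : nat) : G -> 'M[C]_n -> Prop :=
| mgen0 g : mgen M k g 0
| mgenD g a b : mgen M k g a -> mgen M k g b -> mgen M k g (a + b)
| mgenZ g c a : mgen M k g a -> mgen M k g (c *: a)
| mgenL g h a b : mgen M k g a -> mgen M k h b -> mgen M k (g + h) (lb a b)
| mgenI j a : (k <= j < N)%N -> M (g0 *+ j) a -> mgen M k (g0 *+ j) a.

Lemma mgen_sub M k : mgr M -> forall g a, mgen M k g a -> M g a.
Proof. by move=> [s0 sD sZ sL] g a; elim=> *; auto. Qed.
(** Jacobi's identity reduces the bracket to generators [b] of index [j >= k]. For [j = k] the
    partner [y] has degree 0 and vanishes; for [j > k] it has index [N + k - j], again strictly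
    between [k] and [N]. *)
Lemma mgen_bracket M k : mgr M -> (forall a, M 0 a -> a = 0) -> (k < N)%N -> forall i b, mgen M k i b ->
 forall y, M (g0 *+ k - i) y -> mgen M k.+1 (g0 *+ k) (lb y b).
Proof.
move=> gM M0 kN i b; elim=> {i b} [g|g a b _ IHa _ IHb|g c a _ IHa|g h a b Ha IHa Hb IHb|j a /andP[kj jN] Ma] y My.
- by rewrite linear0; exact: mgen0.
- by rewrite linearD; apply: mgenD; [exact: IHa|exact: IHb].
- by rewrite linearZ; apply: mgenZ; exact: IHa.
- rewrite lb_jacobi; apply: mgenD.
 apply: IHb; rewrite (_ : _ - h = (g0 *+ k - (g + h)) + g); last by rewrite opprD addrA addrAC subrK.
 by apply: (mgL gM) => //; exact: mgen_sub Ha.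
 rewrite lb_anti -scaleN1r; apply/mgenZ/IHa.
 rewrite (_ : _ - g = (g0 *+ k - (g + h)) + h); last by rewrite opprD addrA subrK.
 by apply: (mgL gM) => //; exact: mgen_sub Hb.
- move: kj; rewrite leq_eqVlt => /orP[/eqP kj|kj].
 by move: My; rewrite kj subrr => /M0 ->; rewrite lb_anti linear0 oppr0; exact: mgen0.
 have e : g0 *+ k - g0 *+ j = g0 *+ (N + k - j).
 by rewrite mulrnBr ?mulrnDr ?Ng0 ?add0r// (leq_trans (ltnW jN))// leq_addr.
 have -> : g0 *+ k = g0 *+ (N + k - j) + g0 *+ j by rewrite -e subrK.
 rewrite e in My; apply: mgenL; apply: mgenI => //; last by rewrite kj.
 apply/andP; split; first by rewrite ltn_subRL ltn_add2r.
 by rewrite ltn_subLR ?(leq_trans (ltnW jN)) ?leq_addr// [(j + N)%N]addnC ltn_add2l.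
Qed.
(** Equals [2 ^ k - 1]: going from [k] to [k.+1] uses the previous length twice with one derivation
    in between. *)
Fixpoint kreknin_len k := if k is k'.+1 then (kreknin_len k' + (kreknin_len k').+1)%N else 0%N.

(** The inner derived algebra is generated by indices above [k], so by [mgen_bracket] its brackets
    of index [k.+1] come from higher components. Applying the induction hypothesis to the derived
    algebra then eliminates index [k.+1]. *)
Lemma kreknin_step k : (k < N)%N -> forall M, mgr M -> (forall a, M 0 a -> a = 0) ->
 forall g a, derN (kreknin_len k) M g a -> mgen M k.+1 g a.
Proof.
elim: k => [|k IH] kN M gM M0 g a.
 have [j ->] := gen0 g; have -> : g0 *+ j = g0 *+ (j %% N).
 by rewrite {1}(divn_eq j N) mulrnDr mulnC mulrnA Ng0 mul0rn add0r.
 have := ltn_pmod j N0; case: (j %% N)%N => [|i] iN /= Ma; last exact: mgenI.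
 by rewrite mulr0n in Ma; rewrite (M0 _ Ma); exact: mgen0.
rewrite /= derN_add /=; set f := kreknin_len k => Ha; have {}IH := IH (ltnW kN).
have gM1 := derN_mgr f gM; have M1M := derN_sub (i := f) gM.
have [gM2 M2M1 _] := mder_ideal gM1 (ideal_refl gM1).
have M2k h b : mder (derN f M) h b -> h = g0 *+ k.+1 -> mgen M k.+2 h b.
 elim=> {h b} [h|h b c _ IHb _ IHc|h c b _ IHb|h1 h2 b c Mb Mc] e.
 - exact: mgen0.
 - by apply: mgenD; [exact: IHb|exact: IHc].
 - by apply: mgenZ; exact: IHb.
 - rewrite e; apply: (mgen_bracket gM M0 kN (IH M gM M0 _ _ Mc)).
 by rewrite -e addrK; exact: M1M.
have : mgen (mder (derN f M)) k.+1 g a.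
 by apply: IH Ha => // b /M2M1/M1M/M0.
elim=> {g a Ha} [g|g a b _ IHa _ IHb|g c a _ IHa|g h a b _ IHa _ IHb|j a /andP[kj jN] Ma].
- exact: mgen0.
- exact: mgenD.
- exact: mgenZ.
- exact: mgenL.
- move: kj; rewrite leq_eqVlt => /orP[/eqP kj|kj]; first by apply: M2k; rewrite // kj.
 by apply: mgenI; rewrite ?kj//; exact/M1M/M2M1.
Qed.
Lemma kreknin M : mgr M -> (forall a, M 0 a -> a = 0) -> exists m, forall g a, derN m M g a -> a = 0.
Proof.
move=> gM M0; exists (kreknin_len N.-1) => g a; have lt : (N.-1 < N)%N by rewrite prednK.
move=> /(kreknin_step lt gM M0); rewrite prednK//.
elim=> {g a} [//|g a b _ -> _ ->|g c a _ ->|g h a b _ -> _ _|j a /andP[kj jN] Ma].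
- by rewrite addr0.
- by rewrite scaler0.
- by rewrite lb_anti linear0 oppr0.
- by have := leq_ltn_trans kj jN; rewrite ltnn.
Qed.
End Kreknin.

Lemma solvable_zero S m : mgr S -> mirr S -> (forall g a, S g a -> \tr a = 0) ->
 (forall g a, derN m S g a -> a = 0) -> forall g a, S g a -> a = 0.
Proof.
move=> gS irr tr0; elim: m => [//|m IH] H; apply: IH.
have id i : mideal S (derN i S) by elim: i => [|i IHi]; [exact: ideal_refl|exact: mder_ideal].
by apply: (abelian_ideal_zero gS irr tr0 (id m)) => g h a b Ja Jb; apply: (H (g + h)); exact: mderL.
Qed.
Definition good_grading S := (forall g a, S g a -> snil a) \/
 (exists g0 N, [/\ (0 < N)%N, g0 *+ N = 0, forall g, exists k, g = g0 *+ k & forall a, S 0 a -> snil a]).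

(** Trace-zero parts [S'] turn [snil] into nilpotency. If all components are nil, their union is
    weakly closed and vanishes. In the cyclic case the trace radical vanishes and contains the
    degree 0 part, so Kreknin's theorem makes [S'] solvable, hence zero. Then [S] consists of
    scalars, which are irreducible in dimension at most 1 only. *)
Theorem irreducible_matrices S : mgr S -> mirr S -> good_grading S -> (n <= 1)%N.
Proof.
move=> gS irr good; have [//|n1] := leqP n 1; have n0 : (0 < n)%N by exact: ltnW.
have nz : n%:R != 0 :> C by rewrite pnatr_eq0 -lt0n.
pose S' g : set 'M[C]_n := [set x | \tr x = 0 /\ exists l, S g (x + l%:M)].
have lbs a b l m : lb (a + l%:M) (b + m%:M) = lb a b.
 have z x k : lb x k%:M = 0 by rewrite lbE mul_scalar_mx mul_mx_scalar subrr.
 have D x u v : lb x (u + v) = lb x u + lb x v by exact: linearD.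
 by rewrite D z addr0 lb_anti D z addr0 -lb_anti.
have gS' : mgr S'.
 split.
 - by move=> g; split; [rewrite mxtrace0|exists 0; rewrite raddf0 addr0; exact: mg0].
 - move=> g a b [ta [l al]] [tb [m bm]]; split; first by rewrite mxtraceD ta tb addr0.
 by exists (l + m); rewrite raddfD /= addrACA; exact: mgD.
 - move=> g c a [ta [l al]]; split; first by rewrite mxtraceZ ta mulr0.
 by exists (c * l); rewrite -scale_scalar_mx -scalerDr; exact: mgZ.
 - move=> g h a b [ta [l al]] [tb [m bm]]; split; first by rewrite lbE raddfB /= mxtrace_mulC subrr.
 by exists 0; rewrite raddf0 addr0 -(lbs a b l m); exact: (mgL gS).
have irr' : mirr S'.
 move=> U sU; apply: irr => g a Sa; have h : S' g (a - (\tr a / n%:R)%:M).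
 split; first by rewrite raddfB /= mxtrace_scalar -[_ *+ n]mulr_natr divfK// subrr.
 by exists (\tr a / n%:R); rewrite subrK.
 rewrite -[a](subrK (\tr a / n%:R)%:M) mulmxDr mul_mx_scalar.
 by apply: addmx_sub; [exact: sU h|exact: scalemx_sub].
have tr0 g a : S' g a -> \tr a = 0 by case.
have nil g a : (forall b, S g b -> snil b) -> S' g a -> nilm a.
 move=> sn [ta [l /sn[m hm]]]; have := mxtrace_nilm hm; rewrite -addrA -raddfB mxtraceD ta add0r mxtrace_scalar.
 move=> /eqP; rewrite mulrn_eq0 eqn0Ngt n0 /= => /eqP lm.
 by move: hm; rewrite -addrA -raddfB lm raddf0 addr0.
suff Z : forall g a, S' g a -> a = 0.
 have sc g a : S g a -> exists l, a = l%:M.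
 move=> Sa; exists (\tr a / n%:R); apply: subr0_eq; apply: (Z g); split.
 by rewrite raddfB /= mxtrace_scalar -[_ *+ n]mulr_natr divfK// subrr.
 by exists (\tr a / n%:R); rewrite subrK.
 pose i0 := Ordinal n0; have [g a /sc[l ->]|h|h] := irr (delta_mx i0 i0).
 - by rewrite mul_mx_scalar; exact: scalemx_sub.
 - by have := mxrank_delta C i0 i0; rewrite h mxrank0.
 - by have := mxrankS h; rewrite mxrank1 mxrank_delta leqNgt n1.
case: good => [good|[g0 [N [N0 Ng0 gen0 good]]]].
 move=> g a Sa; pose W := [set w | exists g, S' g w]; apply: (normalized_nil_zero irr' (W := W)); last by exists g.
 - by move=> x y [h Sx] [k Sy]; exists (h + k); exact: (mgL gS').
 - by move=> x [h]; apply: nil; exact: good.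
 - by move=> h x y Sx [k Sy]; exists (h + k); exact: (mgL gS').
pose M g : set 'M[C]_n := [set x | S' g x /\ forall y, S' (- g) y -> \tr (x * y) = 0].
have idM : mideal S' M.
 have cl g h x y : S' g x -> M h y -> M (g + h) (lb x y).
 move=> Sx [Sy Hy]; split; first exact: (mgL gS').
 move=> z Sz; have : \tr (y * lb z x) = 0.
 have e : - h = - (g + h) + g by rewrite opprD addrAC addNr add0r.
 by apply: Hy; rewrite e; exact: (mgL gS').
 rewrite /lb -[y * _]/(y *m _) mulmxBr raddfB /= => /eqP; rewrite subr_eq0 => /eqP e.
 have e2 : \tr (x * (y * z)) = \tr (y * (z * x)) by rewrite [in RHS]mulrA; exact: mxtrace_mulC.
 by rewrite mulrBl raddfB /= -!mulrA e2; apply/eqP; rewrite subr_eq0; apply/eqP; exact: e.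
 split=> //; last by move=> g x [].
 split.
 - by move=> g; split=> [|y _]; [exact: mg0|rewrite mul0r mxtrace0].
 - move=> g x y [Sx Hx] [Sy Hy]; split=> [|z Sz]; first exact: mgD.
 by rewrite mulrDl mxtraceD Hx// Hy// addr0.
 - move=> g c x [Sx Hx]; split=> [|z Sz]; first exact: mgZ.
 by rewrite -[_ * z]/(_ *m z) -scalemxAl mxtraceZ Hx// mulr0.
 - by move=> g h x y [Sx _]; exact: cl.
have [gM MS SM] := idM.
have dM0 h b : mder M h b -> b = 0.
 move=> db; pose W := [set w | exists g, mder M g w]; apply: (normalized_nil_zero irr' (W := W)); last by exists h.
 - by move=> x y [g1 /(mder_sub gM) Mx] [g2 /(mder_sub gM) My]; exists (g1 + g2); exact: mderL.
 - move=> x [g1]; apply: (trace_radical_derived gM) => g2 u v [Su Hu] [Sv _]; exact: Hu.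
 - by move=> g1 x y Sx [g2 My]; exists (g1 + g2); have [_ _] := mder_ideal gS' idM; apply.
have M0 : forall g a, M g a -> a = 0.
 by apply: (abelian_ideal_zero gS' irr' tr0 idM) => g1 g2 x y Mx My; apply: (dM0 (g1 + g2)); exact: mderL.
(* Long products in the nil algebra [S' 0] vanish, so each [x * y] is nilpotent and has trace zero:
   [x] lies in the trace radical. *)
have S0 x : S' 0 x -> x = 0.
 move=> Sx; apply: (M0 0); split=> // y; rewrite oppr0 => Sy.
 have nW w : S' 0 w -> nilm w by exact: nil.
 have wW : weakly_closed (S' 0) by move=> u v Su Sv; have := mgL gS' Su Sv; rewrite addr0.
 have [N' HN] := engel_words wW nW.
 apply: mxtrace_nilm; exists N'.
 have lw k : exists w : seq 'M[C]_n, [/\ size w = (k + k)%N, letters (S' 0) w & wprod w = (x * y) ^+ k].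
 elim: k => [|k [w [sw Lw wE]]]; first by exists [::]; split.
 exists [:: x, y & w]; split; first by rewrite /= sw addnS.
 by move=> u; rewrite !inE => /or3P[/eqP->|/eqP->|/Lw].
 by rewrite /= wE exprS mulrA.
 by have [w [sw Lw <-]] := lw N'; rewrite (ann_total HN Lw)// sw leq_addr.
have [m Hm] := kreknin N0 Ng0 gen0 gS' S0.
exact: (solvable_zero gS' irr' tr0 Hm).
Qed.
End MatrixLie.

(** * Nilpotency of brackets without irreducibility *)

Section BlockReduction.
Variables (C : numClosedFieldType) (G : finZmodType).

Lemma mder_image n n' (S : G -> set 'M[C]_n) (P : 'M[C]_n -> Prop) (f : 'M[C]_n -> 'M[C]_n') :
 mgr S -> good_grading S -> linear f -> (forall l, f l%:M = l%:M) -> (forall l, P l%:M) ->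
 (forall g a, S g a -> P a) -> (forall a b, P a -> P b -> [/\ P (a * b), P (a - b) & f (a * b) = f a * f b]) ->
 let S' g := f @` S g in
 [/\ mgr S', good_grading S' & forall g c, mder S g c -> mder S' g (f c)].
Proof.
move=> gS good lf f1 P1 SP Pf S'.
have f0 : f 0 = 0 by have := f1 0; rewrite !raddf0.
have fD a b : f (a + b) = f a + f b by have := lf 1 a b; rewrite !scale1r.
have fZ c a : f (c *: a) = c *: f a by have := lf c a 0; rewrite !addr0 f0 addr0.
have fB a b : f (a - b) = f a - f b by rewrite -scaleN1r fD fZ scaleN1r.
have flb a b : P a -> P b -> f (lb a b) = lb (f a) (f b).
 by move=> Pa Pb; rewrite /lb fB; have [_ _ ->] := Pf a b Pa Pb; have [_ _ ->] := Pf b a Pb Pa.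
have fX a k : P a -> P (a ^+ k) /\ f (a ^+ k) = f a ^+ k.
 move=> Pa; elim: k => [|k [IH1 IH2]]; first by rewrite !expr0; split; [exact: P1|exact: f1].
 by rewrite !exprS; have [? _ ->] := Pf a (a ^+ k) Pa IH1; rewrite IH2.
have sn g a : S g a -> snil a -> snil (f a).
 move=> Sa [l [k hk]]; exists l, k; rewrite -f1 -fB.
 have Pal : P (a - l%:M) by have [] := Pf a l%:M (SP g a Sa) (P1 l).
 by rewrite -(fX _ k Pal).2 hk f0.
split.
- split.
 + by move=> g; exists 0; [exact: mg0|].
 + by move=> g _ _ [a Sa <-] [b Sb <-]; exists (a + b); [exact: mgD|].
 + by move=> g c _ [a Sa <-]; exists (c *: a); [exact: mgZ|].
 + move=> g h _ _ [a Sa <-] [b Sb <-]; exists (lb a b); first exact: (mgL gS).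
 by apply: flb; [exact: SP Sa|exact: SP Sb].
- case: good => [good|[g0 [N [N0 Ng gen good]]]]; [left|right; exists g0, N; split=> //].
 by move=> g _ [a Sa <-]; apply: (sn g) => //; exact: good Sa.
 by move=> _ [a Sa <-]; apply: (sn 0) => //; exact: good Sa.
- move=> g c; elim=> {g c} [g|g a b _ IHa _ IHb|g c a _ IHa|g h a b Sa Sb].
 + by rewrite f0; exact: mder0.
 + by rewrite fD; exact: mderD.
 + by rewrite fZ; exact: mderZ.
 + by rewrite flb; [apply: mderL; [exists a|exists b]|exact: SP Sa|exact: SP Sb].
Qed.
(** A proper invariant subspace [U] yields the restriction [f1] to [U] and the action [f2] on the
    quotient, both of smaller size; nilpotency of both gives nilpotency with the sum of the
    exponents. In the irreducible case the size is at most 1, where brackets vanish. *)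
Lemma mder_nil n (S : G -> set 'M[C]_n) : mgr S -> good_grading S -> forall g c, mder S g c -> nilm c.
Proof.
elim/ltn_ind: n S => n IH S gS good g c dc.
have [irr|nirr] := EM (mirr S).
 have n1 := irreducible_matrices gS irr good.
 suff -> : c = 0 by exists 1%N; rewrite expr1.
 elim: dc => [//|_ a b _ -> _ ->|_ k a _ ->|_ _ a b _ _]; rewrite ?addr0 ?scaler0//.
 clear -n1; case: n n1 a b => [|[|//]] _ a b; first by apply/matrixP => -[].
 by apply/matrixP => i j; rewrite !ord1 !mxE !big_ord1 mulrC subrr.
have [U [sU U0 U1]] : exists U : 'M[C]_n, [/\ forall g a, S g a -> (U *m a <= U)%MS, U <> 0 & ~ (1%:M <= U)%MS].
 apply: contrapT => H; apply: nirr => U sU; apply: contrapT => h; apply: H; exists U.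
 by split=> // h'; apply: h; [left|right].
pose P (a : 'M[C]_n) := (U *m a <= U)%MS.
have P1 l : P l%:M by rewrite /P mul_mx_scalar scalemx_sub.
have PP a b : P a -> P b -> P (a * b) /\ P (a - b).
 move=> Pa Pb; split; first by rewrite /P [a * b]/(a *m b) mulmxA; exact: submx_trans (submxMr _ Pa) Pb.
 by rewrite /P mulmxBr; apply: addmx_sub; rewrite ?eqmx_opp.
pose B := row_base U; have fB : row_free B by exact: row_base_free.
have BU : (B :=: U)%MS by exact: eq_row_base.
pose f1 a := B *m a *m pinvmx B.
have Bf a : P a -> f1 a *m B = B *m a.
 move=> Pa; rewrite /f1 mulmxKpV// BU; have h : (B *m a <= U *m a)%MS by rewrite submxMr// BU.
 exact: submx_trans h Pa.
have r1 : (\rank U < n)%N.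
 by rewrite ltn_neqAle rank_leq_row andbT; apply/negP => /eqP h; apply: U1; rewrite sub1mx /row_full h.
have r2 : (\rank (cokermx U) < n)%N.
 rewrite mxrank_coker ltn_subrL; apply/andP; split; last exact: leq_ltn_trans r1.
 by rewrite lt0n mxrank_eq0; exact/eqP.
have [q [Q [qn fQ QU]]] : exists q (Q : 'M[C]_(n, q)), [/\ (q < n)%N, row_full Q &
 forall p (x : 'M[C]_(p, n)), (x <= U)%MS = (x *m Q == 0)].
 exists (\rank (cokermx U)), (col_base (cokermx U)); split=> // [|p x]; first exact: col_base_full.
 rewrite submxE -{1}(mulmx_base (cokermx U)) mulmxA; apply/eqP/eqP => [h|->]; last by rewrite mul0mx.
 by apply: (row_free_inj (row_base_free (cokermx U))); rewrite mul0mx.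
have [Q' hQ] : exists Q', Q' *m Q = 1%:M by exists (pinvmx Q); exact: mulVpmx.
pose f2 a := Q' *m a *m Q.
have Qf a : P a -> Q *m f2 a = a *m Q.
 move=> Pa; apply/eqP; rewrite /f2 !mulmxA -subr_eq0 -mulmxBl.
 have -> : Q *m Q' *m a - a = (Q *m Q' - 1%:M) *m a by rewrite mulmxBl mul1mx.
 rewrite -QU.
 apply: submx_trans Pa; apply: submxMr; by rewrite QU mulmxBl mul1mx -mulmxA hQ mulmx1 subrr.
have [|||gS1 good1 d1] := mder_image gS good (P := P) (f := f1) _ _ P1 sU.
- by move=> k u v; rewrite /f1 mulmxDr mulmxDl -scalemxAr -scalemxAl.
- by move=> l; rewrite /f1 mul_mx_scalar -scalemxAl mulmxVp// scalemx1.
- move=> a b Pa Pb; have [h1 h2] := PP a b Pa Pb; split=> //.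
 apply: (row_free_inj fB); rewrite (Bf _ h1); transitivity (f1 a *m (f1 b *m B)); last by rewrite (mulmxA (f1 a)).
 by rewrite (Bf b Pb) (mulmxA (f1 a) B b) (Bf a Pa) -(mulmxA B a b).
have [|||gS2 good2 d2] := mder_image gS good (P := P) (f := f2) _ _ P1 sU.
- by move=> k u v; rewrite /f2 mulmxDr mulmxDl -scalemxAr -scalemxAl.
- by move=> l; rewrite /f2 mul_mx_scalar -scalemxAl hQ scalemx1.
- move=> a b Pa Pb; have [h1 h2] := PP a b Pa Pb; split=> //.
 apply: (row_full_inj fQ); rewrite (Qf _ h1); transitivity (Q *m f2 a *m f2 b); last by rewrite -(mulmxA Q).
 by rewrite (Qf a Pa) -(mulmxA a Q) (Qf b Pb) (mulmxA a b Q).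
have [k1 hk1] := IH _ r1 _ gS1 good1 _ _ (d1 _ _ dc).
have [k2 hk2] := IH _ qn _ gS2 good2 _ _ (d2 _ _ dc).
have Pc : P c := sU g c (mder_sub gS dc).
exists (k2 + k1)%N; rewrite exprD.
have h1 k : B *m c ^+ k = f1 c ^+ k *m B.
 elim: k => [|k IHk]; first by rewrite !expr0 mulmx1 mul1mx.
 transitivity (f1 c *m (f1 c ^+ k *m B)); last by rewrite (mulmxA (f1 c)) exprS.
 by rewrite -IHk (mulmxA (f1 c) B (c ^+ k)) (Bf c Pc) -(mulmxA B c) exprS.
have h2 k : c ^+ k *m Q = Q *m f2 c ^+ k.
 elim: k => [|k IHk]; first by rewrite !expr0 mulmx1 mul1mx.
 transitivity (Q *m f2 c ^+ k *m f2 c); last by rewrite -(mulmxA Q) exprSr.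
 by rewrite -IHk -(mulmxA (c ^+ k) Q) (Qf c Pc) (mulmxA (c ^+ k) c Q) exprSr.
have : (c ^+ k2 <= B)%MS by rewrite BU QU h2 hk2 mulmx0.
move=> /submxP[D Dc]; transitivity (D *m (B *m c ^+ k1)); first by rewrite (mulmxA D B) -Dc.
by rewrite h1 hk1 mul0mx mulmx0.
Qed.
Lemma no_eigen_nilm n (m : 'M[C]_n) : (forall v : 'rV[C]_n, forall l, v != 0 -> v *m m = l *: v -> l = 0) -> nilm m.
Proof.
case: n m => [|n] m H; first by exists 0%N; apply/matrixP => -[].
have [s sE] := closed_field_poly_normal (char_poly m).
have s0 z : z \in s -> z = 0.
 move=> zs; have : root (char_poly m) z.
 by rewrite sE (monicP (char_poly_monic m)) scale1r root_prod_XsubC.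
 by rewrite -eigenvalue_root_char => /eigenvalueP[v vm v0]; exact: H vm.
exists (size s); have := Cayley_Hamilton m; rewrite sE (monicP (char_poly_monic m)) scale1r.
rewrite big_seq (eq_bigr (fun=> 'X)) => [|z /s0->]; last by rewrite subr0.
by rewrite -big_seq big_const_seq count_predT iter_mulr_1 rmorphXn /= horner_mx_X.
Qed.
End BlockReduction.

(** * Engel elements in irreducible algebras *)

Section Representation.
Variables (R : realType) (E : banach R) (V : set E) (r : nat) (e : 'I_r -> E).
Hypothesis fb : fbasis V e.
Implicit Types (a b : bop E).

Variable G : finZmodType.
Variable F : G -> set (BL E).
Hypotheses (sF : forall g, subsp (F g)) (FV : forall g (a : bop E), F g a -> forall x, V x -> V (a x)).
Hypothesis FL : forall g h (a b : bop E), F g a -> F h b -> F (g + h) (a * b - b * a).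
Definition rep g : set 'M[R[i]]_r := [set mxof e a | a in (F g : set (bop E))].
Lemma mxof_lb a b : (forall x, V x -> V (a x)) -> (forall x, V x -> V (b x)) -> lb (mxof e a) (mxof e b) = mxof e (b * a - a * b).
Proof.
move=> Va Vb; apply/esym/(mxof_eq fb) => c.
by rewrite subbE !mulbE !(mxofP fb)// -combB /lb mulmxBr !mulmxA.
Qed.
Lemma rep_mgr : mgr rep.
Proof.
split.
- by move=> g; exists 0; [exact: (ss0 (sF g))|apply: (mxof_eq fb) => c; rewrite mulmx0 comb0].
- move=> g _ _ [a Fa <-] [b Fb <-]; exists (a + b); first exact: (ssD (sF g)).
 by apply: (mxof_eq fb) => c; rewrite mulmxDr combD addbE !(mxofP fb)//; by first [exact: (FV Fa)|exact: (FV Fb)].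
- move=> g k _ [a Fa <-]; exists (k *: a); first exact: (ssZ (sF g)).
 by apply: (mxof_eq fb) => c; rewrite -scalemxAr combZ scalebE (mxofP fb)//; exact: (FV Fa).
- move=> g h _ _ [a Fa <-] [b Fb <-]; exists (b * a - a * b); first by rewrite addrC; exact: FL.
 by rewrite mxof_lb//; first [exact: (FV Fa)|exact: (FV Fb)].
Qed.
End Representation.

Section Engel.
Variables (R : realType) (E : banach R).
Implicit Types (a b : bop E) (S : bop E -> Prop).

(** A pointwise Engel condition, with a constant depending on [x]. It follows from quasinilpotence
    of the adjoint action and passes to operators induced on subquotients. *)
Definition loceng S a := forall x, S x -> forall e : R, 0 < e ->
 exists M : R, forall n, bn ((liebr a ^+ n) (x : BL E)) <= M * e ^+ n.

Lemma qnil_eigen a (l : R[i]) x : qnil a -> x != 0 -> a x = l *: x -> l = 0.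
Proof.
move=> qa x0 ax; apply: contrapT => /eqP l0.
have l1 : 0 < nc l by rewrite nc_gt0.
have l2 : 0 < nc l / 2 by rewrite divr_gt0.
have [M M0 HM] := qa (nc l / 2) l2.
have ln n : (a ^+ n) x = l ^+ n *: x.
 by elim: n => [|n IH]; [rewrite !expr0 scale1r|rewrite expbSE IH bopZ ax scalerA -exprSr].
have bx : 0 < bn x by rewrite bn_gt0.
have [n Hn] := @half_small R (M + 1)^-1 ltac:(by rewrite invr_gt0; lra).
have := Hn n (leqnn n) => h.
have := le_trans (opnP (a ^+ n) x) (ler_wpM2r (ltW bx) (HM n)).
rewrite ln bnZ ncX ler_pM2r// exprMn mulrCA -[leLHS]mulr1 ler_pM2l ?exprn_gt0// => h2.
have m1 : 0 < M + 1 by lra.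
have h3 : M * 2^-1 ^+ n < 1.
 apply: (@le_lt_trans _ _ ((M + 1) * 2^-1 ^+ n)); first by apply: ler_wpM2r; [rewrite exprn_ge0// invr_ge0|lra].
 by rewrite mulrC -ltr_pdivlMr// mul1r.
by rewrite leNgt h3 in h2.
Qed.
(** Modulo the generalised eigenspace [K] the operator [al - a] is bounded below by some [d > 0]. If
    [x y] were outside [K], the iterated brackets of [a] with [x] would grow at least like [d ^+ n],
    against the Engel bound for the ratio [d / 2]. *)
Lemma engel_invariant S a (al : R[i]) p : cpt a -> al != 0 ->
 (forall n x, (shft al a ^+ n) x = 0 -> (shft al a ^+ p) x = 0) -> loceng S a ->
 forall x y, S x -> (shft al a ^+ p) y = 0 -> (shft al a ^+ p) (x y) = 0.
Proof.
move=> ca al0 asc le x y Sx Ty; set T := shft al a.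
pose K := kerb (T ^+ p); have sK : subsp K by exact: kerb_subsp.
have sE : subsp (@setT E) by split.
have [Q [q qP]] := subquotient sE (fun _ _ => I) sK (kerb_closd (a := T ^+ p)) (fun _ _ => I).
have Ta n z : (T ^+ n) (a z) = a ((T ^+ n) z).
 by rewrite -!mulbE; congr (bfun _ z); apply/esym/commrX; apply/commr_sym; exact: shiftop_comm.
have stA : stab setT K a by split=> // z Kz; rewrite /K/kerb/= Ta Kz bop0.
pose a' := induced sE sK (fun _ _ => I) qP a.
have a'E z : a' (q z) = q (a z) by exact: inducedE.
have qT z : q (T z) = shft al a' (q z).
 by rewrite !shiftE a'E (sqB sE sK qP)// (sqZ sE sK qP).
have q0 z : q z = 0 <-> K z by exact: (sq_ker qP).
have [d d0 Hd] : exists2 d : R, 0 < d & forall z, d * bn z <= bn (shft al a' z).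
 apply: inj_bounded_below => //; first exact: induced_cpt.
 move=> z; have [w _ <-] := sq_onto qP z; rewrite a'E => e.
 apply/q0; apply: (asc p.+1); rewrite exprSr mulbE; apply/q0.
 by rewrite qT shiftE a'E e subrr.
pose xm m : bop E := (liebr a ^+ m) (x : BL E).
have xS m : xm m.+1 = a * xm m - xm m * a by rewrite /xm exprS; exact: liebrE.
have xmS m z : q (T (xm m z)) = q (xm m (T z)) - q (xm m.+1 z).
 rewrite -(sqB sE sK qP)//; congr q.
 by rewrite xS [(a * _ - _) z]subbE !mulbE /T !shiftE bopB bopZ opprB addrA subrK.
suff H j : forall m z, (T ^+ j) z = 0 -> q (xm m z) = 0 by have := H p 0%N y Ty; rewrite /xm expr0 => /q0.
elim: j => [|j IH] m z; first by rewrite expr0 => /= ->; rewrite bop0; apply/q0; exact: (ss0 sK).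
rewrite exprSr mulbE => /IH Hz; apply: bn_small => c c0.
have grow m' : d * bn (q (xm m' z)) <= bn (q (xm m'.+1 z)).
 by apply: le_trans (Hd _) _; rewrite -qT xmS Hz sub0r bnN.
have growk k : d ^+ k * bn (q (xm m z)) <= bn (q (xm (m + k)%N z)).
 elim: k => [|k IHk]; first by rewrite addn0 expr0 mul1r.
 rewrite addnS exprS -mulrA; apply: le_trans (grow _); rewrite ler_pM2l//.
have d2 : 0 < d / 2 by rewrite divr_gt0.
have [M HM] := le x Sx (d / 2) d2.
pose c' := M * (d / 2) ^+ m * bn z.
have bd k : bn (q (xm m z)) <= c' * 2^-1 ^+ k.
 rewrite -(ler_pM2l (exprn_gt0 k d0)); apply: le_trans (growk k) _.
 apply: le_trans (sq_le qP I) _; apply: opnP_le.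
 apply: le_trans (ler_wpM2r (bn_ge0 z) (HM _)) _.
 by rewrite exprD [(d / 2) ^+ k]exprMn /c' le_eqVlt; apply/orP; left; apply/eqP; ring.
have c1 : 0 < c / (`|c'| + 1) by rewrite divr_gt0// ltr_wpDl.
have [k Hk] := @half_small R _ c1.
have := Hk k (leqnn k); rewrite ltr_pdivlMr ?ltr_wpDl// => h.
apply: le_trans (bd k) _; apply: le_trans (ltW h).
have : (0 : R) <= 2^-1 ^+ k by rewrite exprn_ge0 ?invr_ge0.
set t := _ ^+ k => t0; rewrite mulrC; apply: ler_wpM2l => //; have := ler_norm c'; lra.
Qed.
(** A nonzero eigenvalue has an invariant generalised eigenspace, which is then the whole space. A
    power of [al - a] is therefore zero, so a nonzero scalar is a compact operator and the dimension
    is finite. *)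
Lemma engel_irred S a : irred S -> cpt a -> loceng S a -> qnil a \/
 (exists r (e : 'I_r -> E), fbasis setT e) /\ exists (al : R[i]) p, forall x, (shft al a ^+ p) x = 0.
Proof.
move=> irr ca le; have [H|H] := EM (exists al, al != 0 /\ eigenval a al); last first.
 by left; apply: qnil_no_eigen => // z z0 ez; apply: H; exists z.
right; have [al [al0 [x x0 ax]]] := H; have [p asc] := riesz_ascent ca al0.
have [K0|KT] := irr (kerb (shft al a ^+ p)) (kerb_subsp _) (kerb_closd (a := _)) (fun b y Sb Ky => engel_invariant ca al0 asc le Sb Ky).
 exfalso; move/eqP: x0; apply; apply: K0; apply: (asc 1%N).
 by rewrite expr1 shiftE ax subrr.
split; last by exists al, p.
apply: fin_dim; first by split.
move=> u Hu; have [k ck kE] := shiftopX al p ca.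
have k1 y : y = (al ^+ p)^-1 *: k y.
 have := KT y; rewrite /kerb/= kE shiftE => /eqP; rewrite subr_eq0 => /eqP <-.
 by rewrite scalerA mulVf ?scale1r// expf_neq0.
have [l Hl] := cptP ck (fun n => (Hu n).2).
by exists ((al ^+ p)^-1 *: l); apply: (ulim_ext (ulimZ (al ^+ p)^-1 Hl)) => n; rewrite -k1.
Qed.

Variable G : finZmodType.
(** Both hypotheses of the theorem in one disjunction, so that the reductions to quotients are
    carried out once. *)
Definition egood (Lg : G -> set (BL E)) (S : bop E -> Prop) := (forall g (a : bop E), Lg g a -> loceng S a) \/
 (exists g0 N, [/\ (0 < N)%N, g0 *+ N = 0, forall g : G, exists k, g = g0 *+ k & forall a : bop E, Lg 0 a -> loceng S a]).

(** Either alternative of [engel_irred] makes the matrix of an Engel operator nilpotent up to a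
    scalar, which is what the matrix theorem asks for. *)
Lemma fd_irred (Lg : G -> set (BL E)) r (e : 'I_r -> E) : graded Lg -> irred (homog Lg) -> egood Lg (homog Lg) ->
 fbasis setT e -> (r <= 1)%N.
Proof.
move=> gr irr good fb.
have gS : mgr (rep e Lg) by apply: (rep_mgr fb) => //; [exact: (gr_sub gr)|move=> g h a b; exact: (gr_lie gr)].
apply: (irreducible_matrices gS).
 move=> U sU; pose M : set E := [set comb e c | c in [set c : 'rV[R[i]]_r | (c <= U)%MS]].
 have sM : subsp M.
 split; first by exists 0; rewrite /= ?sub0mx ?comb0.
 by move=> _ _ [c cU <-] [d dU <-]; exists (c + d); rewrite /= ?combD ?addmx_sub.
 by move=> k _ [c cU <-]; exists (k *: c); rewrite /= ?combZ ?scalemx_sub.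
 have [s [f [_ fM _]]] := fbasis_sub fb sM (fun _ _ => I).
 have [|H|H] := irr M sM (fin_dim_closd fM).
 - move=> a _ [g La] [c cU <-]; exists (c *m mxof e a); last by rewrite (mxofP fb).
 apply: submx_trans (submxMr _ cU) _; apply: (sU g); by exists a.
 - left; apply/row_matrixP => i; rewrite row0; apply: (fb_free fb); apply: H.
 by exists (row i U) => //=; exact: row_sub.
 - right; apply/row_subP => i; have [c cU ce] := H (comb e (row i 1%:M)).
 by rewrite -(comb_inj fb ce).
have sn g (a : bop E) : Lg g a -> loceng (homog Lg) a -> snil (mxof e a).
 move=> La le; have cl := mxofP fb (a := a) (fun _ _ => I).
 have [qa|[_ [al [p Hp]]]] := engel_irred irr (gr_cpt gr La) le.
 exists 0; rewrite raddf0 subr0; apply: no_eigen_nilm => v l v0 vl.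
 apply: (qnil_eigen qa (x := comb e v)); last by rewrite cl vl combZ.
 by apply: contra v0 => /eqP h; apply/eqP/(fb_free fb).
 exists al, p; apply/row_matrixP => i; rewrite row0 rowE; apply: (fb_free fb).
 have hc k c : comb e (c *m (mxof e a - al%:M) ^+ k) = (-1) ^+ k *: (shft al a ^+ k) (comb e c).
 elim: k c => [|k IH] c; first by rewrite !expr0 mulmx1 scale1r.
 have -> : c *m (mxof e a - al%:M) ^+ k.+1 = c *m (mxof e a - al%:M) *m (mxof e a - al%:M) ^+ k by rewrite exprS -mulmxA.
 have e1 : comb e (c *m (mxof e a - al%:M)) = -1 *: shft al a (comb e c).
 by rewrite mulmxBr mul_mx_scalar combB combZ shiftE cl scaleN1r opprB.
 by rewrite IH e1 bopZ scalerA -exprSr -mulbE -exprSr.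
 by rewrite hc Hp scaler0.
case: good => [good|[g0 [N [N0 Ng gen good]]]]; [left|right; exists g0, N; split=> //].
 by move=> g _ [a La <-]; apply: (sn g) => //; exact: good La.
by move=> _ [a La <-]; apply: (sn 0) => //; exact: good La.
Qed.
End Engel.

(** * Nil algebras of finite rank normalised by an irreducible Lie algebra *)

Section NilAlgebra.
Variables (R : realType) (E : banach R).
Local Notation C := (R[i]).
Implicit Types (a b l m s t : bop E) (u v w : seq (bop E)) (x y z : E).

Definition bw w : bop E := foldr (fun a b => a * b) 1 w.
Lemma bw_cat u v : bw (u ++ v) = bw u * bw v.
Proof. by elim: u => [|a u IH] /=; rewrite ?mul1r// IH mulrA. Qed.
Lemma bw_cons a w : bw (a :: w) = a * bw w. Proof. by []. Qed.
Lemma bw_rcons w a : bw (rcons w a) = bw w * a.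
Proof. by rewrite -cats1 bw_cat; congr (_ * _); exact: mulr1. Qed.
Lemma bw_nseq n l : bw (nseq n l) = l ^+ n.
Proof. by elim: n => [|n IH]; rewrite ?expr0// exprS -IH. Qed.
Lemma liebr_pow l n a : ((liebr l ^+ n) (a : BL E) : bop E) =
 \sum_(i < n.+1) (((-1) ^+ i * 'C(n, i)%:R : C) *: (l ^+ (n - i) * a * l ^+ i)).
Proof.
have c : GRing.comm (conj_op l 1) (conj_op 1 l).
 by apply: bop_eq => y; rewrite !mulbE /= !mulr1 !mul1r mulrA.
have p1 k (y : BL E) : ((conj_op l 1 ^+ k) y : bop E) = l ^+ k * y.
 by elim: k y => [|k IH] y; rewrite ?expr0 ?mul1r// exprS mulbE /= IH mulr1 mulrA -exprS.
have p2 k (y : BL E) : ((conj_op 1 l ^+ k) y : bop E) = (y : bop E) * l ^+ k.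
 by elim: k y => [|k IH] y; rewrite ?expr0 ?mulr1// exprSr mulbE /= IH mul1r -mulrA -exprS.
rewrite /liebr (exprBn_comm n c) sumbE; apply: eq_bigr => i _.
have sgn (T : bop (BL E)) : (-1) ^+ i * T = (-1 : C) ^+ i *: T.
 by elim: (i : nat) => [|j IH]; rewrite ?expr0 ?mul1r ?scale1r// !exprS -mulrA IH mulN1r -scalerA scaleN1r.
rewrite -scaler_nat -mulrA sgn scalerA mulrC scalebE mulbE p1 p2.
by rewrite mulrA mulrC.
Qed.
(** Derivative at [c = 0] of the [n]-th power of [l + c m]: the sum of the words with one letter [m]
    and all other letters [l]. *)
Fixpoint first_order l m n : bop E := if n is k.+1 then m * l ^+ k + l * first_order l m k else 0.
Lemma first_orderP l m n : exists2 K : R, 0 <= K & forall c : R, 0 <= c <= 1 ->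
 opn ((l + c%:C%C *: m) ^+ n - (l ^+ n + c%:C%C *: first_order l m n)) <= K * c ^+ 2.
Proof.
elim: n => [|n [K K0 IH]].
 by exists 0 => // c _; rewrite !expr0 scaler0 addr0 subrr mul0r; apply: opn_le => // x; rewrite zerobE bn0 mul0r.
exists (opn m * opn (first_order l m n) + (opn l + opn m) * K).
 by rewrite addr_ge0 ?mulr_ge0 ?addr_ge0 ?opn_ge0.
move=> c /andP[c0 c1]; have := IH c; rewrite c0 c1 => /(_ isT).
set q := (l + c%:C%C *: m) ^+ n; set d := first_order l m n; set rr := q - _ => hr.
have -> : (l + c%:C%C *: m) ^+ n.+1 - (l ^+ n.+1 + c%:C%C *: first_order l m n.+1) =
 (c%:C%C * c%:C%C) *: (m * d) + (l + c%:C%C *: m) * rr.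
 have qE : q = l ^+ n + c%:C%C *: d + rr by rewrite /rr addrC subrK.
 rewrite !exprS -/q qE.
 rewrite (mulrDr (l + c%:C%C *: m)) addrAC; congr (_ + _).
 rewrite (mulrDl l) !(mulrDr _ (l ^+ n)) -!scAl -!scAr scalerA /= -/d (scalerDr _ (m * _)).
 set X1 := l * l ^+ n; set X2 := c%:C%C *: (l * d); set X3 := c%:C%C *: (m * l ^+ n); set X4 := _ *: (m * d).
 by rewrite addrA [X1 + X2 + X3]addrAC -[X1 + X3 + X2]addrA addrAC subrr add0r.
have nc2 : nc (c%:C%C * c%:C%C : C) = c ^+ 2 by rewrite ncM nc_pos// expr2.
apply: le_trans (opnD _ _) _; rewrite opnZ nc2 [leRHS]mulrDl.
apply: lerD; first by rewrite mulrC; apply: ler_wpM2r; [exact: exprn_ge0|exact: opnM].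
apply: opnM_le; rewrite -mulrA; apply: ler_pM => //; rewrite ?opn_ge0//.
apply: le_trans (opnD _ _) _; rewrite lerD2l opnZ nc_pos//.
by rewrite -[leRHS]mul1r; apply: ler_wpM2r; rewrite ?opn_ge0.
Qed.

Variables (L A : set (BL E)).
Hypotheses (sL : subsp L) (LL : forall a b, L a -> L b -> L (a * b - b * a : bop E)) (irr : irred (L : bop E -> Prop)).
Hypotheses (AM : forall a b, A a -> A b -> A (a * b : bop E))
 (LA : forall l a, L l -> A a -> A (l * a - a * l : bop E))
 (Afin : forall a, A a -> finrk a) (Anil : forall a, A a -> exists k, a ^+ k = 0).

Section MinimalRank.
Variables (s : bop E) (r : nat) (e : 'I_r -> E).
Hypotheses (As : A s) (s0 : s <> 0) (se : forall x, cspan e (s x))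
 (minr : forall t k (f : 'I_k -> E), A t -> t <> 0 -> (forall x, cspan f (t x)) -> (r <= k)%N).

Lemma min_ran t : A t -> t <> 0 -> (forall x, ran s (t x)) -> forall x, ran t (s x).
Proof.
move=> At t0 ts x; have [k [f [kr fb]]] := fbasis_ex e.
have [|k1 [f1 [k1k fb1 _]]] := fbasis_sub fb (ran_subsp s); first by move=> _ [y _ <-]; exact: se.
have [|k2 [f2 [k2k fb2 eq2]]] := fbasis_sub fb1 (ran_subsp t); first by move=> _ [y _ <-]; exact: ts.
rewrite eq2; first by exists x.
apply/eqP; rewrite eqn_leq k2k; apply: leq_trans k1k _; apply: leq_trans kr _.
by apply: (minr (f := f2) At t0) => y; rewrite -(fb_span fb2); exists y.
Qed.
Lemma min_iter b : A (s * b * s) -> s * b * s <> 0 -> forall n x, exists y, s x = ((s * b) ^+ n) (s y).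
Proof.
move=> At t0; have H := min_ran At t0 (fun x => ex_intro2 _ _ ((b * s) x) I erefl).
elim=> [|n IH] x; first by exists x; rewrite expr0.
by have [y _ yx] := H x; have [z zy] := IH y; exists z; rewrite -yx expbSE -zy.
Qed.
(** By minimality of the rank, a nonzero [s * b * s] has the same range as [s]. Iterating, every
    [s x] lies in the range of [(s * b) ^+ n * s], so the vanishing of the latter would give
    [s = 0]. *)
Lemma min_nil b n : A (s * b * s) -> (s * b) ^+ n * s = 0 -> s * b * s = 0.
Proof.
move=> At h; apply: contrapT => t0; apply: s0; apply: bop_eq => x.
by have [y ->] := min_iter At t0 n x; rewrite -mulbE h.
Qed.
Lemma min_sas a : A a -> s * a * s = 0.
Proof.
move=> Aa; have [k hk] := Anil (AM As Aa); apply: (min_nil (n := k)); first by apply: AM => //; exact: AM.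
by rewrite hk mul0r.
Qed.
Lemma min_ss : s * s = 0.
Proof.
have [k hk] := Anil As; have := min_nil (b := 1) (n := k); rewrite !mulr1 hk mul0r; apply=> //.
exact: AM.
Qed.
Lemma ad_mem l n : L l -> A ((liebr l ^+ n) (s : BL E)).
Proof. by move=> Ll; elim: n => [|n IH]; [rewrite expr0|rewrite exprS mulbE liebrE; exact: LA]. Qed.
(** Expand iterated brackets of [l] with [s] next to [s]; lower powers vanish by induction. Order
    [k] shows that [s * l ^+ k * s] is in [A]. Order [k + k], enclosed between two [s], leaves only
    the middle term [s * l ^+ k * s * l ^+ k * s], whose binomial coefficient is nonzero. *)
Lemma min_power l : L l -> forall k, s * l ^+ k * s = 0.
Proof.
move=> Ll; elim/ltn_ind => k IH; have [->|k0] := posnP k; first by rewrite expr0 mulr1 min_ss.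
have At : A (s * l ^+ k * s).
 have := AM As (ad_mem k Ll); rewrite liebr_pow mulr_sumr big_ord_recl big1 => [|i _].
 by rewrite addr0 /= expr0 mul1r subn0 expr0 mulr1 bin0 scale1r mulrA.
 by rewrite -scAr !mulrA IH ?mul0r ?scaler0// lift0 ltn_subrL.
apply: (min_nil (n := 2)) => //.
have := min_sas (ad_mem (k + k) Ll); rewrite liebr_pow mulr_sumr mulr_suml.
have kk : (k < (k + k).+1)%N by rewrite ltnS leq_addr.
rewrite (bigD1 (Ordinal kk))//= big1 => [|i ik]; last first.
 rewrite -scAr -scAl; have [ilt|ige] := ltnP i k.
 by rewrite -!mulrA mulrA [s * (l ^+ i * s)]mulrA IH// !mulr0 scaler0.
 rewrite !mulrA IH ?mul0r ?scaler0// ltn_subLR; last by rewrite -ltnS.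
 by rewrite ltn_add2r ltn_neqAle ige andbT eq_sym.
rewrite addr0 addnK -scAr -scAl => /eqP; rewrite scaler_eq0 mulf_eq0 signr_eq0 /= pnatr_eq0.
rewrite eqn0Ngt bin_gt0 leq_addr /= => /eqP h.
by rewrite expr2 -h !mulrA.
Qed.
Definition Lw w := forall a, a \in w -> L a.
Lemma Lw_cons a w : Lw (a :: w) <-> L a /\ Lw w.
Proof.
split=> [H|[La Lw'] b]; last by rewrite inE => /orP[/eqP->|/Lw'].
by split=> [|b bw]; apply: H; rewrite inE ?eqxx// bw orbT.
Qed.
Lemma Lw_cat u v : Lw (u ++ v) <-> Lw u /\ Lw v.
Proof.
split=> [H|[Lu Lv] b]; last by rewrite mem_cat => /orP[/Lu|/Lv].
by split=> b bw; apply: H; rewrite mem_cat bw ?orbT.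
Qed.
Lemma Lw_nseq n l : L l -> Lw (nseq n l).
Proof. by move=> Ll b /nseqP[->]. Qed.
(** Exchanging neighbours changes the word by a shorter one, so letters may be permuted. A word with
    a single [m] next to a power of [l] is then, up to a positive integer, the first-order term of a
    power of [l + c m], and such powers are covered by the induction on the remaining letters. *)
Lemma min_word w : Lw w -> s * bw w * s = 0.
Proof.
elim/ltn_ind: (size w) {-2}w (erefl (size w)) => k IH {}w sw LwH.
have swap u v a b : Lw (u ++ [:: a, b & v]) -> size (u ++ [:: a, b & v]) = k ->
 s * bw (u ++ [:: a, b & v]) * s = s * bw (u ++ [:: b, a & v]) * s.
 move=> /Lw_cat[Lu /Lw_cons[La /Lw_cons[Lb Lv]]] sz.
 have : s * bw (u ++ (a * b - b * a) :: v) * s = 0.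
 apply: (IH (size u + (size v).+1)%N).
 - by rewrite -sz size_cat /= !addnS.
 - by rewrite size_cat.
 - by apply/Lw_cat; split=> //; apply/Lw_cons; split=> //; exact: LL.
 rewrite !bw_cat !bw_cons.
 rewrite (mulrBl (bw v)) !(mulrBr (bw u)) !(mulrBr s) !(mulrBl s) => /eqP; rewrite subr_eq0 => /eqP.
 by rewrite -!mulrA.
have front u v m : Lw (u ++ m :: v) -> size (u ++ m :: v) = k -> s * bw (u ++ m :: v) * s = s * bw (m :: u ++ v) * s.
 elim/last_ind: u v => [//|u a IHu] v; rewrite !cat_rcons => Lu sz.
 rewrite swap// IHu//; last by move: sz; rewrite !size_cat /=.
 by move/Lw_cat: Lu => [Lu /Lw_cons[La /Lw_cons[Lm Lv]]]; apply/Lw_cat; split=> //; do 2 (apply/Lw_cons; split=> //).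
have fo l m : L l -> L m -> forall n j v, Lw v -> (j + n + size v)%N = k ->
 s * (l ^+ j * first_order l m n * bw v) * s = (n%:R : C) *: (s * bw (m :: nseq (j + n).-1 l ++ v) * s).
 move=> Ll Lm; elim=> [|n IHn] j v Lv sz; first by rewrite /= mulr0 mul0r mulr0 mul0r scale0r.
 have -> : l ^+ j * first_order l m n.+1 * bw v = bw (nseq j l ++ m :: nseq n l ++ v) + l ^+ j.+1 * first_order l m n * bw v.
 rewrite /= mulrDr mulrDl bw_cat bw_cons bw_cat !bw_nseq exprSr !mulrA//.
 rewrite mulrDr mulrDl IHn ?addSnnS//= front; last 2 first.
 - by apply/Lw_cat; split; [exact: Lw_nseq|apply/Lw_cons; split=> //; apply/Lw_cat; split=> //; exact: Lw_nseq].
 - by rewrite size_cat /= size_cat !size_nseq -sz !addnS !addSn addnA.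
 by rewrite addnS /= catA -nseqD -[n.+1%:R]natr1 scalerDl scale1r addrC.
suff Q : forall v n l, L l -> Lw v -> (n + size v)%N = k -> s * bw (nseq n l ++ v) * s = 0.
 by apply: (Q w 0%N 0) => //; exact: (ss0 sL).
elim=> [|m v IHv] n l Ll Lv sz.
 by rewrite cats0 bw_nseq; exact: min_power.
have [Lm {}Lv] := (Lw_cons _ _).1 Lv.
rewrite front; [|by apply/Lw_cat; split; [exact: Lw_nseq|exact/Lw_cons]|by rewrite size_cat size_nseq].
have szn : (n.+1 + size v)%N = k by rewrite addSnnS.
set Y := s * _ * s; have [K K0 HK] := first_orderP l m n.+1.
have fY : s * (first_order l m n.+1 * bw v) * s = (n.+1%:R : C) *: Y.
 by have := fo l m Ll Lm n.+1 0%N v Lv szn; rewrite expr0 mul1r.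
suff : (n.+1%:R : C) *: Y = 0 by move/eqP; rewrite scaler_eq0 pnatr_eq0 => /eqP.
pose K' := opn s * K * opn (bw v) * opn s.
have K'0 : 0 <= K' by rewrite !mulr_ge0 ?opn_ge0.
apply: (@bn_small R (BL E)) => d d0.
(* The error is at most [K' * c ^+ 2] against a first-order term proportional to [c]; this choice
   makes [K' * c] at most [d] and keeps [c] between 0 and 1. *)
pose c := d / (K' + d); have kd : 0 < K' + d by rewrite ltr_wpDl.
have c0 : 0 < c by rewrite divr_gt0.
have c1 : c <= 1 by rewrite ler_pdivrMr// mul1r lerDr.
have := HK c; rewrite (ltW c0) c1 => /(_ isT); set rr := _ - _ => hr.
have z1 : s * ((l + c%:C%C *: m) ^+ n.+1 * bw v) * s = 0.
 by rewrite -bw_nseq -bw_cat IHv//; apply: (ssD sL) => //; exact: (ssZ sL).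
have z2 : s * (l ^+ n.+1 * bw v) * s = 0 by rewrite -bw_nseq -bw_cat IHv.
have e1 : s * (rr * bw v) * s = - (c%:C%C *: ((n.+1%:R : C) *: Y)).
 rewrite /rr (mulrBl (bw v)) (mulrBr s) (mulrBl s) z1 sub0r; congr (- _).
 by rewrite (mulrDl (l ^+ n.+1)) (mulrDr s) (mulrDl _ _ s) z2 add0r -scAl -scAr -scAl fY.
have := congr1 (fun T : bop E => opn T) e1; rewrite -scaleN1r !opnZ ncN nc1 mul1r nc_pos ?(ltW c0)// -opnZ => e2.
have h : c * opn ((n.+1%:R : C) *: Y) <= K' * c ^+ 2.
 rewrite -e2; apply: opnM_le.
 have -> : K' * c ^+ 2 = opn s * (K * c ^+ 2 * opn (bw v)) * opn s by rewrite /K'; ring.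
 apply: ler_wpM2r; first exact: opn_ge0.
 apply: opnM_le; apply: ler_wpM2l; first exact: opn_ge0.
 by apply: opnM_le; apply: ler_wpM2r; rewrite ?opn_ge0.
rewrite expr2 mulrCA ler_pM2l// in h; apply: le_trans h _.
by rewrite /c mulrA ler_pdivrMr// mulrC ler_pM2l// lerDl ltW.
Qed.
(** The vectors killed by all [s * bw w] form a closed invariant subspace that contains the range of
    [s]; both outcomes of irreducibility force [s = 0]. *)
Lemma min_false : False.
Proof.
pose M : set E := fun x => forall w, Lw w -> s (bw w x) = 0.
have [|||M0|MT] := irr (M := M).
- split=> [w _|x y Hx Hy w Lw'|c x Hx w Lw']; first by rewrite !bop0.
 by rewrite !bopD Hx// Hy// addr0.
 by rewrite !bopZ Hx// scaler0.
- move=> x Hx w Lw'; apply: (kerb_closd (a := s * bw w)) => d d0.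
 by have [y My yx] := Hx d d0; exists y => //; exact: My.
- move=> a x La Mx w Lw'; have := Mx (rcons w a); rewrite bw_rcons; apply.
 rewrite -cats1; by apply/Lw_cat; split=> //; apply/Lw_cons.
- apply: s0; apply: bop_eq => x; apply: M0 => w Lw'.
 by rewrite -!mulbE min_word.
- by apply: s0; apply: bop_eq => x; have := MT x [::]; apply.
Qed.
End MinimalRank.

Theorem nil_algebra_zero a : A a -> a = 0.
Proof.
move=> Aa; apply: contrapT => a0.
pose P r := `[< exists s (e : 'I_r -> E), [/\ A s, s <> 0 & forall x, cspan e (s x)] >].
have exP : exists r, P r.
 by have [r [e H]] := Afin Aa; exists r; apply/asboolP; exists a, e.
case: (ex_minnP exP) => r /asboolP[s [e [As s0 se]]] minr.
apply: (min_false As s0 se) => t k f At t0 ft; apply: minr; apply/asboolP.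
by exists t, f.
Qed.
End NilAlgebra.

(** * Algebras generated by finite rank operators *)

Section FiniteRank.
Variables (R : realType) (X : banach R) (G : finZmodType).
Implicit Types (a b f : bop X) (B : bop X -> Prop).

Lemma bracket_jacobi a b f : f * (a * b - b * a) - (a * b - b * a) * f =
 ((f * a - a * f) * b - b * (f * a - a * f)) + (a * (f * b - b * f) - (f * b - b * f) * a).
Proof.
rewrite (mulrBr f) (mulrBl f) (mulrBl b) (mulrBr b) (mulrBr a) (mulrBl a) !mulrA.
set x1 := f * a * b; set x2 := f * b * a; set x3 := a * b * f; set x4 := b * a * f; set x5 := a * f * b; set x6 := b * f * a.
rewrite !opprB [RHS]addrACA !addrA [x1 - x5 + x5]subrK -![_ + x6 - _]addrA.
by rewrite -!addrA; congr (_ + _); rewrite addKr addrCA [RHS]addrCA; congr (_ + _); rewrite addrC.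
Qed.

Inductive alg B : bop X -> Prop :=
| alg0 : alg B 0
| algI a : B a -> alg B a
| algD a b : alg B a -> alg B b -> alg B (a + b)
| algZ (c : R[i]) a : alg B a -> alg B (c *: a)
| algM a b : alg B a -> alg B b -> alg B (a * b).

Lemma alg_mono B B' : (forall a, B a -> B' a) -> forall a, alg B a -> alg B' a.
Proof. by move=> BB' a; elim=> *; [exact: alg0|apply: algI; exact: BB'|exact: algD|exact: algZ|exact: algM]. Qed.
Lemma alg_subsp B : subsp (alg B : set (BL X)).
Proof. by split; [exact: alg0|exact: algD|exact: algZ]. Qed.
Lemma finrkZ (c : R[i]) a : finrk a -> finrk (c *: a).
Proof. by move=> [r [e H]]; exists r, e => x; exact: (ssZ (cspan_subsp e)). Qed.
Lemma finrk0 : finrk (0 : bop X).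
Proof. by exists 0%N, (fun _ => 0) => x; exact: (ss0 (cspan_subsp _)). Qed.
Lemma finrkB a b : finrk a -> finrk b -> finrk (a - b).
Proof. by move=> fa fb; rewrite -[- b]scaleN1r; apply: finrkD => //; exact: finrkZ. Qed.
Lemma alg_finrk B : (forall a, B a -> finrk a) -> forall a, alg B a -> finrk a.
Proof.
move=> H a; elim=> {a} [|a /H//|a b _ Ha _|c a _|a b _ Ha _ _]; [exact: finrk0|exact: finrkD|exact: finrkZ|exact: finrkMr].
Qed.
Lemma alg_ad B l : (forall a, B a -> alg B (l * a - a * l)) -> forall a, alg B a -> alg B (l * a - a * l).
Proof.
move=> H a; elim=> {a} [|a /H//|a b _ Ha _ Hb|c a _ Ha|a b Aa Ha Ab Hb].
- by rewrite mulr0 mul0r subrr; exact: alg0.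
- by rewrite mulrDr mulrDl opprD addrACA; exact: algD.
- by rewrite -scAr -scAl -scalerBr; exact: algZ.
- have -> : l * (a * b) - a * b * l = (l * a - a * l) * b + a * (l * b - b * l).
 by rewrite mulrBl mulrBr !mulrA addrA subrK.
 by apply: algD; apply: algM.
Qed.
Lemma nil_add a b : GRing.comm a b -> (exists k, a ^+ k = 0) -> (exists k, b ^+ k = 0) -> exists k, (a + b) ^+ k = 0.
Proof.
move=> c [k ak] [j bj]; exists (k + j)%N; rewrite (exprDn_comm _ c) big1// => i _.
have [ij|ij] := leqP j i; first by rewrite -(subnK ij) exprD bj !mulr0 mul0rn.
have kk : (k <= k + j - i)%N by rewrite -addnBA ?leq_addr// ltnW.
by rewrite -(subnK kk) exprD ak mulr0 mul0r mul0rn.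
Qed.
Lemma alg_comm_nil B : (forall a b, B a -> B b -> GRing.comm a b) -> (forall a, B a -> exists k, a ^+ k = 0) ->
 forall a, alg B a -> exists k, a ^+ k = 0.
Proof.
move=> cB nB.
have c1 b : B b -> forall a, alg B a -> GRing.comm b a.
 move=> Bb a; elim=> {a} [|a Ba|a a' _ Ha _ Ha'|c a _ Ha|a a' _ Ha _ Ha'].
 - exact: commr0.
 - exact: cB.
 - exact: commrD.
 - by rewrite /GRing.comm -scAr Ha scAl.
 - exact: commrM.
have c2 a b : alg B a -> alg B b -> GRing.comm a b.
 move=> Aa; elim=> {b} [|b Bb|b b' _ Hb _ Hb'|c b _ Hb|b b' _ Hb _ Hb'].
 - exact: commr0.
 - by apply: commr_sym; exact: c1.
 - exact: commrD.
 - by rewrite /GRing.comm -scAr Hb scAl.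
 - exact: commrM.
move=> a; elim=> {a} [|a /nB//|a b Aa Ha Ab Hb|c a _ [k ak]|a b Aa [k ak] Ab Hb].
- by exists 1%N; rewrite expr1.
- by apply: nil_add => //; exact: c2.
- by exists k; rewrite scaleb_pow ak scaler0.
- by exists k; rewrite exprMn_comm ?ak ?mul0r//; exact: c2.
Qed.
Lemma finrk_qnil_nil f : finrk f -> qnil f -> exists k, f ^+ k = 0.
Proof.
move=> [r [e He]] qf; have [s [e' [_ fb]]] := fbasis_ex e.
have fP := mxofP fb (a := f) (fun x _ => He x).
have [k hk] : nilm (mxof e' f).
 apply: no_eigen_nilm => v l v0 vl; apply: (qnil_eigen qf (x := comb e' v)); last by rewrite fP vl combZ.
 by apply: contra v0 => /eqP h; apply/eqP/(fb_free fb).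
have fk j c : (f ^+ j) (comb e' c) = comb e' (c *m mxof e' f ^+ j).
 elim: j c => [|j IH] c; first by rewrite !expr0 mulmx1.
 by rewrite exprSr mulbE fP IH -mulmxA exprS.
exists k.+1; apply: bop_eq => x; rewrite exprSr mulbE; have [c <-] := comb_fbasis fb (He x).
by rewrite fk hk mulmx0 comb0.
Qed.

Section LocalNil.
Variable F : G -> set (BL X).
Hypotheses (sF : forall g, subsp (F g)) (FL : forall g h (a b : bop X), F g a -> F h b -> F (g + h) (a * b - b * a))
 (Ffin : forall g (f : bop X), F g f -> finrk f)
 (Fgood : (forall g (f : bop X), F g f -> qnil f) \/
 exists g0 N, [/\ (0 < N)%N, g0 *+ N = 0, forall g : G, exists k, g = g0 *+ k & forall f : bop X, F 0 f -> qnil f]).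

Definition fbr f := exists g h a b, [/\ F g a, F h b & f = a * b - b * a].
Definition fbr_in (V : set X) f := exists g h a b, [/\ F g a, F h b, (forall x, V (a x)), (forall x, V (b x)) & f = a * b - b * a].

(** An element of the algebra involves finitely many brackets, and the ranges of all operators in
    them lie in one finite-dimensional space; this opens the way to matrices. *)
Lemma alg_local a : alg fbr a -> exists r (e : 'I_r -> X), alg (fbr_in (cspan e)) a.
Proof.
have join r (e : 'I_r -> X) r' (e' : 'I_r' -> X) : exists s (d : 'I_s -> X), cspan e `<=` cspan d /\ cspan e' `<=` cspan d.
 pose d (i : 'I_(r + r')) := match fintype.split i with inl j => e j | inr j => e' j end.
 exists (r + r')%N, d; split; apply: cspan_min; try exact: cspan_subsp.
 - move=> i; have -> : e i = d (lshift r' i) by rewrite /d (unsplitK (inl i)).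
 exact: cspan_mem.
 - move=> i; have -> : e' i = d (rshift r i) by rewrite /d (unsplitK (inr i)).
 exact: cspan_mem.
have mono (V V' : set X) b : V `<=` V' -> alg (fbr_in V) b -> alg (fbr_in V') b.
 move=> VV'; apply: alg_mono => f [g [h [u [v [Fu Fv Vu Vv ->]]]]].
 by exists g, h, u, v; split=> // x; apply: VV'.
elim=> {a} [|f [g [h [u [v [Fu Fv ->]]]]]|a b _ [r [e Ha]] _ [r' [e' Hb]]|c a _ [r [e Ha]]|a b _ [r [e Ha]] _ [r' [e' Hb]]].
- by exists 0%N, (fun _ => 0); exact: alg0.
- have [r [e He]] := Ffin Fu; have [r' [e' He']] := Ffin Fv; have [s [d [h1 h2]]] := join _ e _ e'.
 by exists s, d; apply: algI; exists g, h, u, v; split=> // x; [apply: h1|apply: h2].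
- have [s [d [h1 h2]]] := join _ e _ e'; exists s, d; apply: algD; [exact: mono Ha|exact: mono Hb].
- by exists r, e; exact: algZ.
- have [s [d [h1 h2]]] := join _ e _ e'; exists s, d; apply: algM; [exact: mono Ha|exact: mono Hb].
Qed.
(** On the common finite-dimensional range the homogeneous brackets are nilpotent by [mder_nil] and
    form a weakly closed set, hence have a finite annihilator series. Each bracket lowers the series
    by one, and so do sums and products of brackets. *)
Lemma alg_bracket_nil a : alg fbr a -> exists k, a ^+ k = 0.
Proof.
move=> /alg_local[r0 [e0]]; have [r [e [_ fb]]] := fbasis_ex e0; set V := cspan e0 in fb *; move=> Aa.
pose Fe g : set (BL X) := [set f : BL X | F g f /\ forall x, V ((f : bop X) x)].
have sV : subsp V by exact: cspan_subsp.
have sFe g : subsp (Fe g).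
 split=> [|a1 b1 [Fa Va] [Fb Vb]|c a1 [Fa Va]].
 - by split; [exact: (ss0 (sF g))|move=> x; exact: (ss0 sV)].
 - by split; [exact: (ssD (sF g))|move=> x; exact: (ssD sV)].
 - by split; [exact: (ssZ (sF g))|move=> x; exact: (ssZ sV)].
have FeV g (b : bop X) : Fe g b -> forall x, V x -> V (b x) by move=> [_ H] x _; exact: H.
have FeL g h (b1 b2 : bop X) : Fe g b1 -> Fe h b2 -> Fe (g + h) (b1 * b2 - b2 * b1).
 move=> [F1 V1] [F2 V2]; split; first exact: FL.
 by move=> x; rewrite subbE !mulbE; apply: (ssB sV); [exact: V1|exact: V2].
have gS := rep_mgr fb sFe FeV FeL.
have sn g (f : bop X) : Fe g f -> qnil f -> snil (mxof e f).
 move=> Ff qf; exists 0; rewrite raddf0 subr0.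
 have fP := mxofP fb (a := f) (FeV g f Ff).
 apply: no_eigen_nilm => v l v0 vl; apply: (qnil_eigen qf (x := comb e v)); last by rewrite fP vl combZ.
 by apply: contra v0 => /eqP h; apply/eqP/(fb_free fb).
have good : good_grading (rep e Fe).
 case: Fgood => [H|[g0 [N [N0 Ng gen H]]]]; [left|right; exists g0, N; split=> //].
 by move=> g _ [f Ff <-]; apply: (sn g) => //; case: Ff => Ff _; exact: H Ff.
 by move=> _ [f Ff <-]; apply: (sn 0) => //; case: Ff => Ff _; exact: H Ff.
pose W : set 'M[R[i]]_r := [set m | exists g, mder (rep e Fe) g m].
have nW m : W m -> nilm m by move=> [g]; exact: mder_nil.
have wW : weakly_closed W.
 move=> m1 m2 [g /(mder_sub gS) h1] [h /(mder_sub gS) h2]; exists (g + h); exact: mderL.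
have [N HN] := engel_words wW nW.
have down b : alg (fbr_in V) b -> (forall j c, ann W j.+1 c -> exists2 d, b (comb e c) = comb e d & ann W j d) /\ forall x, V (b x).
 elim=> {b} [|f [g [h [u [v [Fu Fv Vu Vv ->]]]]]|b1 b2 _ [H1 V1] _ [H2 V2]|k b1 _ [H1 V1]|b1 b2 _ [H1 V1] _ [H2 V2]].
 - split=> [j c _|x]; last exact: (ss0 sV).
 by exists 0; [rewrite comb0|exact: ann0].
 - have Vu' x : V x -> V (u x) by []. have Vv' x : V x -> V (v x) by [].
 split=> [j c Kc|x]; last by rewrite subbE !mulbE; apply: (ssB sV).
 exists (c *m lb (mxof e v) (mxof e u)).
 by rewrite (mxof_lb fb)// (mxofP fb)// => x _; rewrite subbE !mulbE; apply: (ssB sV).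
 by apply: Kc; exists (h + g); apply: mderL; [exists v|exists u].
 - split=> [j c Kc|x]; last exact: (ssD sV).
 have [d1 e1 k1] := H1 j c Kc; have [d2 e2 k2] := H2 j c Kc.
 by exists (d1 + d2); [rewrite addbE e1 e2 combD|exact: annD].
 - split=> [j c Kc|x]; last exact: (ssZ sV).
 by have [d1 e1 k1] := H1 j c Kc; exists (k *: d1); [rewrite scalebE e1 combZ|exact: annZ].
 - split=> [j c Kc|x]; last exact: V1.
 have [d2 e2 k2] := H2 j c Kc; have [d1 e1 k1] := H1 j d2 (annS k2).
 by exists d1; rewrite // mulbE e2 e1.
have [dn Va] := down a Aa.
have pw j : forall c, ann W j c -> (a ^+ j) (comb e c) = 0.
 elim: j => [|j IH] c Kc; first by rewrite [c]Kc comb0 bop0.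
 by have [d ad Kd] := dn j c Kc; rewrite exprSr mulbE ad IH.
exists N.+1; apply: bop_eq => x; rewrite exprSr mulbE; have [c <-] := comb_fbasis fb (Va x).
exact/pw/HN.
Qed.
End LocalNil.
End FiniteRank.

(** * Irreducible graded algebras leave no closed subspace *)

Section Star.
Variables (R : realType) (X : banach R) (G : finZmodType) (Lg : G -> set (BL X)).
Implicit Types (a b f l : bop X).
Hypotheses (gr : graded Lg) (irr : irred (homog Lg)) (good : egood Lg (homog Lg)).

Definition finite_dimensional := exists r (e : 'I_r -> X), fbasis setT e.
Hypothesis infd : ~ finite_dimensional.

Let F g : set (BL X) := [set f : BL X | finrk f /\ clos (Lg g) f].

Lemma F_subsp g : subsp (F g).
Proof.
have sc : subsp (clos (Lg g)) by apply: clos_subsp; exact: (gr_sub gr).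
split=> [|x y [fx cx] [fy cy]|c x [fx cx]]; split.
- exact: finrk0.
- exact: (ss0 sc).
- exact: finrkD.
- exact: (ssD sc).
- exact: finrkZ.
- exact: (ssZ sc).
Qed.
Lemma F_ad g h l f : Lg g l -> F h f -> F (g + h) (l * f - f * l).
Proof. by move=> Ll [ff cf]; split; [apply: finrkB; [exact: finrkMl|exact: finrkMr]|exact: clos_lie]. Qed.
Lemma F_lie g h a b : F g a -> F h b -> F (g + h) (a * b - b * a).
Proof.
move=> [fa ca] [fb cb]; split; first by apply: finrkB; exact: finrkMr.
have sc : subsp (clos (Lg (g + h))) by apply: clos_subsp; exact: (gr_sub gr).
have cV : closd (fun x : BL X => clos (Lg (g + h)) (liebr b x)) by apply: pre_closd; exact: clos_closd.
have sub : Lg g `<=` (fun x : BL X => clos (Lg (g + h)) (liebr b x)).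
 by move=> x Lx; rewrite liebrE -opprB; apply: (@ssN R (BL X) _ _ sc); exact: clos_lie.
by have := clos_min cV sub ca; rewrite liebrE => h1; rewrite -opprB; apply: (@ssN R (BL X) _ _ sc).
Qed.
Lemma engel_qnil a : homog Lg a -> loceng (homog Lg) a -> qnil a.
Proof.
move=> [g La] le; have [//|[H _]] := engel_irred irr (gr_cpt gr La) le.
by exfalso; exact: infd.
Qed.
Lemma F_qnil g : (forall a, Lg g a -> loceng (homog Lg) a) -> forall f, F g f -> qnil f.
Proof.
move=> H f [ff cf]; apply: cpt_qnil_lim.
 apply: cpt_lim => e e0; have [b Lb be] := cf e e0; exists b; first exact: gr_cpt Lb.
 by move: be; rewrite bnC.
move=> e e0; have [b Lb be] := cf e e0; exists b; first by apply: engel_qnil; [exists g|exact: H].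
by move: be; rewrite bnC.
Qed.
Lemma F_good : (forall g f, F g f -> qnil f) \/
 exists g0 N, [/\ (0 < N)%N, g0 *+ N = 0, forall g : G, exists k, g = g0 *+ k & forall f, F 0 f -> qnil f].
Proof.
case: good => [H|[g0 [N [N0 Ng gen H]]]]; [left=> g f|right; exists g0, N; split=> //].
 by apply: F_qnil; exact: H.
exact: F_qnil H.
Qed.
Definition span_homog : set (BL X) := spn (homog Lg : set (BL X)).
Lemma span_subsp : subsp span_homog. Proof. exact: spn_subsp. Qed.
Lemma span_ind (P : set (BL X)) : subsp P -> (forall l, homog Lg l -> P l) -> forall l, span_homog l -> P l.
Proof. by move=> sP H l; exact: (@spn_min R (BL X) (homog Lg) P sP H). Qed.
Lemma span_irred : irred (span_homog : bop X -> Prop).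
Proof.
move=> M sM cM HM; apply: irr => // a x Sa Mx; apply: HM => //.
exact: (@spn_sub R (BL X) (homog Lg)).
Qed.
Lemma br_subspl (M : set (BL X)) f : subsp M -> subsp (fun l : BL X => M (l * f - f * l : bop X)).
Proof.
move=> sM; split=> [|x y Hx Hy|c x Hx].
- by rewrite mul0r mulr0 subrr; exact: (ss0 sM).
- by rewrite mulrDl mulrDr opprD addrACA; exact: (ssD sM).
- by rewrite -scAl -scAr -scalerBr; exact: (ssZ sM).
Qed.
Lemma br_subspr (M : set (BL X)) l : subsp M -> subsp (fun f : BL X => M (l * f - f * l : bop X)).
Proof.
move=> sM; split=> [|x y Hx Hy|c x Hx].
- by rewrite mul0r mulr0 subrr; exact: (ss0 sM).
- by rewrite mulrDr mulrDl opprD addrACA; exact: (ssD sM).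
- by rewrite -scAl -scAr -scalerBr; exact: (ssZ sM).
Qed.
Lemma span_lie a b : span_homog a -> span_homog b -> span_homog (a * b - b * a).
Proof.
move=> Sa; apply: (span_ind (br_subspr a span_subsp)) => l [h Ll].
apply: (span_ind (br_subspl l span_subsp)) Sa => k [g Lk].
by apply: spn_sub; exists (g + h); exact: gr_lie.
Qed.
Lemma alg_zero B : (forall f, B f -> finrk f) -> (forall a, alg B a -> exists k, a ^+ k = 0) ->
 (forall l f, homog Lg l -> B f -> alg B (l * f - f * l)) -> forall a, alg B a -> a = 0.
Proof.
move=> Bf Bn Bad a Aa.
have LA l b : span_homog l -> alg B b -> alg B (l * b - b * l).
 move=> Sl Ab; apply: (span_ind (br_subspl b (alg_subsp B))) Sl => k hk.
 by apply: alg_ad Ab => f Bfx; exact: Bad.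
exact: (@nil_algebra_zero R X span_homog (alg B) span_subsp span_lie span_irred (@algM _ _ B) LA
 (alg_finrk Bf) Bn a Aa).
Qed.
(** [alg_zero] is used twice. The algebra generated by the brackets of [F] is nil, hence zero, so
    [F] is commutative. Then bracketing twice with [u] in [F] gives zero, so [u] is Engel,
    quasinilpotent and, by finite rank, nilpotent; the commutative algebra generated by [F] is nil
    as well. *)
Lemma F_zero g f : F g f -> f = 0.
Proof.
have br0 : forall a, alg (fbr F) a -> a = 0.
 apply: alg_zero.
 - by move=> a [g1 [h1 [u [v [[fu _] [fv _] ->]]]]]; apply: finrkB; exact: finrkMr.
 - by apply: alg_bracket_nil; [exact: F_subsp|exact: F_lie|move=> g1 u [fu _]|exact: F_good].
 - move=> l a [k Ll] [g1 [h1 [u [v [Fu Fv ->]]]]]; rewrite bracket_jacobi; apply: (@algD R X (fbr F)); apply: algI.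
 by exists (k + g1), h1, (l * u - u * l), v; split=> //; exact: F_ad.
 by exists g1, (k + h1), u, (l * v - v * l); split=> //; exact: F_ad.
have cF g1 g2 u v : F g1 u -> F g2 v -> u * v - v * u = 0.
 by move=> Fu Fv; apply: br0; apply: algI; exists g1, g2, u, v.
have qF g1 u : F g1 u -> qnil u.
 move=> Fu; have [fu cu] := Fu.
 have cpu : cpt u.
 apply: cpt_lim => e e0; have [b Lb be] := cu e e0; exists b; first exact: gr_cpt Lb.
 by move: be; rewrite bnC.
 suff le : loceng (homog Lg) u by have [//|[H _]] := engel_irred irr cpu le; exfalso; exact: infd.
 (* Only the iterates [n = 0] and [n = 1] can be nonzero; the constant is the sum of what these two
    require. *)
 move=> x [k Lx] e e0; exists (opn x + opn (u * x - x * u) / e) => n.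
 have p0 : 0 <= opn (u * x - x * u) / e by rewrite divr_ge0 ?opn_ge0// ltW.
 case: n => [|n]; first by rewrite expr0 mulr1 onebE lerDl.
 rewrite exprSr mulbE liebrE; case: n => [|n].
 by rewrite expr0 expr1 mulrDl divfK ?gt_eqF// lerDr mulr_ge0 ?opn_ge0// ltW.
 rewrite exprSr mulbE liebrE (cF g1 (k + g1) u).
 - by rewrite bop0 bn0 mulr_ge0 ?exprn_ge0 ?addr_ge0 ?opn_ge0// ltW.
 - exact: Fu.
 - by rewrite -opprB; apply: (@ssN R (BL X) _ _ (F_subsp _)); exact: F_ad.
move=> Ff; have : alg (fun u => exists g1, F g1 u) f by apply: algI; exists g.
apply: alg_zero.
- by move=> u [g1 []].
- apply: alg_comm_nil => [u v [g1 Fu] [g2 Fv]|u [g1 Fu]].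
 by have /eqP := cF _ _ _ _ Fu Fv; rewrite subr_eq0 => /eqP.
 by apply: finrk_qnil_nil; [case: Fu|exact: qF Fu].
- by move=> l u [k Ll] [g1 Fu]; apply: algI; exists (k + g1); exact: F_ad.
Qed.
End Star.

(** In finite dimension the size is at most 1. Otherwise a nonzero homogeneous operator gives, by
    [extraction], a finite-dimensional invariant subspace or a finite rank limit, both impossible;
    and if all operators are zero, every closed subspace is invariant. *)
Theorem star (R : realType) (X : banach R) (G : finZmodType) (Lg : G -> set (BL X)) :
 graded Lg -> irred (homog Lg) -> egood Lg (homog Lg) ->
 forall M : set X, subsp M -> closd M -> (forall x, M x -> x = 0) \/ forall x, M x.
Proof.
move=> gr irr good M sM cM; have [[r [e fb]]|infd] := EM (@finite_dimensional R X).
 have r1 := fd_irred gr irr good fb; have [s [f [sr fM eqM]]] := fbasis_sub fb sM (fun _ _ => I).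
 case: (ltngtP s r) sr => // [lt _|sr _]; last by right=> x; rewrite eqM.
 have s0 : s = 0%N by apply/eqP; rewrite -leqn0 -ltnS; exact: leq_trans lt r1.
 left=> x; rewrite (fb_span fM) => -[c _ <-]; rewrite /comb big1// => i _.
 by have := ltn_ord i; rewrite {2}s0.
have [[K [hK K0]]|H] := EM (exists K, homog Lg K /\ K != 0); last first.
 apply: irr => // a x ha Mx; have -> : a = 0; last by rewrite zerobE; exact: (ss0 sM).
 by apply: contrapT => /eqP h; apply: H; exists a.
have [[W [sW [r [e fb]] [x x0 Wx] HW]]|[g [F [F0 fF cF]]]] := extraction gr irr hK K0.
 have [W0|WT] := irr W sW (fin_dim_closd fb) HW; first by rewrite (W0 x Wx) eqxx in x0.
 exfalso; apply: infd; exists r, e; suff <- : W = setT by [].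
 by apply/seteqP; split.
by exfalso; move/eqP: F0; apply; apply: (F_zero gr irr good infd (g := g)); split.
Qed.

(** * Maximal chains of invariant subspaces *)

Section Triangularization.
Variables (R : realType) (X : banach R).
Implicit Types (a b l w : bop X) (x y z v : X) (M N K V W Y Z : set X) (Ch D : set (set X)).

Definition invariant (S : bop X -> Prop) M := forall a x, S a -> M x -> M (a x).
Lemma clos_bop a M N : (forall x, M x -> N (a x)) -> forall x, clos M x -> clos N (a x).
Proof.
move=> H; have cV : closd (fun x => clos N (a x)) by apply: pre_closd; exact: clos_closd.
by apply: (clos_min cV) => x /H; exact: sub_clos.
Qed.
Definition cchain Ch := (forall M, Ch M -> subsp M /\ closd M) /\ (forall M N, Ch M -> Ch N -> M `<=` N \/ N `<=` M).
(** Maximality among all chains of closed subspaces, tested on one additional subspace at a time. *)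
Definition cmax Ch := forall M, subsp M -> closd M -> (forall K, Ch K -> K `<=` M \/ M `<=` K) -> Ch M.
Lemma chain_cap Ch (P : set X -> Prop) : cchain Ch ->
 subsp (fun x => forall K, Ch K -> P K -> K x) /\ closd (fun x => forall K, Ch K -> P K -> K x).
Proof.
move=> [cc _]; split; last first.
 move=> x Hx K CK PK; have [_ cK] := cc _ CK; apply: cK => e e0.
 by have [y Ny yx] := Hx e e0; exists y => //; exact: Ny.
split=> [K CK PK|x y Nx Ny K CK PK|c x Nx K CK PK]; have [[K0 KD KZ] _] := cc _ CK;
 [exact: K0|apply: KD; [exact: Nx|exact: Ny]|apply: KZ; exact: Nx].
Qed.
Lemma chain_cup Ch (P : set X -> Prop) : cchain Ch -> Ch [set 0] -> P [set 0] ->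
 subsp (fun x => exists K, [/\ Ch K, P K & K x]).
Proof.
move=> [cc ct] C0 P0; split=> [|x y [K [CK PK Kx]] [K' [CK' PK' Ky]]|c x [K [CK PK Kx]]].
- by exists [set 0].
- have [[_ KD _] _] := cc _ CK; have [[_ KD' _] _] := cc _ CK'.
 by have [h|h] := ct _ _ CK CK'; [exists K'|exists K]; split; auto.
- by exists K; split=> //; have [[_ _ KZ] _] := cc _ CK; auto.
Qed.

Section Gap.
Variables (G : finZmodType) (Lg : G -> set (BL X)).
Hypotheses (gr : graded Lg) (good : egood Lg (homog Lg)).

(** The operators induced on [Y / Z] form a graded algebra of compact operators with the same Engel
    property; a gap without invariant subspaces makes it irreducible, and [star] decides the image
    of [M]. *)
Lemma gap_trivial Y Z : subsp Y -> closd Y -> subsp Z -> closd Z -> Z `<=` Y ->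
 invariant (homog Lg) Y -> invariant (homog Lg) Z ->
 (forall W, subsp W -> closd W -> invariant (homog Lg) W -> Z `<=` W -> W `<=` Y -> W `<=` Z \/ Y `<=` W) ->
 forall M, subsp M -> closd M -> Z `<=` M -> M `<=` Y -> M `<=` Z \/ Y `<=` M.
Proof.
move=> sY cY sZ cZ ZY iY iZ gap M sM cM ZM MY.
have [Q [p pP]] := subquotient sY cY sZ cZ ZY.
pose ind a := induced sY sZ ZY pP a.
have st a : homog Lg a -> stab Y Z a by move=> ha; split=> x; [exact: iY|exact: iZ].
pose Lg' g : set (BL Q) := [set ind a | a in (Lg g : set (bop X))].
have stg g a : Lg g a -> stab Y Z a by move=> La; apply: st; exists g.
have gr' : graded Lg'.
 split.
 - move=> g; have sg := gr_sub gr g; split.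
 + by exists 0; [exact: (ss0 sg)|exact: induced0].
 + move=> _ _ [a La <-] [b Lb <-]; exists (a + b); first exact: (ssD sg).
 by apply: inducedD; apply: stg; eassumption.
 + move=> c _ [a La <-]; exists (c *: a); first exact: (ssZ sg).
 by apply: inducedZ; apply: stg; eassumption.
 - move=> g h _ _ [a La <-] [b Lb <-]; exists (a * b - b * a); first exact: (gr_lie gr).
 have sa := stg _ _ La; have sb := stg _ _ Lb.
 by rewrite /ind inducedB ?inducedM//; apply: stabM.
 - by move=> g _ [a La <-]; apply: induced_cpt; exact: gr_cpt La.
have le a : homog Lg a -> loceng (homog Lg) a -> loceng (homog Lg') (ind a).
 move=> ha la x' [g [x Lx <-]] e e0; have hx : homog Lg x by exists g.
 have [B HB] := la x hx e e0; exists B => n; apply: le_trans (HB n).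
 have [_ ->] : stab Y Z ((liebr a ^+ n) (x : BL X)) /\ ((liebr (ind a) ^+ n) (ind x : BL Q) : bop Q) = ind ((liebr a ^+ n) (x : BL X)).
 elim: n => [|n [IH1 IH2]]; first by rewrite !expr0; split=> //; exact: st.
 have sa := st a ha; rewrite !exprS !mulbE !liebrE IH2; split.
 by apply: stabB => //; apply: stabM.
 by rewrite /ind inducedB ?inducedM//; apply: stabM.
 exact: induced_le.
have good' : egood Lg' (homog Lg').
 case: good => [H|[g0 [N [N0 Ng gen H]]]]; [left|right; exists g0, N; split=> //].
 by move=> g _ [a La <-]; apply: le; [exists g|exact: H La].
 by move=> _ [a La <-]; apply: le; [exists 0|exact: H La].
have pcl (V : set Q) : closd V -> closd (fun x => Y x /\ V (p x)).
 move=> cV x Hx; have Yx : Y x by apply: cY => e e0; have [y [Yy _] yx] := Hx e e0; exists y.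
 split=> //; apply: cV => e e0; have [y [Yy Vy] yx] := Hx e e0; exists (p y) => //.
 rewrite -(sqB sY sZ pP)//; apply: le_lt_trans (sq_le pP _) yx; exact: ssB.
have psb (V : set Q) : subsp V -> subsp (fun x => Y x /\ V (p x)).
 move=> sV; split=> [|x y [Yx Vx] [Yy Vy]|c x [Yx Vx]].
 - by split; [exact: (ss0 sY)|rewrite (sq0 sY sZ pP); exact: (ss0 sV)].
 - by split; [exact: (ssD sY)|rewrite (sqD pP)//; exact: (ssD sV)].
 - by split; [exact: (ssZ sY)|rewrite (sqZ sY sZ pP)//; exact: (ssZ sV)].
have irr : irred (homog Lg').
 move=> V sV cV iV; have [|||h|h] := gap _ (psb V sV) (pcl V cV).
 - move=> a x ha [Yx Vx]; split; first exact: iY.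
 have -> : p (a x) = ind a (p x) by rewrite /ind inducedE//; exact: st.
 by apply: iV => //; have [g La] := ha; exists g, a.
 - by move=> x Zx; split; [exact: (ZY x Zx)|rewrite (sq_ker pP (ZY x Zx)).2//; exact: (ss0 sV)].
 - by move=> x [].
 - by left=> q Vq; have [x Yx xq] := sq_onto pP q; rewrite -xq; apply/(sq_ker pP Yx)/h; rewrite xq.
 - by right=> q; have [x Yx <-] := sq_onto pP q; have [] := h x Yx.
pose V : set Q := [set p x | x in M].
have MV x : Y x -> V (p x) -> M x.
 move=> Yx [m Mm mx]; rewrite -[x](subrK m); apply: (ssD sM) => //; apply: ZM.
 by apply/(sq_eq sY sZ pP) => //; exact: MY.
have sV : subsp V.
 split.
 - by exists 0; [exact: (ss0 sM)|exact: (sq0 sY sZ pP)].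
 - by move=> _ _ [x Mx <-] [y My <-]; exists (x + y); [exact: (ssD sM)|rewrite (sqD pP)//; exact: MY].
 - by move=> c _ [x Mx <-]; exists (c *: x); [exact: (ssZ sM)|rewrite (sqZ sY sZ pP)//; exact: MY].
have cV : closd V.
 move=> q Hq; have [x Yx xq] := sq_onto pP q; exists x => //; apply: cM => e e0.
 have e2 : 0 < e / 2 by rewrite divr_gt0.
 have [_ [m Mm <-] mx] := Hq _ e2; have Ym := MY _ Mm.
 have [z Zz hz] := sq_lift pP (ssB sY Yx Ym) e2; exists (m + z); first by apply: (ssD sM) => //; exact: ZM.
 rewrite bnC opprD addrA; apply: lt_le_trans hz _.
 by rewrite (sqB sY sZ pP)// xq bnC [leRHS](splitr e) lerD2r ltW.
have [h|h] := star gr' irr good' sV cV.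
 by left=> x Mx; apply/(sq_ker pP (MY _ Mx))/h; exists x.
by right=> x Yx; apply: MV => //; exact: h.
Qed.

(** Take a maximal chain of invariant subspaces. A closed [M] comparable with all members lies
    between the intersection [N] of those above it and the closure of the union of those below it.
    Both belong to the chain with no invariant subspace strictly in between, so [gap_trivial]
    identifies [M] with one of them. *)
Theorem triangular_chain : exists Ch, [/\ cchain Ch, cmax Ch & forall M, Ch M -> invariant (homog Lg) M].
Proof.
pose P Ch := cchain Ch /\ forall M, Ch M -> invariant (homog Lg) M.
have [F FP tF|Ch [[[cc ct] ci] Cmax]] := @Zorn_bigcup (set X) P.
 split; first split.
 - by move=> M [Ch FC CM]; have [[h _] _] := FP _ FC; exact: h.
 - move=> M N [Ch FC CM] [Ch' FC' CN]; have [h|h] := tF _ _ FC FC'.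
 by have [[_ H] _] := FP _ FC'; apply: H => //; exact: h.
 by have [[_ H] _] := FP _ FC; apply: H => //; exact: h.
 - by move=> M [Ch FC CM]; have [_ H] := FP _ FC; exact: H.
have imax M : subsp M -> closd M -> invariant (homog Lg) M -> (forall K, Ch K -> K `<=` M \/ M `<=` K) -> Ch M.
 move=> sM cM iM cmp; apply: contrapT => nC; apply: (Cmax (Ch `|` [set M])).
 by split=> [K CK|h]; [left|apply: nC; apply: h; right].
 split; first split.
 - by move=> K [/cc//|->].
 - by move=> K K' [CK|->] [CK'|->]; [exact: ct|exact: cmp|have [|] := cmp _ CK'; [right|left]|left].
 - by move=> K [/ci//|->].
exists Ch; split=> // M sM cM cmp.
pose N : set X := fun x => forall K, Ch K -> M `<=` K -> K x.
pose U : set X := fun x => exists K, [/\ Ch K, K `<=` M & K x].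
have C0 : Ch [set 0].
 apply: imax; [exact: set0_subsp|exact: set0_closd|by move=> a _ _ ->; rewrite /= bop0|].
 by move=> K CK; right; apply: set0_sub; have [] := cc _ CK.
have cCh : cchain Ch by [].
have [sN cN] : subsp N /\ closd N by exact: chain_cap.
have iN : invariant (homog Lg) N by move=> a x ha Nx K CK MK; apply: (ci _ CK) => //; exact: Nx.
have CN : Ch N.
 apply: imax => // K CK; have [KM|MK] := cmp _ CK.
 by left=> x Kx K' CK' MK'; apply: MK'; exact: KM.
 by right=> x Nx; exact: Nx.
have sU : subsp U by apply: chain_cup => //; exact: set0_sub.
have UM : clos U `<=` M by apply: clos_min => // x [K [_ KM Kx]]; exact: KM.
have iU : invariant (homog Lg) (clos U).
 move=> a x ha; apply: clos_bop => y [K [CK KM Ky]]; exists K; split=> //; exact: (ci _ CK).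
have CU : Ch (clos U).
 apply: imax => //; [exact: clos_subsp|exact: clos_closd|move=> K CK].
 have [KM|MK] := cmp _ CK; last by right=> x /UM/MK.
 by left=> x Kx; apply: sub_clos; exists K.
have MN : M `<=` N by move=> x Mx K CK MK; exact: MK.
have [||h|h] := @gap_trivial N (clos U) sN cN (clos_subsp sU) (clos_closd (M := U)) _ iN iU _ M sM cM UM MN.
- by move=> x /UM/MN.
- move=> W sW cW iW UW WN; have CW : Ch W.
 apply: imax => // K CK; have [KM|MK] := cmp _ CK.
 by left=> x Kx; apply: UW; apply: sub_clos; exists K.
 by right=> x /WN; apply.
 have [WM|MW] := cmp _ CW; [left=> x Wx; apply: sub_clos; exists W|right=> x]; first by [].
 by apply.
- by rewrite (_ : M = clos U)//; apply/seteqP; split.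
- by rewrite (_ : M = N)//; apply/seteqP; split.
Qed.
End Gap.
End Triangularization.

(** * Diagonal coefficients and the step of E-solvability *)

Section Ringrose.
Variables (R : realType) (X : banach R).
Implicit Types (a b l w : bop X) (x y z v : X) (M N K V W Y Z U : set X).
Variable Ch : set (set X).
Hypotheses (cc : cchain Ch) (cm : cmax Ch).

Lemma chain_zero : Ch [set 0].
Proof.
apply: cm; [exact: set0_subsp|exact: set0_closd|move=> K CK; right; apply: set0_sub].
by have [H _] := cc; have [] := H K CK.
Qed.
Lemma chain_full : Ch setT. Proof. by apply: cm => [|//|K _]; [split|left]. Qed.
Lemma induced_shift M w (la : R[i]) : subsp M -> closd M -> cpt w -> (forall x, M x -> M (w x)) ->
 exists (Q : banach R) (p : X -> Q) (w' : bop Q), [/\ subquo M [set 0] p, cpt w', (forall x, M x -> M (shft la w x)) &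
 forall x, M x -> shft la w' (p x) = p (shft la w x)].
Proof.
move=> sM cM cw Mw; have sM0 : subsp [set (0 : X)] by exact: set0_subsp.
have [Q [p pP]] := subquotient sM cM sM0 (set0_closd (E := X)) (set0_sub sM).
have st : stab M [set 0] w by split=> // x ->; rewrite /= bop0.
exists Q, p, (induced sM sM0 (set0_sub sM) pP w); split=> // [|x Mx|x Mx].
- exact: induced_cpt.
- by rewrite shiftE; apply: (ssB sM); [exact: (ssZ sM)|exact: Mw].
- by rewrite !shiftE inducedE// (sqB sM sM0 pP) ?(sqZ sM sM0 pP)//; [exact: (ssZ sM)|exact: Mw].
Qed.
(** The Fredholm alternative for the restriction to [M], with [M] treated as a space of its own. *)
Lemma eigen_restrict M w (la : R[i]) : subsp M -> closd M -> cpt w -> la != 0 -> (forall x, M x -> M (w x)) ->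
 (exists2 x, x != 0 & M x /\ w x = la *: x) \/
 (forall y, M y -> exists2 x, M x & shft la w x = y).
Proof.
move=> sM cM cw l0 Mw; have sM0 : subsp [set (0 : X)] by exact: set0_subsp.
have [Q [p [w' [pP cw' shM sh]]]] := induced_shift la sM cM cw Mw.
have p0 x : M x -> p x = 0 -> x = 0 by move=> Mx; exact: (sq_ker pP Mx).1.
have [[q [q0 qe]]|H] := EM (exists q, q != 0 /\ shft la w' q = 0).
 left; have [x Mx xq] := sq_onto pP q; exists x.
 by apply: contra q0 => /eqP x0; rewrite -xq x0 (sq0 sM sM0 pP).
 by split=> //; apply/esym/subr0_eq; rewrite -shiftE; apply: p0; rewrite -?sh ?xq//; exact: shM.
right=> y My; have [//||b [b1 _]] := @riesz_inverse R Q w' la _ l0.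
 by move=> q qe; apply: contrapT => /eqP q0; apply: H; exists q; rewrite shiftE qe subrr.
have [x Mx xb] := sq_onto pP (b (p y)); exists x => //; have sx := shM x Mx.
apply: subr0_eq; apply: p0; first exact: (ssB sM).
by rewrite (sqB sM sM0 pP)// -sh// xb -mulbE b1 onebE subrr.
Qed.
(** The restriction of [la - w] to [M] has closed range containing the dense part [U], so it is
    onto; for a nonzero scalar minus a compact operator this implies injectivity. *)
Lemma eigen_approx M U w (la : R[i]) : subsp M -> closd M -> cpt w -> la != 0 -> (forall x, M x -> M (w x)) ->
 (forall x, M x -> clos U x) -> (forall y, U y -> exists2 x, M x & shft la w x = y) ->
 forall x, M x -> w x = la *: x -> x = 0.
Proof.
move=> sM cM cw l0 Mw MU Us x Mx wx; have sM0 : subsp [set (0 : X)] by exact: set0_subsp.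
have [Q [p [w' [pP cw' shM sh]]]] := induced_shift la sM cM cw Mw.
have sur q : exists q', shft la w' q' = q.
 suff [q' _ <-] : ran (shft la w') q by exists q'.
 apply: (ran_closd cw' l0) => e e0; have [y My yq] := sq_onto pP q.
 have [u Uu uy] := MU y My e e0; have [z Mz zu] := Us u Uu.
 exists (p u); first by exists (p z) => //; rewrite sh// zu.
 have Mu : M u by rewrite -zu; exact: shM.
 by rewrite -yq -(sqB sM sM0 pP)//; apply: le_lt_trans (sq_le pP _) uy; exact: (ssB sM).
apply: (sq_ker pP Mx).1; apply: (riesz_surj_inj cw' l0 sur).
by rewrite sh// shiftE wx subrr (sq0 sM sM0 pP).
Qed.
(* Ringrose: a nonzero eigenvalue of [w] is a diagonal coefficient of [w] along the chain. *)
Lemma ringrose w (la : R[i]) : cpt w -> la != 0 -> eigenval w la -> (forall M, Ch M -> forall x, M x -> M (w x)) ->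
 exists N Nm v, [/\ Ch N, Ch Nm, N v, ~ Nm v & w v = la *: v] /\
 forall x, N x -> exists k y, Nm y /\ x = k *: v + y.
Proof.
move=> cw l0 [v0 v00 wv0] inv; have [cg ct] := cc.
pose ker : set X := [set x | w x = la *: x].
have sker : subsp ker.
 split=> [|x y wx wy|c x wx]; rewrite /ker/= ?bop0 ?scaler0//.
 - by rewrite bopD wx wy scalerDr.
 - by rewrite bopZ wx !scalerA mulrC.
have [r [e fb]] : exists r (e : 'I_r -> X), fbasis ker e.
 apply: (fin_dim sker) => u Hu; have [l Hl] := cptP cw (fun n => (Hu n).2).
 exists (la^-1 *: l); apply: (ulim_ext (ulimZ la^-1 Hl)) => n.
 by have [-> _] := Hu n; rewrite scalerA mulVf// scale1r.
pose meets K := exists2 x, x != 0 & K x /\ ker x.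
have sI K : Ch K -> subsp (K `&` ker) by move=> /cg[sK _]; exact: subspI.
(* The eigenspace has finite dimension. A member whose intersection with it is nonzero of least
   dimension shows that all members meeting the eigenspace share an eigenvector, which then survives
   in their intersection [N]. *)
pose P s := `[< exists K, [/\ Ch K, meets K & exists f : 'I_s -> X, fbasis (K `&` ker) f] >].
have exP : exists s, P s.
 have [|s [f [_ fbf _]]] := fbasis_sub fb (sI setT chain_full); first by move=> x [].
 exists s; apply/asboolP; exists setT; split; [exact: chain_full|by exists v0|by exists f].
case: (ex_minnP exP) => s /asboolP[K0 [CK0 mK0 [f fbf]]] mins.
have K0min K : Ch K -> meets K -> forall x, K0 x -> ker x -> K x.
 move=> CK mK x K0x kx; have [K0K|KK0] := ct _ _ CK0 CK; first exact: K0K.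
 have [|s' [f' [ss' fb' eq']]] := fbasis_sub fbf (sI K CK); first by move=> y [Ky ky]; split=> //; exact: KK0.
 have e' : s' = s.
 by apply/eqP; rewrite eqn_leq ss' mins//; apply/asboolP; exists K; split=> //; exists f'.
 have := eq' e' => /(congr1 (fun A : set X => A x)) /= h.
 by have : K0 x /\ ker x by []; rewrite -h => -[].
pose N : set X := fun x => forall K, Ch K -> meets K -> K x.
pose U : set X := fun x => exists K, [/\ Ch K, ~ meets K & K x].
have [v vn0 [K0v kv]] := mK0.
have Nv : N v by move=> K CK mK; exact: K0min.
have sep K K' : Ch K -> Ch K' -> meets K -> ~ meets K' -> K' `<=` K.
 move=> CK CK' [x x0 [Kx kx]] nm; have [h|//] := ct _ _ CK CK'.
 by exfalso; apply: nm; exists x => //; split=> //; exact: h.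
have [sN cN] : subsp N /\ closd N by exact: chain_cap.
have CN : Ch N.
 apply: cm => // K CK; have [mK|nK] := EM (meets K); first by right=> x; apply.
 by left=> x Kx K' CK' mK'; apply: (sep K' K).
have sU : subsp U.
 by apply: chain_cup => //; [exact: chain_zero|move=> [x x0 [h _]]; rewrite h eqxx in x0].
have CU : Ch (clos U).
 apply: cm; [exact: clos_subsp|exact: clos_closd|move=> K CK].
 have [mK|nK] := EM (meets K); last by left=> x Kx; apply: sub_clos; exists K.
 right; have [_ cK] := cg _ CK; apply: clos_min => // x [K' [CK' nK' Kx]].
 exact: (sep K K').
have [sUc cUc] := cg _ CU.
have Uinv := inv _ CU.
(* On a member without eigenvectors [la - w] is onto; hence every vector of [U] is attained from
   [clos U], and [eigen_approx] excludes an eigenvector in the closure. *)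
have nUv : ~ clos U v.
 move=> Uv; move/eqP: vn0; apply; apply: (eigen_approx sUc cUc cw l0 Uinv (U := U)) kv => //.
 move=> y [K [CK nK Ky]]; have [sK cK] := cg _ CK.
 have [[x x0 [Kx kx]]|sur] := eigen_restrict sK cK cw l0 (inv _ CK); first by exfalso; apply: nK; exists x.
 by have [x Kx <-] := sur y Ky; exists x => //; apply: sub_clos; exists K.
exists N, (clos U), v; split=> //.
(* The span of [v] and [clos U] is comparable with every member, so it belongs to the chain; as it
   contains an eigenvector, [N] lies inside it. *)
pose W : set X := fun z => exists k y, clos U y /\ z = k *: v + y.
have sW : subsp W.
 split=> [|x y [k1 [y1 [U1 ->]]] [k2 [y2 [U2 ->]]]|c x [k1 [y1 [U1 ->]]]].
 - by exists 0, 0; rewrite scale0r addr0; split=> //; exact: (ss0 sUc).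
 - by exists (k1 + k2), (y1 + y2); split; [exact: (ssD sUc)|rewrite scalerDl addrACA].
 - by exists (c * k1), (c *: y1); split; [exact: (ssZ sUc)|rewrite scalerDr scalerA].
have UW x : clos U x -> W x by move=> Ux; exists 0, x; rewrite scale0r add0r.
have UN x : clos U x -> N x.
 by have := clos_min cN (M := U); apply => y [K [CK nK Ky]] K' CK' mK'; apply: (sep K' K).
have CW : Ch W.
 apply: cm => //; first exact: closd_add.
 move=> K CK; have [mK|nK] := EM (meets K); last by left=> x Kx; apply/UW/sub_clos; exists K.
 right=> x [k [y [Uy ->]]]; have [sK _] := cg _ CK.
 by apply: (ssD sK); [apply: (ssZ sK); exact: Nv|exact: UN].
move=> x Nx; apply: (Nx W CW); exists v => //; split=> //.
by exists 1, 0; rewrite scale1r addr0; split=> //; exact: (ss0 sUc).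
Qed.

Variable L : set (BL X).
Hypotheses (sL : subsp L) (LL : forall a b, L a -> L b -> L (a * b - b * a : bop X)) (Lc : forall a, L a -> cpt a)
 (LCh : forall M, Ch M -> forall a x, L a -> M x -> M (a x)).

Definition brackets : set (BL X) := spn (fun x : BL X => exists a b, [/\ L a, L b & x = a * b - b * a :> bop X]).
Lemma brackets_sub : brackets `<=` L.
Proof. by apply: (@spn_min R (BL X)) => // x [a [b [La Lb ->]]]; exact: LL. Qed.
(** The eigenvalue is the coefficient of [w] on a one-dimensional quotient [N / Nm] of the chain.
    Scalars commute, so [d] acts there as zero and [w - d] as [la]; an induced operator has no
    larger norm. *)
Lemma eigen_mod_brackets w d (la : R[i]) : L w -> brackets d -> la != 0 -> eigenval w la -> nc la <= opn (w - d).
Proof.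
move=> Lw Dd l0 ew; have Ld : L d by exact: brackets_sub.
have [N [Nm [v [[CN CNm Nv nv wv] span1]]]] := ringrose (Lc Lw) l0 ew (fun M CM x => LCh CM Lw).
have [[sNm cNm] [sN _]] := ((cc.1 _ CNm), (cc.1 _ CN)).
have dv : Nm (d v).
 pose S : set (BL X) := [set a : BL X | Nm ((a : bop X) v)].
 have sS : subsp S.
 split=> [|a b Sa Sb|c a Sa].
 - exact: (ss0 sNm).
 - exact: (ssD sNm).
 - exact: (ssZ sNm).
 apply: (@spn_min R (BL X) _ S sS _ d Dd) => x [a [b [La Lb ->]]]; rewrite -[S _]/(Nm ((a * b - b * a : bop X) v)).
 have [ka [na [Na av]]] := span1 _ (LCh CN La Nv); have [kb [nb [Nb bv]]] := span1 _ (LCh CN Lb Nv).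
 have -> : (a * b - b * a) v = (kb *: na + a nb) - (ka *: nb + b na).
 rewrite subbE !mulbE bv av !bopD !bopZ av bv !scalerDr !scalerA [ka * kb]mulrC -!addrA.
 rewrite opprD [LHS]addrCA; congr (_ + _); rewrite [LHS]addrCA; congr (_ + _); exact: addNKr.
 by apply: (ssB sNm); apply: (ssD sNm); [exact: (ssZ sNm)|exact: LCh|exact: (ssZ sNm)|exact: LCh].
pose e := w - d; have Le : L e by exact: (ssB sL).
have [dl dl0 Hd] := not_closd_dist cNm nv.
have dist0 : 0 < dst Nm v.
 apply: lt_le_trans dl0 _; apply: dst_ge => // z Nz; rewrite bnC; exact: Hd.
rewrite -(ler_pM2r dist0) -dstZ//.
apply/ler_addgt0Pr => t t0; have o1 : 0 < opn e + 1 by rewrite ltr_wpDl ?opn_ge0.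
have t1 : 0 < t / (opn e + 1) by rewrite divr_gt0.
have [z Nz hz] := dst_lift sNm v t1.
have -> : dst Nm (la *: v) = dst Nm (e v).
 have ev : e v = la *: v - d v by rewrite subbE wv.
 by rewrite ev dst_modr.
rewrite -(dst_modr sNm (e v) (z := e z)); last by apply: LCh.
apply: le_trans (dst_le0 sNm _) _; rewrite -bopB; apply: opnP_le.
apply: le_trans (ler_wpM2l (opn_ge0 e) (ltW hz)) _; rewrite mulrDr lerD2l mulrCA -[leRHS]mulr1.
by apply: ler_wpM2l; [exact: ltW|rewrite ler_pdivrMr// mul1r lerDl].
Qed.
Lemma liebr_growth w (s B : R) : 0 <= B -> (forall n, opn (w ^+ n) <= B * s ^+ n) -> 0 <= s ->
 forall n (x : bop X), opn ((liebr w ^+ n) (x : BL X)) <= B ^+ 2 * (2 * s) ^+ n * opn x.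
Proof.
move=> B0 HB s0 n x; rewrite liebr_pow.
apply: le_trans (@bn_sum R (BL X) _ _ _ _) _.
have -> : B ^+ 2 * (2 * s) ^+ n * opn x = \sum_(i < n.+1) ('C(n, i)%:R * (B ^+ 2 * s ^+ n * opn x)).
 rewrite -mulr_suml -natr_sum; have <- : (2 ^ n = \sum_(i < n.+1) 'C(n, i))%N.
 by rewrite -[2%N]/(1 + 1)%N Pascal; apply: eq_bigr => i _; rewrite !exp1n !muln1.
 by rewrite natrX exprMn; ring.
apply: ler_sum => i _; rewrite -[bn _]/(opn _) opnZ ncM ncX ncN nc1 expr1n mul1r nc_nat.
apply: ler_wpM2l => //; apply: opnM_le.
apply: le_trans (ler_wpM2r (opn_ge0 _) (opnM _ _)) _.
have h1 := HB (n - i)%N; have h2 := HB i; have ni : (i <= n)%N by rewrite -ltnS.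
apply: (@le_trans _ _ ((B * s ^+ (n - i)) * opn x * (B * s ^+ i))).
 by apply: ler_pM; rewrite ?mulr_ge0 ?opn_ge0//; apply: ler_wpM2r; rewrite ?opn_ge0.
rewrite (_ : s ^+ n = s ^+ (n - i) * s ^+ i); last by rewrite -exprD subnK.
by rewrite le_eqVlt; apply/orP; left; apply/eqP; ring.
Qed.

Variable I : set (BL X).
Hypotheses (IL : I `<=` L) (sI : subsp I) (LI : forall l (x : BL X), L l -> I x -> I (l * x - x * l : bop X)) (IneL : I <> L).

Theorem esolvable_step : exists J : set (BL X), [/\ J `<=` L, subsp J, (forall l (x : BL X), L l -> J x -> J (l * x - x * l : bop X)),
 (forall x : BL X, L x -> clos J x -> J x) & I `<=` J] /\ J <> I /\
 forall a, J a -> forall d : R, 0 < d -> exists2 B : R, 0 <= B & forall n (x : BL X), J x -> dst I x <= 1 ->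
 dst I ((liebr a ^+ n) x) <= B * d ^+ n.
Proof.
have Ldl a (x : BL X) n : L a -> L x -> L ((liebr a ^+ n) x).
 by move=> La Lx; elim: n => [|n IH]; rewrite ?expr0// exprS mulbE liebrE; exact: LL.
have [DI|nDI] := EM (brackets `<=` I).
 exists L; split; first by split.
 split=> [|a La d d0]; first exact/nesym.
 exists 1 => // -[|n] x Lx dx; first by rewrite !expr0 mulr1.
 rewrite dst0; first by rewrite mul1r exprn_ge0// ltW.
 exact: sI.
 apply: DI; apply: (@spn_sub R (BL X)); rewrite exprS mulbE liebrE.
 by exists a, ((liebr a ^+ n) x); split=> //; exact: Ldl.
pose S : set (BL X) := fun x : BL X => exists i d : BL X, [/\ I i, brackets d & x = i + d].
have sD : subsp brackets by exact: spn_subsp.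
have sS : subsp S.
 split=> [|x y [i [d [Ii Dd ->]]] [i' [d' [Ii' Dd' ->]]]|c x [i [d [Ii Dd ->]]]].
 - by exists 0, 0; split; [exact: (ss0 sI)|exact: (ss0 sD)|rewrite addr0].
 - by exists (i + i'), (d + d'); split; [exact: (ssD sI)|exact: (ssD sD)|rewrite addrACA].
 - by exists (c *: i), (c *: d); split; [exact: (ssZ sI)|exact: (ssZ sD)|rewrite scalerDr].
pose J : set (BL X) := L `&` clos S.
exists J; split.
 split.
 - by move=> x [].
 - exact/subspI/clos_subsp.
 - move=> l x Ll [Lx cx]; split; first exact: LL.
 have := @clos_bop R (BL X) (liebr l) S S _ x cx; rewrite liebrE; apply.
 move=> y [i [d [Ii Dd ->]]]; rewrite liebrE; exists (l * i - i * l), (l * d - d * l); split.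
 + exact: LI.
 + by apply: (@spn_sub R (BL X)); exists l, d; split=> //; exact: brackets_sub.
 + by rewrite (mulrDr l) (mulrDl i) opprD addrACA.
 - move=> x Lx cx; split=> //; apply: (@clos_closd R (BL X) S) => e e0.
 by have [y [_ Sy] yx] := cx e e0; exists y.
 - move=> x Ix; split; first exact: IL.
 by apply: sub_clos; exists x, 0; split=> //; [exact: (ss0 sD)|rewrite addr0].
split=> [JI|a [La ca] d d0].
 apply: nDI => x Dx; rewrite -JI; split; first exact: brackets_sub.
 by apply: sub_clos; exists 0, x; split=> //; [exact: (ss0 sI)|rewrite add0r].
have s0 : 0 < d / 2 by rewrite divr_gt0.
have [_ [i [v [Ii Dv ->]]] hv] := ca (d / 2) s0.
pose w : bop X := a - i; have Lw : L w by apply: (ssB sL) => //; exact: IL.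
have gw : grows_le (d / 2) w.
 apply: cpt_decay => //; first exact: Lc.
 move=> z hz ez; have z0 : z != 0 by rewrite -nc_gt0; exact: lt_le_trans hz.
 have := eigen_mod_brackets Lw Dv z0 ez; apply/negP; rewrite -ltNge; apply: lt_le_trans hz.
 by move: hv; rewrite bnC /w -[bn _]/(opn _) opprD addrA.
have [B B0 HB] := gw; exists (B ^+ 2 * 2); first by rewrite mulr_ge0 ?exprn_ge0.
move=> n x [Lx _] dx; have [i' Ii' hi'] := dst_lift sI x (ltr01 : 0 < 1 :> R).
have Ly : L (x - i' : BL X) by apply: (ssB sL) => //; exact: IL.
(* Since [a] and [w] differ by an element of [I], their iterated brackets agree modulo [I], even
   with [x] replaced by the representative [x - i'], whose norm is below 2; hence the factor 2 in
   the constant. *)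
have key m : I ((liebr a ^+ m) x - (liebr w ^+ m) (x - i' : BL X)).
 elim: m => [|m IH]; first by rewrite !expr0 !onebE opprB addrC subrK.
 set y := (liebr a ^+ m) x in IH; set y' := (liebr w ^+ m) _ in IH.
 rewrite !exprS !mulbE -/y -/y'; have Ly' : L y' by exact: Ldl.
 have -> : liebr a y - liebr w y' = (liebr a (y - y') : BL X) - (liebr y' i : BL X).
 have hw : liebr w y' = (liebr a y' + liebr y' i : BL X).
 rewrite !liebrE /w (mulrBl (y' : bop X)) (mulrBr (y' : bop X)) opprB addrACA [RHS]addrACA.
 by congr (_ + _); rewrite addrC.
 by rewrite hw bopB opprD addrA.
 by apply: (ssB sI); rewrite liebrE; exact: LI.
apply: le_trans (dst_le sI _ (key n)) _.
rewrite opprB addrC subrK; apply: le_trans (liebr_growth B0 HB (ltW s0) n _) _.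
have -> : 2 * (d / 2) = d by field.
rewrite [leRHS]mulrAC; apply: ler_wpM2l; first by rewrite mulr_ge0 ?exprn_ge0// ltW.
by apply: ltW; apply: lt_le_trans hi' _; lra.
Qed.
End Ringrose.

(** * Passage to the notions of the statement *)

Lemma quasinil_of_growth (R : realType) (t : nat -> R) : (forall n, 0 <= t n) ->
 (forall d : R, 0 < d -> exists2 B : R, 0 <= B & forall n, t n <= B * d ^+ n) -> quasinil_seq t.
Proof.
move=> t0 H; apply/cvgrPdist_lt => e e0.
(* One factor 1/2 absorbs the constant [B] for large [n]; the other makes the final inequality
   strict. *)
have d0 : 0 < e / 4 by rewrite divr_gt0.
have [B B0 HB] := H _ d0; have b1 : 0 < (B + 1)^-1 by rewrite invr_gt0; lra.
have [N HN] := @half_small R _ b1.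
exists (maxn N 1) => // n /=; rewrite geq_max => /andP[Nn n1].
have nn : (n%:R : R) != 0 by rewrite pnatr_eq0 -lt0n.
have e2 : 0 <= e / 2 by rewrite divr_ge0// ltW.
have h : t n <= (e / 2) ^+ n.
 apply: le_trans (HB n) _; have -> : e / 4 = 2^-1 * (e / 2) by field.
 rewrite exprMn mulrA -[leRHS]mul1r; apply: ler_wpM2r; first exact: exprn_ge0.
 have := HN n Nn; rewrite -[(B + 1)^-1]mul1r ltr_pdivlMr; last by lra.
 have : (0 : R) <= 2^-1 ^+ n by rewrite exprn_ge0 ?invr_ge0.
 by move=> p0 h; rewrite mulrC; move: p0 h; set q := _ ^+ n; nra.
rewrite sub0r normrN ger0_norm ?powR_ge0//.
have : powR (t n) n%:R^-1 <= powR ((e / 2) ^+ n) n%:R^-1.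
 by apply: ge0_ler_powR => //; rewrite ?invr_ge0// nnegrE ?exprn_ge0.
rewrite -(powR_mulrn _ e2) -powRrM mulfV// powRr1// => h2.
by apply: le_lt_trans h2 _; lra.
Qed.
Lemma growth_of_quasinil (R : realType) (s : nat -> R) (e : R) : 0 < e -> (forall n, 0 <= s n) -> quasinil_seq s ->
 exists2 B : R, 0 <= B & forall n, s n <= B * e ^+ n.
Proof.
move=> e0 s0 /cvgrPdist_lt /(_ e e0) [N _ HN].
pose B := 1 + \sum_(i < N.+1) s i / e ^+ i.
have pos i : 0 <= s i / e ^+ i by rewrite divr_ge0// exprn_ge0// ltW.
have S0 : 0 <= \sum_(i < N.+1) s i / e ^+ i by apply: sumr_ge0.
exists B => [|n]; first by rewrite addr_ge0.
have [nN|Nn] := ltnP n N.+1.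
 rewrite -ler_pdivrMr ?exprn_gt0// /B (bigD1 (Ordinal nN))//= addrCA lerDl addr_ge0//.
 by apply: sumr_ge0.
have n0 : (0 < n)%N by exact: leq_ltn_trans Nn.
have nn : (n%:R : R) != 0 by rewrite pnatr_eq0 -lt0n.
have := HN n (ltnW Nn); rewrite sub0r normrN ger0_norm ?powR_ge0// => h.
have : powR (powR (s n) n%:R^-1) n%:R <= powR e n%:R.
 by apply: ge0_ler_powR; rewrite ?nnegrE ?powR_ge0// ltW.
rewrite -powRrM mulVf// powRr1// powR_mulrn ?(ltW e0)// => h2.
apply: le_trans h2 _; rewrite -[leLHS]mul1r; apply: ler_wpM2r; first by rewrite exprn_ge0// ltW.
by rewrite /B lerDl.
Qed.

Section Bridge.
Variables (R : realType) (X : completeNormedModType R[i]).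
Local Notation C := (R[i]).
Implicit Types (x y : X) (f : X -> X).

Lemma nrmE x : `|x| = (nrm x)%:C%C.
Proof. by rewrite /nrm RRe_real// normr_real. Qed.
Lemma nrmD x y : nrm (x + y) <= nrm x + nrm y.
Proof. by rewrite -lecR rmorphD /= -!nrmE; exact: ler_normD. Qed.
Lemma nrmZ (c : C) x : nrm (c *: x) = nc c * nrm x.
Proof. by rewrite {1}/nrm normrZ nrmE nc_norm -rmorphM. Qed.
Lemma nrm_eq0 x : nrm x = 0 -> x = 0.
Proof. by move=> h; apply/eqP; rewrite -normr_eq0 nrmE h. Qed.
Lemma nrm_ball x y (e : R) : ball x (e%:C%C : C) y <-> nrm (y - x) < e.
Proof.
rewrite -ball_normE /ball_/= distrC nrmE ltcR.
by split.
Qed.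
Lemma pos_real (e : C) : 0 < e -> exists2 r : R, 0 < r & e = r%:C%C.
Proof.
move=> e0; exists (complex.Re e); last by rewrite RRe_real// ger0_real// ltW.
by rewrite -ltcR RRe_real// ger0_real// ltW.
Qed.
Lemma nrm_complete (u : nat -> X) :
 (forall e, 0 < e -> exists N, forall m n, (N <= m)%N -> (N <= n)%N -> nrm (u m - u n) < e) ->
 exists l, forall e, 0 < e -> exists N, forall n, (N <= n)%N -> nrm (u n - l) < e.
Proof.
move=> H; have cu : cvg (u @ \oo).
 apply: cauchy_cvg; apply: cauchy_exP => e /pos_real[r r0 ->].
 have [N HN] := H r r0; exists (u N); exists N => // n /= Nn; apply/nrm_ball; exact: HN.
exists (lim (u @ \oo)) => e e0.
have ec : 0 < (e%:C%C : C) by rewrite ltcR.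
have [N _ HN] := (cvg_ballP _ _).1 cu _ ec.
by exists N => n Nn; apply/nrm_ball; exact: HN.
Qed.
Definition bX : banach R := @Banach R X (@nrm R X) nrmD nrmZ nrm_eq0 nrm_complete.

Lemma bop_of f : is_bounded_op f -> exists b : bop bX, bfun b = f.
Proof. by move=> [lf bf]; exists (@Bop R bX f lf bf). Qed.
Lemma cpt_of (a : bop bX) : is_compact_op (bfun a) -> cpt a.
Proof.
move=> [_ ca]; apply: ucpt_cpt => u Hu.
pose U := projT1 (cid free_ultrafilter).
have UU : UltraFilter U by rewrite /U; case: cid => /= ? [].
have UP : ProperFilter U by exact: @ultra_proper _ _ UU.
pose v n : X := a (u n).
have [|l [_ cl]] := ca (v @ U) _.
 apply: (@filterS _ U _ _ _ _ (@filterT _ U _)) => n _; apply: subset_closure.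
 by exists (u n) => //; exact: Hu.
exists l => e e0; have ec : 0 < (e%:C%C : C) by rewrite ltcR.
apply: contrapT => /ev_not h.
have [y [ny /nrm_ball yl]] := cl (fun y => ~ nrm (y - l) < e) _ h (nbhsx_ballx l _ ec).
exact: ny.
Qed.
Lemma closed_closd (M : set X) : closed M <-> @closd R bX M.
Proof.
split=> [cM x Hx|cM x cx].
 apply: cM => B /nbhs_ballP[e /= /pos_real[r r0 ->] rB].
 by have [y My yx] := Hx r r0; exists y; split=> //; apply/rB/nrm_ball.
apply: cM => e e0; have ec : 0 < (e%:C%C : C) by rewrite ltcR.
have [y [My yx]] := cx _ (nbhsx_ballx x _ ec); exists y => //.
by move/nrm_ball: yx.
Qed.
Lemma closed_subspaceP (M : set X) : closed_subspace M <-> @subsp R bX M /\ @closd R bX M.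
Proof.
by split=> [[/closed_closd cM M0 MD MZ]|[[M0 MD MZ] /closed_closd cM]]; split.
Qed.
Definition LB (A : set (X -> X)) : set (BL bX) := [set a : BL bX | A (bfun (a : bop bX))].
Lemma LB_subsp A : is_subspace A -> subsp (LB A).
Proof. by move=> [A0 AD AZ]; split; [exact: A0|move=> a b; exact: AD|move=> c a; exact: AZ]. Qed.
Lemma lieE (a b : bop bX) : lie (bfun a) (bfun b) = bfun (a * b - b * a).
Proof. by apply/funext => x; rewrite subbE. Qed.
Lemma iter_lieE n (a x : bop bX) : iter n (lie (bfun a)) (bfun x) = bfun ((liebr a ^+ n) (x : BL bX) : bop bX).
Proof. by elim: n => [|n IH]; rewrite ?expr0// iterS IH lieE exprS mulbE liebrE. Qed.
Lemma opsubE (a b : bop bX) : opsub (bfun a) (bfun b) = bfun (a - b).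
Proof. by apply/funext => x; rewrite subbE. Qed.
Lemma opnormE (a : bop bX) : opnorm (bfun a) = opn a. Proof. by []. Qed.

Variables (L : set (X -> X)).
Hypotheses (lL : operator_lie_algebra L) (cL : forall a, L a -> is_compact_op a).
Let Lb f : L f -> is_bounded_op f. Proof. by have [H _ _] := lL; exact: H. Qed.
Let sL : is_subspace L. Proof. by have [_ H _] := lL. Qed.
Let LL : forall a b, L a -> L b -> L (lie a b). Proof. by have [_ _ H] := lL. Qed.
(** Normalising by [opn x + 1] instead of [opn x] covers [x = 0] without a case distinction. *)
Lemma ad_pow_normP (a : bop bX) n : L (bfun a) -> 0 <= ad_pow_norm L (bfun a) n /\
 forall x : bop bX, L (bfun x) -> opn ((liebr a ^+ n) (x : BL bX)) <= ad_pow_norm L (bfun a) n * (opn x + 1).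
Proof.
move=> La; have ub : has_ubound [set opnorm (iter n (lie (bfun a)) x) | x in [set x | L x /\ opnorm x <= 1]].
 exists (opn (liebr a ^+ n)) => _ [f [Lf f1] <-]; have [x xf] := bop_of (Lb Lf).
 rewrite -xf iter_lieE opnormE; apply: le_trans (opnP (liebr a ^+ n) (x : BL bX)) _.
 by rewrite -xf opnormE in f1; rewrite -[leRHS]mulr1; apply: ler_wpM2l; rewrite ?opn_ge0.
have L0 : L (bfun (0 : bop bX)) by have [H _ _] := sL.
have mem (x : bop bX) : L (bfun x) -> opn x <= 1 -> opn ((liebr a ^+ n) (x : BL bX)) <= ad_pow_norm L (bfun a) n.
 by move=> Lx x1; apply: (ub_le_sup ub); exists (bfun x); [split|rewrite iter_lieE opnormE].
split=> [|x Lx].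
 by apply: le_trans (mem 0 L0 _); [exact: opn_ge0|apply: opn_le => // x; rewrite bn0 mulr_ge0// bn_ge0].
have c0 : 0 < opn x + 1 by rewrite ltr_wpDl ?opn_ge0.
have Ly : L (bfun ((opn x + 1)^-1%:C%C *: x : bop bX)) by have [_ _ H] := sL; exact: H.
rewrite -ler_pdivrMr//; have := mem _ Ly; rewrite bopZ !opnZ nc_pos ?invr_ge0 ?(ltW c0)//.
rewrite [_ / _]mulrC; apply; rewrite mulrC ler_pdivrMr// mul1r lerDl//.
Qed.

Variables (G : finZmodType) (Lg : G -> set (X -> X)).
Hypothesis gL : subgraded L Lg.
Let LBg g := LB (Lg g).

Lemma Lg_sub g f : Lg g f -> L f.
Proof.
have [sg -> _] := gL => Lf; exists (fun h => if h == g then f else fun _ => 0); split=> [h|].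
 by case: eqVneq => [->//|_]; have [H _ _] := sg h.
apply/funext => x; rewrite (bigD1 g)//= eqxx big1 ?addr0// => h /negbTE ->.
by [].
Qed.
Lemma LB_graded : graded LBg.
Proof.
have [sg _ lg] := gL; split.
- by move=> g; exact: LB_subsp.
- by move=> g h a b La Lb'; have := lg g h _ _ La Lb'; rewrite lieE.
- by move=> g a La; apply: cpt_of; apply: cL; exact: Lg_sub La.
Qed.
Lemma LB_loceng g (a : bop bX) : LBg g a -> engel_element L (bfun a) -> loceng (homog LBg) a.
Proof.
move=> La ea x [h Lx] e e0; have [s0 _] := ad_pow_normP 0 (Lg_sub La).
have [B B0 HB] := growth_of_quasinil e0 (fun n => (ad_pow_normP n (Lg_sub La)).1) ea.
exists (B * (opn x + 1)) => n; have [_ h1] := ad_pow_normP n (Lg_sub La).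
apply: le_trans (h1 x (Lg_sub Lx)) _; rewrite mulrAC; apply: ler_wpM2r => //.
by rewrite addr_ge0 ?opn_ge0.
Qed.

Section Conclusion.
Hypothesis good : egood LBg (homog LBg).

Lemma L_invariant (M : set X) : @subsp R bX M -> (@invariant R bX (homog LBg) M) ->
 forall T, L T -> forall x, M x -> M (T x).
Proof.
move=> sM iM T LT x Mx; have [_ LE _] := gL; move: (LT); rewrite {1}LE => -[f [Lf ->]].
apply: (ss_sum _ sM) => g _; have [b bf] := bop_of (Lb (Lg_sub (Lf g))).
by rewrite -bf; apply: iM => //; exists g; rewrite /LBg /LB/= bf.
Qed.
Lemma triangularizable_of_good : triangularizable L.
Proof.
have [Ch [[cc ct] cm ci]] := triangular_chain LB_graded good.
exists Ch; split; last first.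
 by move=> M CM; apply: L_invariant; [have [] := cc M CM|exact: ci].
split; first by split=> [M CM|]; [apply/closed_subspaceP; exact: cc|exact: ct].
move=> D [Dc Dt] CD; apply/seteqP; split=> // M DM; have [sM cM] := (closed_subspaceP M).1 (Dc M DM).
by apply: cm => // K CK; apply: Dt => //; exact: CD.
Qed.
Lemma qnormE (I : set (X -> X)) (x : bop bX) : I `<=` L -> qnorm I (bfun x) = dst (LB I) (x : BL bX).
Proof.
move=> IL; rewrite /qnorm /dst; congr inf; apply/seteqP; split=> [_ [f If <-]|_ [b Ib <-]].
 have [b bf] := bop_of (Lb (IL f If)); exists b; first by rewrite /LB/= bf.
 by rewrite -bf opsubE opnormE.
by exists (bfun b) => //; rewrite opsubE opnormE.
Qed.
Lemma E_solvable_of_good : E_solvable L.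
Proof.
have [Ch [[cc ct] cm ci]] := triangular_chain LB_graded good.
move=> I [[IL sI LI] cI] IneL.
have LBc (a : bop bX) : LB L a -> cpt a by move=> La; apply: cpt_of; exact: cL.
have LBl (a b : bop bX) : LB L a -> LB L b -> LB L (a * b - b * a).
 by move=> La Lb'; have := LL La Lb'; rewrite lieE.
have LCh (M : set X) : Ch M -> forall (a : bop bX) (x : X), LB L a -> M x -> M (a x).
 by move=> CM a x La; apply: L_invariant => //; [have [] := cc M CM|exact: ci].
have sIB := LB_subsp sI.
have IBL : LB I `<=` LB L by move=> a; exact: IL.
have [||J [[JL sJ LJ cJ IJ] [JneI eJ]]] := @esolvable_step R bX Ch (conj cc ct) cm (LB L) (LB_subsp sL) LBl LBc LCh (LB I) IBL sIB.
- by move=> l x Ll Ix; have := LI _ _ Ll Ix; rewrite lieE.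
- move=> h; apply: IneL; apply/seteqP; split=> // f Lf; have [b bf] := bop_of (Lb Lf).
 have : LB I b by rewrite h /LB/= bf.
 by rewrite /LB/= bf.
pose Jf : set (X -> X) := [set f | exists2 b : bop bX, J b & bfun b = f].
have JfE (b : bop bX) : Jf (bfun b) -> J b by move=> [c Jc cb]; rewrite (_ : b = c)//; apply: bop_eq => x; rewrite cb.
have IJf : I `<=` Jf.
 by move=> f If; have [b bf] := bop_of (Lb (IL f If)); exists b => //; apply: IJ; rewrite /LB/= bf.
have JfL : Jf `<=` L by move=> _ [b Jb <-]; exact: JL.
exists Jf; split.
- split; first split=> //.
 + split.
 * by exists 0; [exact: (ss0 sJ)|].
 * by move=> _ _ [a Ja <-] [b Jb <-]; exists (a + b); [exact: (ssD sJ)|].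
 * by move=> c _ [a Ja <-]; exists (c *: a); [exact: (ssZ sJ)|].
 + move=> f _ Lf [x Jx <-]; have [a af] := bop_of (Lb Lf); rewrite -af lieE.
 by exists (a * x - x * a) => //; apply: LJ => //; rewrite /LB/= af.
 + move=> f Lf Hf; have [x xf] := bop_of (Lb Lf); exists x => //; apply: cJ; first by rewrite /LB/= xf.
 move=> e e0; have [_ [[b Jb <-] be]] := Hf e e0; exists b => //.
 by rewrite bnC; move: be; rewrite -xf opsubE.
- exact: IJf.
- move=> JI; apply: JneI; apply/seteqP; split=> // b Jb; rewrite /LB/= -JI; by exists b.
move=> _ [a Ja <-]; apply: quasinil_of_growth => [n|d d0].
 have [B B0 HB] := eJ a Ja 1 ltr01.
 apply: le_trans (ub_le_sup _ (x := qnorm I (iter n (lie (bfun a)) (bfun (0 : bop bX)))) _).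
 - by rewrite iter_lieE qnormE//; exact: dst_ge0.
 - exists (B * 1 ^+ n) => _ [_ [[x Jx <-] x1] <-]; rewrite iter_lieE qnormE//; apply: HB => //.
 by rewrite -qnormE.
 - exists (bfun (0 : bop bX)) => //; split; first by exists 0 => //; exact: (ss0 sJ).
 by rewrite qnormE// dst0//; exact: (ss0 sIB).
have [B B0 HB] := eJ a Ja d d0; exists B => // n; apply: ge_sup.
 exists (qnorm I (iter n (lie (bfun a)) (bfun (0 : bop bX)))), (bfun (0 : bop bX)) => //.
 split; first by exists 0 => //; exact: (ss0 sJ).
 by rewrite qnormE// dst0//; exact: (ss0 sIB).
move=> _ [_ [[x Jx <-] x1] <-]; rewrite iter_lieE qnormE//; apply: HB => //.
by rewrite -qnormE.
Qed.
End Conclusion.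
End Bridge.

Theorem mainTheorem1 (R : realType) (X : completeNormedModType R[i])
  (G : finZmodType) (L : set (X -> X)) (Lg : G -> set (X -> X)) :
  operator_lie_algebra L ->
  (forall a, L a -> is_compact_op a) ->
  subgraded L Lg ->
  ((forall g a, Lg g a -> engel_element L a) ->
      E_solvable L /\ triangularizable L) /\
  (cyclic_group G -> (forall a, Lg 0 a -> engel_element L a) ->
      E_solvable L /\ triangularizable L).
Proof.
move=> lL cL gL; split=> [H|[g0 gen] H].
 have good : egood (fun g => LB (Lg g)) (homog (fun g => LB (Lg g))).
  by left=> g a La; apply: (LB_loceng lL gL La); exact: H La.
 by split; [exact: (E_solvable_of_good lL cL gL good)|exact: (triangularizable_of_good lL cL gL good)].
have good : egood (fun g => LB (Lg g)) (homog (fun g => LB (Lg g))).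
 (* Writing [- g0] as [g0 *+ k] yields the positive [N = k.+1] with [g0 *+ N = 0] that the cyclic
    case carries along for Kreknin's theorem. *)
 right; have [k gk] := gen (- g0); exists g0, k.+1; split=> //.
  by rewrite mulrS -gk subrr.
 by move=> a La; apply: (LB_loceng lL gL La); exact: H La.
by split; [exact: (E_solvable_of_good lL cL gL good)|exact: (triangularizable_of_good lL cL gL good)].
Qed.
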